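(* Let $\mathbb{X}$ be a weighted projective line over a finite field $\mathbf{k}=\mathbb{F}_q$. Let $L,L'$ be line bundles on $\mathbb{X}$ and let $S,S',S''$ be torsion sheaves (or zero sheaves). Then there exists an exact sequence $$0\longrightarrow L\oplus S\longrightarrow L'\oplus S'\longrightarrow S''\longrightarrow 0$$ if and only if there are sheaves $S_1$ and $S_2$ with exact sequences $$0\to S\to S'\to S_1\to 0,\qquad 0\to L\to L'\to S_2\to 0,\qquad 0\to S_1\to S''\to S_2\to 0.$$ In this case, we have $$F_{S''\,L\oplus S}^{L'\oplus S'}=\frac{|\mathrm{Hom}(L',S')|}{|\mathrm{Hom}(L',S)|}\cdot\sum_{[X_2]}F_{X_2S}^{S'}F_{S_2X_2}^{S''}\frac{a_{X_2}a_{S_2}}{a_{S''}},$$ where the sum runs over isomorphism classes of objects $X_2$. In particular, if both $S'$ and $S''$ are indecomposable, then (in this case) $$F_{S''\,L\oplus S}^{L'\oplus S'}=\begin{cases}|\mathrm{Hom}(L,S'')|,&\text{if }L\cong L';\\ a_{S'/S},&\text{if }L\not\cong L'.\end{cases}$$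
   Context: Weighted projective line $\mathbb{X}$ over a field $\mathbf{k}$: given by a weight sequence $(p_1,\dots,p_t)$ of positive integers and distinct points $\lambda_1,\dots,\lambda_t\in\mathbb{P}^1(\mathbf{k})$ normalized so that $\lambda_1=\infty,\lambda_2=0,\lambda_3=1$. $\mathbb{L}$ is the abelian group with generators $\vec{x}_1,\dots,\vec{x}_t$ and relations $p_1\vec{x}_1=\cdots=p_t\vec{x}_t=:\vec{c}$. Let $A=\mathbf{k}[X_1,\dots,X_t]/(f_3,\dots,f_t)$ with $f_i=X_i^{p_i}-X_2^{p_2}+\lambda_iX_1^{p_1}$, $\mathbb{L}$-graded by $\deg X_i=\vec{x}_i$. Then $\mathrm{coh}\,\mathbb{X}=\mathrm{mod}^{\mathbb{L}}(A)/\mathrm{mod}_0^{\mathbb{L}}(A)$, the quotient of finitely generated $\mathbb{L}$-graded $A$-modules by those of finite length; it is a hereditary abelian category. The structure sheaf $\mathcal{O}$ is the image of $A$, and the line bundles are the grading shifts $\mathcal{O}(\vec{x})$, $\vec{x}\in\mathbb{L}$. Torsion sheaves are the finite length objects of $\mathrm{coh}\,\mathbb{X}$; indecomposable torsion sheaves are uniserial. Hall number: $F_{AB}^{M}=|\{X\subseteq M\mid X\cong B,\ M/X\cong A\}|$. For an object $M$, $a_M=|\mathrm{Aut}(M)|$ (so $a_0=1$). $S'/S$ denotes the cokernel of the embedding $S\to S'$. *)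

(* Defs.v *)
From HB Require Import structures.
From mathcomp Require Import all_boot all_order all_algebra.
From mathcomp Require Import generic_quotient ring_quotient zify ring.
From mathcomp Require Import boolp classical_sets.
From mathcomp Require Import mpoly.

Set Implicit Arguments.
Unset Strict Implicit.
Unset Printing Implicit Defensive.

Import GRing.Theory.
Import Quotient.Exports.

Local Open Scope classical_set_scope.
Local Open Scope ring_scope.
Local Open Scope quotient_scope.

(* The number of elements of A; the value is 0 when A is infinite.  Here and in
   the categorical part plain predicates are used instead of set, whose universe
   is too small for the objects of the category constructed below. *)
Definition ncard (T : Type) (A : T -> Prop) : nat :=
  xget 0%N [set n : nat | exists f : 'I_n -> T,
    (forall i j, f i = f j -> i = j) /\ forall x, A x <-> exists i, f i = x].

Record category := Category {
  obj :> Type;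
  hom : obj -> obj -> Type;
  idm : forall A, hom A A;
  comp : forall A B C, hom B C -> hom A B -> hom A C;
  comp_idl : forall A B (f : hom A B), comp (idm B) f = f;
  comp_idr : forall A B (f : hom A B), comp f (idm A) = f;
  comp_assoc : forall A B C D (h : hom C D) (g : hom B C) (f : hom A B),
    comp h (comp g f) = comp (comp h g) f }.

Arguments idm {c} A.

Section CategoryTheory.
Variable C : category.
Implicit Types A B M X Y Z E : C.

Definition is_iso A B (f : hom A B) : Prop :=
  exists g : hom B A, comp g f = idm A /\ comp f g = idm B.

Definition isomorphic A B : Prop := exists f : hom A B, is_iso f.

Definition is_mono A B (f : hom A B) : Prop :=
  forall X (g h : hom X A), comp f g = comp f h -> g = h.

Definition is_zero Z : Prop :=
  forall X, (exists! f : hom X Z, True) /\ (exists! f : hom Z X, True).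

Definition zero_mor A B (f : hom A B) : Prop :=
  exists Z, is_zero Z /\
    exists (g : hom A Z) (h : hom Z B), f = comp h g.

Definition is_kernel K A B (i : hom K A) (f : hom A B) : Prop :=
  zero_mor (comp f i) /\
  forall X (g : hom X A), zero_mor (comp f g) ->
    exists! u : hom X K, comp i u = g.

Definition is_cokernel A B Q (p : hom B Q) (f : hom A B) : Prop :=
  zero_mor (comp p f) /\
  forall X (g : hom B X), zero_mor (comp g f) ->
    exists! u : hom Q X, comp u p = g.

(* There is an exact sequence 0 -> A -> B -> Q -> 0. *)
Definition ses A B Q : Prop :=
  exists (i : hom A B) (p : hom B Q), is_kernel i p /\ is_cokernel p i.

Definition is_biproduct A B E : Prop :=
  exists (i1 : hom A E) (i2 : hom B E) (p1 : hom E A) (p2 : hom E B),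
    [/\ comp p1 i1 = idm A /\ comp p2 i2 = idm B,
        zero_mor (comp p1 i2) /\ zero_mor (comp p2 i1),
        forall X (f : hom X A) (g : hom X B),
          exists! u : hom X E, comp p1 u = f /\ comp p2 u = g
      & forall X (f : hom A X) (g : hom B X),
          exists! u : hom E X, comp u i1 = f /\ comp u i2 = g].

Definition indecomposable M : Prop :=
  ~ is_zero M /\
  forall A B, is_biproduct A B M -> is_zero A \/ is_zero B.

Definition simple M : Prop :=
  ~ is_zero M /\
  forall X (i : hom X M), is_mono i -> is_zero X \/ is_iso i.

(* M has a composition series. *)
Inductive finite_length : C -> Prop :=
| finite_length0 Z : is_zero Z -> finite_length Z
| finite_lengthS A B M :
    ses A B M -> simple A -> finite_length M -> finite_length B.

(* A subobject of M is an equivalence class of monomorphisms into M. *)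
Definition sub_class M X (i : hom X M) : {Y : C & hom Y M} -> Prop :=
  fun j => exists2 u : hom X (projT1 j), is_iso u & comp (projT2 j) u = i.

(* The Hall number F_{AB}^M. *)
Definition hall A B M : nat :=
  ncard (fun K : {Y : C & hom Y M} -> Prop =>
    exists X (i : hom X M),
      [/\ is_mono i, isomorphic X B,
          exists p : hom M A, is_cokernel p i
        & K = sub_class i]).

Definition aut_card M : nat := ncard (fun f : hom M M => is_iso f).

Definition hom_card A B : nat := ncard (fun _ : hom A B => True).

(* The sum of f over the isomorphism classes of objects, for an
   isomorphism-invariant f of finite support: e enumerates, without repetition,
   representatives of finitely many classes, including all those where f does
   not vanish. *)
Definition sum_iso (f : C -> rat) : rat :=
  xget 0 [set v : rat | exists (n : nat) (e : 'I_n -> C),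
    [/\ forall i j, isomorphic (e i) (e j) -> i = j,
        forall X, f X <> 0 -> exists i, isomorphic X (e i)
      & v = \sum_i f (e i)]].

End CategoryTheory.

(* P^1(F) is option F, with None as the point at infinity.  There are
   t = wt_n.+2 marked points, indexed from 0; the condition on the third one
   is only present when t >= 3. *)
Record wpl (F : fieldType) := Wpl {
  wt_n : nat;
  wt : 'I_wt_n.+2 -> nat;
  pt : 'I_wt_n.+2 -> option F;
  wt_gt0 : forall i, (0 < wt i)%N;
  pt_inj : injective pt;
  pt0 : pt ord0 = None;
  pt1 : pt (lift ord0 ord0) = Some 0;
  pt2 : forall i : 'I_wt_n.+2, i = 2%N :> nat -> pt i = Some 1 }.

Arguments wt {F} w i.
Arguments pt {F} w i.
Arguments wt_gt0 {F} w i.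

Section Algebra.
Variables (F : fieldType) (X : wpl F).
Local Notation t := (wt_n X).+2.
Local Notation o1 := (lift ord0 ord0 : 'I_t).
Local Notation poly := {mpoly F[t]}.

(* The subgroup of Z^t generated by the elements p_i e_i - p_j e_j. *)
Definition Lrel : {pred 'rV[int]_t} := fun v =>
  `[< exists c : 'I_t -> 'I_t -> int,
        v = \sum_i \sum_j
          (delta_mx 0 i *+ wt X i - delta_mx 0 j *+ wt X j) *~ c i j >].

Lemma Lrel_closed : zmod_closed Lrel.
Proof.
split=> [|u v /asboolP[c ->] /asboolP[d ->]]; apply/asboolP.
  by exists (fun _ _ => 0); rewrite big1 // => i _; rewrite big1.
exists (fun i j => c i j - d i j); rewrite -sumrB; apply: eq_bigr => i _.
by rewrite -sumrB; apply: eq_bigr => j _; rewrite mulrzBr.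
Qed.

HB.instance Definition _ :=
  GRing.isZmodClosed.Build 'rV[int]_t Lrel Lrel_closed.

Definition Lgrp := Quotient.quot (Lrel : zmodClosed 'rV[int]_t).
HB.instance Definition _ := GRing.Zmodule.on Lgrp.

Definition Lgen (i : 'I_t) : Lgrp := \pi_Lgrp (delta_mx 0 i).

Definition frel (i : 'I_t) : poly :=
  'X_i ^+ wt X i - 'X_o1 ^+ wt X o1
  + (odflt 0 (pt X i))%:MP * 'X_ord0 ^+ wt X ord0.

Definition Aideal : {pred poly} := fun p =>
  `[< exists g : 'I_t -> poly, p = \sum_(i < t | (2 <= i)%N) g i * frel i >].

Lemma frel_at0 i : (frel i).@[fun=> 0] = 0.
Proof.
rewrite /frel mevalD mevalB mevalM !rmorphXn /= !mevalXU.
by rewrite !expr0n !(gtn_eqF (wt_gt0 X _)) mulr0 subr0 addr0.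
Qed.

Lemma Aideal_closed : idealr_closed Aideal.
Proof.
split.
- by apply/asboolP; exists (fun _ => 0); rewrite big1 // => i _; exact: mul0r.
- apply/negP => /asboolP[g] /(congr1 (meval (fun=> 0))).
  rewrite meval1 rmorph_sum /= big1 => [/eqP|i _]; first by rewrite oner_eq0.
  by rewrite mevalM frel_at0 mulr0.
- move=> a u v /asboolP[g ->] /asboolP[h ->]; apply/asboolP.
  exists (fun i => a * g i + h i).
  by rewrite mulr_sumr -big_split; apply: eq_bigr => i _ /=; ring.
Qed.

HB.instance Definition _ := isIdealr.Build poly Aideal Aideal_closed.

Definition Aalg := Quotient.quot (Aideal : idealr poly).
HB.instance Definition _ := GRing.ComNzRing.on Aalg.

Definition mdegL (m : 'X_{1..t}) : Lgrp := \sum_i Lgen i *+ m i.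

Definition Ahomog (y : Lgrp) (a : Aalg) : Prop :=
  exists2 p : poly, {in msupp p, forall m, mdegL m = y} & a = \pi_Aalg p.

(* A finitely generated L-graded A-module.  The decomposition into the direct
   sum of the homogeneous parts M_x is given by its projections gpr x, so that
   M_x = [set m | gpr x m = m]. *)
Record gmod := GMod {
  car :> lmodType Aalg;
  gpr : Lgrp -> car -> car;
  gprB : forall x, {morph gpr x : m n / m - n};
  gpr_idem : forall x y m, gpr x (gpr y m) = if x == y then gpr y m else 0;
  gpr_sum : forall m, exists s : seq Lgrp,
    [/\ uniq s, forall x, x \notin s -> gpr x m = 0
      & m = \sum_(x <- s) gpr x m];
  gpr_act : forall x y a m, Ahomog y a -> gpr (x + y) (a *: m) = a *: gpr x m;
  gmod_fg : exists (n : nat) (e : 'I_n -> car),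
    forall m, exists c : 'I_n -> Aalg, m = \sum_i c i *: e i }.

Definition hpart (y : Lgrp) (p : poly) : poly :=
  \sum_(m <- msupp p | mdegL m == y) p@_m *: 'X_[m].

Lemma hpartE y p m : (hpart y p)@_m = if mdegL m == y then p@_m else 0.
Proof.
rewrite /hpart raddf_sum /= big_mkcond /=.
under eq_bigr do rewrite mcoeffZ mcoeffX.
have [mp|mp] := boolP (m \in msupp p).
  rewrite (bigD1_seq m) //= eqxx mulr1 big1_seq => [|k /andP[/negbTE km _]].
    by rewrite addr0.
  by rewrite km mulr0 if_same.
rewrite big1_seq => [|k /andP[_ kp]].
  by rewrite (memN_msupp_eq0 mp) if_same.
case: eqP => // _; case: eqP kp => [->|]; first by rewrite (negbTE mp).
by rewrite mulr0.
Qed.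

Lemma hpartB y : {morph hpart y : p q / p - q}.
Proof.
move=> p q; apply/mpolyP => m; rewrite mcoeffB !hpartE mcoeffB.
by case: ifP; rewrite ?subr0.
Qed.

HB.instance Definition _ y :=
  GRing.isZmodMorphism.Build poly poly (hpart y) (hpartB y).

Lemma hpartZ y c p : hpart y (c *: p) = c *: hpart y p.
Proof.
apply/mpolyP => m; rewrite mcoeffZ !hpartE mcoeffZ.
by case: ifP; rewrite ?mulr0.
Qed.

Lemma mdegLD m n : mdegL (m + n) = mdegL m + mdegL n.
Proof.
by rewrite -big_split; apply: eq_bigr => i _; rewrite mnmDE mulrnDr.
Qed.

Lemma hpartX y m : hpart y 'X_[m] = if mdegL m == y then 'X_[m] else 0.
Proof.
apply/mpolyP => n; rewrite hpartE mcoeffX.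
case: (eqVneq m n) => [->|mn]; first by case: ifP; rewrite ?mcoeffX ?eqxx ?mcoeff0.
by case: ifP; case: ifP; rewrite ?mcoeffX ?(negbTE mn) ?mcoeff0.
Qed.

Lemma hpartM x y p q : {in msupp p, forall m, mdegL m = y} ->
  hpart (x + y) (p * q) = p * hpart x q.
Proof.
move=> hp; rewrite [p]mpolyE mulr_suml raddf_sum mulr_suml /=.
apply: eq_big_seq => m /hp hm; rewrite {1}[q]mpolyE [in RHS]/hpart.
rewrite !mulr_sumr raddf_sum /= [RHS]big_mkcond /=.
apply: eq_bigr => n _.
rewrite -!scalerAl -!scalerAr -mpolyXD !hpartZ hpartX mdegLD hm addrC.
by rewrite (inj_eq (addIr y)); case: ifP; rewrite ?scaler0.
Qed.

Lemma Lgen_rel i j : Lgen i *+ wt X i = Lgen j *+ wt X j.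
Proof.
apply/eqP; rewrite -subr_eq0 -!raddfMn -raddfB.
rewrite -(raddf0 (\pi_Lgrp)) /=.
rewrite -Quotient.idealrBE subr0; apply/asboolP.
exists (fun k l => ((k == i) && (l == j))%:R).
rewrite (bigD1 i) //= (bigD1 j) //= !eqxx mulr1z big1 => [|l /negbTE lj].
  rewrite big1 ?addr0 // => k /negbTE ki.
  by rewrite big1 // => l _; rewrite ki mulr0z.
by rewrite lj mulr0z.
Qed.

Lemma frel_homog i : {in msupp (frel i), forall m, mdegL m = Lgen ord0 *+ wt X ord0}.
Proof.
have XE j : 'X_j ^+ wt X j = 'X_[U_(j) *+ wt X j] :> poly by rewrite mpolyXn.
have dE j : mdegL (U_(j) *+ wt X j)%MM = Lgen ord0 *+ wt X ord0.
  rewrite (Lgen_rel ord0 j) /mdegL (bigD1 j) //= big1 ?addr0.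
    by rewrite mulmnE mnm1E eqxx mul1n.
  by move=> k /negbTE kj; rewrite mulmnE mnm1E eq_sym kj mul0n mulr0n.
move=> m; rewrite mcoeff_msupp /frel !XE mcoeffD mcoeffB mcoeffCM !mcoeffX.
move=> nz; apply/eqP; apply: contraNT nz => ne.
have ne' j : ((U_(j) *+ wt X j)%MM == m) = false.
  by apply/negP => /eqP jm; move: ne; rewrite -jm dE eqxx.
by rewrite !ne' mulr0 subr0 addr0.
Qed.

Lemma hpart_ideal y p : p \in Aideal -> hpart y p \in Aideal.
Proof.
move=> /asboolP[g ->]; apply/asboolP.
exists (fun i => hpart (y - Lgen ord0 *+ wt X ord0) (g i)).
rewrite raddf_sum /=; apply: eq_bigr => i _; rewrite mulrC.
rewrite -{1}[y](subrK (Lgen ord0 *+ wt X ord0)) hpartM; last exact: frel_homog.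
by rewrite mulrC.
Qed.

Definition Apr (y : Lgrp) (a : Aalg^o) : Aalg^o := \pi_Aalg (hpart y (repr a)).

Lemma AprE y p : Apr y (\pi_Aalg p) = \pi_Aalg (hpart y p).
Proof.
apply/eqP; rewrite -Quotient.idealrBE -hpartB; apply: hpart_ideal.
by rewrite Quotient.idealrBE reprK.
Qed.

Lemma Apr_lift (a : Aalg) : exists p : poly, a = \pi_Aalg p.
Proof. by exists (repr a); rewrite reprK. Qed.

Lemma AprB y : {morph Apr y : a b / a - b}.
Proof.
move=> a b; have [p ->] := Apr_lift a; have [q ->] := Apr_lift b.
by rewrite -[_ - _](raddfB (\pi_Aalg)) !AprE hpartB raddfB.
Qed.

Lemma Apr_idem x y a : Apr x (Apr y a) = if x == y then Apr y a else 0.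
Proof.
have [p ->] := Apr_lift a; rewrite !AprE.
have -> : hpart x (hpart y p) = if x == y then hpart y p else 0.
  apply/mpolyP => m; case: (eqVneq x y) => [->|xy] /=; rewrite ?mcoeff0 !hpartE.
    by case: (mdegL m == y).
  by case: eqP => // ->; rewrite (negbTE xy).
by case: ifP => // _; rewrite raddf0.
Qed.

Lemma Apr_sum a : exists s : seq Lgrp,
  [/\ uniq s, forall x, x \notin s -> Apr x a = 0 & a = \sum_(x <- s) Apr x a].
Proof.
have [p ->] := Apr_lift a.
exists (undup (map mdegL (msupp p))); split; first exact: undup_uniq.
  move=> x; rewrite mem_undup => xs; rewrite AprE /hpart big1_seq ?raddf0 //.
  move=> m /andP[/eqP mx mp]; case/negP: xs; apply/mapP; by exists m.
under eq_bigr do rewrite AprE.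
rewrite -(raddf_sum (\pi_Aalg)); congr (\pi_Aalg _); apply/mpolyP => m.
rewrite raddf_sum /=; under eq_bigr do rewrite hpartE.
have [mp|mp] := boolP (m \in msupp p).
  rewrite (bigD1_seq (mdegL m)) ?undup_uniq //=; last first.
    by rewrite mem_undup map_f.
  by rewrite eqxx big1 ?addr0 // => k; rewrite eq_sym => /negbTE ->.
by rewrite (memN_msupp_eq0 mp) big1 // => k _; rewrite if_same.
Qed.

Lemma Apr_act x y a (b : Aalg^o) :
  Ahomog y a -> Apr (x + y) (a *: b) = a *: Apr x b.
Proof.
move=> [p hp ->]; have [r ->] := Apr_lift b.
have pM q : \pi_Aalg p *: (\pi_Aalg q : Aalg^o) = \pi_Aalg (p * q).
  by rewrite rmorphM.
by rewrite pM !AprE hpartM // pM.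
Qed.

Lemma Afg : exists (n : nat) (e : 'I_n -> Aalg^o),
  forall m, exists c : 'I_n -> Aalg, m = \sum_i c i *: e i.
Proof.
exists 1%N, (fun=> 1) => m; exists (fun=> m).
by rewrite big_ord1 -[RHS]/(m * 1) mulr1.
Qed.

Definition Amod : gmod := GMod AprB Apr_idem Apr_sum Apr_act Afg.

Section Shift.
Variables (M : gmod) (z : Lgrp).

Lemma shift_idem x y (m : M) :
  gpr (x + z) (gpr (y + z) m) = if x == y then gpr (y + z) m else 0.
Proof. by rewrite gpr_idem (inj_eq (addIr z)). Qed.

Lemma shift_sum (m : M) : exists s : seq Lgrp,
  [/\ uniq s, forall x, x \notin s -> gpr (x + z) m = 0
    & m = \sum_(x <- s) gpr (x + z) m].
Proof.
have [s [su s0 sE]] := gpr_sum m.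
exists [seq x - z | x <- s]; split.
- by rewrite map_inj_uniq //; exact: addIr.
- move=> x xs; apply: s0; apply: contra xs => xs.
  by apply/mapP; exists (x + z); rewrite ?addrK.
- by rewrite big_map [LHS]sE; apply: eq_bigr => x _; rewrite subrK.
Qed.

Lemma shift_act x y a (m : M) :
  Ahomog y a -> gpr (x + y + z) (a *: m) = a *: gpr (x + z) m.
Proof. by move=> h; rewrite addrAC gpr_act. Qed.

(* M(z)_x = M_(x + z). *)
Definition shift : gmod :=
  @GMod (car M) (fun x => gpr (x + z)) (fun x => @gprB M (x + z))
    shift_idem shift_sum shift_act (gmod_fg M).

End Shift.

Definition gsub (M : gmod) (P : set M) : Prop :=
  [/\ P 0, forall a m n, P m -> P n -> P (a *: m + n)
    & forall x m, P m -> P (gpr x m)].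

(* Q/P has finite length as a graded module: the lengths of the strictly
   increasing chains of graded submodules between P and Q are bounded. *)
Definition fin_len (M : gmod) (P Q : set M) : Prop :=
  exists n : nat, forall U : nat -> set M,
    (forall i, [/\ gsub (U i), P `<=` U i & U i `<=` Q]) ->
    (forall i, U i `<=` U i.+1) ->
    exists2 i, (i < n)%N & U i.+1 `<=` U i.

Definition rdom (M N : gmod) (R : M -> N -> Prop) : set M :=
  [set m | exists n, R m n].

Definition rind (M N : gmod) (R : M -> N -> Prop) : set N := [set n | R 0 n].

(* Representatives of the morphisms M -> N of the quotient category
   mod(A)/mod_0(A), where Hom(M, N) is the colimit of the groups
   Hom(M', N/N') over the graded submodules M' of M and N' of N such that
   M/M' and N' have finite length.  A degree-preserving A-linear map
   f : M' -> N/N' is encoded by the relation R m n <-> m \in M' /\ n \in f m;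
   the graded submodules R of M x N correspond bijectively to the triples
   (M', N', f), with M' = rdom R and N' = rind R. *)
Definition frac (M N : gmod) (R : M -> N -> Prop) : Prop :=
  [/\ R 0 0,
      forall a m n m' n', R m n -> R m' n' -> R (a *: m + m') (a *: n + n'),
      forall x m n, R m n -> R (gpr x m) (gpr x n),
      fin_len (rdom R) setT
    & fin_len [set 0] (rind R)].

(* R and R' induce the same map M' -> N/N' for some M' and N' as above, that is,
   they are equal in the colimit. *)
Definition frac_eq (M N : gmod) (R R' : M -> N -> Prop) : Prop :=
  exists (M' : set M) (N' : set N),
    [/\ gsub M' /\ fin_len M' setT, gsub N' /\ fin_len [set 0] N',
        M' `<=` rdom R /\ M' `<=` rdom R'
      & forall m n n', M' m -> R m n -> R' m n' -> N' (n - n')].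

Definition rcomp (M N P : gmod) (S : N -> P -> Prop) (R : M -> N -> Prop) :
  M -> P -> Prop := fun m p => exists2 n, R m n & S n p.

End Algebra.

Section Coh.
Variables (F : fieldType) (X : wpl F).
Section Submodules.
Variable M : gmod X.
Implicit Types P Q U V : set M.

Lemma gsubD P m n : gsub P -> P m -> P n -> P (m + n).
Proof. by move=> [_ h _] pm pn; rewrite -[m]scale1r; apply: h. Qed.

Lemma gsubN P m : gsub P -> P m -> P (- m).
Proof. by move=> [z h _] pm; rewrite -scaleN1r -[_ *: _]addr0; apply: h. Qed.

Lemma gsubB P m n : gsub P -> P m -> P n -> P (m - n).
Proof. by move=> h pm pn; apply: gsubD => //; apply: gsubN. Qed.

Lemma gpr0 x : gpr x (0 : M) = 0.
Proof. by have := gprB x (0 : M) 0; rewrite !subrr. Qed.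

Lemma gprD x (m n : M) : gpr x (m + n) = gpr x m + gpr x n.
Proof. by rewrite -{1}[n]opprK -[- n]sub0r !gprB gpr0 sub0r opprK. Qed.

Lemma gsub0 : gsub [set (0 : M)].
Proof.
split=> [|a m n -> ->|x m ->] /=; first by [].
  by rewrite scaler0 addr0.
exact: gpr0.
Qed.

Lemma gsubT : gsub [set: M]. Proof. by split. Qed.

Lemma gsubI P Q : gsub P -> gsub Q -> gsub (P `&` Q).
Proof.
move=> [p1 p2 p3] [q1 q2 q3]; split=> [//|a m n [? ?] [? ?]|x m [? ?]].
  by split; [apply: p2 | apply: q2].
by split; [apply: p3 | apply: q3].
Qed.

Definition gadd P Q : set M := [set m | exists p q, [/\ P p, Q q & m = p + q]].

Lemma gsubA P Q : gsub P -> gsub Q -> gsub (gadd P Q).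
Proof.
move=> [p1 p2 p3] [q1 q2 q3]; split.
- by exists 0, 0; rewrite addr0.
- move=> a m n [p [q [hp hq ->]]] [p' [q' [hp' hq' ->]]].
  exists (a *: p + p'), (a *: q + q'); split; [exact: p2|exact: q2|].
  by rewrite scalerDr addrACA.
- move=> x m [p [q [hp hq ->]]]; exists (gpr x p), (gpr x q).
  by split; [exact: p3|exact: q3|exact: gprD].
Qed.

Lemma gaddl P Q : gsub Q -> P `<=` gadd P Q.
Proof. by move=> [q _ _] m pm; exists m, 0; rewrite addr0. Qed.

Lemma gaddr P Q : gsub P -> Q `<=` gadd P Q.
Proof. by move=> [q _ _] m pm; exists 0, m; rewrite add0r. Qed.

Definition inter P Q U := [/\ gsub U, P `<=` U & U `<=` Q].

Lemma fin_len_rank P Q : fin_len P Q ->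
  exists (n : nat) (r : set M -> nat),
    [/\ forall U, inter P Q U -> (r U <= n)%N,
        forall U V, inter P Q U -> inter P Q V -> U `<=` V -> (r U <= r V)%N
      & forall U V, inter P Q U -> inter P Q V -> U `<=` V ->
          (r V <= r U)%N -> V `<=` U].
Proof.
move=> [n hn].
pose ch U k := exists c : nat -> set M,
  [/\ forall i, inter P Q (c i), forall i, c i `<=` c i.+1,
      forall i, (i < k)%N -> ~ c i.+1 `<=` c i & c k `<=` U].
have ch0 U : inter P Q U -> ch U 0%N.
  by move=> iU; exists (fun=> U); split=> // i m.
have chn U k : ch U k -> (k <= n)%N.
  move=> [c [c1 c2 c3 _]]; rewrite leqNgt; apply/negP => nk.
  have [i iln] := hn c c1 c2; apply: c3; exact: ltn_trans nk.
pose pr U : pred nat := fun k => `[< ch U k >].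
have prn U k : pr U k -> (k <= n)%N by move=> /asboolP; apply: chn.
pose r U := if pselect (exists k, pr U k) is left e then ex_maxn e (@prn U)
            else 0%N.
have rP U : inter P Q U -> ch U (r U) /\ forall k, ch U k -> (k <= r U)%N.
  move=> iU; rewrite /r; case: pselect => [e|[]]; last first.
    by exists 0%N; apply/asboolP; apply: ch0.
  by case: ex_maxnP => k /asboolP ck mx; split=> // j cj; apply: mx; apply/asboolP.
exists n, r; split.
- by move=> U /rP[/chn].
- move=> U V /rP[cU _] /rP[_ mV] UV; apply: mV.
  by move: cU => [c [c1 c2 c3 c4]]; exists c; split=> // m /c4 /UV.
- move=> U V iU iV UV rVU; apply: contrapT => VU.
  have [[c [c1 c2 c3 c4]] _] := rP U iU; have [_ mV] := rP V iV.
  suff /mV : ch V (r U).+1 by rewrite ltnNge rVU.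
  exists (fun i => if (i <= r U)%N then c i else V); split.
  + by move=> i; case: ifP.
  + move=> i; case: (ltngtP i (r U)) => [iU'|iU'|iU'].
    * exact: c2.
    * by [].
    * by move=> m; rewrite iU' => /c4 /UV.
  + move=> i; rewrite ltnS => iU'; rewrite iU'.
    case: ltnP => [|le]; first exact: c3.
    have -> : i = r U by apply/eqP; rewrite eqn_leq iU'.
    by move=> h; apply: VU => m /h /c4.
  + by rewrite ltnn.
Qed.

Lemma rank_fin_len P Q (n : nat) (r : set M -> nat) :
  (forall U, inter P Q U -> (r U <= n)%N) ->
  (forall U V, inter P Q U -> inter P Q V -> U `<=` V ->
     (r V <= r U)%N -> V `<=` U) -> fin_len P Q.
Proof.
move=> rn rs; exists n.+1 => U U1 U2; apply: contrapT => no.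
have st i : (i < n.+1)%N -> (r (U i) < r (U i.+1))%N.
  move=> il; rewrite ltnNge; apply/negP => le; apply: no; exists i => //.
  exact: rs le.
have : (n.+1 <= r (U n.+1))%N.
  have : (n.+1 <= n.+1)%N by [].
  elim: {1 3 4}n.+1 => [//|k ih] kn.
  exact: leq_ltn_trans (ih (ltnW kn)) (st k kn).
by rewrite ltnNge rn.
Qed.

Lemma fin_len_ext P Q U : gsub Q -> gsub U -> P `<=` Q -> Q `<=` U ->
  fin_len P Q -> fin_len Q U -> fin_len P U.
Proof.
move=> gQ gU PQ QU /fin_len_rank[n1 [r1 [b1 m1 s1]]].
move=> /fin_len_rank[n2 [r2 [b2 m2 s2]]].
have i1 V : inter P U V -> inter P Q (V `&` Q).
  by move=> [gV PV VU]; split=> [|m pm|m []//]; [exact: gsubI|split; auto].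
have i2 V : inter P U V -> inter Q U (gadd V Q).
  move=> [gV PV VU]; split=> [||m [v [q [hv hq ->]]]].
  - exact: gsubA.
  - exact: gaddr.
  - by apply: gsubD => //; auto.
apply: (@rank_fin_len _ _ (n1 + n2)
          (fun V => r1 (V `&` Q) + r2 (gadd V Q))%N) => [V iV|V W iV iW VW le].
  by apply: leq_add; [apply: b1; apply: i1|apply: b2; apply: i2].
have VW1 : V `&` Q `<=` W `&` Q by move=> m [/VW ? ?].
have VW2 : gadd V Q `<=` gadd W Q.
  by move=> m [v [q [/VW hv hq ->]]]; exists v, q.
have l1 := m1 _ _ (i1 _ iV) (i1 _ iW) VW1.
have l2 := m2 _ _ (i2 _ iV) (i2 _ iW) VW2.
have {}s1 := s1 _ _ (i1 _ iV) (i1 _ iW) VW1 ltac:(lia).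
have {}s2 := s2 _ _ (i2 _ iV) (i2 _ iW) VW2 ltac:(lia).
have [gV _ _] := iV; have [gW _ _] := iW.
move=> w hw; have [v [q [hv hq E]]] := s2 w (gaddl gQ hw).
have [vq _] : (V `&` Q) q.
  apply: s1; split=> //; have -> : q = w - v by rewrite E addrAC subrr add0r.
  by apply: gsubB => //; apply: VW.
by rewrite E; apply: gsubD.
Qed.

Lemma fin_len_transport (N : gmod X) (P Q : set M) (P' Q' : set N)
    (phi : set M -> set N) :
  (forall U, inter P Q U -> [/\ gsub (phi U), P' `<=` phi U & phi U `<=` Q']) ->
  (forall U V, inter P Q U -> inter P Q V -> U `<=` V -> phi U `<=` phi V) ->
  (forall U V, inter P Q U -> inter P Q V -> U `<=` V -> phi V `<=` phi U ->
     V `<=` U) ->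
  fin_len P' Q' -> fin_len P Q.
Proof.
move=> h1 h2 h3 [n hn]; exists n => U U1 U2.
have [i|i|i iln le] := hn (phi \o U); [exact/h1|exact/h2|].
by exists i => //; apply: h3 le.
Qed.

Lemma fin_len_sub P Q Q' : Q `<=` Q' -> fin_len P Q' -> fin_len P Q.
Proof.
move=> QQ; apply: (@fin_len_transport _ _ _ _ _ id) => // U [? ? UQ]; split=> //.
by move=> m /UQ /QQ.
Qed.

Lemma fin_len_refl P : fin_len P P.
Proof.
exists 1%N => U U1 U2; exists 0%N => //.
by have [_ h _] := U1 0%N; have [_ _ h'] := U1 1%N; move=> m /h' /h.
Qed.

Lemma fin_len_add P Q : gsub P -> gsub Q ->
  fin_len [set 0] P -> fin_len [set 0] Q -> fin_len [set 0] (gadd P Q).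
Proof.
move=> gP gQ fP fQ; apply: (@fin_len_ext _ P) => //.
- exact: gsubA.
- by move=> m ->; case: gP.
- exact: gaddl.
apply: (@fin_len_transport _ _ _ _ _ (fun U => U `&` Q)) fQ.
- move=> U [gU _ _]; split=> [|m ->|m []//]; first exact: gsubI.
  by case: (gsubI gU gQ).
- by move=> U V _ _ UV m [/UV].
- move=> U V [gU PU _] [gV PV Va] UV VU v hv.
  have [p [q [hp hq E]]] := Va v hv.
  have [uq _] : (U `&` Q) q.
    apply: VU; split=> //; have -> : q = v - p by rewrite E addrAC subrr add0r.
    by apply: gsubB => //; apply: PV.
  by rewrite E; apply: gsubD => //; apply: PU.
Qed.

Lemma cofin_cap P Q : gsub P -> gsub Q ->
  fin_len P setT -> fin_len Q setT -> fin_len (P `&` Q) setT.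
Proof.
move=> gP gQ fP fQ; apply: (fin_len_ext gP gsubT _ _ _ fP) => //.
apply: (@fin_len_transport _ _ _ _ _ (fun U => gadd U Q)) fQ.
- by move=> U [gU _ _]; split=> //; [exact: gsubA|exact: gaddr].
- by move=> U V _ _ UV m [v [q [/UV hv hq ->]]]; exists v, q.
- move=> U V [gU PU UP] [gV PV VP] UV VU v hv.
  have [u [q [hu hq E]]] := VU v (gaddl gQ hv).
  have uq : U q.
    apply: PU; split=> //; have -> : q = v - u by rewrite E addrAC subrr add0r.
    by apply: gsubB => //; [apply: VP|apply: UP].
  by rewrite E; apply: gsubD.
Qed.

End Submodules.

Section Fractions.
Variables M N : gmod X.
Implicit Types R : M -> N -> Prop.

Definition rlin R : Prop :=
  [/\ R 0 0,
      forall a m n m' n', R m n -> R m' n' -> R (a *: m + m') (a *: n + n')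
    & forall x m n, R m n -> R (gpr x m) (gpr x n)].

Lemma frac_rlin R : frac R -> rlin R. Proof. by case. Qed.

Lemma rlinB R m n m' n' : rlin R -> R m n -> R m' n' -> R (m - m') (n - n').
Proof.
move=> [_ h _] r r'; have := h (-1) _ _ _ _ r' r.
by rewrite !scaleN1r [- m' + _]addrC [- n' + _]addrC.
Qed.

Definition rim R (U : set M) : set N := [set n | exists2 m, U m & R m n].
Definition rpre R (U : set N) : set M := [set m | exists2 n, U n & R m n].

Lemma gsub_rim R U : rlin R -> gsub U -> gsub (rim R U).
Proof.
move=> [r0 rl rg] [u0 ul ug]; split; first by exists 0.
- move=> a n n' [m um rm] [m' um' rm']; exists (a *: m + m'); first exact: ul.
  exact: rl.
- by move=> x n [m um rm]; exists (gpr x m); [exact: ug|exact: rg].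
Qed.

Lemma gsub_rpre R U : rlin R -> gsub U -> gsub (rpre R U).
Proof.
move=> [r0 rl rg] [u0 ul ug]; split; first by exists 0.
- move=> a n n' [m um rm] [m' um' rm']; exists (a *: m + m'); first exact: ul.
  exact: rl.
- by move=> x n [m um rm]; exists (gpr x m); [exact: ug|exact: rg].
Qed.

Lemma rdomE R : rdom R = rpre R setT.
Proof. by rewrite eqEsubset; split=> m [n]; [exists n|exists n]. Qed.

Lemma rindE R : rind R = rim R [set 0].
Proof.
by rewrite eqEsubset; split=> [n r|n [m -> r]//]; exists 0.
Qed.

Lemma gsub_rdom R : rlin R -> gsub (rdom R).
Proof. by move=> h; rewrite rdomE; apply: gsub_rpre. Qed.

Lemma gsub_rind R : rlin R -> gsub (rind R).
Proof. by move=> h; rewrite rindE; apply: gsub_rim => //; apply: gsub0. Qed.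

Lemma cofin_rpre R U : frac R -> gsub U -> fin_len U setT ->
  fin_len (rpre R U) setT.
Proof.
move=> fR gU fU; have lR := frac_rlin fR; have gd := gsub_rdom lR.
have [_ _ _ cR _] := fR.
apply: (fin_len_ext gd (gsubT _) _ _ _ cR) => //.
  by move=> m [n _ r]; exists n.
apply: (@fin_len_transport _ _ _ _ _ _ (fun V => gadd (rim R V) U)) fU.
- move=> V [gV _ _]; have g1 := gsub_rim lR gV.
  by split=> //; [exact: gsubA|exact: gaddr].
- move=> V W _ _ VW n [p [q [[m /VW hm r] hq ->]]].
  by exists p, q; split=> //; exists m.
- move=> V W [gV pV Vd] [gW pW Wd] VW WV w hw.
  have [n r] := Wd w hw.
  have [p [q [[v hv rv] hq E]]] : gadd (rim R V) U n.
    by apply: WV; apply: gaddl => //; exists w.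
  rewrite -(subrK v w); apply: gsubD => //; apply: pV; exists q => //.
  have -> : q = n - p by rewrite E addrAC subrr add0r.
  exact: rlinB.
Qed.

Lemma fin_rim R U : frac R -> gsub U -> fin_len [set 0] U ->
  fin_len [set 0] (rim R U).
Proof.
move=> fR gU fU; have lR := frac_rlin fR; have gd := gsub_rind lR.
have [_ _ _ _ cR] := fR.
apply: (@fin_len_ext _ _ (rind R)) => //.
- exact: gsub_rim.
- by move=> n ->; case: lR.
- by move=> n r; exists 0 => //; case: gU.
apply: (@fin_len_transport _ _ _ _ _ _ (fun V => rpre R V `&` U)) fU.
- move=> V [gV _ _]; have g1 := gsubI (gsub_rpre lR gV) gU.
  split=> [//|m ->|m []//]; by case: g1.
- by move=> V W _ _ VW m [[n /VW hn r] um]; split=> //; exists n.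
- move=> V W [gV pV Vd] [gW pW Wd] VW WV w hw.
  have [m um r] := Wd w hw.
  have [[v hv rv] _] : (rpre R V `&` U) m by apply: WV; split=> //; exists w.
  rewrite -(subrK v w); apply: gsubD => //; apply: pV.
  by rewrite /rind /= -(subrr m); apply: rlinB.
Qed.

Lemma frac_eq_refl R : frac R -> frac_eq R R.
Proof.
move=> fR; have lR := frac_rlin fR; exists (rdom R), (rind R).
have [_ _ _ ? ?] := fR; split.
- by split=> //; exact: gsub_rdom.
- by split=> //; exact: gsub_rind.
- by split.
- by move=> m n n' _ r r'; rewrite /rind /= -(subrr m); apply: rlinB.
Qed.

Lemma frac_eq_sym R R' : frac_eq R R' -> frac_eq R' R.
Proof.
move=> [M' [N' [h1 [h2 h2'] [h3 h3'] h4]]]; exists M', N'; split=> //.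
by move=> m n n' hm r r'; rewrite -opprB; apply: gsubN => //; apply: h4 hm r' r.
Qed.

Lemma frac_eq_trans R R' R'' :
  frac_eq R R' -> frac_eq R' R'' -> frac_eq R R''.
Proof.
move=> [M1 [N1 [[g1 f1] [g1' f1'] [d1 d1'] h1]]].
move=> [M2 [N2 [[g2 f2] [g2' f2'] [d2 d2'] h2]]].
exists (M1 `&` M2), (gadd N1 N2); split.
- by split; [exact: gsubI|exact: cofin_cap].
- by split; [exact: gsubA|exact: fin_len_add].
- by split=> m [? ?]; [apply: d1|apply: d2'].
- move=> m n n'' [m1 m2] r r''; have [n' r'] := d1' m m1.
  exists (n - n'), (n' - n''); split; [exact: h1 r r'|exact: h2 r' r''|].
  by rewrite addrA subrK.
Qed.

End Fractions.

Lemma frac_rcomp (M N P : gmod X) (S : N -> P -> Prop) (R : M -> N -> Prop) :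
  frac S -> frac R -> frac (rcomp S R).
Proof.
move=> fS fR; have [s0 sl sg sd si] := fS; have [r0 rl rg rd ri] := fR.
have lS := frac_rlin fS; have lR := frac_rlin fR.
have dE : rdom (rcomp S R) = rpre R (rdom S).
  rewrite eqEsubset; split=> [m [p [n r s]]|m [n [p s] r]].
    by exists n => //; exists p.
  by exists p, n.
have iE : rind (rcomp S R) = rim S (rind R).
  by rewrite eqEsubset; split=> [p [n r s]|p [n r s]]; exists n.
split.
- by exists 0.
- move=> a m p m' p' [n r s] [n' r' s']; exists (a *: n + n'); [exact: rl|exact: sl].
- by move=> x m p [n r s]; exists (gpr x n); [exact: rg|exact: sg].
- by rewrite dE; apply: cofin_rpre => //; apply: gsub_rdom.
- by rewrite iE; apply: fin_rim => //; apply: gsub_rind.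
Qed.

Lemma frac_eq_comp (M N P : gmod X) (S S' : N -> P -> Prop)
    (R R' : M -> N -> Prop) :
  frac S -> frac S' -> frac R -> frac R' -> frac_eq S S' -> frac_eq R R' ->
  frac_eq (rcomp S R) (rcomp S' R').
Proof.
move=> fS fS' fR fR' [N1 [P1 [[g1 f1] [g1' f1'] [d1 d1'] h1]]].
move=> [M2 [N2 [[g2 f2] [g2' f2'] [d2 d2'] h2]]].
have lS := frac_rlin fS; have lR := frac_rlin fR.
have lS' := frac_rlin fS'; have lR' := frac_rlin fR'.
have gi := gsub_rim lS g2'; have gi' := gsub_rim lS' g2'.
have gp := gsub_rpre lR g1; have gp' := gsub_rpre lR' g1.
have fi := fin_rim fS g2' f2'; have fi' := fin_rim fS' g2' f2'.
have fp := cofin_rpre fR g1 f1; have fp' := cofin_rpre fR' g1 f1.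
exists (M2 `&` (rpre R N1 `&` rpre R' N1)),
  (gadd P1 (gadd (rim S N2) (rim S' N2))); split.
- have g := gsubI gp gp'.
  by split; [exact: gsubI|apply: cofin_cap => //; exact: cofin_cap].
- have g := gsubA gi gi'.
  by split; [exact: gsubA|apply: fin_len_add => //; exact: fin_len_add].
- split=> m [_ [[n hn r] [n' hn' r']]].
    by have [p s] := d1 n hn; exists p, n.
  by have [p s] := d1' n' hn'; exists p, n'.
- move=> m p p' [m2 [[n0 hn0 r0] _]] [n r s] [n' r' s'].
  have [p0 s0] := d1 n0 hn0; have [p0' s0'] := d1' n0 hn0.
  exists (p0 - p0'), ((p - p0) + (p0' - p')); split; first exact: h1 s0 s0'.
  + exists (p - p0), (p0' - p'); split=> //.
      exists (n - n0); last exact: rlinB.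
      rewrite -[n - n0]subr0; apply: (h2 0); first by case: g2.
        by rewrite -(subrr m); apply: rlinB.
      by case: lR'.
    exists (n0 - n'); [exact: h2 r0 r'|exact: rlinB].
  + by rewrite addrCA [p0 - p0' + _]addrA subrK addrA subrK.
Qed.

(* Morphisms are equivalence classes of representatives, as sets. *)
Definition cohom (M N : gmod X) : Type :=
  {K : set (M -> N -> Prop) |
    exists2 R, frac R & K = [set R' | frac R' /\ frac_eq R R']}.

Lemma cohom_inj (M N : gmod X) (f g : cohom M N) : sval f = sval g -> f = g.
Proof. by case: f g => [K hK] [K' hK'] /= E; exact: eq_exist. Qed.

Definition cls (M N : gmod X) (R : M -> N -> Prop) (fR : frac R) : cohom M N :=
  exist _ [set R' | frac R' /\ frac_eq R R'] (ex_intro2 _ _ R fR erefl).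

Lemma clsP (M N : gmod X) (f : cohom M N) :
  exists (R : M -> N -> Prop) (fR : frac R), f = cls fR.
Proof. by case: f => K [R fR KE]; exists R, fR; apply: eq_exist. Qed.

Lemma cls_eq (M N : gmod X) (R R' : M -> N -> Prop) (fR : frac R)
  (fR' : frac R') : frac_eq R R' -> cls fR = cls fR'.
Proof.
move=> e; apply: eq_exist; rewrite eqEsubset; split=> T [fT h]; split=> //.
  exact: frac_eq_trans (frac_eq_sym e) h.
exact: frac_eq_trans e h.
Qed.

Lemma frac_id (M : gmod X) : frac (fun m n : M => m = n).
Proof.
split=> //.
- by move=> a m n m' n' -> ->.
- by move=> x m n ->.
- have -> : rdom (fun m n : M => m = n) = setT.
    by rewrite eqEsubset; split=> // m _; exists m.
  exact: fin_len_refl.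
- have -> : rind (fun m n : M => m = n) = [set 0].
    by rewrite eqEsubset; split=> m /esym.
  exact: fin_len_refl.
Qed.

Definition coh_rep (M N : gmod X) (f : cohom M N) : M -> N -> Prop :=
  s2val (cid2 (svalP f)).

Lemma coh_repP (M N : gmod X) (f : cohom M N) : frac (coh_rep f).
Proof. exact: (s2valP (cid2 (svalP f))). Qed.

Lemma coh_repK (M N : gmod X) (f : cohom M N) : cls (coh_repP f) = f.
Proof.
by apply: cohom_inj => /=; rewrite -(s2valP' (cid2 (svalP f))).
Qed.

Lemma coh_rep_cls (M N : gmod X) (R : M -> N -> Prop) (fR : frac R) :
  frac_eq (coh_rep (cls fR)) R.
Proof.
have /(congr1 sval)/= E := coh_repK (cls fR).
have : [set R' | frac R' /\ frac_eq R R'] R by split=> //; exact: frac_eq_refl.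
by rewrite -E => -[].
Qed.

Definition coh_comp (M N P : gmod X) (g : cohom N P) (f : cohom M N) :
  cohom M P := cls (frac_rcomp (coh_repP g) (coh_repP f)).

Lemma coh_compE (M N P : gmod X) (S : N -> P -> Prop) (R : M -> N -> Prop)
  (fS : frac S) (fR : frac R) :
  coh_comp (cls fS) (cls fR) = cls (frac_rcomp fS fR).
Proof.
apply: cls_eq; apply: frac_eq_comp => //; try exact: coh_repP.
  exact: coh_rep_cls.
exact: coh_rep_cls.
Qed.

Lemma cls_ext (M N : gmod X) (R R' : M -> N -> Prop) (fR : frac R)
  (fR' : frac R') : (forall m n, R m n <-> R' m n) -> cls fR = cls fR'.
Proof.
move=> h; have E : R = R' by apply/funext => m; apply/funext => n; apply/propext.
by apply: cls_eq; rewrite -E; apply: frac_eq_refl.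
Qed.

Lemma coh_idl (M N : gmod X) (f : cohom M N) :
  coh_comp (cls (frac_id N)) f = f.
Proof.
have [R [fR ->]] := clsP f; rewrite coh_compE; apply: cls_ext => m n.
by split=> [[k r <-]//|r]; exists n.
Qed.

Lemma coh_idr (M N : gmod X) (f : cohom M N) :
  coh_comp f (cls (frac_id M)) = f.
Proof.
have [R [fR ->]] := clsP f; rewrite coh_compE; apply: cls_ext => m n.
by split=> [[k <- r]//|r]; exists m.
Qed.

Lemma coh_assoc (M N P Q : gmod X) (h : cohom P Q) (g : cohom N P)
  (f : cohom M N) : coh_comp h (coh_comp g f) = coh_comp (coh_comp h g) f.
Proof.
have [R [fR ->]] := clsP f; have [S [fS ->]] := clsP g.
have [T [fT ->]] := clsP h; rewrite !coh_compE; apply: cls_ext => m q.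
split=> [[p [n r s] t]|[n r [p s t]]].
  by exists n => //; exists p.
by exists p => //; exists n.
Qed.

Definition coh : category := Category coh_idl coh_idr coh_assoc.

Definition Osh (z : Lgrp X) : coh := shift (Amod X) z.

Definition is_line_bundle (M : coh) : Prop :=
  exists z : Lgrp X, isomorphic M (Osh z).

Definition is_torsion (M : coh) : Prop := finite_length M.

End Coh.

(* Main.v *)
(** A line bundle L' lifts along epimorphisms with torsion kernel and receives no
    nonzero morphism from a torsion sheaf.  Hence an epimorphism
    pi : L' + S' -> S'' has kernel L + S exactly when its restriction
    h : S' -> S'' has kernel S and the composite L' -> S'' -> coker h is an
    epimorphism with kernel L.  The cokernel of h is then
    isomorphic to S_2: comparing localisations forces two quotients of L' by copies
    of L to be isomorphic.  Any two epimorphisms of a line bundle onto the same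
    torsion sheaf differ by an automorphism of the target, so for fixed h the
    admissible restrictions L' -> S'' number a_{S_2} |Hom(L', im h)|, where
    |Hom(L', im h)| = |Hom(L', S')| / |Hom(L', S)|.  Sorting the morphisms h by their
    image gives the sum over X_2, and dividing by a_{S''} turns epimorphisms into
    subobjects.

    If S' and S'' are indecomposable they are uniserial, because only one prime of A
    acts nilpotently on them; then every h factors through the same quotient of S'
    and the same subobject of S'', and there are a_{S'/S} of them.  If S_2 is nonzero,
    a morphism L' -> S'' is epi as soon as its composite with S'' -> S_2 is, so
    a_{S''} = a_{S_2} |Hom(L', S_1)|. *)

From HB Require Import structures.
From mathcomp Require Import all_boot all_order all_algebra.
From mathcomp Require Import generic_quotient ring_quotient zify ring.
From mathcomp Require Import boolp classical_sets.
From mathcomp Require Import ssrcomplements mpoly.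
Require Import Defs.

Set Implicit Arguments.
Unset Strict Implicit.
Unset Printing Implicit Defensive.

Import Order.TTheory GRing.Theory Num.Theory.
Import Quotient.Exports.

Local Open Scope classical_set_scope.
Local Open Scope ring_scope.
Local Open Scope quotient_scope.

(** * Noetherianity of the coordinate algebra *)

(** Over a finite field the quotient category is concrete: a graded module has finitely many
    homogeneous elements below any given degree, so a graded subquotient has finite length exactly
    when it vanishes in large degree, and a morphism is a graded map known in large degree. No Ext
    group is computed. Two facts about the variables [xg ord0] and [xg o1] at the points infinity
    and zero take its place: they form a regular sequence on homogeneous elements, and $N$-th powers
    of the two generate $A$ in large degree. A morphism from $\mathcal{O}(z)$ is therefore the same
    as a pair of images of these powers, subject to one compatibility; lifting, the absence of maps
    from torsion, and finiteness of Hom all come down to manipulating such pairs. The delicate point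
    of the count is that the cokernel of $h$ has to be isomorphic to $S_2$. Numerical agreement
    comes from cardinalities of homogeneous localisations, which are multiplicative on short exact
    sequences; it becomes an isomorphism because both cokernels are quotients of one line bundle by
    copies of another. *)

Lemma dickson (n : nat) (S : seq nat -> Prop) :
  exists B : seq (seq nat),
    (forall b, b \in B -> S b /\ size b = n) /\
    forall s, S s -> size s = n -> exists2 b, b \in B & all2 leq b s.
Proof.
elim: n S => [|n ih] S.
  have [S0|S0] := pselect (S [::]).
    exists [:: [::]]; split=> [b|[]//]; first by rewrite inE => /eqP ->.
    by exists [::]; rewrite ?mem_head.
  by exists [::]; split=> [b|[]//]; rewrite in_nil.
pose W t k := S (k :: t).
have [B [B1 B2]] := ih (fun t => exists k, W t k).
have /choice[w wP] : forall b, exists k, b \in B -> W b k.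
  move=> b; have [/B1[[k hk] _]|nb] := boolP (b \in B); first by exists k.
  by exists 0%N.
(* An element with head at least [K] dominates one built from [B]; below [K] only finitely many
   slices remain, one for each head. *)
pose K := (\max_(b <- B) w b)%N.
have /choice[C CP] := fun k => ih (W^~ k).
exists ([seq w b :: b | b <- B] ++ flatten [seq [seq k :: b | b <- C k] | k <- iota 0 K]).
split.
  move=> b; rewrite mem_cat => /orP[/mapP[b' hb ->]|/flattenP[l /mapP[k _ ->]]].
    by have [_ sz] := B1 _ hb; split; [exact: wP|rewrite /= sz].
  by move=> /mapP[b' /(proj1 (CP k))[hb sz] ->]; rewrite /= sz.
move=> [//|k t] St [sz]; have [kK|kK] := ltnP k K.
  have [b hb le] := (proj2 (CP k)) t St sz.
  exists (k :: b); last by rewrite /= leqnn.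
  rewrite mem_cat; apply/orP; right; apply/flattenP.
  exists [seq k :: b | b <- C k]; last by apply/mapP; exists b.
  by apply/mapP; exists k; rewrite ?mem_iota.
have [b hb le] := B2 t (ex_intro _ k St) sz.
exists (w b :: b); first by rewrite mem_cat; apply/orP; left; apply/mapP; exists b.
rewrite /= le andbT; apply: leq_trans kK.
by apply: (@leq_bigmax_seq _ B xpredT w).
Qed.

Definition fgen (R : pzRingType) (M : lmodType R) (U : M -> Prop) : Prop :=
  exists (n : nat) (e : 'I_n -> M), (forall i, U (e i)) /\
    forall m, U m -> exists c : 'I_n -> R, m = \sum_i c i *: e i.

Definition submod (R : pzRingType) (M : lmodType R) (U : M -> Prop) : Prop :=
  U 0 /\ forall a m n, U m -> U n -> U (a *: m + n).

Lemma submod_sum (R : pzRingType) (M : lmodType R) (U : M -> Prop)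
    (I : Type) (r : seq I) (c : I -> R) (e : I -> M) :
  submod U -> (forall i, U (e i)) -> U (\sum_(i <- r) c i *: e i).
Proof.
move=> [U0 UD] Ue; elim: r => [|i r ih]; first by rewrite big_nil.
by rewrite big_cons; apply: UD.
Qed.

(* Gröbner division by finitely many elements of U whose leading monomials
   dominate all the leading monomials of U. *)
Lemma mpoly_ideal_fgen (F : fieldType) (n : nat) (U : {mpoly F[n]}^o -> Prop) :
  submod U -> fgen U.
Proof.
move=> hU; have [U0 UD] := hU.
have [B [B1 B2]] := dickson n (fun s => exists p : {mpoly F[n]},
  [/\ U p, p != 0 & s = mlead p]).
have /choice[g gP] : forall b, exists p : {mpoly F[n]},
    b \in B -> [/\ U p, p != 0 & b = mlead p].
  move=> b; have [/B1[[p hp] _]|nb] := boolP (b \in B); first by exists p.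
  by exists 0.
pose e (i : 'I_(size B)) : {mpoly F[n]}^o := g (nth [::] B i).
have eP i : [/\ U (e i), e i != 0 & nth [::] B i = mlead (e i)].
  by apply: gP; apply: mem_nth.
exists (size B), e; split=> [i|p]; first by case: (eP i).
move: p; apply: mleadrect => p ih Up.
have [p0|p0] := eqVneq p 0.
  by exists (fun=> 0); rewrite p0 big1 // => i _; rewrite scale0r.
have [|b bB le] := B2 (mlead p) (ex_intro _ p (And3 Up p0 erefl)).
  exact: size_tuple.
have ib : (index b B < size B)%N by rewrite index_mem.
pose i : 'I_(size B) := Ordinal ib.
have [Ue e0] := eP i; rewrite /= nth_index // => be.
have lem : (mlead (e i) <= mlead p)%MM.
  apply/mnm_lepP => j; rewrite !(mnm_nth 0%N) -be.
  move: le; rewrite all2E => /andP[/eqP sz] /all_nthP h.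
  have jb : (j < size b)%N by rewrite sz size_tuple.
  have := h (0, 0)%N j; rewrite size_zip -sz minnn => /(_ jb).
  by rewrite nth_zip.
pose c := p@_(mlead p) / (e i)@_(mlead (e i)).
pose m := (mlead p - mlead (e i))%MM.
pose q : {mpoly F[n]} := c *: 'X_[m] * e i.
have c0 : c != 0 by rewrite mulf_neq0 ?invr_eq0 ?mleadc_eq0.
have cX0 : c *: 'X_[F, m] != 0.
  by rewrite -mleadc_eq0 mleadcZE mleadXm mcoeffX eqxx mulr1.
have q0 : q != 0 by rewrite mulf_neq0.
have lq : mlead q = mlead p.
  by rewrite mleadM // mleadZ // mleadXm submK.
have cq : q@_(mlead p) = p@_(mlead p).
  rewrite -{1}lq /q mleadM // mleadcM mleadZ // mleadXm mcoeffZ mcoeffX eqxx mulr1.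
  by rewrite /c mulfVK ?mleadc_eq0.
have Uq : U (p - q).
  by rewrite addrC /q -mulNr; exact: (UD (- (c *: 'X_[m])) (e i) p).
have [pq|pq] := eqVneq (p - q) 0.
  exists (fun j => if j == i then c *: 'X_[m] else 0).
  rewrite (bigD1 i) //= eqxx big1 ?addr0; last first.
    by move=> j /negbTE ->; rewrite scale0r.
  by apply/eqP; rewrite -subr_eq0; apply/eqP.
have [|//|d hd] := ih (p - q).
  have le' : (mlead (p - q) <= mlead p)%O.
    by apply: le_trans (mleadB_le _ _) _; rewrite lq leUx lexx.
  rewrite lt_neqAle le' andbT; apply: contra pq => /eqP E.
  by rewrite -mleadc_eq0 E mcoeffB cq subrr.
exists (fun j => d j + if j == i then c *: 'X_[m] else 0).
under eq_bigr do rewrite scalerDl.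
rewrite big_split /= -hd (bigD1 i) //= eqxx big1 ?addr0; last first.
  by move=> j /negbTE ->; rewrite scale0r.
by rewrite -[X in _ - X + _]/(q) -[X in _ = _ - _ + X]/(q) subrK.
Qed.

Section Noetherian.
Variables (F : fieldType) (X : wpl F).
Local Notation A := (Aalg X).

Lemma Aideal_fgen (J : A^o -> Prop) : submod J -> fgen J.
Proof.
move=> [J0 JD]; pose pi (p : {mpoly F[(wt_n X).+2]}) : A := \pi_(Aalg X) p.
have piD : {morph pi : p q / p + q} by move=> p q; rewrite /pi rmorphD.
have piM : {morph pi : p q / p * q} by move=> p q; rewrite /pi rmorphM.
have pi0 : pi 0 = 0 by rewrite /pi rmorph0.
have [|n [e [e1 e2]]] := @mpoly_ideal_fgen F _ (fun p => J (pi p)).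
  by split=> [|a p q hp hq]; rewrite ?pi0 // piD piM; apply: JD.
exists n, (fun i => pi (e i)); split=> // m Jm.
have [p mE] := Apr_lift m; have [c cE] := e2 p ltac:(by rewrite /pi -mE).
exists (fun i => pi (c i)).
by rewrite mE -/(pi p) cE (big_morph pi piD pi0); apply: eq_bigr => i _; rewrite piM.
Qed.

(** Induction on the number of generators: the part of [U] in the span of all but the last one and
    the ideal [J] of possible last coefficients are both finitely generated. [J] is defined by
    existence because coefficients are not unique. *)
Lemma span_noetherian (M : lmodType A) n (e : 'I_n -> M) (U : M -> Prop) :
  submod U -> (forall m, U m -> exists c : 'I_n -> A, m = \sum_i c i *: e i) ->
  fgen U.
Proof.
elim: n e U => [|n ih] e U hU.
  move=> Ue; exists 0%N, (fun=> 0); split=> [[]//|m /Ue[c]].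
  by rewrite big_ord0 => ->; exists (fun=> 0); rewrite big_ord0.
move=> Ue; have [U0 UD] := hU.
pose e' (i : 'I_n) := e (widen_ord (leqnSn n) i).
pose sp m := exists c : 'I_n -> A, m = \sum_i c i *: e' i.
have sp0 : sp 0 by exists (fun=> 0); rewrite big1 // => i _; rewrite scale0r.
have spD a m k : sp m -> sp k -> sp (a *: m + k).
  move=> [c ->] [d ->]; exists (fun i => a * c i + d i).
  rewrite scaler_sumr -big_split /=; apply: eq_bigr => i _.
  by rewrite scalerDl scalerA.
have sps : submod sp by split.
have [||n1 [f1 [f1U f1P]]] := ih e' (fun m => U m /\ sp m).
- by split=> // a m k [? ?] [? ?]; split; [apply: UD|apply: spD].
- by move=> m [].
pose J (a : A^o) := exists2 u, U u & sp (u - a *: e ord_max).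
have [|n2 [f2 [f2J f2P]]] := @Aideal_fgen J.
  split; first by exists 0 => //; rewrite scale0r subr0.
  move=> a b c [u Uu hu] [v Uv hv]; exists (a *: u + v); first exact: UD.
  have -> : a *: u + v - (a *: b + c) *: e ord_max =
            a *: (u - b *: e ord_max) + (v - c *: e ord_max).
    by rewrite scalerBr scalerA scalerDl opprD addrACA.
  exact: spD.
have /choice[w wP] : forall j, exists u, U u /\ sp (u - f2 j *: e ord_max).
  by move=> j; have [u] := f2J j; exists u.
exists (n1 + n2)%N, (fun i => match split i with inl j => f1 j | inr j => w j end).
split=> [i|m Um].
  by case: split => j; [case: (f1U j)|case: (wP j)].
have [c mE] := Ue m Um.
have [|d dE] := f2P (c ord_max).
  exists m => //; rewrite mE big_ord_recr /= addrK.
  by exists (fun i => c (widen_ord (leqnSn n) i)).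
pose m' := m - \sum_j d j *: w j.
have [|b bE] := f1P m'.
  split.
    rewrite /m' addrC -scaleN1r; apply: UD => //.
    by apply: submod_sum => // j; case: (wP j).
  have -> : m' = \sum_i c (widen_ord (leqnSn n) i) *: e' i
                 - \sum_j d j *: (w j - f2 j *: e ord_max).
    have -> : \sum_j d j *: (w j - f2 j *: e ord_max) =
              \sum_j d j *: w j - c ord_max *: e ord_max.
      rewrite dE scaler_suml -sumrB; apply: eq_bigr => j _.
      by rewrite scalerBr scalerA.
    by rewrite /m' mE big_ord_recr /= opprB addrA.
  rewrite -scaleN1r addrC; apply: spD; last by exists (fun i => c (widen_ord (leqnSn n) i)).
  by apply: submod_sum => // j; case: (wP j).
exists (fun i => match split i with inl j => b j | inr j => d j end).
rewrite big_split_ord /=.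
under eq_bigr do rewrite (unsplitK (inl _ : 'I_n1 + 'I_n2)).
under [X in _ + X]eq_bigr do rewrite (unsplitK (inr _ : 'I_n1 + 'I_n2)).
by rewrite -bE subrK.
Qed.

Lemma gmod_noetherian (M : gmod X) (U : set M) : gsub U -> fgen U.
Proof.
move=> [U0 UD _]; have [n [e eP]] := gmod_fg M.
by apply: (@span_noetherian M n e) => // m _; apply: eP.
Qed.

End Noetherian.

(** * The degree map on the grading group *)

Section Degree.
Variables (F : fieldType) (X : wpl F).
Local Notation t := (wt_n X).+2.
Local Notation L := (Lgrp X).

(* [ldeg] is normalised so that the canonical element c has degree [wtot]. *)
Definition wtot : nat := (\prod_i wt X i)%N.
Definition xdeg (i : 'I_t) : nat := wtot %/ wt X i.

Lemma wt_xdeg i : (wt X i * xdeg i)%N = wtot.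
Proof.
rewrite mulnC divnK // /wtot (bigD1 i) //=; exact: dvdn_mulr.
Qed.

Lemma xdeg_wt i : (xdeg i * wt X i)%N = wtot.
Proof. by rewrite mulnC wt_xdeg. Qed.

Lemma wtot_gt0 : (0 < wtot)%N.
Proof. by apply: prodn_gt0 => i; apply: wt_gt0. Qed.

Lemma xdeg_gt0 i : (0 < xdeg i)%N.
Proof. by have := wtot_gt0; rewrite -(wt_xdeg i) muln_gt0 => /andP[]. Qed.

Definition vdeg (v : 'rV[int]_t) : int := \sum_i v 0 i * (xdeg i)%:Z.

Lemma vdegB : {morph vdeg : u v / u - v}.
Proof.
move=> u v; rewrite /vdeg -sumrB; apply: eq_bigr => i _.
by rewrite !mxE mulrBl.
Qed.

HB.instance Definition _ := GRing.isZmodMorphism.Build _ _ vdeg vdegB.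

Lemma vdeg_delta i : vdeg (delta_mx 0 i) = (xdeg i)%:Z.
Proof.
rewrite /vdeg (bigD1 i) //= mxE !eqxx mul1r big1 ?addr0 // => j /negbTE ji.
by rewrite mxE ji andbF mul0r.
Qed.

Lemma vdeg_rel v : v \in @Lrel F X -> vdeg v = 0.
Proof.
move=> /asboolP[c ->]; rewrite raddf_sum big1 // => i _.
rewrite raddf_sum big1 // => j _ /=.
rewrite raddfMz raddfB !raddfMn /= !vdeg_delta.
rewrite -[_ *+ wt X i]mulr_natr -[_ *+ wt X j]mulr_natr !natz.
by rewrite mulNr -!PoszM !xdeg_wt subrr mul0rz.
Qed.

Definition ldeg (x : L) : int := vdeg (repr x).

Lemma ldeg_pi v : ldeg (\pi_(Lgrp X) v) = vdeg v.
Proof.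
apply/eqP; rewrite -subr_eq0 -raddfB; apply/eqP/vdeg_rel.
by rewrite Quotient.idealrBE reprK.
Qed.

Lemma ldegB : {morph ldeg : x y / x - y}.
Proof.
move=> x y; rewrite -[x]reprK -[y]reprK -(raddfB (\pi_(Lgrp X))).
by rewrite !ldeg_pi raddfB.
Qed.

HB.instance Definition _ := GRing.isZmodMorphism.Build _ _ ldeg ldegB.

Lemma ldeg_gen i : ldeg (Lgen i) = (xdeg i)%:Z.
Proof. by rewrite /Lgen ldeg_pi vdeg_delta. Qed.

Lemma ldeg_mdegL m : ldeg (@mdegL F X m) = (\sum_i m i * xdeg i)%N%:Z.
Proof.
rewrite /mdegL raddf_sum /= (big_morph Posz PoszD (erefl _)).
by apply: eq_bigr => i _; rewrite raddfMn /= ldeg_gen -mulr_natr mulnC PoszM natz.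
Qed.

End Degree.

Lemma count_lt (T : eqType) (a b : pred T) (s : seq T) x :
  subpred a b -> x \in s -> ~~ a x -> b x -> (count a s < count b s)%N.
Proof.
move=> ab + /negbTE ax bx; elim: s => //= y s ih; rewrite inE => /orP[/eqP <-|/ih].
  by rewrite ax bx add0n add1n ltnS; apply: sub_count.
have /implyP := ab y; case: (a y); case: (b y) => //= _; lia.
Qed.

(** * Homogeneous elements, and finite length as vanishing in large degree *)

Section Homogeneous.
Variables (F : finFieldType) (X : wpl F).
Local Notation t := (wt_n X).+2.
Local Notation A := (Aalg X).
Local Notation L := (Lgrp X).
Local Notation poly := {mpoly F[t]}.

(* Objects and morphisms of coh X only depend on the modules in large degree,
   so every statement about them is tested there. *)
Definition ev (P : L -> Prop) : Prop :=
  exists d : int, forall x, d <= ldeg x -> P x.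

Lemma evT (P : L -> Prop) : (forall x, P x) -> ev P.
Proof. by move=> h; exists 0. Qed.

Lemma evS (P Q : L -> Prop) : ev P -> (forall x, P x -> Q x) -> ev Q.
Proof. by move=> [d h] PQ; exists d => x /h /PQ. Qed.

Lemma evI (P Q : L -> Prop) : ev P -> ev Q -> ev (fun x => P x /\ Q x).
Proof.
move=> [d h] [e k]; exists (Num.max d e) => x; rewrite ge_max => /andP[hd he].
by split; [exact: h|exact: k].
Qed.

Lemma ev_shift (P : L -> Prop) y : ev P -> ev (fun x => P (x + y)).
Proof.
by move=> [d h]; exists (d - ldeg y) => x hx; apply: h; rewrite raddfD /=; lia.
Qed.

Lemma ev_all (n : nat) (P : 'I_n -> L -> Prop) :
  (forall i, ev (P i)) -> ev (fun x => forall i, P i x).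
Proof.
move=> /choice[d hd]; exists (\sum_i `|d i|) => x hx i; apply: hd.
apply: le_trans hx; rewrite (bigD1 i) //=; apply: le_trans (ler_norm _) _.
by rewrite lerDl sumr_ge0.
Qed.

Definition xg (i : 'I_t) : A := \pi_(Aalg X) 'X_i.
Definition mon (m : 'X_{1..t}) : A := \pi_(Aalg X) 'X_[m].
Definition cst (c : F) : A := \pi_(Aalg X) c%:MP.

Lemma AhomogP (y : L) (a : A) : Ahomog y a <-> Apr y a = a.
Proof.
split=> [[p hp ->]|<-].
  rewrite AprE; congr (\pi_(Aalg X) _); apply/mpolyP => m; rewrite hpartE.
  case: eqP => // ne; apply/esym/eqP; rewrite mcoeff_eq0; apply/negP => /hp.
  exact: ne.
have [p ->] := Apr_lift a; rewrite AprE; exists (hpart y p) => // m.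
by rewrite mcoeff_msupp hpartE; case: ifP => [/eqP//|_]; rewrite eqxx.
Qed.

Lemma Apr0 (y : L) : Apr y (0 : A) = 0.
Proof. exact: (@gpr0 _ _ (Amod X)). Qed.

Lemma AprD (y : L) : {morph @Apr F X y : a b / a + b}.
Proof. exact: (@gprD _ _ (Amod X)). Qed.

Lemma Ahomog0 y : Ahomog y (0 : A).
Proof. by apply/AhomogP; apply: Apr0. Qed.

Lemma AhomogB y (a b : A) : Ahomog y a -> Ahomog y b -> Ahomog y (a - b).
Proof. by move=> /AhomogP ha /AhomogP hb; apply/AhomogP; rewrite AprB ha hb. Qed.

Lemma AhomogN y (a : A) : Ahomog y a -> Ahomog y (- a).
Proof. by rewrite -sub0r; apply: AhomogB; apply: Ahomog0. Qed.

Lemma AhomogD y (a b : A) : Ahomog y a -> Ahomog y b -> Ahomog y (a + b).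
Proof. by move=> ha hb; rewrite -[b]opprK; apply: AhomogB => //; apply: AhomogN. Qed.

Lemma AhomogM y z (a b : A) : Ahomog y a -> Ahomog z b -> Ahomog (y + z) (a * b).
Proof.
move=> ha /AhomogP hb; apply/AhomogP.
by rewrite addrC -[a * b]/(a *: (b : A^o)) Apr_act // hb.
Qed.

Lemma Ahomog_mon m : Ahomog (mdegL m) (mon m).
Proof. by exists 'X_[m] => // k; rewrite msuppX inE => /eqP ->. Qed.

Lemma mdegL1 i : mdegL U_(i) = Lgen i :> L.
Proof.
rewrite /mdegL (bigD1 i) //= mnm1E eqxx mulr1n big1 ?addr0 // => j ji.
by rewrite mnm1E eq_sym (negbTE ji) mulr0n.
Qed.

Lemma mdegL0 : mdegL 0%MM = 0 :> L.
Proof. by rewrite /mdegL big1 // => i _; rewrite mnm0E mulr0n. Qed.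

Lemma mdegLn (m : 'X_{1..t}) n : mdegL (m *+ n)%MM = mdegL m *+ n :> L.
Proof.
rewrite /mdegL -sumrMnl; apply: eq_bigr => i _.
by rewrite mulmnE mulrnA.
Qed.

Lemma Ahomog_xg i : Ahomog (Lgen i) (xg i).
Proof. by rewrite -mdegL1; apply: Ahomog_mon. Qed.

Lemma Ahomog_cst c : Ahomog 0 (cst c).
Proof.
exists c%:MP => // m; rewrite msuppC; case: ifP => // _.
by rewrite inE => /eqP ->; apply: mdegL0.
Qed.

Lemma cst1 : cst 1 = 1. Proof. by rewrite /cst rmorph1. Qed.

Lemma Ahomog1 : Ahomog 0 (1 : A).
Proof. by rewrite -cst1; apply: Ahomog_cst. Qed.

Lemma AhomogX y (a : A) n : Ahomog y a -> Ahomog (y *+ n) (a ^+ n).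
Proof.
move=> ha; elim: n => [|n ih]; first exact: Ahomog1.
by rewrite exprS mulrS; apply: AhomogM.
Qed.

Lemma Ahomog_sum y (I : Type) (r : seq I) (f : I -> A) :
  (forall i, Ahomog y (f i)) -> Ahomog y (\sum_(i <- r) f i).
Proof.
move=> h; elim: r => [|i r ih]; first by rewrite big_nil; apply: Ahomog0.
by rewrite big_cons; apply: AhomogD.
Qed.

Lemma monD m n : mon (m + n)%MM = mon m * mon n.
Proof. by rewrite /mon mpolyXD rmorphM. Qed.

Lemma mon0 : mon 0%MM = 1. Proof. by rewrite /mon mpolyX0 rmorph1. Qed.

Lemma mon_xg i n : mon (U_(i) *+ n)%MM = xg i ^+ n.
Proof. by rewrite /mon -mpolyXn rmorphXn. Qed.

Lemma Ahomog_ind y (P : A -> Prop) : P 0 ->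
  (forall a b, P a -> P b -> P (a + b)) ->
  (forall c m, mdegL m = y -> P (cst c * mon m)) ->
  forall a, Ahomog y a -> P a.
Proof.
move=> P0 PD Pm a [p hp ->]; rewrite [p]mpolyE rmorph_sum /= big_seq_cond.
elim/big_rec: _ => // m b; rewrite andbT => mp Pb; apply: PD => //.
by rewrite -mul_mpolyC rmorphM; apply: Pm; apply: hp.
Qed.

Lemma ldeg_mon_ge0 (m : 'X_{1..t}) : 0 <= ldeg (mdegL m : L).
Proof. by rewrite ldeg_mdegL. Qed.

Lemma Ahomog_neg y (a : A) : ldeg y < 0 -> Ahomog y a -> a = 0.
Proof.
move=> hy; move: a; apply: Ahomog_ind => // [a b -> ->|c m my]; first by rewrite addr0.
by have := ldeg_mon_ge0 m; rewrite my leNgt hy.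
Qed.

Lemma Ahomog_decomp (P : A -> Prop) : P 0 ->
  (forall a b, P a -> P b -> P (a + b)) ->
  (forall y a, Ahomog y a -> P a) -> forall a, P a.
Proof.
move=> P0 PD Ph a; have [s [_ _ ->]] := Apr_sum a.
elim/big_rec: _ => // x b _ Pb; apply: PD => //; apply: (Ph x).
by apply/AhomogP; rewrite Apr_idem eqxx.
Qed.

Section Mod.
Variable M : gmod X.
Implicit Types (m n : M) (x y : L) (a : A).

HB.instance Definition _ x := GRing.isZmodMorphism.Build M M (@gpr F X M x) (@gprB F X M x).

Definition hm x m : Prop := gpr x m = m.

Lemma hm_gpr x m : hm x (gpr x m).
Proof. by rewrite /hm gpr_idem eqxx. Qed.

Lemma hm0 x : hm x 0. Proof. exact: gpr0. Qed.

Lemma hmB x m n : hm x m -> hm x n -> hm x (m - n).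
Proof. by move=> hx hy; rewrite /hm raddfB /= hx hy. Qed.

Lemma hmN x m : hm x m -> hm x (- m).
Proof. by move=> h; rewrite -sub0r; apply: hmB => //; apply: hm0. Qed.

Lemma hmD x m n : hm x m -> hm x n -> hm x (m + n).
Proof. by move=> hx hy; rewrite /hm raddfD /= hx hy. Qed.

Lemma hmZ x y a m : Ahomog y a -> hm x m -> hm (x + y) (a *: m).
Proof. by move=> ha hx; rewrite /hm gpr_act // hx. Qed.

Lemma gpr_hm x y m : hm y m -> gpr x m = if x == y then m else 0.
Proof. by move=> h; rewrite -h gpr_idem. Qed.

Lemma gpr_ext m n : (forall x, gpr x m = gpr x n) -> m = n.
Proof.
move=> h; apply/eqP; rewrite -subr_eq0; have [s [_ _ ->]] := gpr_sum (m - n).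
by rewrite big1 // => x _; rewrite raddfB /= h subrr.
Qed.

Lemma gsub_hm (U : set M) m : gsub U -> (forall x, U (gpr x m)) -> U m.
Proof.
move=> gU h; have [s [_ _ ->]] := gpr_sum m.
elim/big_rec: _ => [|x n _ Un]; first by case: gU.
exact: gsubD.
Qed.

Lemma gprZ x y a m : hm x m -> gpr (x + y) (a *: m) = Apr y a *: m.
Proof.
move=> hx; move: a; apply: Ahomog_decomp.
- by rewrite scale0r gpr0 Apr0 scale0r.
- by move=> a b ha hb; rewrite scalerDl raddfD /= ha hb -scalerDl AprD.
- move=> z a ha; rewrite (gpr_hm (x + y) (hmZ ha hx)) (inj_eq (addrI x)).
  have /AhomogP E := ha; rewrite -{2}E Apr_idem E; case: ifP => //.
  by rewrite scale0r.
Qed.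

(** [V] is graded, so the homogeneous components of its generators lie in [V] again; projecting an
    expression of [v] to its degree makes the coefficients homogeneous. *)
Lemma hgen (V : set M) : gsub V ->
  exists (n : nat) (d : 'I_n -> L) (e : 'I_n -> M),
    (forall j, V (e j) /\ hm (d j) (e j)) /\
    forall x v, V v -> hm x v -> exists a : 'I_n -> A,
      (forall j, Ahomog (x - d j) (a j)) /\ v = \sum_j a j *: e j.
Proof.
move=> gV; have [_ _ Vg] := gV; have [n [e [eV eS]]] := gmod_noetherian gV.
have /choice[s sP] := fun i => gpr_sum (e i).
pose l := flatten [seq [seq (x, gpr x (e i)) | x <- s i] | i <- enum 'I_n].
pose d0 : L * M := (0, 0).
exists (size l), (fun j => (nth d0 l j).1), (fun j => (nth d0 l j).2).
have lP q : q \in l -> V q.2 /\ hm q.1 q.2.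
  move=> /flattenP[_ /mapP[i _ ->] /mapP[x _ ->]] /=.
  by split; [apply: Vg|apply: hm_gpr].
have dP (j : 'I_(size l)) : V (nth d0 l j).2 /\ hm (nth d0 l j).1 (nth d0 l j).2.
  by apply: lP; apply: mem_nth.
split=> // x v Vv hv.
have [c [vE]] : exists c : 'I_(size l) -> A, v = \sum_j c j *: (nth d0 l j).2 /\ True.
  have [c ->] := eS v Vv.
  pose sp m := exists c : 'I_(size l) -> A, m = \sum_j c j *: (nth d0 l j).2.
  suff [c' ->] : sp (\sum_i c i *: e i) by exists c'.
  have sp0 : sp 0 by exists (fun=> 0); rewrite big1 // => j _; rewrite scale0r.
  have spD a m k : sp m -> sp k -> sp (a *: m + k).
    move=> [f ->] [g ->]; exists (fun i => a * f i + g i).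
    rewrite scaler_sumr -big_split /=; apply: eq_bigr => i _.
    by rewrite scalerDl scalerA.
  have spe q : q \in l -> sp q.2.
    move=> ql; have il : (index q l < size l)%N by rewrite index_mem.
    exists (fun j => if j == Ordinal il then 1 else 0).
    rewrite (bigD1 (Ordinal il)) //= eqxx scale1r nth_index // big1 ?addr0 //.
    by move=> j /negbTE ->; rewrite scale0r.
  apply: (@submod_sum A M) => // i; have [_ _ ->] := sP i.
  rewrite big_seq; elim/big_rec: _ => // x' m x's spm.
  rewrite -[gpr x' _]scale1r; apply: spD => //.
  apply: (spe (x', gpr x' (e i))); apply/flattenP.
  exists [seq (x, gpr x (e i)) | x <- s i]; last by apply/mapP; exists x'.
  by apply/mapP; exists i => //; rewrite mem_enum.
move=> _; exists (fun j : 'I_(size l) => Apr (x - (nth d0 l j).1) (c j)); split=> [j|].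
  by apply/AhomogP; rewrite Apr_idem eqxx.
rewrite -{1}hv vE raddf_sum /=; apply: eq_bigr => j _.
by rewrite -(gprZ _ _ (proj2 (dP j))) addrC subrK.
Qed.

Lemma hm_span (d : L) (e : M) x a : hm d e -> gpr x (a *: e) = Apr (x - d) a *: e.
Proof. by move=> he; rewrite -(gprZ _ _ he) addrC subrK. Qed.

End Mod.

Lemma gsubZ (M : gmod X) (U : set M) a m : gsub U -> U m -> U (a *: m).
Proof. by move=> [U0 UD _] Um; rewrite -[_ *: _]addr0; apply: UD. Qed.

Lemma hpow (i : 'I_t) k : Ahomog (Lgen i *+ k) (xg i ^+ k).
Proof. by apply: AhomogX; apply: Ahomog_xg. Qed.

(** Apply the bound on chains to the submodules $U + A x_i^{n-j} e$. Where the chain stops,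
    $x_i^{n-j-1}e$ lies in $U + A x_i^{n-j}e$; in its own degree the coefficient has negative degree
    and vanishes, so the element lies in [U]. *)
Lemma fin_len_nilp (M : gmod X) (U V : set M) (d : L) (e : M) i :
  gsub U -> gsub V -> U `<=` V -> fin_len U V -> V e -> hm d e ->
  exists k, U (xg i ^+ k *: e).
Proof.
move=> gU gV UV [n hn] Ve he.
pose c j : set M := [set m | exists u a, U u /\ m = u + a *: (xg i ^+ (n - j) *: e)].
have he' k : hm (d + Lgen i *+ k) (xg i ^+ k *: e) by apply: hmZ => //; apply: hpow.
have gc j : gsub (c j).
  split; first by exists 0, 0; rewrite scale0r addr0; split=> //; case: gU.
    move=> b m m' [u [a [Uu ->]]] [u' [a' [Uu' ->]]].
    exists (b *: u + u'), (b * a + a'); split; first by case: gU => _ h _; apply: h.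
    by rewrite scalerDr addrACA scalerDl -(scalerA b a).
  move=> x m [u [a [Uu ->]]]; exists (gpr x u), (Apr (x - (d + Lgen i *+ (n - j))) a).
  split; first by case: gU => _ _; apply.
  by rewrite raddfD /= (hm_span _ _ (he' _)).
have [j|j m [u [a [Uu ->]]]|j jn] := hn c.
- split=> //; first by move=> m Um; exists m, 0; rewrite scale0r addr0.
  move=> m [u [a [Uu ->]]]; apply: gsubD => //; first exact: UV.
  by apply: gsubZ => //; apply: gsubZ.
- have [jn|jn] := ltnP j n; last first.
    exists u, a; split=> //; congr (_ + _ *: (_ ^+ _ *: _)).
    by lia.
  exists u, (a * xg i); split=> //; congr (_ + _).
  by rewrite !scalerA -mulrA -exprS; congr (_ * _ ^+ _ *: _); lia.
move=> /(_ (xg i ^+ (n - j.+1) *: e)) [|u [a [Uu E]]].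
  by exists 0, 1; rewrite scale1r add0r; split=> //; case: gU.
exists (n - j.+1)%N; rewrite -(he' (n - j.+1)%N) E raddfD /=.
have -> : gpr (d + Lgen i *+ (n - j.+1)) (a *: (xg i ^+ (n - j) *: e)) = 0.
  rewrite (hm_span _ _ (he' _)).
  have -> : Apr (d + Lgen i *+ (n - j.+1) - (d + Lgen i *+ (n - j))) a = 0.
    apply: (@Ahomog_neg (d + Lgen i *+ (n - j.+1) - (d + Lgen i *+ (n - j)))).
      have -> : (n - j = (n - j.+1).+1)%N by lia.
      rewrite mulrSr addrA opprD addrA subrr sub0r raddfN /= ldeg_gen.
      by have := xdeg_gt0 i; lia.
    by apply/AhomogP; rewrite Apr_idem eqxx.
  by rewrite scale0r.
by rewrite addr0; case: gU => _ _; apply.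
Qed.

(** A monomial of large degree contains a high power of some variable, and high powers of each
    variable send the finitely many homogeneous generators of [V] into [U]. *)
Lemma fin_len_ev (M : gmod X) (U V : set M) :
  gsub U -> gsub V -> U `<=` V -> fin_len U V ->
  ev (fun x => forall m, hm x m -> V m -> U m).
Proof.
move=> gU gV UV fl; have [n [d [e [eP eS]]]] := hgen gV.
have /choice[k kP] : forall q : 'I_n * 'I_t, exists k, U (xg q.2 ^+ k *: e q.1).
  by move=> [j i] /=; have [Ve he] := eP j; exact: (fin_len_nilp i gU gV UV fl Ve he).
pose K := (\max_q k q)%N.
have KP j i q : (K <= q)%N -> U (xg i ^+ q *: e j).
  move=> Kq; have kK : (k (j, i) <= q)%N by apply: leq_trans Kq; apply: leq_bigmax.
  by rewrite -(subnK kK) exprD -scalerA; apply: gsubZ => //; apply: (kP (j, i)).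
suff : ev (fun x => forall j, forall a, Ahomog (x - d j) a -> U (a *: e j)).
  move=> /evS; apply=> x h m hx Vm; have [a [ha ->]] := eS _ _ Vm hx.
  elim/big_rec: _ => [|j b _ Ub]; first by case: gU.
  by apply: gsubD => //; apply: h.
apply: ev_all => j.
exists (ldeg (d j) + (\sum_i K * @xdeg F X i)%N%:Z) => x hx.
apply: Ahomog_ind.
- by rewrite scale0r; case: gU.
- by move=> a b ha hb; rewrite scalerDl; apply: gsubD.
move=> c m mx; rewrite -scalerA; apply: gsubZ => //.
have [i Ki] : exists i, (K <= m i)%N.
  apply: contrapT => no; have lt i : (m i < K)%N.
    by rewrite ltnNge; apply/negP => h; apply: no; exists i.
  have : ldeg (mdegL m : L) < (\sum_i K * @xdeg F X i)%N%:Z.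
    rewrite ldeg_mdegL ltz_nat; rewrite (bigD1 ord0) //= [ltnRHS](bigD1 ord0) //=.
    rewrite -addSn leq_add //; first by rewrite ltn_pmul2r ?xdeg_gt0.
    by apply: leq_sum => i _; rewrite leq_pmul2r ?xdeg_gt0 // ltnW.
  by rewrite mx raddfB /= ltrBlDl ltNge hx.
have le : (U_(i) *+ m i <= m)%MM.
  apply/mnm_lepP => i'; rewrite mulmnE mnm1E; case: eqP => [->|_]; first by rewrite mul1n.
  by rewrite mul0n.
by rewrite -(submK le) monD mon_xg -scalerA; apply: gsubZ => //; apply: KP.
Qed.

(** Every variable has positive degree, so finitely many monomials occur, and their coefficients
    range over a finite field. *)
Lemma low_finite_alg (d : int) :
  exists s : seq A, forall y a, ldeg y < d -> Ahomog y a -> a \in s.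
Proof.
pose B := `|d|.+1%N.
exists (codom (fun f : {ffun 'X_{1..t < B} -> F} =>
                 \pi_(Aalg X) (\sum_m f m *: 'X_[m] : poly))) => y a yd [p hp ->].
apply/codomP; exists [ffun m : 'X_{1..t < B} => p@_m].
rewrite {1}(@mpolywE _ _ B p); last first.
  rewrite msizeE; apply/bigmax_leqP_seq => m mp _.
  move: (hp m mp) => mE; move: yd; rewrite -mE ldeg_mdegL /B.
  have : (mdeg m <= \sum_i m i * @xdeg F X i)%N.
    by rewrite mdegE; apply: leq_sum => i _; rewrite leq_pmulr ?xdeg_gt0.
  by lia.
by congr (\pi_(Aalg X) _); apply: eq_bigr => m _; rewrite ffunE.
Qed.

Lemma low_finite (M : gmod X) (d : int) :
  exists s : seq M, forall x m, ldeg x < d -> hm x m -> m \in s.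
Proof.
have [n [g [e [_ eS]]]] := hgen (gsubT M).
have [s sP] := low_finite_alg (d + \sum_j `|ldeg (g j)|).
exists (codom (fun f : {ffun 'I_n -> 'I_(size s)} => \sum_j s`_(f j) *: e j)).
move=> x m xd hx; have [a [ha ->]] := eS x m I hx.
have as_ j : a j \in s.
  apply: sP (ha j); rewrite raddfB /= (bigD1 j) //=.
  have := ler_norm (- ldeg (g j)); rewrite normrN.
  by set S := (X in _ < d + (_ + X)); have : 0 <= S by [apply: sumr_ge0]; lia.
apply/codomP; exists [ffun j => Ordinal (ltac:(by rewrite index_mem) : (index (a j) s < size s)%N)].
by apply: eq_bigr => j _; rewrite ffunE /= nth_index.
Qed.

(** Converse of [fin_len_ev]. A graded submodule between [U] and [V] is determined by its
    homogeneous elements of degree below [d]; counting the members of the finite list [s] that it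
    contains gives a bounded, strictly monotone rank. *)
Lemma ev_fin_len (M : gmod X) (U V : set M) :
  ev (fun x => forall m, hm x m -> V m -> U m) -> fin_len U V.
Proof.
move=> [d hd]; have [s sP] := low_finite M d.
apply: (@rank_fin_len _ _ _ _ _ (size s) (fun W => count (fun m => `[< W m >]) s)).
  by move=> W _; apply: count_size.
move=> W1 W2 [g1 UW1 _] [g2 _ WV2] W12 le m W2m.
apply: gsub_hm => // x; have W2x : W2 (gpr x m) by case: g2 => _ _; apply.
have [xd|xd] := leP d (ldeg x).
  by apply: UW1; apply: (hd x) => //; [apply: hm_gpr|apply: WV2].
have ms := sP x _ xd (hm_gpr x m).
apply: contrapT => nW1; move: le; rewrite leqNgt => /negP; apply.
apply: (@count_lt _ _ _ _ (gpr x m)) => //; last exact/asboolP.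
  by move=> n /asboolP/W12/asboolP.
by apply/negP => /asboolP.
Qed.

End Homogeneous.

(** * Morphisms, kernels and cokernels in large degree *)

Section Tails.
Variables (F : finFieldType) (X : wpl F).
Local Notation L := (Lgrp X).

Section Maps.
Variables M N : gmod X.

(* Maps that need only be A-linear in large degree: these represent exactly the
   morphisms of the quotient category. *)
Definition tmap (phi : M -> N) : Prop :=
  [/\ {morph phi : m n / m - n}, forall x m, phi (gpr x m) = gpr x (phi m)
    & ev (fun x => forall y a m, Ahomog y a -> hm x m ->
            phi (a *: m) = a *: phi m)].

(** A map given separately in each degree, as choice delivers it: additivity and linearity are asked
    only between homogeneous elements of large degree. *)
Definition wtmap (phi : L -> M -> N) : Prop :=
  ev (fun x => [/\ forall m, hm x m -> hm x (phi x m),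
    forall m n, hm x m -> hm x n -> phi x (m - n) = phi x m - phi x n
    & forall y a m, 0 <= ldeg y -> Ahomog y a -> hm x m ->
        phi (x + y) (a *: m) = a *: phi x m]).

(** Putting zero below [d] and summing over the finitely many homogeneous components of an element
    turns the family into one additive graded map. *)
Lemma wtmap_tmap phi : wtmap phi ->
  exists psi : M -> N, tmap psi /\ ev (fun x => forall m, hm x m -> psi m = phi x m).
Proof.
move=> [d hd].
have phi0 x : d <= ldeg x -> phi x 0 = 0.
  by move=> /hd[_ h _]; have := h 0 0 (hm0 _ _) (hm0 _ _); rewrite !subrr.
have /choice[psi psiP] : forall m, exists n : N, forall x,
    gpr x n = if d <= ldeg x then phi x (gpr x m) else 0.
  move=> m; have [s [su s0 _]] := gpr_sum m.
  exists (\sum_(z <- s) if d <= ldeg z then phi z (gpr z m) else 0) => x.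
  rewrite raddf_sum /=.
  under eq_bigr => z _.
    have -> : gpr x (if d <= ldeg z then phi z (gpr z m) else 0) =
              if x == z then (if d <= ldeg x then phi x (gpr x m) else 0) else 0.
      case: ifP => dz; last by rewrite gpr0; case: eqP => // ->; rewrite dz.
      have [h _ _] := hd z dz; rewrite (gpr_hm _ (h _ (hm_gpr _ _))).
      by case: eqP => // ->; rewrite dz.
    over.
  have [xs|xs] := boolP (x \in s).
    rewrite (bigD1_seq x) //= eqxx big1 ?addr0 // => z.
    by rewrite eq_sym => /negbTE ->.
  rewrite big1_seq => [|z /andP[_ zs]]; last first.
    by case: eqP xs => // ->; rewrite zs.
  by rewrite s0 //; case: ifP => // /phi0.
have psiE x m : d <= ldeg x -> hm x m -> psi m = phi x m.
  move=> dx hx; apply: gpr_ext => z; rewrite psiP.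
  have [h _ _] := hd x dx; rewrite (gpr_hm _ (h _ hx)) (gpr_hm _ hx).
  by case: eqP => [->|_]; [rewrite dx|case: ifP => // /phi0].
exists psi; split; last by exists d => x dx m; apply: psiE.
split.
- move=> m n; apply: gpr_ext => x; rewrite raddfB /= !psiP raddfB /=.
  case: ifP => [/hd[_ h _]|_]; last by rewrite subrr.
  by apply: h; apply: hm_gpr.
- move=> z m; apply: gpr_ext => x; rewrite psiP !gpr_idem.
  case: (x =P z) => [->|_]; first by rewrite psiP.
  by case: ifP => // /phi0.
- exists d => x dx y a m ha hx.
  have [yn|yp] := ltP (ldeg y) 0.
    rewrite (Ahomog_neg yn ha) !scale0r; apply: gpr_ext => z; rewrite psiP !gpr0.
    by case: ifP => // /phi0.
  rewrite (psiE (x + y)); last exact: hmZ.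
    by rewrite (psiE x) //; have [_ _ h] := hd x dx; apply: h.
  by rewrite raddfD /=; lia.
Qed.

(** The truncation $M_{\ge d}$. It is a submodule because $A$ has no negative degrees, it is
    cofinite, and for suitable [d] a [tmap] is linear on it. *)
Definition hsupp (d : int) : set M := [set m | forall x, ldeg x < d -> gpr x m = 0].

Lemma hsupp_hm d x m : d <= ldeg x -> hm x m -> hsupp d m.
Proof.
by move=> dx hx z zd; rewrite (gpr_hm z hx); case: eqP => // E; move: zd; rewrite E; lia.
Qed.

Lemma hsupp_ind d (P : M -> Prop) : P 0 ->
  (forall m n, P m -> P n -> P (m + n)) ->
  (forall x m, d <= ldeg x -> hm x m -> P m) -> forall m, hsupp d m -> P m.
Proof.
move=> P0 PD Ph m hm; have [s [_ _ ->]] := gpr_sum m.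
elim/big_rec: _ => // x n _ Pn; apply: PD => //.
have [/hm ->//|dx] := ltP (ldeg x) d.
exact: Ph dx (hm_gpr x m).
Qed.

Lemma gsub_hsupp d : gsub (hsupp d).
Proof.
have hD m n : hsupp d m -> hsupp d n -> hsupp d (m + n).
  by move=> hx hy x xd; rewrite raddfD /= hx // hy // addr0.
have h0 : hsupp d 0 by move=> x _; rewrite gpr0.
split=> //; last first.
  by move=> x m h z zd; rewrite gpr_idem; case: eqP => // E; rewrite h // -E.
move=> a m n hx hn; apply: (hD _ _) => //; move: m hx; apply: hsupp_ind.
- by rewrite scaler0.
- by move=> m m' hx hy; rewrite scalerDr; apply: hD.
move=> x m dx hx; move: a; apply: Ahomog_decomp.
- by rewrite scale0r.
- by move=> a b ha hb; rewrite scalerDl; apply: hD.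
move=> y a ha; have [yn|yp] := ltP (ldeg y) 0.
  by rewrite (Ahomog_neg yn ha) scale0r.
by apply: (@hsupp_hm _ (x + y)); [rewrite raddfD /=; lia|apply: hmZ].
Qed.

Lemma cofin_hsupp d : fin_len (hsupp d) setT.
Proof. by apply: ev_fin_len; exists d => x dx m hx _; apply: hsupp_hm hx. Qed.

Section TmapTheory.
Variable phi : M -> N.
Hypothesis hphi : tmap phi.

Lemma tmapB : {morph phi : m n / m - n}. Proof. by case: hphi. Qed.

Lemma tmap0 : phi 0 = 0. Proof. by have := tmapB 0 0; rewrite !subrr. Qed.

Lemma tmapN m : phi (- m) = - phi m.
Proof. by rewrite -sub0r tmapB tmap0 sub0r. Qed.

Lemma tmapD : {morph phi : m n / m + n}.
Proof. by move=> m n; rewrite -{1}[n]opprK tmapB tmapN opprK. Qed.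

Lemma tmap_hm x m : hm x m -> hm x (phi m).
Proof. by move=> hx; rewrite /hm; case: hphi => _ h _; rewrite -h hx. Qed.

Lemma tmap_frac : exists d, frac (fun m n => hsupp d m /\ n = phi m).
Proof.
have [_ hg [d hd]] := hphi; exists d.
have [g0 gD gG] := gsub_hsupp d.
have lin a m : hsupp d m -> phi (a *: m) = a *: phi m.
  move: m; apply: hsupp_ind.
  - by rewrite scaler0 tmap0 scaler0.
  - by move=> m n hx hy; rewrite scalerDr !tmapD hx hy scalerDr.
  move=> x m dx hx; move: a; apply: Ahomog_decomp.
  - by rewrite !scale0r tmap0.
  - by move=> a b ha hb; rewrite !scalerDl tmapD ha hb.
  by move=> y a ha; exact: (hd x dx y a m ha hx).
split.
- by split=> //; rewrite tmap0.
- move=> a m n m' n' [hx ->] [hy ->]; split; first exact: gD.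
  by rewrite tmapD lin.
- by move=> x m n [hx ->]; split; [apply: gG|rewrite hg].
- apply: ev_fin_len; exists d => x dx m hx _; exists (phi m); split=> //.
  exact: hsupp_hm hx.
- by apply: ev_fin_len; apply: evT => x m _ [_ ->]; rewrite tmap0.
Qed.

End TmapTheory.

(** The quotient by the domain and the indeterminacy of a fraction have finite length, so in large
    degree the relation is total and single-valued. *)
Lemma frac_ev (R : M -> N -> Prop) : frac R ->
  ev (fun x => (forall m, hm x m -> exists2 n, hm x n & R m n) /\
               (forall n, hm x n -> R 0 n -> n = 0)).
Proof.
move=> fR; have lR := frac_rlin fR; have [_ _ rg fd fi] := fR.
apply: evI.
  apply: evS (fin_len_ev (gsub_rdom lR) (gsubT _) _ fd) _ => // x h m hx.
  have [n r] := h m hx I; exists (gpr x n); first exact: hm_gpr.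
  by rewrite -hx; apply: rg.
have sub : [set 0] `<=` rind R by move=> n ->; case: fR.
by apply: evS (fin_len_ev (gsub0 _) (gsub_rind lR) sub fi) _ => x h n hx r; apply: h.
Qed.

Lemma frac_eq_ev (R R' : M -> N -> Prop) : frac_eq R R' ->
  ev (fun x => forall m n n', hm x m -> hm x n -> hm x n' ->
        R m n -> R' m n' -> n = n').
Proof.
move=> [M' [N' [[gM fM] [gN fN] _ h]]].
have sub : [set 0] `<=` N' by move=> n ->; case: gN.
have := evI (fin_len_ev gM (gsubT _) (fun _ _ => I) fM) (fin_len_ev (gsub0 _) gN sub fN).
move=> /evS; apply=> x [h1 h2] m n n' hx hn hn' r r'.
apply/eqP; rewrite -subr_eq0; apply/eqP; apply: h2; first exact: hmB.
by apply: (h m) => //; apply: h1.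
Qed.

Lemma cohom_tmap (f : cohom M N) : exists phi : M -> N, tmap phi /\
  ev (fun x => forall m, hm x m -> coh_rep f m (phi m)).
Proof.
have fR := coh_repP f; set R := coh_rep f in fR *; have lR := frac_rlin fR.
have [_ rl rg _ _] := fR; have [d hd] := frac_ev fR.
have /choice[phi0 phiP] : forall q : L * M, exists n,
    d <= ldeg q.1 -> hm q.1 q.2 -> hm q.1 n /\ R q.2 n.
  move=> [x m] /=; have [[dx hx]|no] := pselect (d <= ldeg x /\ hm x m).
    by have [n hn r] := proj1 (hd x dx) m hx; exists n.
  by exists 0 => dx hx; case: no.
have [|phi [phiT phiE]] := @wtmap_tmap (fun x m => phi0 (x, m)).
  exists d => x dx.
  have uniq z m n n' : d <= ldeg z -> hm z n -> hm z n' -> R m n -> R m n' -> n = n'.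
    move=> dz hn hn' r r'; apply/eqP; rewrite -subr_eq0; apply/eqP.
    apply: (proj2 (hd z dz)); first exact: hmB.
    by rewrite -(subrr m); apply: rlinB.
  split.
  - by move=> m hx; case: (phiP (x, m) dx hx).
  - move=> m n hx hn; have [h1 r1] := phiP (x, m) dx hx.
    have [h2 r2] := phiP (x, n) dx hn.
    have [h3 r3] := phiP (x, m - n) dx (hmB hx hn).
    by apply: (uniq x (m - n)) => //; [apply: hmB|apply: rlinB].
  - move=> y a m yp ha hx; have dxy : d <= ldeg (x + y) by rewrite raddfD /=; lia.
    have [h1 r1] := phiP (x, m) dx hx.
    have [h2 r2] := phiP (x + y, a *: m) dxy (hmZ ha hx).
    apply: (uniq (x + y) (a *: m)) => //; first exact: hmZ.
    have [r0 _ _] := lR; have := rl a _ _ _ _ r1 r0.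
    by rewrite !addr0.
exists phi; split=> //; have evd : ev (fun x : L => d <= ldeg x) by exists d.
apply: evS (evI phiE evd) _ => x [E dx] m hx; rewrite E //.
by case: (phiP (x, m) dx hx).
Qed.

(** A chosen representative. It is compatible with composition, identities and sums of morphisms
    only in large degree, which is why such identities are stated under [ev]. *)
Definition fn (f : cohom M N) : M -> N := sval (cid (cohom_tmap f)).

Lemma fnT f : tmap (fn f).
Proof. by case: (svalP (cid (cohom_tmap f))). Qed.

Lemma fn_rep f : ev (fun x => forall m, hm x m -> coh_rep f m (fn f m)).
Proof. by case: (svalP (cid (cohom_tmap f))). Qed.

Lemma fn_cls (R : M -> N -> Prop) (fR : frac R) (phi : M -> N) : tmap phi ->
  ev (fun x => forall m, hm x m -> R m (phi m)) ->
  ev (fun x => forall m, hm x m -> fn (cls fR) m = phi m).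
Proof.
move=> hphi hR; have := evI (frac_eq_ev (coh_rep_cls fR)) (evI hR (fn_rep (cls fR))).
move=> /evS; apply=> x [h [h1 h2]] m hx; apply: (h m) => //.
- by apply: tmap_hm => //; apply: fnT.
- exact: tmap_hm.
- exact: h2.
- exact: h1.
Qed.

Lemma tmap_hom (phi : M -> N) : tmap phi ->
  exists f : cohom M N, ev (fun x => forall m, hm x m -> fn f m = phi m).
Proof.
move=> hphi; have [d fr] := tmap_frac hphi; exists (cls fr).
apply: fn_cls => //; exists d => x dx m hx; split=> //; exact: hsupp_hm hx.
Qed.

Lemma wtmap_hom (phi : L -> M -> N) : wtmap phi ->
  exists f : cohom M N, ev (fun x => forall m, hm x m -> fn f m = phi x m).
Proof.
move=> /wtmap_tmap[psi [/tmap_hom[f fE] E]]; exists f.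
by apply: evS (evI fE E) _ => x [h1 h2] m hx; rewrite h1 // h2.
Qed.

(** Equality in the colimit is witnessed by the truncation of [M] as the smaller domain and by the
    sum of the two indeterminacies as the submodule of [N] to divide out. *)
Lemma hom_ext (f g : cohom M N) :
  ev (fun x => forall m, hm x m -> fn f m = fn g m) -> f = g.
Proof.
move=> h; rewrite -[f]coh_repK -[g]coh_repK; apply: cls_eq.
have fR := coh_repP f; have gR := coh_repP g.
have lR := frac_rlin fR; have lR' := frac_rlin gR.
have [d hd] := evI h (evI (fn_rep f) (fn_rep g)).
have rD (R : M -> N -> Prop) (k : cohom M N) : rlin R ->
    (forall x, d <= ldeg x -> forall m, hm x m -> R m (fn k m)) ->
    forall m, hsupp d m -> R m (fn k m).
  move=> [r0 rl rg] hR; apply: hsupp_ind.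
  - by rewrite tmap0 //; apply: fnT.
  - move=> m n r r'; rewrite (tmapD (fnT k)); have := rl 1 _ _ _ _ r r'.
    by rewrite !scale1r.
  - by move=> x m dx hx; apply: hR hx.
have rf := rD _ f lR (fun x dx => proj1 (proj2 (hd x dx))).
have rg := rD _ g lR' (fun x dx => proj2 (proj2 (hd x dx))).
have fg m : hsupp d m -> fn f m = fn g m.
  move: m; apply: hsupp_ind.
  - by rewrite !tmap0 //; apply: fnT.
  - by move=> m n E E'; rewrite !tmapD ?E ?E' //; apply: fnT.
  - by move=> x m dx hx; apply: (proj1 (hd x dx)).
exists (hsupp d), (gadd (rind (coh_rep f)) (rind (coh_rep g))); split.
- by split; [apply: gsub_hsupp|apply: cofin_hsupp].
- have [_ _ _ _ i1] := fR; have [_ _ _ _ i2] := gR.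
  have g1 := gsub_rind lR; have g2 := gsub_rind lR'.
  by split; [apply: gsubA|apply: fin_len_add].
- by split=> m hx; [exists (fn f m); apply: rf|exists (fn g m); apply: rg].
- move=> m n n' hx r r'; exists (n - fn f m), (fn g m - n'); split.
  + by rewrite /rind /= -(subrr m); apply: rlinB => //; apply: rf.
  + by rewrite /rind /= -(subrr m); apply: rlinB => //; apply: rg.
  + by rewrite fg // addrA subrK.
Qed.

End Maps.

Lemma fn_comp (M N P : gmod X) (g : cohom N P) (f : cohom M N) :
  ev (fun x => forall m, hm x m -> fn (coh_comp g f) m = fn g (fn f m)).
Proof.
apply: (@fn_cls M P _ _ (fun m => fn g (fn f m))).
  have [f1 f2 f3] := fnT f; have [g1 g2 g3] := fnT g; split.
  - by move=> m n; rewrite f1 g1.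
  - by move=> x m; rewrite f2 g2.
  - apply: evS (evI f3 g3) _ => x [h1 h2] y a m ha hx.
    by rewrite (h1 y) // (h2 y) //; apply: tmap_hm => //; apply: fnT.
apply: evS (evI (fn_rep f) (fn_rep g)) _ => x [h1 h2] m hx.
exists (fn f m); first exact: h1.
by apply: h2; apply: tmap_hm => //; apply: fnT.
Qed.

Lemma fn_id (M : gmod X) :
  ev (fun x => forall m, hm x m -> fn (cls (frac_id M)) m = m).
Proof.
apply: (@fn_cls M M _ _ id); last exact: evT.
by split=> //; apply: evT.
Qed.

End Tails.

(** * Graded submodules and quotients as objects *)

Record gsubobj (F : finFieldType) (X : wpl F) (M : gmod X) :=
  GSubObj { gset : set M; gsetP : gsub gset }.

Section Subquotients.
Variables (F : finFieldType) (X : wpl F) (M : gmod X) (U : gsubobj M).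
Local Notation A := (Aalg X).
Local Notation L := (Lgrp X).

Definition gset_pred : {pred M} := fun m => `[< gset U m >].

Lemma gset_closed : submod_closed gset_pred.
Proof.
have [u0 ul _] := gsetP U; split; first exact/asboolP.
by move=> a m n /asboolP hx /asboolP hy; apply/asboolP; apply: ul.
Qed.

HB.instance Definition _ := GRing.isSubmodClosed.Build A M gset_pred gset_closed.

Record gsub_car := GSubCar { gsub_val : M; _ : gsub_val \in gset_pred }.

HB.instance Definition _ := [isSub for gsub_val].
HB.instance Definition _ := [Choice of gsub_car by <:].
HB.instance Definition _ := [SubChoice_isSubLmodule of gsub_car by <:].

Lemma gsub_pr_subproof x (m : gsub_car) : gpr x (val m) \in gset_pred.
Proof.
by apply/asboolP; have [_ _ ug] := gsetP U; apply: ug; apply/asboolP; apply: valP m.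
Qed.

Definition gsub_pr x (m : gsub_car) : gsub_car := GSubCar (gsub_pr_subproof x m).

Lemma gsub_prB x : {morph gsub_pr x : m n / m - n}.
Proof. by move=> m n; apply: val_inj; rewrite /= !raddfB. Qed.

Lemma gsub_pr_idem x y m : gsub_pr x (gsub_pr y m) = if x == y then gsub_pr y m else 0.
Proof. by apply: val_inj; rewrite /= gpr_idem; case: eqP. Qed.

Lemma gsub_pr_sum m : exists s : seq L,
  [/\ uniq s, forall x, x \notin s -> gsub_pr x m = 0 & m = \sum_(x <- s) gsub_pr x m].
Proof.
have [s [su s0 sE]] := gpr_sum (val m); exists s; split=> //.
  by move=> x /s0 h; apply: val_inj.
by apply: val_inj; rewrite raddf_sum.
Qed.

Lemma gsub_pr_act x y a m : Ahomog y a ->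
  gsub_pr (x + y) (a *: m) = a *: gsub_pr x m.
Proof. by move=> h; apply: val_inj; exact: gpr_act. Qed.

Lemma gsub_fg : exists (n : nat) (e : 'I_n -> gsub_car),
  forall m, exists c : 'I_n -> A, m = \sum_i c i *: e i.
Proof.
have [n [e [eU eS]]] := gmod_noetherian (gsetP U).
have eP i : e i \in gset_pred by apply/asboolP.
exists n, (fun i => GSubCar (eP i)) => m.
have [c cE] := eS (val m) ltac:(by apply/asboolP; exact: valP m).
exists c; apply: val_inj; rewrite raddf_sum /= cE; apply: eq_bigr => i _.
by [].
Qed.

Definition gsub_mod : gmod X :=
  GMod gsub_prB gsub_pr_idem gsub_pr_sum gsub_pr_act gsub_fg.

Definition gquo := Quotient.quot (gset_pred : zmodClosed M).
HB.instance Definition _ := GRing.Zmodule.on gquo.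

Definition gquo_scale (a : A) (q : gquo) : gquo := \pi_gquo (a *: repr q).

Lemma gquo_piP (m n : M) : \pi_gquo m = \pi_gquo n <-> gset U (m - n).
Proof.
split=> [/eqP|h]; first by rewrite -Quotient.idealrBE => /asboolP.
by apply/eqP; rewrite -Quotient.idealrBE; apply/asboolP.
Qed.

Lemma gquo_scaleE a m : gquo_scale a (\pi_gquo m) = \pi_gquo (a *: m).
Proof.
apply/gquo_piP; rewrite -scalerBr; apply: gsubZ; first exact: gsetP.
by apply/gquo_piP; rewrite reprK.
Qed.

Lemma gquo_lift (q : gquo) : exists m, q = \pi_gquo m.
Proof. by exists (repr q); rewrite reprK. Qed.

Lemma gquo_scaleA a b q : gquo_scale a (gquo_scale b q) = gquo_scale (a * b) q.
Proof. by have [m ->] := gquo_lift q; rewrite !gquo_scaleE scalerA. Qed.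

Lemma gquo_scale1 : left_id 1 gquo_scale.
Proof. by move=> q; have [m ->] := gquo_lift q; rewrite gquo_scaleE scale1r. Qed.

Lemma gquo_scaleDr : right_distributive gquo_scale +%R.
Proof.
move=> a q r; have [m ->] := gquo_lift q; have [n ->] := gquo_lift r.
by rewrite -[_ + _](raddfD (\pi_gquo)) !gquo_scaleE scalerDr raddfD.
Qed.

Lemma gquo_scaleDl q : {morph gquo_scale^~ q : a b / a + b}.
Proof.
move=> a b; have [m ->] := gquo_lift q; rewrite !gquo_scaleE scalerDl.
by rewrite raddfD.
Qed.

HB.instance Definition _ := GRing.Zmodule_isLmodule.Build A gquo
  gquo_scaleA gquo_scale1 gquo_scaleDr gquo_scaleDl.

Definition gquo_pr x (q : gquo) : gquo := \pi_gquo (gpr x (repr q)).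

Lemma gquo_prE x m : gquo_pr x (\pi_gquo m) = \pi_gquo (gpr x m).
Proof.
apply/gquo_piP; rewrite -gprB; have [_ _ ug] := gsetP U; apply: ug.
by apply/gquo_piP; rewrite reprK.
Qed.

Lemma gquo_prB x : {morph gquo_pr x : m n / m - n}.
Proof.
move=> q r; have [m ->] := gquo_lift q; have [n ->] := gquo_lift r.
by rewrite -[_ - _](raddfB (\pi_gquo)) !gquo_prE gprB raddfB.
Qed.

Lemma gquo_pr_idem x y q : gquo_pr x (gquo_pr y q) = if x == y then gquo_pr y q else 0.
Proof.
have [m ->] := gquo_lift q; rewrite !gquo_prE gpr_idem.
by case: eqP => // _; rewrite raddf0.
Qed.

Lemma gquo_pr_sum q : exists s : seq L,
  [/\ uniq s, forall x, x \notin s -> gquo_pr x q = 0 & q = \sum_(x <- s) gquo_pr x q].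
Proof.
have [m ->] := gquo_lift q; have [s [su s0 sE]] := gpr_sum m; exists s; split=> //.
  by move=> x /s0 h; rewrite gquo_prE h raddf0.
under eq_bigr do rewrite gquo_prE.
by rewrite {1}sE raddf_sum.
Qed.

Lemma gquo_pr_act x y a (q : gquo) : Ahomog y a ->
  gquo_pr (x + y) (a *: q) = a *: gquo_pr x q.
Proof.
have [m ->] := gquo_lift q => h.
by rewrite -[LHS]/(gquo_pr _ (gquo_scale _ _)) -[RHS]/(gquo_scale _ _)
           gquo_scaleE !gquo_prE gquo_scaleE gpr_act.
Qed.

Lemma gquo_fg : exists (n : nat) (e : 'I_n -> gquo),
  forall m, exists c : 'I_n -> A, m = \sum_i c i *: e i.
Proof.
have [n [e eP]] := gmod_fg M; exists n, (fun i => \pi_gquo (e i)) => q.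
have [m ->] := gquo_lift q; have [c ->] := eP m; exists c.
rewrite raddf_sum; apply: eq_bigr => i _; exact: esym (gquo_scaleE _ _).
Qed.

Definition gquo_mod : gmod X :=
  GMod gquo_prB gquo_pr_idem gquo_pr_sum gquo_pr_act gquo_fg.

End Subquotients.

(** * Kernels, cokernels and exactness in large degree *)

Section Exactness.
Variables (F : finFieldType) (X : wpl F).
Local Notation L := (Lgrp X).
Local Notation C := (coh X).
Implicit Types M N P Q K : C.

Lemma fnB M N (f : hom M N) m n : fn f (m - n) = fn f m - fn f n.
Proof. exact: tmapB (fnT f) m n. Qed.

Lemma fnD M N (f : hom M N) m n : fn f (m + n) = fn f m + fn f n.
Proof. exact: tmapD (fnT f) m n. Qed.

Lemma fn0 M N (f : hom M N) : fn f 0 = 0.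
Proof. exact: tmap0 (fnT f). Qed.

Lemma fn_hm M N (f : hom M N) x m : hm x m -> hm x (fn f m).
Proof. exact: tmap_hm (fnT f) x m. Qed.

Lemma fn_gpr M N (f : hom M N) x m : fn f (gpr x m) = gpr x (fn f m).
Proof. by case: (fnT f). Qed.

Lemma fnZ M N (f : hom M N) : ev (fun x : L => forall y a m, Ahomog y a -> hm x m ->
  fn f (a *: m) = a *: fn f m).
Proof. by case: (fnT f). Qed.

Definition cinj M N (f : hom M N) : Prop :=
  ev (fun x => forall m : car M, hm x m -> fn f m = 0 -> m = 0).
Definition csurj M N (f : hom M N) : Prop :=
  ev (fun x => forall n : car N, hm x n -> exists2 m : car M, hm x m & fn f m = n).
Definition cexact M N P (f : hom M N) (g : hom N P) : Prop :=
  ev (fun x => forall n : car N, hm x n ->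
    (fn g n = 0 <-> exists2 m : car M, hm x m & fn f m = n)).
Definition cnull M N (f : hom M N) : Prop :=
  ev (fun x => forall m : car M, hm x m -> fn f m = 0).
Definition czero M : Prop := ev (fun x => forall m : car M, hm x m -> m = 0).

Lemma sub_obj M (U : set (car M)) : gsub U -> exists (K : C) (i : hom K M),
  cinj i /\ ev (fun x => forall m : car M, hm x m ->
    (U m <-> exists2 k : car K, hm x k & fn i k = m)).
Proof.
move=> gU; pose W := GSubObj gU; exists (gsub_mod W).
have [|i iE] := @tmap_hom F X (gsub_mod W) M (@gsub_val _ _ _ W).
  by split=> [m n|x m|]; rewrite ?raddfB //; apply: evT.
exists i; split.
  by apply: evS iE _ => x h m hx; rewrite h // => E; apply: val_inj.
apply: evS iE _ => x h m hx; split=> [Um|[k hk <-]].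
  have Wm : m \in gset_pred W by apply/asboolP.
  have hk : hm (M := gsub_mod W) x (GSubCar Wm) by apply: val_inj.
  by exists (GSubCar Wm) => //; rewrite h.
by rewrite h //; apply/asboolP; apply: (valP k).
Qed.

Lemma quo_obj M (U : set (car M)) : gsub U -> exists (Q : C) (p : hom M Q),
  csurj p /\ ev (fun x => forall m : car M, hm x m -> (fn p m = 0 <-> U m)).
Proof.
move=> gU; pose W := GSubObj gU; exists (gquo_mod W).
have [|p pE] := @tmap_hom F X M (gquo_mod W) (\pi_(gquo W)).
  split=> [m n|x m|]; first by rewrite raddfB.
    by rewrite [RHS]gquo_prE.
  by apply: evT => x y a m _ _; apply/esym; exact: (gquo_scaleE W a m).
exists p; split; apply: evS pE _ => x h m hx; last first.
  rewrite h // -(raddf0 (\pi_(gquo W))); split=> [/gquo_piP|Um]; first by rewrite subr0.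
  by apply/gquo_piP; rewrite subr0.
have [n nE] := gquo_lift m; exists (gpr x n); first exact: hm_gpr.
rewrite h; last exact: hm_gpr.
by rewrite -gquo_prE -nE.
Qed.

Lemma homP M N (f g : hom M N) :
  ev (fun x => forall m : car M, hm x m -> fn f m = fn g m) <-> f = g.
Proof. by split=> [|->]; [apply: hom_ext|apply: evT]. Qed.

Lemma fnM M N P (g : hom N P) (f : hom M N) :
  ev (fun x => forall m : car M, hm x m -> fn (comp g f) m = fn g (fn f m)).
Proof. exact: fn_comp. Qed.

Lemma fn1 M : ev (fun x => forall m : car M, hm x m -> fn (idm M) m = m).
Proof. exact: fn_id. Qed.

Lemma hom0_ex M N : exists f : hom M N, cnull f.
Proof.
apply: (@tmap_hom F X M N (fun=> 0)).
by split=> [m n|x m|]; rewrite ?subr0 ?gpr0 //; apply: evT => x y a m _ _; rewrite scaler0.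
Qed.

Definition hom0 M N : hom M N := sval (cid (hom0_ex M N)).

Lemma hom0E M N : cnull (hom0 M N). Proof. exact: (svalP (cid (hom0_ex M N))). Qed.

Lemma cnullP M N (f : hom M N) : cnull f <-> f = hom0 M N.
Proof.
split=> [h|->]; last exact: hom0E.
apply/homP; apply: evS (evI h (hom0E M N)) _ => x [h1 h2] m hx.
by rewrite h1 // h2.
Qed.

Lemma is_zeroP Z : is_zero Z <-> czero Z.
Proof.
split=> [h|h].
  have [[f [_ fU]] _] := h Z.
  have E : idm Z = hom0 Z Z by rewrite -(fU (idm Z) I) -(fU (hom0 Z Z) I).
  have := hom0E Z Z; rewrite -E => h0.
  by apply: evS (evI h0 (fn1 Z)) _ => x [h1 h2] m hx; rewrite -(h2 m) // h1.
move=> M; split.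
  exists (hom0 M Z); split=> // g _; apply/homP; apply: evS h _ => x h m hx.
  by rewrite (h (fn g m)) 1?(h (fn (hom0 M Z) m)) //; apply: fn_hm.
exists (hom0 Z M); split=> // g _; apply/homP; apply: evS h _ => x h m hx.
by rewrite [m]h // !fn0.
Qed.

Lemma zero_ex : exists Z : C, is_zero Z.
Proof.
pose M := Osh (0 : L); have [K [i [iI iE]]] := @sub_obj M _ (gsub0 M).
exists K; apply/is_zeroP; apply: evS (evI iI iE) _ => x [h1 h2] k hk.
by apply: h1 => //; apply/(h2 _ (fn_hm i hk)); exists k.
Qed.

Lemma zero_morP M N (f : hom M N) : zero_mor f <-> f = hom0 M N.
Proof.
rewrite -cnullP; split=> [[Z [/is_zeroP hZ [g [h ->]]]]|h].
  apply: evS (evI (fnM h g) hZ) _ => x [h1 h2] m hx.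
  by rewrite h1 // [fn g m]h2 ?fn0 //; apply: fn_hm.
have [Z hZ] := zero_ex; exists Z; split=> //.
exists (hom0 M Z), (hom0 Z N); apply/homP.
apply: evS (evI h (evI (fnM (hom0 Z N) (hom0 M Z)) (hom0E M Z))) _.
by move=> x [h1 [h2 h3]] m hx; rewrite h1 // h2 // h3 // fn0.
Qed.

(** Preimages under [i] are chosen degree by degree; injectivity in large degree makes them unique
    there, hence additive and linear. *)
Lemma lift_inj M N K (i : hom K N) (g : hom M N) : cinj i ->
  ev (fun x => forall m : car M, hm x m -> exists2 k : car K, hm x k & fn i k = fn g m) ->
  exists u : hom M K, comp i u = g.
Proof.
move=> iI ig; have [d hd] := evI ig (evI iI (evI (fnZ i) (fnZ g))).
have /choice[phi phiP] : forall q : L * car M, exists k : car K,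
    d <= ldeg q.1 -> hm q.1 q.2 -> hm q.1 k /\ fn i k = fn g q.2.
  move=> [x m] /=; have [[dx hx]|no] := pselect (d <= ldeg x /\ hm x m).
    by have [h _] := hd x dx; have [k hk E] := h m hx; exists k.
  by exists 0 => dx hx; case: no.
have un x k k' : d <= ldeg x -> hm x k -> hm x k' -> fn i k = fn i k' -> k = k'.
  move=> dx hk hk' E; apply/eqP; rewrite -subr_eq0; apply/eqP.
  have [_ [h _]] := hd x dx; apply: h; first exact: hmB.
  by rewrite fnB E subrr.
have [|u uE] := @wtmap_hom F X M K (fun x m => phi (x, m)).
  exists d => x dx; split.
  - by move=> m hx; case: (phiP (x, m) dx hx).
  - move=> m n hx hn; have [h1 E1] := phiP (x, m) dx hx.
    have [h2 E2] := phiP (x, n) dx hn; have [h3 E3] := phiP (x, m - n) dx (hmB hx hn).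
    apply: (un x) => //; first exact: hmB.
    by rewrite fnB E1 E2 E3 /= fnB.
  - move=> y a m yp ha hx; have dxy : d <= ldeg (x + y) by rewrite raddfD /=; lia.
    have [h1 E1] := phiP (x, m) dx hx.
    have [h2 E2] := phiP (x + y, a *: m) dxy (hmZ ha hx).
    apply: (un (x + y)) => //; first exact: hmZ.
    have [_ [_ [hi hg]]] := hd x dx.
    by rewrite E2 (hi y) // E1 /= (hg y).
exists u; apply/homP; have evd : ev (fun x : L => d <= ldeg x) by exists d.
apply: evS (evI evd (evI uE (fnM i u))) _ => x [dx [h1 h2]] m hx.
by rewrite h2 // h1 //; case: (phiP (x, m) dx hx).
Qed.

(** Two chosen preimages under [p] differ by an element that [g] kills, so applying [g] to them
    gives well-defined, additive and linear values. *)
Lemma lift_surj M N K (p : hom M K) (g : hom M N) : csurj p ->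
  ev (fun x => forall m : car M, hm x m -> fn p m = 0 -> fn g m = 0) ->
  exists u : hom K N, comp u p = g.
Proof.
move=> pS pg; have [d hd] := evI pg (evI pS (evI (fnZ p) (fnZ g))).
have /choice[s sP] : forall q : L * car K, exists m : car M,
    d <= ldeg q.1 -> hm q.1 q.2 -> hm q.1 m /\ fn p m = q.2.
  move=> [x k] /=; have [[dx hx]|no] := pselect (d <= ldeg x /\ hm x k).
    by have [_ [h _]] := hd x dx; have [m hm E] := h k hx; exists m.
  by exists 0 => dx hx; case: no.
have un x m m' : d <= ldeg x -> hm x m -> hm x m' -> fn p m = fn p m' -> fn g m = fn g m'.
  move=> dx hk hk' E; apply/eqP; rewrite -subr_eq0 -fnB; apply/eqP.
  have [h _] := hd x dx; apply: h; first exact: hmB.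
  by rewrite fnB E subrr.
have [|u uE] := @wtmap_hom F X K N (fun x k => fn g (s (x, k))).
  exists d => x dx; split.
  - by move=> k hk; apply: fn_hm; case: (sP (x, k) dx hk).
  - move=> m n hx hn; have [h1 E1] := sP (x, m) dx hx.
    have [h2 E2] := sP (x, n) dx hn; have [h3 E3] := sP (x, m - n) dx (hmB hx hn).
    rewrite -fnB; apply: (un x) => //; first exact: hmB.
    by rewrite fnB E1 E2 E3.
  - move=> y a m yp ha hx; have dxy : d <= ldeg (x + y) by rewrite raddfD /=; lia.
    have [h1 E1] := sP (x, m) dx hx.
    have [h2 E2] := sP (x + y, a *: m) dxy (hmZ ha hx).
    have [_ [_ [hp hg]]] := hd x dx.
    rewrite -(hg y) //; apply: (un (x + y)) => //; first exact: hmZ.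
    by rewrite E2 (hp y) // E1.
exists u; apply/homP; have evd : ev (fun x : L => d <= ldeg x) by exists d.
apply: evS (evI evd (evI uE (fnM u p))) _ => x [dx [h1 h2]] m hx.
rewrite h2 // h1; last exact: fn_hm.
have [h3 E3] := sP (x, fn p m) dx (fn_hm p hx).
exact: (un x).
Qed.

Lemma cinj_cancel M N P (i : hom N P) (f g : hom M N) : cinj i ->
  comp i f = comp i g -> f = g.
Proof.
move=> iI /homP E; apply/homP.
apply: evS (evI iI (evI E (evI (fnM i f) (fnM i g)))) _ => x [h1 [h2 [h3 h4]]] m hx.
apply/eqP; rewrite -subr_eq0; apply/eqP; apply: h1; first by apply: hmB; apply: fn_hm.
by rewrite fnB -h3 // -h4 // h2 // subrr.
Qed.

Lemma csurj_cancel M N P (p : hom M N) (f g : hom N P) : csurj p ->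
  comp f p = comp g p -> f = g.
Proof.
move=> pS /homP E; apply/homP.
apply: evS (evI pS (evI E (evI (fnM f p) (fnM g p)))) _ => x [h1 [h2 [h3 h4]]] n hn.
by have [m hx <-] := h1 n hn; rewrite -h3 // h2 // h4.
Qed.

(** [fn f] is linear only above some degree [d], so its zero set has to be cut down to the
    truncation at [d] to become a submodule. *)
Lemma ker_ex M N (f : hom M N) : exists (K : C) (i : hom K M), cinj i /\ cexact i f.
Proof.
have [d hd] := fnZ f.
pose U : set (car M) := [set m | hsupp d m /\ fn f m = 0].
have gU : gsub U.
  have [g0 gD gG] := gsub_hsupp M d; split.
  - by split=> //; apply: fn0.
  - move=> a m n [hx E] [hy E']; split; first exact: gD.
    rewrite fnD E' addr0.
    have fr m' : hsupp d m' -> fn f (a *: m') = a *: fn f m'.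
      move: m'; apply: hsupp_ind.
      - by rewrite scaler0 fn0 scaler0.
      - by move=> m' n' h1 h2; rewrite scalerDr !fnD h1 h2 scalerDr.
      move=> x m' dx hx'; move: a; apply: Ahomog_decomp.
      - by rewrite !scale0r fn0.
      - by move=> a b ha hb; rewrite !scalerDl fnD ha hb.
      by move=> y a ha; exact: (hd x dx y a m' ha hx').
    by rewrite fr // E scaler0.
  - by move=> x m [hx E]; split; [apply: gG|rewrite fn_gpr E gpr0].
have [K [i [iI iE]]] := sub_obj gU; exists K, i; split=> //.
have evd : ev (fun x : L => d <= ldeg x) by exists d.
apply: evS (evI evd iE) _ => x [dx h] m hx; rewrite -h //.
by split=> [E|[]//]; split=> //; apply: hsupp_hm hx.
Qed.

Lemma im_gsub M N (f : hom M N) : exists U : set (car N), gsub U /\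
  ev (fun x => forall n : car N, hm x n -> (U n <-> exists2 m : car M, hm x m & fn f m = n)).
Proof.
have [d hd] := fnZ f; have [g0 gD gG] := gsub_hsupp M d.
exists [set n | exists2 m, hsupp d m & fn f m = n]; split.
  split; first by exists 0 => //; rewrite fn0.
  - move=> a n n' [m hx <-] [m' hx' <-]; exists (a *: m + m'); first exact: gD.
    rewrite fnD; congr (_ + _); move: m hx; apply: hsupp_ind.
    - by rewrite scaler0 fn0 scaler0.
    - by move=> m n1 h1 h2; rewrite scalerDr !fnD h1 h2 scalerDr.
    move=> x m dx hx; move: a; apply: Ahomog_decomp.
    - by rewrite !scale0r fn0.
    - by move=> a b ha hb; rewrite !scalerDl fnD ha hb.
    by move=> y a ha; exact: (hd x dx y a m ha hx).
  - by move=> x n [m hx <-]; exists (gpr x m); [apply: gG|rewrite fn_gpr].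
exists d => x dx n hn; split=> [[m hx E]|[m hx <-]].
  by exists (gpr x m); [apply: hm_gpr|rewrite fn_gpr E].
by exists m => //; apply: hsupp_hm hx.
Qed.

Lemma coker_ex M N (f : hom M N) : exists (Q : C) (p : hom N Q), csurj p /\ cexact f p.
Proof.
have [U [gU UE]] := im_gsub f; have [Q [p [pS pE]]] := quo_obj gU.
exists Q, p; split=> //; apply: evS (evI UE pE) _ => x [h1 h2] n hn.
by rewrite h2 // h1.
Qed.

Lemma comp_hom0l M N P (f : hom M N) : comp (hom0 N P) f = hom0 M P.
Proof.
apply/cnullP; apply: evS (evI (fnM (hom0 N P) f) (hom0E N P)) _ => x [h1 h2] m hx.
by rewrite h1 // h2 //; apply: fn_hm.
Qed.

Lemma comp_hom0r M N P (f : hom N P) : comp f (hom0 M N) = hom0 M P.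
Proof.
apply/cnullP; apply: evS (evI (fnM f (hom0 M N)) (hom0E M N)) _ => x [h1 h2] m hx.
by rewrite h1 // h2 // fn0.
Qed.

Lemma cexact_comp M N P (f : hom M N) (g : hom N P) : cexact f g -> comp g f = hom0 M P.
Proof.
move=> e; apply/cnullP; apply: evS (evI e (fnM g f)) _ => x [h1 h2] m hx.
by rewrite h2 //; apply/h1; [apply: fn_hm|exists m].
Qed.

Lemma ker_lift K M N P (i : hom K M) (f : hom M N) (g : hom P M) :
  cinj i -> cexact i f -> comp f g = hom0 P N -> exists u : hom P K, comp i u = g.
Proof.
move=> iI e /cnullP h; apply: lift_inj => //.
apply: evS (evI e (evI h (fnM f g))) _ => x [h1 [h2 h3]] m hx.
by apply/h1; [apply: fn_hm|rewrite -h3 // h2].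
Qed.

Lemma coker_lift Q M N P (p : hom N Q) (f : hom M N) (g : hom N P) :
  csurj p -> cexact f p -> comp g f = hom0 M P -> exists u : hom Q P, comp u p = g.
Proof.
move=> pS e /cnullP h; apply: lift_surj => //.
apply: evS (evI e (evI h (fnM g f))) _ => x [h1 [h2 h3]] n hn E.
by have [m hx <-] := proj1 (h1 n hn) E; rewrite -h3 // h2.
Qed.

Lemma is_monoP M N (i : hom M N) : is_mono i <-> cinj i.
Proof.
split=> [h|h P f g]; last exact: cinj_cancel.
have [K [k [kI ke]]] := ker_ex i.
have E : k = hom0 K M by apply: h; rewrite (cexact_comp ke) comp_hom0r.
move: E => /cnullP E; apply: evS (evI ke E) _ => x [h1 h2] m hx im.
by have [l hl <-] := proj1 (h1 m hx) im; rewrite h2.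
Qed.

Lemma is_isoP M N (f : hom M N) : is_iso f <-> cinj f /\ csurj f.
Proof.
split=> [[g [/homP gf /homP fg]]|[fI fS]].
  split.
    apply: evS (evI gf (evI (fnM g f) (fn1 M))) _ => x [h1 [h2 h3]] m hx E.
    by rewrite -(h3 m) // -h1 // h2 // E fn0.
  apply: evS (evI fg (evI (fnM f g) (fn1 N))) _ => x [h1 [h2 h3]] n hn.
  by exists (fn g n); [apply: fn_hm|rewrite -h2 // h1 // h3].
have [|g gE] := @lift_inj N N M f (idm N) fI.
  apply: evS (evI fS (fn1 N)) _ => x [h1 h2] n hn.
  by rewrite h2 //; apply: h1.
exists g; split=> //; apply: (cinj_cancel fI).
by rewrite comp_assoc gE comp_idl comp_idr.
Qed.

Lemma isoN M N : @isomorphic C M N -> isomorphic N M.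
Proof. by move=> [f [g [h1 h2]]]; exists g, f. Qed.

(** A categorical kernel is compared with the one built in [ker_ex]: the universal properties give
    an isomorphism, along which injectivity and exactness are carried over. *)
Lemma is_kernelP K M N (i : hom K M) (f : hom M N) :
  is_kernel i f <-> cinj i /\ cexact i f.
Proof.
split=> [[/zero_morP h0 h]|[iI e]].
  have [K' [k [kI ke]]] := ker_ex f.
  have [|u [uE _]] := h K' k; first by apply/zero_morP; apply: cexact_comp.
  have [v vE] := ker_lift kI ke h0.
  have vu : comp v u = idm K'.
    by apply: (cinj_cancel kI); rewrite comp_assoc vE uE comp_idr.
  have uv : comp u v = idm K.
    have [|w [_ wU]] := h K i; first exact/zero_morP.
    by rewrite -(wU (idm K)) ?comp_idr // -(wU (comp u v)) // comp_assoc uE vE.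
  have /is_isoP[vI vS] : is_iso v by exists u.
  split.
    apply: evS (evI vI (evI kI (evI (fnM k v) (proj2 (homP _ _) vE)))) _.
    move=> x [h1 [h2 [h3 h4]]] m hx E; apply: h1 => //; apply: h2; first exact: fn_hm.
    by rewrite -h3 // h4.
  apply: evS (evI vS (evI ke (evI (fnM k v) (proj2 (homP _ _) vE)))) _.
  move=> x [h1 [h2 [h3 h4]]] m hx; rewrite h2 //; split=> [[l hl <-]|[l hl <-]].
    by have [q hq <-] := h1 l hl; exists q => //; rewrite -h4 // h3.
  by exists (fn v l); [apply: fn_hm|rewrite -h3 // h4].
split; first by apply/zero_morP; apply: cexact_comp.
move=> P g /zero_morP E; have [u uE] := ker_lift iI e E.
by exists u; split=> // v vE; apply: (cinj_cancel iI); rewrite uE vE.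
Qed.

Lemma is_cokernelP Q M N (p : hom N Q) (f : hom M N) :
  is_cokernel p f <-> csurj p /\ cexact f p.
Proof.
split=> [[/zero_morP h0 h]|[pS e]].
  have [Q' [q [qS qe]]] := coker_ex f.
  have [|u [uE _]] := h Q' q; first by apply/zero_morP; apply: cexact_comp.
  have [v vE] := coker_lift qS qe h0.
  have uv : comp u v = idm Q'.
    by apply: (csurj_cancel qS); rewrite -comp_assoc vE uE comp_idl.
  have vu : comp v u = idm Q.
    have [|w [_ wU]] := h Q p; first exact/zero_morP.
    by rewrite -(wU (idm Q)) ?comp_idl // -(wU (comp v u)) // -comp_assoc uE vE.
  have /is_isoP[vI vS] : is_iso v by exists u.
  split.
    apply: evS (evI vS (evI qS (evI (fnM v q) (proj2 (homP _ _) vE)))) _.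
    move=> x [h1 [h2 [h3 h4]]] n hn; have [n' hn' <-] := h1 n hn.
    by have [m hx <-] := h2 n' hn'; exists m => //; rewrite -h4 // h3.
  apply: evS (evI vI (evI qe (evI (fnM v q) (proj2 (homP _ _) vE)))) _.
  move=> x [h1 [h2 [h3 h4]]] n hn; rewrite -h2 // -h4 // h3 //; split=> [E|->].
    by apply: h1 => //; apply: fn_hm.
  by rewrite fn0.
split; first by apply/zero_morP; apply: cexact_comp.
move=> P g /zero_morP E; have [u uE] := coker_lift pS e E.
by exists u; split=> // v vE; apply: (csurj_cancel pS); rewrite uE vE.
Qed.

Definition cses M N P (i : hom M N) (p : hom N P) : Prop :=
  [/\ cinj i, csurj p & cexact i p].

Lemma sesP M N P : @ses C M N P <-> exists (i : hom M N) (p : hom N P), cses i p.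
Proof.
split=> [[i [p [/is_kernelP[iI e] /is_cokernelP[pS _]]]]|[i [p [iI pS e]]]].
  by exists i, p.
by exists i, p; split; [apply/is_kernelP|apply/is_cokernelP].
Qed.

(** A [category] carries no addition of morphisms; it is recovered here from representatives. *)
Lemma hadd_ex M N (f g : hom M N) : exists h : hom M N,
  ev (fun x => forall m : car M, hm x m -> fn h m = fn f m + fn g m).
Proof.
apply: (@tmap_hom F X M N (fun m => fn f m + fn g m)).
have [f1 f2 f3] := fnT f; have [g1 g2 g3] := fnT g; split.
- by move=> m n; rewrite f1 g1 opprD addrACA.
- by move=> x m; rewrite f2 g2 gprD.
- by apply: evS (evI f3 g3) _ => x [h1 h2] y a m ha hx; rewrite (h1 y) // (h2 y) // scalerDr.
Qed.

Definition hadd M N (f g : hom M N) : hom M N := sval (cid (hadd_ex f g)).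

Lemma haddE M N (f g : hom M N) :
  ev (fun x => forall m : car M, hm x m -> fn (hadd f g) m = fn f m + fn g m).
Proof. exact: (svalP (cid (hadd_ex f g))). Qed.

Lemma hopp_ex M N (f : hom M N) : exists h : hom M N,
  ev (fun x => forall m : car M, hm x m -> fn h m = - fn f m).
Proof.
apply: (@tmap_hom F X M N (fun m => - fn f m)).
have [f1 f2 f3] := fnT f; split.
- by move=> m n; rewrite f1 opprD.
- by move=> x m; rewrite f2 (raddfN (gpr x)).
- by apply: evS f3 _ => x h1 y a m ha hx; rewrite (h1 y) // scalerN.
Qed.

Definition hopp M N (f : hom M N) : hom M N := sval (cid (hopp_ex f)).

Lemma hoppE M N (f : hom M N) :
  ev (fun x => forall m : car M, hm x m -> fn (hopp f) m = - fn f m).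
Proof. exact: (svalP (cid (hopp_ex f))). Qed.

End Exactness.

(** * Normal forms in the coordinate algebra *)

Section Model.
Variables (F : finFieldType) (X : wpl F).
Local Notation t := (wt_n X).+2.
Local Notation A := (Aalg X).
Local Notation poly := {mpoly F[t]}.
Local Notation o1 := (lift ord0 ord0 : 'I_t).

Definition lam (i : 'I_t) : F := odflt 0 (pt X i).
Definition lin (i : 'I_t) : {poly F} := if i == ord0 then 1 else 'X - (lam i)%:P.
Definition gmon (m : 'X_{1..t}) : {poly F} := \prod_i lin i ^+ (m i %/ wt X i).

(* Dehomogenisation: [tg i] = X_i ^ p_i goes to the linear form [lin i] in the
   affine coordinate of P^1, the remaining part of a monomial being dropped. *)
Definition gam0 (p : poly) : {poly F} := \sum_(m <- msupp p) p@_m *: gmon m.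

Lemma gam0E (p : poly) k : (msize p <= k)%N ->
  gam0 p = \sum_(m : 'X_{1..t < k}) p@_m *: gmon m.
Proof.
move=> le_pk; set I : subFinType _ := 'X_{1..t < k}.
rewrite /gam0 (big_mksub I) ?msupp_uniq //=; first last.
  by move=> x /msize_mdeg_lt /leq_trans; apply.
by rewrite big_rmcond //= => j /memN_msupp_eq0 ->; rewrite scale0r.
Qed.

Lemma gam0B : {morph gam0 : p q / p - q}.
Proof.
move=> p q; pose k := maxn (msize (p - q)) (maxn (msize p) (msize q)).
rewrite !(@gam0E _ k) ?leq_max ?leqnn ?orbT // -sumrB; apply: eq_bigr => m _.
by rewrite mcoeffB scalerBl.
Qed.

HB.instance Definition _ := GRing.isZmodMorphism.Build poly {poly F} gam0 gam0B.

Lemma gam0Z c p : gam0 (c *: p) = c *: gam0 p.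
Proof.
rewrite (@gam0E _ (msize p)) ?msizeZ_le // (@gam0E p (msize p)) // scaler_sumr.
by apply: eq_bigr => m _; rewrite mcoeffZ scalerA.
Qed.

Lemma gam0X m : gam0 'X_[m] = gmon m.
Proof. by rewrite /gam0 msuppX big_seq1 mcoeffX eqxx scale1r. Qed.

Lemma gmonT i m : gmon (U_(i) *+ wt X i + m)%MM = lin i * gmon m.
Proof.
rewrite /gmon (bigD1 i) //= [in RHS](bigD1 i) //= mulrA; congr (_ * _).
  rewrite mnmDE mulmnE mnm1E eqxx mul1n divnDl ?dvdnn // divnn wt_gt0.
  by rewrite exprD expr1.
by apply: eq_bigr => j ji; rewrite mnmDE mulmnE mnm1E eq_sym (negbTE ji) mul0n add0n.
Qed.

Lemma gam0T i p : gam0 ('X_i ^+ wt X i * p) = lin i * gam0 p.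
Proof.
rewrite {1}[p]mpolyE mulr_sumr raddf_sum /= [in RHS]/gam0 mulr_sumr; apply: eq_bigr => m _.
by rewrite -!scalerAr gam0Z mpolyXn -mpolyXD gam0X gmonT.
Qed.

Lemma lam1 : lam o1 = 0. Proof. by rewrite /lam (pt1 X). Qed.

Lemma lin0 : lin ord0 = 1. Proof. by rewrite /lin eqxx. Qed.

Lemma linE i : i != ord0 -> lin i = 'X - (lam i)%:P.
Proof. by rewrite /lin => /negbTE ->. Qed.

Lemma lin1 : lin o1 = 'X. Proof. by rewrite linE // lam1 subr0. Qed.

(** The relation [frel i] dehomogenises to $(T-\lambda_i) - T + \lambda_i = 0$. *)
Lemma gam0_ideal p : p \in @Aideal F X -> gam0 p = 0.
Proof.
move=> /asboolP[g ->]; rewrite raddf_sum big1 //= => i i2.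
rewrite mulrC /frel mulrDl mulrBl raddfD raddfB /= -mulrA mul_mpolyC gam0Z !gam0T.
have i0 : i != ord0 by apply: contraTneq i2 => ->.
rewrite (linE i0) lin1 lin0 mul1r -/(lam i).
by rewrite -mul_polyC; ring.
Qed.

Definition gam (a : A) : {poly F} := gam0 (repr a).

Lemma gam_pi p : gam (\pi_(Aalg X) p) = gam0 p.
Proof.
apply/eqP; rewrite -subr_eq0 -raddfB; apply/eqP/gam0_ideal.
by rewrite Quotient.idealrBE reprK.
Qed.

Lemma gamB : {morph gam : a b / a - b}.
Proof.
move=> a b; have [p ->] := Apr_lift a; have [q ->] := Apr_lift b.
by rewrite -[_ - _](raddfB (\pi_(Aalg X))) !gam_pi raddfB.
Qed.

HB.instance Definition _ := GRing.isZmodMorphism.Build A {poly F} gam gamB.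

Lemma gamC c a : gam (cst X c * a) = c *: gam a.
Proof.
have [p ->] := Apr_lift a.
by rewrite -[_ * _](rmorphM (\pi_(Aalg X))) !gam_pi mul_mpolyC gam0Z.
Qed.

Definition tg (i : 'I_t) : A := xg i ^+ wt X i.

Lemma gamT i a : gam (tg i * a) = lin i * gam a.
Proof.
have [p ->] := Apr_lift a; rewrite /tg /xg -rmorphXn.
by rewrite -[_ * _](rmorphM (\pi_(Aalg X))) !gam_pi gam0T.
Qed.

Lemma gam_mon m : gam (mon m) = gmon m.
Proof. by rewrite /mon gam_pi gam0X. Qed.

Lemma tgE i : i != ord0 -> tg i = tg o1 - cst X (lam i) * tg ord0.
Proof.
move=> i0; have [i2|i2] := ltnP 1 i.
  apply/eqP; rewrite -subr_eq0; apply/eqP.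
  rewrite /tg /xg /cst -!rmorphXn -rmorphM -!rmorphB.
  rewrite -(rmorph0 (\pi_(Aalg X))); apply/eqP; rewrite -Quotient.idealrBE subr0.
  apply/asboolP; exists (fun j => (j == i)%:R).
  rewrite (bigD1 i) //= eqxx mul1r big1 ?addr0 => [|j /andP[_ /negbTE ->]]; last exact: mul0r.
  by rewrite /frel opprB addrCA addrC -addrA [- _ + _]addrC.
have -> : i = o1.
  by apply: val_inj; move: i0 i2; rewrite -(inj_eq val_inj) /=; case: (nat_of_ord i) => [|[]].
by rewrite lam1 /cst mpolyC0 rmorph0 mul0r subr0.
Qed.

(** Homogenisation: the binary form of degree [n] in [tg o1] and [tg ord0], both of degree
    $\vec{c}$, whose dehomogenisation is [p] when [p] has degree at most [n]. *)
Definition hform n (p : {poly F}) : A :=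
  \sum_(j < n.+1) cst X p`_j * (tg o1 ^+ j * tg ord0 ^+ (n - j)).

Lemma cstB : {morph @cst F X : c d / c - d}.
Proof. by move=> c d; rewrite /cst mpolyCB rmorphB. Qed.

Lemma cst0 : cst X 0 = 0. Proof. by rewrite /cst mpolyC0 rmorph0. Qed.

Lemma cstM : {morph @cst F X : c d / c * d}.
Proof. by move=> c d; rewrite /cst mpolyCM rmorphM. Qed.

Lemma hformB n : {morph hform n : p q / p - q}.
Proof.
move=> p q; rewrite /hform -sumrB; apply: eq_bigr => j _.
by rewrite coefB cstB mulrBl.
Qed.

HB.instance Definition _ n := GRing.isZmodMorphism.Build {poly F} A (hform n) (hformB n).

Lemma hformC n c p : hform n (c *: p) = cst X c * hform n p.
Proof.
by rewrite /hform mulr_sumr; apply: eq_bigr => j _; rewrite coefZ cstM -mulrA.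
Qed.

Lemma hform_T0 n (p : {poly F}) : (size p <= n.+1)%N -> tg ord0 * hform n p = hform n.+1 p.
Proof.
move=> sp; rewrite {2}/hform big_ord_recr /= nth_default // cst0 mul0r addr0.
rewrite /hform mulr_sumr; apply: eq_bigr => j _.
by rewrite subSn -1?ltnS // exprS; ring.
Qed.

Lemma hform_T1 n p : tg o1 * hform n p = hform n.+1 ('X * p).
Proof.
rewrite {2}/hform big_ord_recl /= coefXM /= cst0 mul0r add0r.
rewrite /hform mulr_sumr; apply: eq_bigr => j _.
by rewrite coefXM /= /bump /= add1n subSS exprS; ring.
Qed.

Lemma size_lin i : (size (lin i) <= 2)%N.
Proof. by rewrite /lin; case: ifP => _; rewrite ?size_polyC ?oner_eq0 // size_XsubC. Qed.

Lemma size_linM i n (p : {poly F}) : (size p <= n.+1)%N -> (size (lin i * p)%R <= n.+2)%N.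
Proof.
move=> sp; apply: leq_trans (size_polyMleq _ _) _.
by have := size_lin i; lia.
Qed.

Lemma hform_T i n (p : {poly F}) : (size p <= n.+1)%N -> tg i * hform n p = hform n.+1 (lin i * p).
Proof.
move=> sp; have [->|i0] := eqVneq i ord0; first by rewrite lin0 mul1r hform_T0.
rewrite tgE // linE // mulrBl -mulrA hform_T0 // hform_T1 mulrBl raddfB /=.
by rewrite mul_polyC hformC.
Qed.

Lemma hform1 : hform 0 1 = 1.
Proof. by rewrite /hform big_ord1 coef1 eqxx cst1 !expr0 !mulr1. Qed.

(** The size bound accompanies the identity because [hform n] forgets the coefficients beyond
    [n]. *)
Lemma prod_tg (r : seq 'I_t) (q : 'I_t -> nat) :
  (size (\prod_(i <- r) lin i ^+ q i)%R <= (\sum_(i <- r) q i).+1)%N /\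
  \prod_(i <- r) tg i ^+ q i = hform (\sum_(i <- r) q i) (\prod_(i <- r) lin i ^+ q i).
Proof.
elim: r => [|i r [sz ih]]; first by rewrite !big_nil hform1 size_polyC oner_eq0.
rewrite !big_cons ih.
elim: (q i) => [|k [sk ihk]]; first by rewrite !expr0 !mul1r add0n.
rewrite !exprS addSn -!mulrA; split; first exact: size_linM.
by rewrite ihk hform_T.
Qed.

Lemma gam_hform n (p : {poly F}) a : (size p <= n.+1)%N -> gam (hform n p * a) = p * gam a.
Proof.
move=> sp; have gT i k b : gam (tg i ^+ k * b) = lin i ^+ k * gam b.
  by elim: k => [|k ih]; rewrite ?mul1r // !exprS -!mulrA gamT ih.
rewrite /hform mulr_suml raddf_sum /=.
under eq_bigr do rewrite -!mulrA gamC !gT lin0 lin1 expr1n mul1r scalerAl.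
rewrite -mulr_suml; congr (_ * _).
rewrite [RHS](_ : p = \poly_(i < n.+1) p`_i); last first.
  apply/polyP => i; rewrite coef_poly; case: ltnP => // le.
  by rewrite nth_default // (leq_trans sp).
by rewrite poly_def.
Qed.

End Model.

(** * Normal forms in the grading group and homogeneous components of the algebra *)

Section NormalForm.
Variables (F : finFieldType) (X : wpl F).
Local Notation t := (wt_n X).+2.
Local Notation A := (Aalg X).
Local Notation L := (Lgrp X).
Local Notation o1 := (lift ord0 ord0 : 'I_t).
Local Notation hform := (@hform F X).

Definition vco i (v : 'rV[int]_t) : int := v 0 i.

Lemma vcoB i : {morph vco i : u v / u - v}.
Proof. by move=> u v; rewrite /vco !mxE. Qed.

HB.instance Definition _ i := GRing.isZmodMorphism.Build _ _ (vco i) (vcoB i).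

Lemma vco_delta i j : vco i (delta_mx 0 j) = (i == j)%:R.
Proof. by rewrite /vco mxE. Qed.

(** The normal form $y = \sum_i l_i\vec{x}_i + l\vec{c}$ with $0\le l_i<p_i$: [res] gives the $l_i$,
    [bas] collects them in a monomial, and [nl] gives $l$. *)
Definition res (y : L) (i : 'I_t) : nat := `|(vco i (repr y) %% (wt X i)%:Z)%Z|%N.
Definition bas (y : L) : 'X_{1..t} := [multinom res y i | i < t].
Definition can : L := Lgen (ord0 : 'I_t) *+ wt X ord0.
Definition nl (y : L) : int := \sum_i (vco i (repr y) %/ (wt X i)%:Z)%Z.

Lemma Lrel_dvd v i : v \in @Lrel F X -> ((wt X i)%:Z %| vco i v)%Z.
Proof.
move=> /asboolP[c ->]; rewrite raddf_sum; apply: rpred_sum => j _.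
rewrite raddf_sum; apply: rpred_sum => k _.
have dv l : vco i (delta_mx 0 l *+ wt X l) \in dvdz (wt X i)%:Z.
  rewrite raddfMn /= vco_delta; case: eqP => [->|_]; last by rewrite mul0rn dvdz0.
  by rewrite mulr1n natz dvdzz.
by rewrite raddfMz /= raddfB; apply: rpredMz; apply: rpredB; apply: dv.
Qed.

Lemma res_lt y i : (res y i < wt X i)%N.
Proof.
rewrite -ltz_nat /res gez0_abs ?ltz_pmod ?modz_ge0 ?ltz_nat ?wt_gt0 //.
by have := wt_gt0 X i; lia.
Qed.

Lemma resE (y : L) i : vco i (repr y) = (res y i)%:Z + (wt X i)%:Z * (vco i (repr y) %/ (wt X i)%:Z)%Z.
Proof.
rewrite /res gez0_abs ?modz_ge0 //; last by have := wt_gt0 X i; lia.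
by rewrite addrC mulrC -divz_eq.
Qed.

Lemma ldeg_nl (y : L) : ldeg y = (\sum_i res y i * xdeg i)%N%:Z + nl y * (@wtot F X)%:Z.
Proof.
rewrite /ldeg /vdeg (big_morph Posz PoszD (erefl _)) /nl mulr_suml -big_split /=.
apply: eq_bigr => i _; rewrite -[repr y 0 i]/(vco i (repr y)).
by rewrite [X in X * _ = _]resE -(wt_xdeg i) !PoszM; ring.
Qed.

Lemma Lgen_can i : Lgen i *+ wt X i = can.
Proof. exact: Lgen_rel. Qed.

Lemma ldeg_can : ldeg can = (@wtot F X)%:Z.
Proof. by rewrite /can raddfMn /= ldeg_gen -mulr_natr natz -PoszM xdeg_wt. Qed.

Lemma bas_nl (y : L) : y = mdegL (bas y) + can *~ nl y.
Proof.
have E : y = \sum_i Lgen i *~ (vco i (repr y)).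
  rewrite -{1}[y]reprK /Lgen; set v := repr y.
  rewrite {1}[v]matrix_sum_delta big_ord1 raddf_sum /=; apply: eq_bigr => i _.
  by rewrite -[_ *: _]/(v 0 i *: delta_mx 0 i) -{1}[v 0 i]intz scaler_int raddfMz.
rewrite {1}E /mdegL /nl mulrz_sumr -big_split /=; apply: eq_bigr => i _.
rewrite [X in _ *~ X = _]resE mnmE mulrzDr; congr (_ + _).
by rewrite mulrzA -pmulrn Lgen_can.
Qed.

(** Relations of the grading group have coordinates divisible by the weights, which fixes the
    residues. The coefficient of [can] then follows by comparing degrees, [can] having nonzero
    degree. *)
Lemma nl_uniq (y : L) m (j : int) : y = mdegL m + can *~ j ->
  (forall i, res y i = (m i %% wt X i)%N) /\ nl y = (\sum_i m i %/ wt X i)%N%:Z + j.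
Proof.
move=> yE; pose v : 'rV[int]_t := \row_i (m i)%:Z + (delta_mx 0 ord0 *+ wt X ord0) *~ j.
have vE : y = \pi_(Lgrp X) v.
  rewrite yE raddfD raddfMz raddfMn /=; congr (_ + _).
  rewrite /mdegL [\row_i _ in RHS]matrix_sum_delta big_ord1 raddf_sum /=.
  by apply: eq_bigr => i _; rewrite mxE -[(m i)%:Z]intz scaler_int raddfMz.
have rel : repr y - v \in @Lrel F X by rewrite Quotient.idealrBE reprK vE.
have rE i : res y i = (m i %% wt X i)%N.
  have := Lrel_dvd i rel; rewrite raddfB /= raddfD /= raddfMz raddfMn /= vco_delta.
  rewrite /vco !mxE => dv.
  have d0 : ((i == ord0)%:R *+ wt X ord0) *~ j \in dvdz (wt X i)%:Z.
    apply: rpredMz; case: eqP => [->|_]; last by rewrite mul0rn dvdz0.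
    by rewrite mulr1n natz dvdzz.
  have : ((wt X i)%:Z %| vco i (repr y) - (m i)%:Z)%Z.
    have := rpredD dv d0; by rewrite opprD addrA subrK.
  rewrite -eqz_mod_dvd => /eqP E; rewrite /res E modz_nat.
  by [].
split=> //.
have : ldeg y = (\sum_i (m i %% wt X i) * xdeg i)%N%:Z +
    ((\sum_i m i %/ wt X i)%N%:Z + j) * (@wtot F X)%:Z.
  rewrite yE raddfD raddfMz /= ldeg_can ldeg_mdegL mulrDl addrA.
  rewrite -[_ *~ j]mulrzl intz; congr (_ + _).
  rewrite -PoszM -PoszD big_distrl -big_split /=; congr Posz.
  apply: eq_bigr => i _; rewrite {1}(divn_eq (m i) (wt X i)) mulnDl -mulnA wt_xdeg.
  by rewrite addnC.
rewrite ldeg_nl (eq_bigr (fun i => m i %% wt X i * xdeg i)%N) => [|i _]; last by rewrite rE.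
by move=> /addrI /mulIf; apply; have := wtot_gt0 X; lia.
Qed.

Lemma mon_bas m : mon m = mon [multinom m i %% wt X i | i < t] *
  \prod_i tg i ^+ (m i %/ wt X i).
Proof.
have mE k : mon k = \prod_i xg i ^+ k i.
  by rewrite /mon mpolyXE_id rmorph_prod; apply: eq_bigr => i _; rewrite rmorphXn.
rewrite !mE -big_split /=; apply: eq_bigr => i _.
by rewrite mnmE /tg -exprM -exprD mulnC addnC -divn_eq.
Qed.

Lemma nform_neg (y : L) a : nl y < 0 -> Ahomog y a -> a = 0.
Proof.
move=> yn; move: a; apply: Ahomog_ind => // [a b -> ->|c m my]; first by rewrite addr0.
have [|_ E] := @nl_uniq y m 0; first by rewrite mulr0z addr0.
by move: yn; rewrite E; lia.
Qed.

(** A monomial of degree [y] is [mon (bas y)] times a product of [nl y] factors $X_i^{p_i}$, and by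
    [prod_tg] such a product is a binary form of degree [nl y]. *)
Lemma nform (y : L) (n : nat) a : nl y = n -> Ahomog y a ->
  (size (gam a) <= n.+1)%N /\ a = mon (bas y) * hform n (gam a).
Proof.
move=> yn; move: a; apply: Ahomog_ind.
- by rewrite raddf0 size_poly0 raddf0 mulr0.
- move=> a b [sa ea] [sb eb]; rewrite !raddfD /= mulrDr -ea -eb; split=> //.
  by apply: leq_trans (size_polyD _ _) _; rewrite geq_max sa.
move=> c m my; have [|r E] := @nl_uniq y m 0; first by rewrite mulr0z addr0.
have nE : n = (\sum_i m i %/ wt X i)%N by move: E; rewrite yn; lia.
have [sz pE] := prod_tg (index_enum _) (fun i => m i %/ wt X i)%N.
rewrite gamC gam_mon hformC; split.
  by apply: leq_trans (size_scale_leq _ _) _; rewrite nE.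
rewrite mulrCA; congr (_ * _); rewrite mon_bas pE nE; congr (mon _ * _).
by apply/mnmP => i; rewrite !mnmE r.
Qed.

Lemma Ahomog_tg i : Ahomog can (tg i).
Proof. by rewrite -(Lgen_can i); apply: hpow. Qed.

Lemma Ahomog_hform n p : Ahomog (can *+ n) (hform n p).
Proof.
apply: Ahomog_sum => j.
rewrite -[can *+ n]add0r; apply: AhomogM; first exact: Ahomog_cst.
have -> : can *+ n = can *+ j + can *+ (n - j).
  by rewrite -mulrnDr subnKC // -ltnS.
by apply: AhomogM; apply: AhomogX; exact: Ahomog_tg.
Qed.

Lemma gam_inj (y : L) a b : Ahomog y a -> Ahomog y b -> gam a = gam b -> a = b.
Proof.
move=> ha hb E; case nE: (nl y) => [n|n].
  by rewrite (proj2 (nform nE ha)) (proj2 (nform nE hb)) E.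
by rewrite (nform_neg _ ha) ?nE // (nform_neg _ hb) ?nE.
Qed.

Lemma hformM n k (p q : {poly F}) : (size p <= n.+1)%N -> (size q <= k.+1)%N ->
  hform n p * hform k q = hform (n + k) (p * q).
Proof.
move=> sp sq; apply: (@gam_inj (can *+ (n + k))).
- by rewrite mulrnDr; apply: AhomogM; apply: Ahomog_hform.
- exact: Ahomog_hform.
have gE i (r : {poly F}) : (size r <= i.+1)%N -> gam (hform i r) = r.
  move=> sr; rewrite -[hform i r]mulr1 gam_hform //.
  have -> : gam (1 : A) = 1; last by rewrite mulr1.
  have <- : mon 0%MM = 1 :> A by exact: mon0.
  by rewrite gam_mon /gmon big1 // => j _; rewrite mnm0E div0n.
rewrite gam_hform // gE // gE //.
by apply: leq_trans (size_polyMleq _ _) _; lia.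
Qed.

(** [gam] is not multiplicative: residual exponents dropped in each factor may add up to a full
    $X_i^{p_i}$, and the last factor records this. It is nonzero, which is what makes [Ahom_domain]
    work. *)
Lemma gam_homM (y z : L) a b : Ahomog y a -> Ahomog z b ->
  gam (a * b) = gam a * gam b * gmon (bas y + bas z).
Proof.
move=> ha hb; case nE: (nl y) => [n|n]; last first.
  by rewrite (nform_neg _ ha) ?nE // mul0r raddf0 !mul0r.
case kE: (nl z) => [k|k]; last first.
  by rewrite (nform_neg _ hb) ?kE // mulr0 raddf0 mulr0 mul0r.
have [sa ea] := nform nE ha; have [sb eb] := nform kE hb.
rewrite {1}ea {1}eb mulrACA -monD hformM // mulrC gam_hform ?gam_mon //.
by apply: leq_trans (size_polyMleq _ _) _; lia.
Qed.

Lemma gmon_neq0 m : @gmon F X m != 0.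
Proof.
apply/prodf_neq0 => i _; rewrite expf_neq0 // /lin.
by case: ifP => _; rewrite ?oner_eq0 ?polyXsubC_eq0.
Qed.

Lemma gam_eq0 (y : L) a : Ahomog y a -> gam a = 0 -> a = 0.
Proof. by move=> ha E; apply: (gam_inj ha (Ahomog0 y)); rewrite E raddf0. Qed.

Lemma Ahom_domain (y z : L) a b : Ahomog y a -> Ahomog z b ->
  a * b = 0 -> a = 0 \/ b = 0.
Proof.
move=> ha hb /(congr1 (@gam F X)); rewrite (gam_homM ha hb) raddf0 => /eqP.
rewrite !mulf_eq0 (negbTE (gmon_neq0 _)) orbF => /orP[]/eqP E; [left|right].
  exact: gam_eq0 ha E.
exact: gam_eq0 hb E.
Qed.

Lemma Ahom_cancel (y z : L) a b b' : Ahomog y a -> Ahomog z b -> Ahomog z b' ->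
  a <> 0 -> a * b = a * b' -> b = b'.
Proof.
move=> ha hb hb' a0 E; apply/eqP; rewrite -subr_eq0; apply/eqP.
have [|//|//] := Ahom_domain ha (AhomogB hb hb').
by rewrite mulrBr E subrr.
Qed.

Lemma gam_mul_xg (y : L) a i N : Ahomog y a ->
  gam (xg i ^+ N * a) = lin i ^+ ((res y i + N) %/ wt X i) * gam a.
Proof.
move=> ha; case nE: (nl y) => [n|n]; last first.
  by rewrite (nform_neg _ ha) ?nE // mulr0 raddf0 mulr0.
have [sa ea] := nform nE ha; rewrite {1}ea mulrA -mon_xg -monD mulrC gam_hform //.
rewrite gam_mon mulrC; congr (_ * _); rewrite /gmon (bigD1 i) //= big1 ?mulr1.
  by rewrite mnmDE mulmnE mnm1E eqxx mul1n mnmE addnC.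
move=> j ji; rewrite mnmDE mulmnE mnm1E eq_sym (negbTE ji) mul0n add0n mnmE.
by rewrite divn_small ?res_lt // expr0.
Qed.

Lemma nl_xg (y : L) i N : nl (y + Lgen i *+ N) = nl y + ((res y i + N) %/ wt X i)%N%:Z /\
  forall j, res (y + Lgen i *+ N) j = ((res y j + (i == j) * N) %% wt X j)%N.
Proof.
have [|r n] := @nl_uniq (y + Lgen i *+ N) (bas y + U_(i) *+ N)%MM (nl y).
  by rewrite mdegLD mdegLn mdegL1 {1}[y]bas_nl addrAC.
split; last by move=> j; rewrite r mnmDE mulmnE mnmE mnm1E.
rewrite n addrC; congr (_ + _); congr Posz.
rewrite (bigD1 i) //= big1 ?addn0.
  by rewrite mnmDE mulmnE mnm1E eqxx mul1n mnmE.
move=> j ji; rewrite mnmDE mulmnE mnm1E eq_sym (negbTE ji) mul0n addn0 mnmE.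
by rewrite divn_small ?res_lt.
Qed.

Lemma xg_dvd (y : L) a i : Ahomog y a -> (0 < res y i)%N ->
  exists2 b, Ahomog (y - Lgen i) b & a = xg i * b.
Proof.
move=> ha ri; case nE: (nl y) => [n|n]; last first.
  exists 0; first exact: Ahomog0.
  by rewrite (nform_neg _ ha) ?nE // mulr0.
have [sa ea] := nform nE ha.
have le : (U_(i) <= bas y)%MM.
  by apply/mnm_lepP => j; rewrite mnm1E mnmE; case: eqP => [<-|].
have bE : bas y = (U_(i) + (bas y - U_(i)))%MM by rewrite addmC submK.
exists (mon (bas y - U_(i))%MM * hform n (gam a)).
  have -> : y - Lgen i = mdegL (bas y - U_(i)) + can *+ n.
    by rewrite {1}[y]bas_nl nE {1}bE mdegLD mdegL1 [Lgen i + _]addrC addrAC addrK.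
  by apply: AhomogM; [apply: Ahomog_mon|apply: Ahomog_hform].
by rewrite {1}ea {1}bE monD -mulrA.
Qed.

(** A zero at infinity is invisible in the affine coordinate except as a drop in degree: a form of
    degree [n] whose dehomogenisation has degree below [n] contains the factor [tg ord0]. *)
Lemma xg0_dvd (y : L) a n : nl y = n%:Z -> Ahomog y a -> (size (gam a) <= n)%N ->
  exists2 b, Ahomog (y - Lgen ord0) b & a = xg ord0 * b.
Proof.
move=> nE ha sz; case: n nE sz => [|n] nE sz.
  exists 0; first exact: Ahomog0.
  rewrite mulr0; apply: gam_eq0 ha _; apply/eqP; rewrite -size_poly_eq0; lia.
have [sa ea] := nform nE ha.
exists (mon (bas y) * (xg ord0 ^+ (wt X ord0).-1 * hform n (gam a))).
  have -> : y - Lgen ord0 = mdegL (bas y) + (Lgen ord0 *+ (wt X ord0).-1 + can *+ n).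
    rewrite {1}[y]bas_nl nE -addrA; congr (_ + _).
    rewrite -pmulrn mulrSr addrC addrCA addrC; congr (_ + _).
    by rewrite /can -{1}(prednK (wt_gt0 X ord0)) mulrS addrA addNr add0r.
  apply: AhomogM; first exact: Ahomog_mon.
  by apply: AhomogM; [apply: hpow|apply: Ahomog_hform].
rewrite {1}ea -hform_T0 // [RHS]mulrCA; congr (_ * _); rewrite mulrA -exprS.
by rewrite prednK ?wt_gt0.
Qed.

Lemma xg0_dvdP (y : L) b : Ahomog y b -> res (y + Lgen ord0) ord0 = 0%N ->
  forall n, nl (y + Lgen ord0) = n%:Z -> (size (gam (xg ord0 * b)%R) <= n)%N.
Proof.
move=> hb r0 n nE; have [nx rx] := nl_xg y ord0 1; rewrite mulr1n in nx rx.
have wt0 := wt_gt0 X ord0; have := res_lt y ord0.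
move: (rx ord0); rewrite r0 eqxx mul1n => E lt.
have E1 : (res y ord0 + 1 = wt X ord0)%N.
  have [|h] := leqP (wt X ord0) (res y ord0 + 1); first by lia.
  by move: E; rewrite modn_small // addn1.
have := gam_mul_xg ord0 1 hb; rewrite expr1 lin0 expr1n mul1r => ->.
move: nx; rewrite E1 divnn wt0 nE => nE'.
case kE: (nl y) nE' => [k|k] nE'; last by rewrite (nform_neg _ hb) ?kE // raddf0 size_poly0.
by have [sb _] := nform kE hb; apply: leq_trans sb _; lia.
Qed.

(** Multiplication by a power of [xg o1] keeps the residue at [ord0], multiplies [gam a] by some
    $T^k$ and raises [nl] by the same $k$; so whether the degree drops at infinity is the same
    before and after. *)
Lemma xg_regular1 (y z : L) a b N : Ahomog y a -> Ahomog z b -> z = y + Lgen o1 *+ N - Lgen ord0 ->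
  xg o1 ^+ N * a = xg ord0 * b -> exists2 a', Ahomog (y - Lgen ord0) a' & a = xg ord0 * a'.
Proof.
move=> ha hb zE E; have [r0|rp] := posnP (res y ord0); last exact: xg_dvd.
have [a0|a0] := pselect (a = 0).
  by exists 0; [apply: Ahomog0|rewrite mulr0].
have [nx rx] := nl_xg y o1 N.
case nE: (nl y) nx => [n|n] nx; last by case: a0; apply: nform_neg ha; rewrite nE.
apply: (xg0_dvd nE ha).
have zy : z + Lgen ord0 = y + Lgen o1 *+ N by rewrite zE subrK.
have := @xg0_dvdP z b hb; rewrite zy rx /= r0 mod0n => /(_ erefl (n + (res y o1 + N) %/ wt X o1)%N).
rewrite nx PoszD => /(_ erefl).
rewrite -E (gam_mul_xg o1 N ha) lin1 size_monicM ?monicXn //; last first.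
  by apply/eqP => g0; apply: a0; apply: gam_eq0 ha g0.
by rewrite size_polyXn addSn /= [(n + _)%N]addnC leq_add2l.
Qed.

Lemma xg_neq0 i : xg i <> 0 :> A.
Proof.
move=> E; have : @gam F X (tg i * 1) = 0.
  by rewrite /tg -(prednK (wt_gt0 X i)) exprS E !mul0r raddf0.
rewrite gamT; have <- : mon 0%MM = 1 :> A by exact: mon0.
rewrite gam_mon => /eqP; rewrite mulf_eq0 (negbTE (gmon_neq0 _)) orbF.
by rewrite /lin; case: ifP => _; rewrite ?oner_eq0 ?polyXsubC_eq0.
Qed.

Lemma Ahom_expn_neq0 (y : L) a n : Ahomog y a -> a <> 0 -> a ^+ n <> 0.
Proof.
move=> ha a0; elim: n => [|n ih]; first by move/eqP; rewrite expr0 oner_eq0.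
by rewrite exprS => /(Ahom_domain ha (AhomogX n ha)) [].
Qed.

(** The factors [xg ord0] are stripped one at a time. This is what glues a section away from
    [xg ord0] and a section away from [xg o1] to a global one. *)
Lemma xg_regular (y z : L) a b N K : Ahomog y a -> Ahomog z b ->
  z = y + Lgen o1 *+ N - Lgen ord0 *+ K -> xg o1 ^+ N * a = xg ord0 ^+ K * b ->
  exists2 a', Ahomog (y - Lgen ord0 *+ K) a' & a = xg ord0 ^+ K * a' /\ b = xg o1 ^+ N * a'.
Proof.
elim: K y a => [|K ih] y a ha hb zE E.
  by exists a; rewrite ?mulr0n ?subr0 // mul1r; split=> //; rewrite E mul1r.
have hb' : Ahomog (z + Lgen ord0 *+ K) (xg ord0 ^+ K * b).
  by rewrite addrC; apply: AhomogM => //; apply: hpow.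
have [||a' ha' aE] := @xg_regular1 y _ a _ N ha hb'.
- by rewrite zE mulrS opprD addrA subrK.
- by rewrite E exprS mulrA.
have [||a2 ha2 [a2E bE]] := ih _ a' ha' hb.
- by rewrite zE mulrS opprD addrA [y - _ + _]addrAC.
- have h1 : Ahomog (y - Lgen ord0 + Lgen o1 *+ N) (xg o1 ^+ N * a').
    by rewrite addrC; apply: AhomogM => //; apply: hpow.
  have h2 : Ahomog (y - Lgen ord0 + Lgen o1 *+ N) (xg ord0 ^+ K * b).
    have -> : y - Lgen ord0 + Lgen o1 *+ N = Lgen ord0 *+ K + z.
      by rewrite zE mulrS opprD [RHS]addrC addrA subrK addrAC.
    by apply: AhomogM => //; apply: hpow.
  apply: (Ahom_cancel (Ahomog_xg ord0) h1 h2); first exact: xg_neq0.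
  by rewrite mulrCA -aE E exprS mulrA.
exists a2; first by rewrite mulrS opprD addrA.
by split=> //; rewrite aE a2E exprS mulrA.
Qed.

Lemma nl_large (n : nat) : ev (fun y : L => n%:Z <= nl y).
Proof.
exists ((\sum_i wt X i * xdeg i)%N%:Z + n%:Z * (@wtot F X)%:Z) => y.
rewrite ldeg_nl => h.
have : (\sum_i res y i * xdeg i <= \sum_(i < t) wt X i * xdeg i)%N.
  by apply: leq_sum => i _; rewrite leq_mul2r ltnW ?orbT // res_lt.
rewrite -lez_nat => h2.
have := le_trans h (lerD h2 (lexx _)); rewrite lerD2l.
by rewrite ler_pM2r // ltz_nat wtot_gt0.
Qed.

(** In a form of degree $n\ge 2N$ each term [tg o1 ^+ j * tg ord0 ^+ (n - j)] has $j\ge N$ or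
    $n-j\ge N$, and [xg i ^+ N] divides [tg i ^+ N] because weights are positive. *)
Lemma cofinite (N : nat) : ev (fun y : L => forall a, Ahomog y a ->
  exists b b', [/\ Ahomog (y - Lgen ord0 *+ N) b, Ahomog (y - Lgen o1 *+ N) b'
    & a = xg ord0 ^+ N * b + xg o1 ^+ N * b']).
Proof.
apply: evS (nl_large (N + N)) _ => y; case nE: (nl y) => [n|//] nN a ha.
have {}nN : (N + N <= n)%N by lia.
have [_ ->] := nform nE ha; rewrite /hform mulr_sumr.
pose P c := exists b b', [/\ Ahomog (y - Lgen ord0 *+ N) b, Ahomog (y - Lgen o1 *+ N) b'
    & c = xg ord0 ^+ N * b + xg o1 ^+ N * b'].
have tgN i k : (N <= k)%N -> tg i ^+ k = xg i ^+ N * (xg i ^+ (wt X i * k - N)).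
  move=> Nk; rewrite /tg -exprM -exprD; congr (_ ^+ _).
  have : (N <= wt X i * k)%N by apply: leq_trans Nk _; rewrite leq_pmull ?wt_gt0.
  by lia.
have hN i k : (N <= k)%N -> Ahomog (can *+ k - Lgen i *+ N) (xg i ^+ (wt X i * k - N)).
  move=> Nk; have -> : can *+ k - Lgen i *+ N = Lgen i *+ (wt X i * k - N).
    rewrite mulrnBr; first by rewrite mulrnA Lgen_can.
    by apply: leq_trans Nk _; rewrite leq_pmull ?wt_gt0.
  exact: hpow.
have yE j : (j <= n)%N -> y = mdegL (bas y) + (0 + (can *+ j + can *+ (n - j))).
  by move=> jn; rewrite add0r -mulrnDr subnKC // pmulrn -nE -bas_nl.
suff : P (\sum_(j < n.+1) mon (bas y) *
    (cst X (gam a)`_j * (tg o1 ^+ j * tg ord0 ^+ (n - j)))) by [].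
elim/big_rec: _ => [|j c _ [b [b' [hb hb' ->]]]].
  by exists 0, 0; rewrite !mulr0 addr0; split=> //; apply: Ahomog0.
have jn : (j <= n)%N by rewrite -ltnS.
have [Nj|Nj] := leqP N j.
  exists b, (mon (bas y) * (cst X (gam a)`_j * (xg o1 ^+ (wt X o1 * j - N) * tg ord0 ^+ (n - j))) + b').
  split=> //; last by rewrite (tgN o1 _ Nj); ring.
  apply: AhomogD => //; rewrite {1}(yE j jn).
  have -> : mdegL (bas y) + (0 + (can *+ j + can *+ (n - j))) - Lgen o1 *+ N =
    mdegL (bas y) + (0 + (can *+ j - Lgen o1 *+ N + can *+ (n - j))).
    by rewrite -!addrA; congr (_ + (_ + (_ + _))); rewrite addrC.
  apply: AhomogM; first exact: Ahomog_mon.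
  apply: AhomogM; first exact: Ahomog_cst.
  by apply: AhomogM; [apply: hN|apply: AhomogX; apply: Ahomog_tg].
have Nj' : (N <= n - j)%N by lia.
exists (mon (bas y) * (cst X (gam a)`_j * (tg o1 ^+ j * xg ord0 ^+ (wt X ord0 * (n - j) - N))) + b), b'.
split=> //; last by rewrite (tgN ord0 _ Nj'); ring.
apply: AhomogD => //; rewrite {1}(yE j jn) -!addrA.
apply: AhomogM; first exact: Ahomog_mon.
apply: AhomogM; first exact: Ahomog_cst.
by apply: AhomogM; [apply: AhomogX; apply: Ahomog_tg|apply: hN].
Qed.

End NormalForm.

(** * Counting up to an equivalence *)

Section SetoidCounting.

Definition equivr (T : Type) (E : T -> T -> Prop) : Prop :=
  [/\ forall x, E x x, forall x y, E x y -> E y x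
    & forall x y z, E x y -> E y z -> E x z].

(** Counting modulo [E]: besides morphisms under equality, germs are counted up to eventual equality
    and objects up to isomorphism. *)
Definition cardE (T : Type) (A : T -> Prop) (E : T -> T -> Prop) (n : nat) : Prop :=
  exists f : 'I_n -> T, [/\ forall i, A (f i), forall i j, E (f i) (f j) -> i = j
    & forall x, A x -> exists i, E x (f i)].

Lemma equivr_eq (T : Type) : equivr (@eq T).
Proof. by split=> // x y z -> ->. Qed.

Lemma cardE_fin (T : Type) (A : T -> Prop) (E : T -> T -> Prop) (I : finType)
    (f : I -> T) : (forall i, A (f i)) -> (forall i j, E (f i) (f j) -> i = j) ->
  (forall x, A x -> exists i, E x (f i)) -> cardE A E #|I|.
Proof.
move=> h1 h2 h3; exists (fun i => f (enum_val i)); split=> // [i j /h2/enum_val_inj//|x].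
by move=> /h3[i Ei]; exists (enum_rank i); rewrite enum_rankK.
Qed.

Lemma cardE_le (T U : Type) (A : T -> Prop) (E : T -> T -> Prop) (B : U -> Prop)
    (E' : U -> U -> Prop) (rho : T -> U -> Prop) n m : equivr E -> equivr E' ->
  (forall x, A x -> exists2 u, B u & rho x u) ->
  (forall x x' u u', A x -> A x' -> B u -> B u' -> rho x u -> rho x' u' ->
     E' u u' -> E x x') ->
  cardE A E n -> cardE B E' m -> (n <= m)%N.
Proof.
move=> [_ _ _] [_ sy tr] h1 h2 [f [f1 f2 _]] [g [g1 _ g3]].
have /choice[r rP] : forall i, exists j, exists u, [/\ B u, rho (f i) u & E' u (g j)].
  move=> i; have [u Bu ru] := h1 _ (f1 i); have [j Ej] := g3 u Bu.
  by exists j, u.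
rewrite -[n]card_ord -[m]card_ord; apply: (leq_card r) => i j rE.
have [u [Bu ru Eu]] := rP i; have [v [Bv rv Ev]] := rP j.
apply: f2; apply: (h2 _ _ u v) => //; apply: (tr _ _ _ Eu); apply: sy.
by rewrite rE.
Qed.

Lemma cardE_uniq (T : Type) (A : T -> Prop) (E : T -> T -> Prop) n m :
  equivr E -> cardE A E n -> cardE A E m -> n = m.
Proof.
move=> eE h1 h2; have [re sy tr] := eE.
have le a b : cardE A E a -> cardE A E b -> (a <= b)%N.
  apply: (@cardE_le _ _ A E A E E) => // [x Ax|x x' u u' _ _ _ _ r r' e].
    by exists x.
  by apply: (tr _ _ _ r); apply: (tr _ _ _ e); apply: sy.
by apply/eqP; rewrite eqn_leq !le.
Qed.

Lemma ncardE (T : Type) (A : T -> Prop) n : cardE A eq n -> ncard A = n.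
Proof.
move=> h; have [f [f1 f2 f3]] := h; rewrite /ncard.
case: xgetP => [k _ [g [g1 g2]]|/(_ n) []].
  apply: (@cardE_uniq _ A eq) => //; first exact: equivr_eq.
  exists g; split=> // [i|x /g2[i <-]]; [by apply/g2; exists i|by exists i].
exists f; split=> // x; split=> [/f3[i ->]|[i <-]//]; by exists i.
Qed.

(** [rho] is a relation and not a map because what is attached to [x], such as its image, may be
    determined only up to [E']. *)
Lemma cardE_fib (T U : Type) (A : T -> Prop) (E : T -> T -> Prop) (B : U -> Prop)
    (E' : U -> U -> Prop) (rho : T -> U -> Prop) n (f : 'I_n -> U) (k : 'I_n -> nat) :
  equivr E -> equivr E' ->
  (forall i, B (f i)) -> (forall i j, E' (f i) (f j) -> i = j) ->
  (forall u, B u -> exists i, E' u (f i)) ->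
  (forall x, A x -> exists2 u, B u & rho x u) ->
  (forall x u u', A x -> B u -> B u' -> E' u u' -> rho x u -> rho x u') ->
  (forall x x' u u', A x -> A x' -> B u -> B u' -> rho x u -> rho x' u' ->
     E x x' -> E' u u') ->
  (forall i, cardE (fun x => A x /\ rho x (f i)) E (k i)) ->
  cardE A E (\sum_i k i).
Proof.
move=> [_ sy tr] _ f1 f2 f3 h1 h2 h3 h4.
pose g i := sval (cid (h4 i)); have gP i := svalP (cid (h4 i)).
have cE : #|{: {i : 'I_n & 'I_(k i)}}| = (\sum_i k i)%N.
  rewrite card_tagged sumnE big_map big_enum /=; apply: eq_bigr => i _.
  by rewrite card_ord.
rewrite -cE.
apply: (@cardE_fin _ A E _ (fun p : {i : 'I_n & 'I_(k i)} => g (tag p) (tagged p))).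
- by move=> [i j] /=; have [gA _ _] := gP i; case: (gA j).
- move=> [i j] [i' j'] /= e.
  have [gA gI _] := gP i; have [gA' gI' _] := gP i'.
  have [Aj rj] := gA j; have [Aj' rj'] := gA' j'.
  have ii := f2 _ _ (h3 _ _ _ _ Aj Aj' (f1 i) (f1 i') rj rj' e).
  by case: _ / ii in j' e Aj' rj' *; rewrite (gI j j').
- move=> x Ax; have [u Bu ru] := h1 x Ax; have [i Ei] := f3 u Bu.
  have [_ _ gS] := gP i; have [|j Ej] := gS x.
    by split=> //; apply: h2 ru.
  by exists (Tagged (fun i => 'I_(k i)) j).
Qed.

Lemma cardE_mul (T U : Type) (A : T -> Prop) (E : T -> T -> Prop) (B : U -> Prop)
    (E' : U -> U -> Prop) (rho : T -> U -> Prop) n k :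
  equivr E -> equivr E' -> cardE B E' n ->
  (forall x, A x -> exists2 u, B u & rho x u) ->
  (forall x u u', A x -> B u -> B u' -> E' u u' -> rho x u -> rho x u') ->
  (forall x x' u u', A x -> A x' -> B u -> B u' -> rho x u -> rho x' u' ->
     E x x' -> E' u u') ->
  (forall u, B u -> cardE (fun x => A x /\ rho x u) E k) ->
  cardE A E (n * k)%N.
Proof.
move=> eE eE' [f [f1 f2 f3]] h1 h2 h3 h4.
have -> : (n * k)%N = (\sum_(i < n) k)%N by rewrite sum_nat_const card_ord.
by apply: (@cardE_fib _ _ A E B E' rho n f) => // i; apply: h4.
Qed.

Lemma cardE_bij (T U : Type) (A : T -> Prop) (E : T -> T -> Prop) (B : U -> Prop)
    (E' : U -> U -> Prop) (rho : T -> U -> Prop) n :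
  (forall x, A x -> exists2 u, B u & rho x u) ->
  (forall u, B u -> exists2 x, A x & rho x u) ->
  (forall x x' u u', A x -> A x' -> B u -> B u' -> rho x u -> rho x' u' ->
     E x x' <-> E' u u') ->
  cardE B E' n -> cardE A E n.
Proof.
move=> h1 h2 h3 [f [f1 f2 f3]].
have /choice[g gP] : forall i, exists x, A x /\ rho x (f i).
  by move=> i; have [x] := h2 _ (f1 i); exists x.
exists g; split.
- by move=> i; case: (gP i).
- move=> i j e; apply: f2; have [Ai ri] := gP i; have [Aj rj] := gP j.
  exact: (proj1 (h3 _ _ _ _ Ai Aj (f1 i) (f1 j) ri rj)).
- move=> x Ax; have [u Bu ru] := h1 x Ax; have [i Ei] := f3 u Bu; exists i.
  have [Ai ri] := gP i; exact: (proj2 (h3 _ _ _ _ Ax Ai Bu (f1 i) ru ri)).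
Qed.

Lemma cardE_sub (T : Type) (A B : T -> Prop) (E : T -> T -> Prop) n : equivr E ->
  (forall x, B x -> A x) -> cardE A E n -> exists m, cardE B E m.
Proof.
move=> [_ sy tr] BA [f [f1 f2 f3]].
pose P i := `[< exists x, B x /\ E x (f i) >].
have /choice[g gP] : forall i : {i | P i}, exists x, B x /\ E x (f (val i)).
  by move=> [i /= /asboolP].
exists #|{: {i | P i}}|; apply: (@cardE_fin _ B E _ g).
- by move=> i; case: (gP i).
- move=> i j e; apply: val_inj; apply: f2.
  have [_ ei] := gP i; have [_ ej] := gP j.
  by apply: (tr _ _ _ _ ej); apply: (tr _ _ _ _ e); apply: sy.
- move=> x Bx; have [i Ei] := f3 x (BA x Bx).
  have Pi : P i by apply/asboolP; exists x.
  by exists (exist _ i Pi); have [_ h] := gP (exist _ i Pi); apply: (tr _ _ _ Ei); apply: sy.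
Qed.

Lemma cardE_inj (T U : Type) (A : T -> Prop) (E : T -> T -> Prop) (B : U -> Prop)
    (E' : U -> U -> Prop) (rho : T -> U -> Prop) n : equivr E' ->
  (forall x, A x -> exists2 u, B u & rho x u) ->
  (forall x x' u u', A x -> A x' -> B u -> B u' -> rho x u -> rho x' u' ->
     E x x' <-> E' u u') ->
  cardE B E' n -> exists m, cardE A E m.
Proof.
move=> eE' h1 h2 cB.
have [m cm] := @cardE_sub _ B (fun u => B u /\ exists2 x, A x & rho x u) E' n eE'
  (fun u => @proj1 _ _) cB.
exists m; apply: (@cardE_bij _ _ A E _ E' rho) cm.
- by move=> x Ax; have [u Bu ru] := h1 x Ax; exists u => //; split=> //; exists x.
- by move=> u [_ [x]]; exists x.
- by move=> x x' u u' Ax Ax' [Bu _] [Bu' _]; apply: h2.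
Qed.

End SetoidCounting.

(** * Torsion sheaves and line bundles *)

Section Torsion.
Variables (F : finFieldType) (X : wpl F).
Local Notation t := (wt_n X).+2.
Local Notation A := (Aalg X).
Local Notation L := (Lgrp X).
Local Notation C := (coh X).
Local Notation o1 := (lift ord0 ord0 : 'I_t).
Local Notation X0 := (xg (ord0 : 'I_t)).
Local Notation X1 := (xg o1).
Local Notation x0 := (Lgen (ord0 : 'I_t) : L).
Local Notation x1 := (Lgen o1 : L).
Implicit Types M N P K : C.

Lemma scale_gpr (M : gmod X) (x y : L) a (m : M) : Ahomog y a ->
  a *: gpr x m = gpr (x + y) (a *: m).
Proof. by move=> ha; rewrite gpr_act. Qed.

Lemma gsub_im (M : gmod X) (y : L) a : Ahomog y a -> gsub [set m : M | exists n, m = a *: n].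
Proof.
move=> ha; split; first by exists 0; rewrite scaler0.
  move=> b m n [m' ->] [n' ->]; exists (b *: m' + n').
  by rewrite scalerDr !scalerA mulrC.
by move=> x m [n ->]; exists (gpr (x - y) n); rewrite (scale_gpr _ _ ha) subrK.
Qed.

Lemma gsub_colon (M : gmod X) (W : set M) (y : L) a : gsub W -> Ahomog y a ->
  gsub [set m : M | W (a *: m)].
Proof.
move=> gW ha; have [w0 wD wG] := gW; split; first by rewrite /= scaler0.
  move=> b m n /= hx hy; rewrite scalerDr scalerA mulrC -scalerA.
  exact: wD.
by move=> x m /= h; rewrite (scale_gpr _ _ ha); apply: wG.
Qed.

(** The submodules $(W : a^k)$ increase with $k$; their union is finitely generated, so one exponent
    serves all its elements. *)
Lemma colon_stab (M : gmod X) (W : set M) (y : L) a : gsub W -> Ahomog y a ->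
  exists l, forall k (m : M), W (a ^+ k *: m) -> W (a ^+ l *: m).
Proof.
move=> gW ha; pose V : set M := [set m | exists k, W (a ^+ k *: m)].
have up k l (m : M) : (k <= l)%N -> W (a ^+ k *: m) -> W (a ^+ l *: m).
  by move=> kl h; rewrite -(subnK kl) exprD -scalerA; apply: gsubZ.
have gV : gsub V.
  split; first by exists 0%N; rewrite scaler0; case: gW.
    move=> b m n [k hk] [l hl]; exists (k + l)%N.
    have [_ + _] := gsub_colon gW (AhomogX (k + l) ha); apply; rewrite /=.
      by apply: up hk; rewrite leq_addr.
    by apply: up hl; rewrite leq_addl.
  move=> x m [k hk]; exists k.
  by have [_ _ +] := gsub_colon gW (AhomogX k ha); apply.
have [n [d [e [eP eS]]]] := hgen gV.
have /choice[l lP] : forall j, exists l, W (a ^+ l *: e j) by move=> j; case: (eP j).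
exists (\max_j l j)%N => k m hk.
have [_ cD _] := gsub_colon gW (AhomogX (\max_j l j) ha).
have sub : submod [set m | W (a ^+ (\max_j l j) *: m)].
  split; first by rewrite /= scaler0; case: gW.
  exact: cD.
apply: gsub_hm => [//|x].
have -> : gpr x (a ^+ (\max_j l j) *: m) = a ^+ (\max_j l j) *: gpr (x - y *+ (\max_j l j)) m.
  by rewrite (scale_gpr _ _ (AhomogX _ ha)) subrK.
have [||c [_ ->]] := eS (x - y *+ (\max_j l j)) (gpr (x - y *+ (\max_j l j)) m).
- by have [_ _ +] := gV; apply; exists k.
- exact: hm_gpr.
apply: (submod_sum _ _ sub) => j; apply: up (lP j).
exact: leq_bigmax.
Qed.

(** By [colon_stab] one exponent [N] serves, so all the elements [m] in question lie in one finitely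
    generated submodule [V]. Both [X0 ^+ N] and [X1 ^+ N] send [V] into [W], and by [cofinite] they
    generate every coefficient of large degree. *)
Lemma tail_sat (M : gmod X) (W : set M) : gsub W ->
  ev (fun x => forall (m : M) (N : nat), hm x m ->
    W (X0 ^+ N *: m) -> W (X1 ^+ N *: m) -> W m).
Proof.
move=> gW.
have [l0 h0] := colon_stab gW (Ahomog_xg ord0).
have [l1 h1] := colon_stab gW (Ahomog_xg o1).
pose N := maxn l0 l1.
pose V : set M := [set m | W (X0 ^+ N *: m) /\ W (X1 ^+ N *: m)].
have gV : gsub V.
  exact: gsubI (gsub_colon gW (hpow _ N)) (gsub_colon gW (hpow _ N)).
have up i k l (m : M) : (k <= l)%N -> W (xg i ^+ k *: m) -> W (xg i ^+ l *: m).
  by move=> kl h; rewrite -(subnK kl) exprD -scalerA; apply: gsubZ.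
have VP (m : M) k : W (X0 ^+ k *: m) -> W (X1 ^+ k *: m) -> V m.
  move=> /h0 hm0 /h1 hm1; split; [apply: up hm0|apply: up hm1].
    exact: leq_maxl.
  exact: leq_maxr.
have [n [d [e [eP eS]]]] := hgen gV.
have : ev (fun x => forall j, forall a, Ahomog (x - d j) a -> W (a *: e j)).
  apply: ev_all => j; apply: evS (ev_shift (- d j) (cofinite X N)) _ => x h a ha.
  have [b [b' [_ _ ->]]] := h a ha; have [[e0 e1] _] := eP j.
  rewrite scalerDl (mulrC _ b) (mulrC _ b') -!scalerA.
  by apply: gsubD => //; apply: gsubZ.
move=> /evS; apply=> x h m k hx m0 m1.
have [a [ha ->]] := eS x m (VP _ _ m0 m1) hx.
elim/big_rec: _ => [|j b _ Wb]; first by case: gW.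
by apply: gsubD => //; apply: h.
Qed.

Lemma tail_zero (M : gmod X) : ev (fun x => forall (m : M) (N : nat), hm x m ->
  X0 ^+ N *: m = 0 -> X1 ^+ N *: m = 0 -> m = 0).
Proof. exact: tail_sat (gsub0 M). Qed.

(* The chains g^n M are eventually constant: a consequence of finite length that
   passes to subobjects, quotients and extensions, and from which every property
   of torsion sheaves is derived. *)
Definition tors (M : C) : Prop := forall (y : L) (g : A), Ahomog y g ->
  exists n, ev (fun x => forall m : car M, hm x m ->
    exists2 m' : car M, hm (x - y) m' & g ^+ n *: m = g ^+ n.+1 *: m').

Lemma tors_iter M (y : L) (g : A) : tors M -> Ahomog y g ->
  exists n, forall k, ev (fun x => forall m : car M, hm x m ->
    exists2 m' : car M, hm (x - y *+ k) m' & g ^+ n *: m = g ^+ (n + k) *: m').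
Proof.
move=> tM hg; have [n h] := tM y g hg; exists n; elim=> [|k ih].
  by apply: evT => x m hx; exists m; rewrite ?mulr0n ?subr0 ?addn0.
apply: evS (evI ih (ev_shift (- (y *+ k)) h)) _ => x [h1 h2] m hx.
have [m' hm' E] := h1 m hx; have [m2 hm2 E2] := h2 m' hm'.
exists m2; first by rewrite mulrSr opprD addrA.
by rewrite E addnC exprD -scalerA E2 scalerA -exprD addnS addnC -addnS.
Qed.

Lemma fnZX M N (f : hom M N) (y : L) (g : A) : Ahomog y g ->
  ev (fun x => forall (m : car M) n, hm x m -> fn f (g ^+ n *: m) = g ^+ n *: fn f m).
Proof.
move=> hg; apply: evS (fnZ f) _ => x h m n hx.
by apply: (h (y *+ n)) => //; apply: AhomogX.
Qed.

Lemma tors_quot M N (p : hom M N) : csurj p -> tors M -> tors N.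
Proof.
move=> pS tM y g hg; have [n h] := tM y g hg; exists n.
have hz := fnZX p hg.
apply: evS (evI h (evI pS (evI hz (ev_shift (- y) hz)))) _ => x [h1 [h2 [h3 h4]]] m hx.
have [k hk <-] := h2 m hx; have [k' hk' E] := h1 k hk.
by exists (fn p k'); [apply: fn_hm|rewrite -h3 // E h4].
Qed.

(** Dividing $g^n m$ inside [N] gives $g^{n+l+1}b$ with [b] outside [M]. The exponent [l] of
    [colon_stab] for the image of [M] ensures that already $g^l b$ comes from [M], and this is the
    divisor needed. *)
Lemma tors_sub M N (i : hom M N) : cinj i -> tors N -> tors M.
Proof.
move=> iI tN y g hg; have [n h] := tors_iter tN hg.
have [W [gW WE]] := im_gsub i; have [l hl] := colon_stab gW hg.
exists n; have hz := fnZX i hg.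
apply: evS (evI (h l.+1) (evI hz (evI (ev_shift (- y) hz) (evI (ev_shift (y *+ n) iI)
  (evI (ev_shift (- y) WE) (ev_shift (y *+ n) WE)))))) _.
move=> x [h1 [h2 [h2' [h3 [h4 h5]]]]] m hx.
have [b hb E] := h1 (fn i m) (fn_hm i hx).
have hgb : hm (x - y) (g ^+ l *: b).
  have -> : x - y = x - y *+ l.+1 + y *+ l.
    by rewrite mulrSr opprD addrA addrAC subrK.
  by apply: hmZ => //; apply: AhomogX.
have [a ha aE] : exists2 a : car M, hm (x - y) a & fn i a = g ^+ l *: b.
  apply/h4 => //; apply: (hl (n + l.+1)%N); rewrite -E -h2 //.
  apply/h5; first by apply: fn_hm; apply: hmZ => //; apply: AhomogX.
  by exists (g ^+ n *: m) => //; apply: hmZ => //; apply: AhomogX.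
exists a => //; apply/eqP; rewrite -subr_eq0; apply/eqP; apply: h3.
  apply: hmB; first by apply: hmZ => //; apply: AhomogX.
  have -> : x + y *+ n = x - y + y *+ n.+1 by rewrite mulrS addrA subrK.
  by apply: hmZ => //; apply: AhomogX.
rewrite fnB h2 // h2' // E aE scalerA -exprD.
by rewrite addSn addnS subrr.
Qed.

(** Modulo [M] the element $g^n b$ is some $g^{n+1}b'$. The defect lies in [M], where a further
    power of [g] makes it divisible enough to be absorbed into $b'$. *)
Lemma tors_ext M N P (i : hom M N) (p : hom N P) : cses i p -> tors M -> tors P -> tors N.
Proof.
move=> [iI pS e] tM tP y g hg.
have [nM hM] := tors_iter tM hg; have [n h] := tP y g hg.
exists (nM + n)%N; have hz := fnZX p hg; have hz' := fnZX i hg.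
apply: evS (evI h (evI (ev_shift (- y) pS) (evI hz (evI (ev_shift (- y) hz)
  (evI (ev_shift (y *+ n) e) (evI (ev_shift (y *+ n) (hM n.+1))
  (evI (ev_shift (y *+ n) hz') (ev_shift (- y) hz')))))))) _.
move=> x [h1 [h2 [h3 [h4 [h5 [h6 [h7 h8]]]]]]] b hb.
have [q hq qE] := h1 (fn p b) (fn_hm p hb); have [b' hb' b'E] := h2 q hq.
have hbb : hm (x + y *+ n) (g ^+ n *: b - g ^+ n.+1 *: b').
  apply: hmB; first by apply: hmZ => //; apply: AhomogX.
  have -> : x + y *+ n = x - y + y *+ n.+1 by rewrite mulrS addrA subrK.
  by apply: hmZ => //; apply: AhomogX.
have [|a ha aE] := proj1 (h5 _ hbb).
  by rewrite fnB h3 // h4 // b'E qE subrr.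
have [a' ha' a'E] := h6 a ha.
have hxy : x + y *+ n - y *+ n.+1 = x - y by rewrite mulrSr opprD addrA addrK.
rewrite hxy in ha'.
exists (b' + fn i a'); first by apply: hmD => //; apply: fn_hm.
have E : g ^+ nM *: (g ^+ n *: b - g ^+ n.+1 *: b') = g ^+ (nM + n.+1) *: fn i a'.
  by rewrite -aE -h7 // a'E h8.
move: E; rewrite scalerBr !scalerA -!exprD addnS => /eqP.
by rewrite subr_eq addrC -scalerDr => /eqP.
Qed.

Lemma tors_zero M : czero M -> tors M.
Proof.
move=> h y g hg; exists 0%N; apply: evS h _ => x h m hx.
by exists 0; [apply: hm0|rewrite (h m) // !scaler0].
Qed.

(** The image of [g] is a subobject: if it is zero, exponent 1 works because [g] kills [M]; if it is
    everything, exponent 0 works. *)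
Lemma tors_simple M : simple M -> tors M.
Proof.
move=> [_ sM] y g hg; have [K [i [iI iE]]] := sub_obj (gsub_im M hg).
have /sM[/is_zeroP zK|/is_isoP[_ iS]] : is_mono i by apply/is_monoP.
  exists 1%N; apply: evS (ev_shift y (evI zK iE)) _ => x [h1 h2] m hx.
  exists 0; first exact: hm0.
  have [|k hk kE] := proj1 (h2 (g *: m) (hmZ hg hx)); first by exists m.
  by rewrite expr1 scaler0 -kE [k]h1 // fn0.
exists 0%N; apply: evS (evI iS iE) _ => x [h1 h2] m hx.
have [k hk kE] := h1 m hx.
have [|n nE] := proj2 (h2 m hx); first by exists k.
exists (gpr (x - y) n); first exact: hm_gpr.
by rewrite expr0 scale1r expr1 (scale_gpr _ _ hg) subrK -nE hx.
Qed.

Lemma torsion_tors M : is_torsion M -> tors M.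
Proof.
elim=> [Z /is_zeroP/tors_zero//|K N P /sesP[i [p e]] sK _ tP].
exact: tors_ext e (tors_simple sK) tP.
Qed.

Lemma hm_Osh (z x : L) (a : car (Osh z)) : hm x a <-> Ahomog (x + z) a.
Proof. by rewrite AhomogP. Qed.

Lemma cofinite2 (N0 N1 : nat) : ev (fun y : L => forall a, Ahomog y a ->
  exists b b', [/\ Ahomog (y - x0 *+ N0) b, Ahomog (y - x1 *+ N1) b'
    & a = X0 ^+ N0 * b + X1 ^+ N1 * b']).
Proof.
apply: evS (cofinite X (maxn N0 N1)) _ => y h a ha.
have [b [b' [hb hb' ->]]] := h a ha.
have l0 := leq_maxl N0 N1; have l1 := leq_maxr N0 N1.
set N := maxn N0 N1 in hb hb' l0 l1 *.
exists (X0 ^+ (N - N0) * b), (X1 ^+ (N - N1) * b'); split.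
- have -> : y - x0 *+ N0 = x0 *+ (N - N0) + (y - x0 *+ N).
    by rewrite addrCA mulrnBr // addrAC subrr add0r.
  by apply: AhomogM => //; apply: hpow.
- have -> : y - x1 *+ N1 = x1 *+ (N - N1) + (y - x1 *+ N).
    by rewrite addrCA mulrnBr // addrAC subrr add0r.
  by apply: AhomogM => //; apply: hpow.
- by rewrite !mulrA -!exprD !subnKC.
Qed.

(** [e0] and [e1] are the prescribed images of [X0 ^+ N0] and [X1 ^+ N1]. By [cofinite2] every
    element of large degree is a combination of these, and [xg_regular] shows that two such
    expressions differ by a multiple of the syzygy on which [e0] and [e1] agree. *)
Lemma Osh_map (z : L) (M : C) (N0 N1 : nat) (e0 e1 : car M) :
  hm (x0 *+ N0 - z) e0 -> hm (x1 *+ N1 - z) e1 -> X1 ^+ N1 *: e0 = X0 ^+ N0 *: e1 ->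
  exists v : hom (Osh z) M, ev (fun x => forall b b' : A,
    Ahomog (x + z - x0 *+ N0) b -> Ahomog (x + z - x1 *+ N1) b' ->
    fn v (X0 ^+ N0 * b + X1 ^+ N1 * b' : car (Osh z)) = b *: e0 + b' *: e1).
Proof.
move=> h0 h1 E.
have [d hd] := ev_shift z (cofinite2 N0 N1).
have /choice[phi phiP] : forall q : L * A, exists m : car M,
   d <= ldeg q.1 -> Ahomog (q.1 + z) q.2 -> exists b b' : A,
    [/\ Ahomog (q.1 + z - x0 *+ N0) b, Ahomog (q.1 + z - x1 *+ N1) b',
        q.2 = X0 ^+ N0 * b + X1 ^+ N1 * b' & m = b *: e0 + b' *: e1].
  move=> [x a] /=; have [[dx ha]|no] := pselect (d <= ldeg x /\ Ahomog (x + z) a).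
    have [b [b' [hb hb' aE]]] := hd x dx a ha.
    by exists (b *: e0 + b' *: e1) => _ _; exists b, b'.
  by exists 0 => dx hx; case: no.
have un x b b' c c' : Ahomog (x + z - x0 *+ N0) b -> Ahomog (x + z - x1 *+ N1) b' ->
    Ahomog (x + z - x0 *+ N0) c -> Ahomog (x + z - x1 *+ N1) c' ->
    X0 ^+ N0 * b + X1 ^+ N1 * b' = X0 ^+ N0 * c + X1 ^+ N1 * c' ->
    b *: e0 + b' *: e1 = c *: e0 + c' *: e1.
  move=> hb hb' hc hc' bcE.
  have rE : X1 ^+ N1 * (b' - c') = X0 ^+ N0 * (c - b).
    rewrite !mulrBr; apply/eqP; rewrite subr_eq addrAC eq_sym subr_eq.
    by rewrite -bcE addrC.
  have zE : x + z - x0 *+ N0 = x + z - x1 *+ N1 + x1 *+ N1 - x0 *+ N0 by rewrite subrK.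
  have [a' ha' [E1 E2]] := xg_regular (AhomogB hb' hc') (AhomogB hc hb) zE rE.
  apply/eqP; rewrite -subr_eq0 opprD addrACA -!scalerBl E1 -opprB E2 scaleNr.
  by rewrite [_ * a']mulrC -scalerA E [X0 ^+ _ * _]mulrC -scalerA addNr.
have hphi x b b' : Ahomog (x + z - x0 *+ N0) b -> Ahomog (x + z - x1 *+ N1) b' ->
    hm x (b *: e0 + b' *: e1).
  move=> hb hb'; apply: hmD.
    have -> : x = (x0 *+ N0 - z) + (x + z - x0 *+ N0).
      by rewrite addrC addrA subrK addrK.
    exact: hmZ.
  have -> : x = (x1 *+ N1 - z) + (x + z - x1 *+ N1).
    by rewrite addrC addrA subrK addrK.
  exact: hmZ.
have [|v vE] := @wtmap_hom F X (Osh z) M (fun x a => phi (x, a)).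
  exists d => x dx; split.
  - by move=> a /hm_Osh ha; have [b [b' [hb hb' _ ->]]] := phiP (x, a) dx ha; apply: hphi.
  - move=> a c ha hc; have /hm_Osh hac := hmB ha hc.
    move: ha hc => /hm_Osh ha /hm_Osh hc.
    have [b [b' [hb hb' /= bE ->]]] := phiP (x, a) dx ha.
    have [k [k' [hk hk' /= kE ->]]] := phiP (x, c) dx hc.
    have [l [l' [hl hl' /= lE ->]]] := phiP (x, a - c) dx hac.
    rewrite opprD addrACA -!scalerBl; apply: (un x) => //; try exact: AhomogB.
    by rewrite -lE bE kE; ring.
  - move=> y c a yp hc ha; have dxy : d <= ldeg (x + y) by rewrite raddfD /=; lia.
    have /hm_Osh hca := hmZ hc ha; move/hm_Osh: ha => ha.
    have [b [b' [hb hb' /= bE ->]]] := phiP (x, a) dx ha.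
    have [l [l' [hl hl' /= lE ->]]] := phiP (x + y, c *: a) dxy hca.
    have sh i (N : nat) : x + y + z - Lgen i *+ N = y + (x + z - Lgen i *+ N).
      by rewrite [x + y]addrC -!addrA.
    rewrite scalerDr !scalerA; apply: (un (x + y)) => //; try by rewrite sh; apply: AhomogM.
    by rewrite -lE bE /GRing.scale /=; ring.
exists v; have evd : ev (fun x : L => d <= ldeg x) by exists d.
apply: evS (evI evd vE) _ => x [dx h] b b' hb hb'.
have hbb : Ahomog (x + z) (X0 ^+ N0 * b + X1 ^+ N1 * b').
  apply: AhomogD.
    by rewrite -[x + z](subrK (x0 *+ N0)) addrC; apply: AhomogM => //; apply: hpow.
  by rewrite -[x + z](subrK (x1 *+ N1)) addrC; apply: AhomogM => //; apply: hpow.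
rewrite h; last exact/hm_Osh.
have [c [c' [hc hc' /= cE ->]]] := phiP (x, _) dx hbb.
exact: (un x).
Qed.

Lemma Osh_ext (z : L) (M : C) (f g : hom (Osh z) M) (N0 N1 : nat) :
  ev (fun x => forall b : A, Ahomog (x + z - x0 *+ N0) b ->
    fn f (X0 ^+ N0 * b : car (Osh z)) = fn g (X0 ^+ N0 * b : car (Osh z))) ->
  ev (fun x => forall b : A, Ahomog (x + z - x1 *+ N1) b ->
    fn f (X1 ^+ N1 * b : car (Osh z)) = fn g (X1 ^+ N1 * b : car (Osh z))) -> f = g.
Proof.
move=> h0 h1; apply/homP.
apply: evS (evI h0 (evI h1 (ev_shift z (cofinite2 N0 N1)))) _.
move=> x [{}h0 [{}h1 h]] a /hm_Osh ha; have [b [b' [hb hb' ->]]] := h a ha.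
by rewrite !fnD h0 // h1.
Qed.

End Torsion.

(** * Morphisms from and into line bundles *)

Section LineBundles.
Variables (F : finFieldType) (X : wpl F).
Local Notation t := (wt_n X).+2.
Local Notation A := (Aalg X).
Local Notation L := (Lgrp X).
Local Notation C := (coh X).
Local Notation o1 := (lift ord0 ord0 : 'I_t).
Local Notation X0 := (xg (ord0 : 'I_t)).
Local Notation X1 := (xg o1).
Local Notation x0 := (Lgen (ord0 : 'I_t) : L).
Local Notation x1 := (Lgen o1 : L).
Implicit Types M P K B D S Y : C.

Lemma ev_pow (P : L -> Prop) (y w : L) : 0 < ldeg y -> ev P ->
  exists N0 : nat, forall N : nat, (N0 <= N)%N -> P (y *+ N + w).
Proof.
move=> yp [d h]; exists `|d - ldeg w|%N => N le; apply: h.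
rewrite raddfD raddfMn /= -mulr_natr natz.
have : N%:Z <= ldeg y * N%:Z by rewrite ler_peMl //; lia.
by lia.
Qed.

Lemma ldeg_xg_gt0 i : 0 < ldeg (Lgen i : L).
Proof. by rewrite ldeg_gen ltz_nat xdeg_gt0. Qed.

Lemma ldeg_xg_ge0 i N : 0 <= ldeg (Lgen i *+ N : L).
Proof. by rewrite raddfMn /= mulrn_wge0 // ltW // ldeg_xg_gt0. Qed.

Lemma Osh_pow (z : L) i N : hm (Lgen i *+ N - z) (xg i ^+ N : car (Osh z)).
Proof. by apply/hm_Osh; rewrite subrK; apply: hpow. Qed.

Lemma scaleO (z : L) (a b : A) : a *: (b : car (Osh z)) = a * b. Proof. by []. Qed.

(** Lift the images of $X_0^N$ and $X_1^N$ to [e0] and [e1]. Their mismatch comes from [K]; this is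
    a Čech cocycle for the two charts, and [tors] for [X0] turns it into a coboundary after the
    powers are raised. *)
Lemma Osh_lift (z : L) K B D (i : hom K B) (p : hom B D) (u : hom (Osh z) D) :
  cses i p -> tors K -> exists v : hom (Osh z) B, comp p v = u.
Proof.
move=> [iI pS e] tK.
have [d hd] := evI (fnZ u) (evI (fnZ p) (evI (fnZ i) (evI pS e))).
have [n hn] := tors_iter tK (Ahomog_xg (ord0 : 'I_t)).
have evd : ev (fun x : L => d <= ldeg x) by exists d.
have [Na hNa] := ev_pow (- z) (ldeg_xg_gt0 ord0) evd.
have [Nb hNb] := ev_pow (- z) (ldeg_xg_gt0 o1) evd.
pose N := maxn Na Nb.
have d0 : d <= ldeg (x0 *+ N - z) by apply: hNa; apply: leq_maxl.
have d1 : d <= ldeg (x1 *+ N - z) by apply: hNb; apply: leq_maxr.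
have [u0 [p0 [_ [s0 _]]]] := hd _ d0; have [u1 [p1 [_ [s1 _]]]] := hd _ d1.
have [e0 he0 pe0] := s0 _ (fn_hm u (Osh_pow z ord0 N)).
have [e1 he1 pe1] := s1 _ (fn_hm u (Osh_pow z o1 N)).
pose w := x0 *+ N + x1 *+ N - z.
have wE0 : w = x0 *+ N - z + x1 *+ N by rewrite /w addrAC.
have wE1 : w = x1 *+ N - z + x0 *+ N by rewrite /w [x0 *+ N + _]addrC addrAC.
have dw : d <= ldeg w by rewrite wE0 raddfD /=; have := ldeg_xg_ge0 o1 N; lia.
have [_ [_ [iw [_ ew]]]] := hd _ dw.
have hdl : hm w (X1 ^+ N *: e0 - X0 ^+ N *: e1).
  by apply: hmB; [rewrite wE0|rewrite wE1]; apply: hmZ => //; apply: hpow.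
have [|k hk kE] := proj1 (ew _ hdl).
  rewrite fnB (p0 _ _ _ (hpow o1 N)) // (p1 _ _ _ (hpow ord0 N)) // pe0 pe1.
  rewrite -(u0 _ _ _ (hpow o1 N)) ?(u1 _ _ _ (hpow ord0 N)) //; last exact: Osh_pow.
  by rewrite -(u1 _ _ _ (hpow ord0 N)) ?scaleO 1?mulrC ?subrr //; apply: Osh_pow.
(* The power [X1 ^+ M] only raises the degree of [k] and [k2] into the range where [tors_iter] and
   linearity hold. *)
have [Ma hMa] := ev_pow w (ldeg_xg_gt0 o1) (hn N).
have [Mb hMb] := ev_pow (w - x0 *+ N) (ldeg_xg_gt0 o1) evd.
pose M := maxn Ma Mb.
have [|k2 hk2 k2E] := hMa M (leq_maxl _ _) (X1 ^+ M *: k).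
  by rewrite addrC; apply: hmZ => //; apply: hpow.
have dk2 := hMb M (leq_maxr _ _); rewrite addrA in dk2.
have [_ [_ [ik2 _]]] := hd _ dk2.
(* Since $X_0^nX_1^M k = X_0^{n+N}k_2$, raising the powers and adding [k2] to the second element
   removes the mismatch. *)
pose f0 := X0 ^+ n *: e0; pose f1 := X1 ^+ M *: e1 + fn i k2.
have hf0 : hm (x0 *+ (n + N) - z) f0.
  by rewrite mulrnDr -addrA addrC; apply: hmZ => //; apply: hpow.
have hf1 : hm (x1 *+ (N + M) - z) f1.
  have -> : x1 *+ (N + M) - z = x1 *+ N - z + x1 *+ M by rewrite mulrnDr addrAC.
  apply: hmD; first by apply: hmZ => //; apply: hpow.
  apply: fn_hm; move: hk2.
  have -> // : x1 *+ M + w - x0 *+ N = x1 *+ N - z + x1 *+ M.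
  by rewrite wE1 addrA addrK addrC.
have fE : X1 ^+ (N + M) *: f0 = X0 ^+ (n + N) *: f1.
  have E : X0 ^+ n *: (X1 ^+ M *: (X1 ^+ N *: e0 - X0 ^+ N *: e1)) = X0 ^+ (n + N) *: fn i k2.
    rewrite -kE -(iw _ _ _ (hpow o1 M)) //.
    have hk' : hm (x1 *+ M + w) (X1 ^+ M *: k).
      by rewrite addrC; apply: hmZ => //; apply: hpow.
    have dk' : d <= ldeg (x1 *+ M + w) by rewrite raddfD /=; have := ldeg_xg_ge0 o1 M; lia.
    have [_ [_ [ik' _]]] := hd _ dk'.
    by rewrite -(ik' _ _ _ (hpow ord0 n)) // k2E (ik2 _ _ _ (hpow ord0 (n + N))).
  have cmp a b c d' : a = c -> b = d' -> a *: e0 = b *: e1 + (c *: e0 - d' *: e1).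
    by move=> -> ->; rewrite addrC subrK.
  by rewrite /f1 scalerDr -E !scalerBr !scalerA; apply: cmp; rewrite !exprD; ring.
have [v vE] := Osh_map hf0 hf1 fE; exists v.
have pf0 : fn p f0 = X0 ^+ n *: fn u (X0 ^+ N : car (Osh z)).
  by rewrite (p0 _ _ _ (hpow ord0 n)) // pe0.
have pf1 : fn p f1 = X1 ^+ M *: fn u (X1 ^+ N : car (Osh z)).
  rewrite fnD (p1 _ _ _ (hpow o1 M)) // pe1.
  suff -> : fn p (fn i k2) = 0 by rewrite addr0.
  have [_ [_ [_ [_ ek2]]]] := hd _ dk2.
  by apply/ek2; [apply: fn_hm|exists k2].
have q0 : d <= ldeg (x0 *+ (n + N) - z).
  have -> : x0 *+ (n + N) - z = x0 *+ n + (x0 *+ N - z) by rewrite mulrnDr addrA.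
  by rewrite [ldeg _]raddfD; have := ldeg_xg_ge0 ord0 n; move: d0; rewrite /=; lia.
have q1 : d <= ldeg (x1 *+ (N + M) - z).
  have -> : x1 *+ (N + M) - z = x1 *+ M + (x1 *+ N - z).
    by rewrite addnC mulrnDr addrA.
  by rewrite [ldeg _]raddfD; have := ldeg_xg_ge0 o1 M; move: d1; rewrite /=; lia.
have [_ [pq0 _]] := hd _ q0; have [_ [pq1 _]] := hd _ q1.
apply: (@Osh_ext F X z D _ _ (n + N) (N + M)).
  apply: evS (evI vE (fnM p v)) _ => x [h1 h2] b hb.
  have hb' : hm x (X0 ^+ (n + N) * b : car (Osh z)).
    by apply/hm_Osh; rewrite -[x + z](subrK (x0 *+ (n + N))) addrC; apply: AhomogM => //; apply: hpow.
  rewrite h2 //; have := h1 b 0 hb (Ahomog0 _); rewrite mulr0 addr0 scale0r addr0 => ->.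
  rewrite (pq0 _ _ _ hb) // pf0.
  have hbn := AhomogM hb (hpow ord0 n).
  rewrite scalerA -(u0 _ _ _ hbn); last exact: Osh_pow.
  by rewrite scaleO exprD; congr (fn u _); ring.
apply: evS (evI vE (fnM p v)) _ => x [h1 h2] b hb.
have hb' : hm x (X1 ^+ (N + M) * b : car (Osh z)).
  by apply/hm_Osh; rewrite -[x + z](subrK (x1 *+ (N + M))) addrC; apply: AhomogM => //; apply: hpow.
rewrite h2 //; have := h1 0 b (Ahomog0 _) hb; rewrite mulr0 add0r scale0r add0r => ->.
rewrite (pq1 _ _ _ hb) // pf1.
have hbn := AhomogM hb (hpow o1 M).
rewrite scalerA -(u1 _ _ _ hbn); last exact: Osh_pow.
by rewrite scaleO exprD; congr (fn u _); ring.
Qed.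

(** Torsion makes $X_1^M s$ divisible by arbitrarily high powers of [X0], up to a common factor
    $X_0^n$. In the line bundle that factor cancels and regularity makes [fn f s] itself divisible,
    until the cofactor has negative degree. *)
Lemma tors_Osh (z : L) S (f : hom S (Osh z)) : tors S -> f = hom0 S (Osh z).
Proof.
move=> tS; apply/cnullP.
have [n hn] := tors_iter tS (Ahomog_xg (ord0 : 'I_t)).
have [d hd] := fnZ f; exists d => x dx s hs.
(* This [k] is chosen so large that a cofactor of $X_0^k$ in degree $x+z$ must vanish. *)
have [k hk] : exists k : nat, ldeg (x + z - x0 *+ k) < 0.
  have [N0 h] := ev_pow (- (x + z)) (ldeg_xg_gt0 ord0) (ex_intro _ 1 (fun _ h => h) : ev (fun y : L => 1 <= ldeg y)).
  by exists N0; have := h N0 (leqnn _); rewrite -opprB !raddfN /= !raddfD !raddfN /=; lia.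
have [Ma hMa] := ev_pow x (ldeg_xg_gt0 o1) (hn k).
have evd : ev (fun x : L => d <= ldeg x) by exists d.
have [Mb hMb] := ev_pow (x - x0 *+ k) (ldeg_xg_gt0 o1) evd.
pose M := maxn Ma Mb.
have hs' : hm (x1 *+ M + x) (X1 ^+ M *: s) by rewrite addrC; apply: hmZ => //; apply: hpow.
have [s2 hs2 sE] := hMa M (leq_maxl _ _) _ hs'.
have ds2 := hMb M (leq_maxr _ _); rewrite addrA in ds2.
have dx' : d <= ldeg (x1 *+ M + x) by rewrite raddfD /=; have := ldeg_xg_ge0 o1 M; lia.
have := congr1 (fn f) sE.
rewrite (hd _ dx' _ _ _ (hpow ord0 n)) // (hd _ dx _ _ _ (hpow o1 M)) //.
rewrite (hd _ ds2 _ _ _ (hpow ord0 (n + k))) // !scaleO exprD -mulrA => E.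
have /hm_Osh ha := fn_hm f hs; have /hm_Osh ha2 := fn_hm f hs2.
set a : A := fn f s in ha E *; set a2 : A := fn f s2 in ha2 E *.
have {}E : X1 ^+ M * a = X0 ^+ k * a2.
  apply: (Ahom_cancel (hpow ord0 n) _ _ _ E).
  - exact: AhomogM (hpow o1 M) ha.
  - have -> : x1 *+ M + (x + z) = x0 *+ k + (x1 *+ M + x - x0 *+ k + z).
      by rewrite addrA [_ - _ + z]addrAC [RHS]addrC subrK.
    exact: AhomogM (hpow ord0 k) ha2.
  - by apply: Ahom_expn_neq0 (Ahomog_xg _) _; apply: xg_neq0.
have [|a' ha' [-> _]] := xg_regular ha ha2 _ E.
  by rewrite [x1 *+ M + x]addrC addrAC -[x + x1 *+ M + z]addrA [x1 *+ M + z]addrC addrA.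
by rewrite (Ahomog_neg hk ha') mulr0.
Qed.

(* The kernel of an epimorphism O(z) -> Y is the annihilator of Y. *)
Lemma Osh_epi_ker (z : L) Y (p p' : hom (Osh z) Y) : csurj p ->
  ev (fun x => forall a : car (Osh z), hm x a -> fn p a = 0 -> fn p' a = 0).
Proof.
move=> pS; have [d hd] := evI (fnZ p) (evI (fnZ p') pS).
have evd : ev (fun x : L => d <= ldeg x) by exists d.
apply: evS (evI evd (tail_zero Y)) _ => x [dx h] a ha pa.
have [u1 [u2 u3]] := hd x dx.
have kill i N : d <= ldeg (Lgen i *+ N - z) -> xg i ^+ N *: fn p' a = 0.
  move=> dN; have [v1 [v2 v3]] := hd _ dN.
  have [c hc cE] := v3 _ (fn_hm p' (Osh_pow z i N)).
  rewrite -(u2 _ _ _ (hpow i N)) // scaleO mulrC -[a * _]scaleO.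
  have /hm_Osh ha' := ha; have /hm_Osh hc' := hc.
  rewrite (v2 _ _ _ ha'); last exact: Osh_pow.
  rewrite -cE -(v1 _ _ _ ha') // scaleO mulrC -scaleO (u1 _ _ _ hc') //.
  by rewrite pa scaler0.
have [Na hNa] := ev_pow (- z) (ldeg_xg_gt0 ord0) evd.
have [Nb hNb] := ev_pow (- z) (ldeg_xg_gt0 o1) evd.
apply: (h _ (maxn Na Nb)); first exact: fn_hm.
  by apply: kill; apply: hNa; apply: leq_maxl.
by apply: kill; apply: hNb; apply: leq_maxr.
Qed.

Lemma Osh_epi_iso (z : L) Y (p p' : hom (Osh z) Y) : csurj p -> csurj p' ->
  exists2 u : hom Y Y, is_iso u & comp u p = p'.
Proof.
move=> pS pS'; have [u uE] := lift_surj pS (Osh_epi_ker p' pS).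
have [v vE] := lift_surj pS' (Osh_epi_ker p pS').
exists u => //; exists v; split.
  by apply: (csurj_cancel pS); rewrite -comp_assoc uE vE comp_idl.
by apply: (csurj_cancel pS'); rewrite -comp_assoc vE uE comp_idl.
Qed.

(** The images [a0], [a1] of $X_0^N$ and $X_1^N$ satisfy $X_1^Na_0 = X_0^Na_1$, so by regularity
    they are these powers times one element [f]. *)
Lemma Osh_hom (z z' : L) (u : hom (Osh z) (Osh z')) : exists2 f : A, Ahomog (z' - z) f &
  ev (fun x => forall a : A, Ahomog (x + z) a -> fn u (a : car (Osh z)) = a * f).
Proof.
have [d hd] := fnZ u; have evd : ev (fun x : L => d <= ldeg x) by exists d.
have [Na hNa] := ev_pow (- z) (ldeg_xg_gt0 ord0) evd.
have [Nb hNb] := ev_pow (- z) (ldeg_xg_gt0 o1) evd.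
pose N := maxn Na Nb.
have d0 : d <= ldeg (x0 *+ N - z) by apply: hNa; apply: leq_maxl.
have d1 : d <= ldeg (x1 *+ N - z) by apply: hNb; apply: leq_maxr.
have /hm_Osh ha0 := fn_hm u (Osh_pow z ord0 N).
have /hm_Osh ha1 := fn_hm u (Osh_pow z o1 N).
set a0 : A := fn u _ in ha0; set a1 : A := fn u _ in ha1.
have E : X1 ^+ N * a0 = X0 ^+ N * a1.
  rewrite -!(scaleO z') -(hd _ d0 _ _ _ (hpow o1 N)); last exact: Osh_pow.
  rewrite -(hd _ d1 _ _ _ (hpow ord0 N)); last exact: Osh_pow.
  by rewrite !scaleO mulrC.
have zE : x1 *+ N - z + z' = x0 *+ N - z + z' + x1 *+ N - x0 *+ N.
  by rewrite [RHS]addrC !addrA addNr add0r [RHS]addrC addrA.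
have [f hf [fE0 fE1]] := xg_regular ha0 ha1 zE E.
exists f.
  by move: hf; rewrite -[x0 *+ N - z + z']addrA [x0 *+ N + _]addrC addrK addrC.
apply: evS (ev_shift z (@cofinite2 F X N N)) _ => x h a ha.
have [b [b' [hb hb' ->]]] := h a ha.
rewrite fnD mulrDl; congr (_ + _).
  rewrite mulrC -[b * _](scaleO z) (hd _ d0 _ _ _ hb); last exact: Osh_pow.
  by rewrite scaleO -/a0 fE0 mulrA.
rewrite mulrC -[b' * _](scaleO z) (hd _ d1 _ _ _ hb'); last exact: Osh_pow.
by rewrite scaleO -/a1 fE1 mulrA.
Qed.

Lemma Osh_mul (z z' : L) (f : A) : Ahomog (z' - z) f ->
  exists u : hom (Osh z) (Osh z'), ev (fun x => forall a : A, Ahomog (x + z) a ->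
    fn u (a : car (Osh z)) = a * f).
Proof.
move=> hf; have [|u uE] := @tmap_hom F X (Osh z) (Osh z') (fun a : A => a * f).
  split.
  - by move=> m n; rewrite mulrBl.
  - move=> x a; rewrite [RHS](_ : _ = Apr (x + z') (a * f)) //.
    rewrite mulrC -[a * f]mulrC -[f * a]/(f *: (a : A^o)).
    have -> : x + z' = x + z + (z' - z) by rewrite -addrA [z + _]addrC subrK.
    by rewrite Apr_act.
  - by apply: evT => x y a m _ _; rewrite !scaleO mulrA.
by exists u; apply: evS uE _ => x h a ha; apply: h; apply/hm_Osh.
Qed.

End LineBundles.

(** * Counting by labels, products and the pigeonhole principle *)

Section MoreCounting.

Lemma cardE_cover (T : Type) (U : eqType) (A : T -> Prop) (E : T -> T -> Prop)
    (s : seq U) (rho : T -> U -> Prop) : equivr E ->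
  (forall x, A x -> exists2 u, u \in s & rho x u) ->
  (forall x x' u, A x -> A x' -> rho x u -> rho x' u -> E x x') ->
  exists n, cardE A E n.
Proof.
move=> [re sy tr] h1 h2.
pose P (i : 'I_(size s)) := exists x, A x /\ rho x (tnth (in_tuple s) i).
have /choice[g gP] : forall i : {i | `[< P i >]}, exists x,
    A x /\ rho x (tnth (in_tuple s) (val i)).
  by move=> [i /= /asboolP].
(* [Q] keeps the first label of each class, so that the representatives are pairwise
   inequivalent. *)
pose Q (i : {i | `[< P i >]}) := `[< forall j : {i | `[< P i >]}, (val j < val i)%N -> ~ E (g j) (g i) >].
exists #|{: {i | Q i}}|.
apply: (@cardE_fin _ A E _ (fun i : {i | Q i} => g (val i))).
- by move=> i; case: (gP (val i)).
- move=> i j e; apply: val_inj; apply: val_inj; apply: val_inj => /=.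
  have /asboolP qi := valP i; have /asboolP qj := valP j.
  case: (ltngtP (val (val i)) (val (val j))) => // lt.
    by case: (qj _ lt).
  by case: (qi _ lt); apply: sy.
- move=> x Ax; have [u us ru] := h1 x Ax.
  have /tnthP[i iE] : u \in in_tuple s by [].
  have Pi : `[< P i >] by apply/asboolP; exists x; rewrite -iE.
  pose R k := `[< exists i : {i | `[< P i >]}, nat_of_ord (val i) = k /\ E x (g i) >].
  have exR : exists k, R k.
    exists i; apply/asboolP; exists (exist _ i Pi); split=> //.
    have [Ag rg] := gP (exist _ i Pi); apply: (h2 _ _ u) => //.
    by rewrite iE.
  case: (ex_minnP exR) => k /asboolP[j [jk Ej]] mn.
  have Qj : Q j.
    apply/asboolP => l lt El; have /mn : R (val l).
      by apply/asboolP; exists l; split=> //; apply: (tr _ _ _ Ej); apply: sy.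
    by rewrite -jk leqNgt lt.
  by exists (exist _ j Qj).
Qed.

Lemma cardE_prod (T U : Type) (A : T -> Prop) (E : T -> T -> Prop) (B : U -> Prop)
    (E' : U -> U -> Prop) n m : cardE A E n -> cardE B E' m ->
  cardE (fun p : T * U => A p.1 /\ B p.2) (fun p q => E p.1 q.1 /\ E' p.2 q.2) (n * m).
Proof.
move=> [f [f1 f2 f3]] [g [g1 g2 g3]].
have <- : #|{: 'I_n * 'I_m}| = (n * m)%N by rewrite card_prod !card_ord.
apply: (@cardE_fin _ _ _ _ (fun p => (f p.1, g p.2))).
- by move=> [i j]; split; [apply: f1|apply: g1].
- by move=> [i j] [i' j'] /= [/f2 -> /g2 ->].
- by move=> [x u] /= [/f3[i Ei] /g3[j Ej]]; exists (i, j).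
Qed.

Lemma cardE_pi (n : nat) (T : 'I_n -> Type) (A : forall j, T j -> Prop)
    (E : forall j, T j -> T j -> Prop) :
  (forall j, exists m, cardE (A j) (E j) m) ->
  exists m, cardE (fun f : forall j, T j => forall j, A j (f j))
    (fun f g => forall j, E j (f j) (g j)) m.
Proof.
move=> h; pose m j := sval (cid (h j)); have hm j : cardE (A j) (E j) (m j) := svalP (cid (h j)).
pose f j := sval (cid (hm j)); have fP j := svalP (cid (hm j)).
exists #|{: {dffun forall j : 'I_n, 'I_(m j)}}|.
apply: (@cardE_fin _ _ _ _ (fun (p : {dffun forall j : 'I_n, 'I_(m j)}) j => f j (p j))).
- by move=> p j; case: (fP j) => h1 _ _; apply: h1.
- by move=> p q e; apply/ffunP => j; case: (fP j) => _ h2 _; apply: h2.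
- move=> x Ax; have ex j : exists i, E j (x j) (f j i) by case: (fP j) => _ _; apply.
  exists [ffun j => sval (cid (ex j))] => j; rewrite ffunE; exact: (svalP (cid (ex j))).
Qed.

Lemma pigeonhole (T : Type) (u : nat -> T) n : cardE (fun _ : T => True) eq n ->
  exists i j, (i < j)%N /\ u i = u j.
Proof.
move=> [f [_ _ f3]].
have /choice[r rP] : forall k : 'I_n.+1, exists i, u k = f i by move=> k; apply: f3.
have /injectivePn[i [j ij E]] : ~~ injectiveb r.
  by apply/negP => /injectiveP/leq_card; rewrite !card_ord ltnn.
wlog lt : i j ij E / (i < j)%N => [h|].
  case: (ltngtP i j) => [lt|lt|/val_inj e]; first exact: (h i j).
    by apply: (h j i) => //; rewrite eq_sym.
  by rewrite e eqxx in ij.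
by exists i, j; split=> //; rewrite rP E -rP.
Qed.

End MoreCounting.

(** * Finiteness of Hom sets and of localisations *)

Section Finiteness.
Variables (F : finFieldType) (X : wpl F).
Local Notation t := (wt_n X).+2.
Local Notation A := (Aalg X).
Local Notation L := (Lgrp X).
Local Notation C := (coh X).
Local Notation o1 := (lift ord0 ord0 : 'I_t).
Local Notation X0 := (xg (ord0 : 'I_t)).
Local Notation X1 := (xg o1).
Implicit Types M P K B D S Y : C.

(* A homogeneous element of degree x of the localisation of M at g, recorded by
   its multiples g^k m for large k. *)
Definition germ (M : C) (x y : L) (g : A) (v : nat -> car M) : Prop :=
  exists k0, forall k, (k0 <= k)%N -> hm (x + y *+ k) (v k) /\ v k.+1 = g *: v k.

Definition geq (M : C) (v w : nat -> car M) : Prop :=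
  exists k0, forall k, (k0 <= k)%N -> v k = w k.

Lemma equivr_geq M : equivr (@geq M).
Proof.
split=> [v|v w [k h]|u v w [k h] [l h']]; first by exists 0%N.
  by exists k => i /h.
exists (maxn k l) => i; rewrite geq_max => /andP[ki li].
by rewrite h // h'.
Qed.

Lemma germ_pow M x y g v k0 : (forall k, (k0 <= k)%N -> hm (x + y *+ k) (v k) /\ v k.+1 = g *: v k) ->
  forall k j, (k0 <= k)%N -> v (k + j)%N = g ^+ j *: (v k : car M).
Proof.
move=> h k j kk; elim: j => [|j ih]; first by rewrite addn0 scale1r.
by rewrite addnS (proj2 (h _ _)) ?ih ?scalerA ?exprS // (leq_trans kk) ?leq_addr.
Qed.

(** By torsion a germ is eventually $g^{k-k_1}w$ with [w] in the fixed degree $x+k_1y$, where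
    [low_finite] leaves finitely many choices. *)
Lemma germ_finite M (x y : L) g : 0 < ldeg y -> Ahomog y g -> tors M ->
  exists n, cardE (@germ M x y g) (@geq M) n.
Proof.
move=> yp hg tM; have [n h] := tM y g hg.
have [k1 hk1] := ev_pow x yp h.
have claim j (m : car M) : hm (x + y *+ (k1 + j)) m -> exists2 w : car M,
    hm (x + y *+ k1) w & g ^+ n *: m = g ^+ (n + j) *: w.
  elim: j m => [|j ih] m hm'; first by exists m; rewrite ?addn0 in hm' *.
  have [|m' hm2 E] := hk1 (k1 + j.+1)%N (leq_addr _ _) m; first by rewrite addrC.
  have [|w hw wE] := ih m'.
    have -> // : x + y *+ (k1 + j) = y *+ (k1 + j.+1) + x - y.
    by rewrite addnS mulrSr addrC addrAC addrK addrC.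
  exists w => //; rewrite E exprS -scalerA wE scalerA -exprS.
  by rewrite addnS.
have [s sP] := low_finite M (ldeg (x + y *+ k1) + 1).
apply: (@cardE_cover _ _ _ _ s (fun v w => exists k0, (k1 <= k0)%N /\
   forall k, (k0 <= k)%N -> v k = g ^+ (k - k1) *: w)).
- exact: equivr_geq.
- move=> v [k0 hv]; pose k := maxn k0 k1.
  have k0k : (k0 <= k)%N by apply: leq_maxl.
  have k1k : (k1 <= k)%N by apply: leq_maxr.
  have [|w hw wE] := claim (k - k1)%N (v k); first by rewrite subnKC //; case: (hv k k0k).
  exists w; first by apply: sP hw; lia.
  exists (k + n)%N; split; first by lia.
  move=> l kl; rewrite -(subnKC kl) -addnA (germ_pow hv) // addnC exprD -scalerA wE.
  by rewrite scalerA -exprD; congr (_ ^+ _ *: _); lia.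
- move=> v v' w _ _ [k0 [_ h0]] [k0' [_ h0']]; exists (maxn k0 k0') => k.
  by rewrite geq_max => /andP[a b]; rewrite h0 // h0'.
Qed.

(** Restriction to two charts: a morphism is recovered from its germs at [X0] and at [X1]. *)
Lemma Osh_hom_finite (z : L) M : tors M -> exists n, cardE (fun _ : hom (Osh z) M => True) eq n.
Proof.
move=> tM.
have [n0 c0] := germ_finite (- z) (ldeg_xg_gt0 ord0) (Ahomog_xg ord0) tM.
have [n1 c1] := germ_finite (- z) (ldeg_xg_gt0 o1) (Ahomog_xg o1) tM.
have e2 : equivr (fun p q : (nat -> car M) * (nat -> car M) => geq p.1 q.1 /\ geq p.2 q.2).
  have [r s t] := equivr_geq M.
  split=> [[v w]|[v w] [v' w'] [/s ? /s ?]|p q p' [h1 h2] [h3 h4]] //=.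
  by split; [apply: t h3|apply: t h4].
apply: (@cardE_inj _ _ _ _ _ _
  (fun (u : hom (Osh z) M) (p : (nat -> car M) * (nat -> car M)) =>
     p = (fun k => fn u (X0 ^+ k : car (Osh z)), fun k => fn u (X1 ^+ k : car (Osh z))))
  _ e2) (cardE_prod c0 c1).
- move=> u _; exists (fun k => fn u (X0 ^+ k : car (Osh z)), fun k => fn u (X1 ^+ k : car (Osh z))) => //=.
  have gi i : germ (- z) (Lgen i) (xg i) (fun k => fn u (xg i ^+ k : car (Osh z))).
    have [k0 hk] := ev_pow (- z) (ldeg_xg_gt0 i) (fnZ u).
    exists k0 => k kk; split; first by rewrite addrC; apply: fn_hm; apply: Osh_pow.
    by rewrite -(hk k kk _ _ _ (Ahomog_xg i)) ?scaleO ?exprS //; apply: Osh_pow.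
  by split.
- move=> u u' p p' _ _ _ _ -> ->; split=> [->|[/= [k0 h0] [k1 h1]]].
    by case: e2.
  have lin_ := evI (fnZ u) (fnZ u').
  have [Na ha] := ev_pow (- z) (ldeg_xg_gt0 ord0) lin_.
  have [Nb hb] := ev_pow (- z) (ldeg_xg_gt0 o1) lin_.
  have key i N b y : (forall y a m, Ahomog y a -> hm (Lgen i *+ N - z) m -> fn u (a *: m) = a *: fn u m) /\
      (forall y a m, Ahomog y a -> hm (Lgen i *+ N - z) m -> fn u' (a *: m) = a *: fn u' m) ->
      fn u (xg i ^+ N : car (Osh z)) = fn u' (xg i ^+ N : car (Osh z)) -> Ahomog y b ->
      fn u (xg i ^+ N * b : car (Osh z)) = fn u' (xg i ^+ N * b : car (Osh z)).
    move=> [l l'] e hy; rewrite mulrC -[b * _](scaleO z).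
    by rewrite (l _ _ _ hy) ?(l' _ _ _ hy) ?e //; apply: Osh_pow.
  apply: (@Osh_ext F X z M _ _ (maxn k0 Na) (maxn k1 Nb)).
    apply: evT => x b; apply: key; first by apply: ha; apply: leq_maxr.
    by apply: h0; apply: leq_maxl.
  apply: evT => x b; apply: key; first by apply: hb; apply: leq_maxr.
  by apply: h1; apply: leq_maxl.
Qed.

Lemma fn_sum M P (f : hom M P) n (e : 'I_n -> car M) : fn f (\sum_j e j) = \sum_j fn f (e j).
Proof. exact: (big_morph (fn f) (fnD f) (fn0 f)). Qed.

Lemma Osh_elt M (d : L) (e : car M) : hm d e -> exists u : hom (Osh (- d)) M,
  ev (fun x => forall a : A, Ahomog (x - d) a -> fn u (a : car (Osh (- d))) = a *: e).
Proof.
move=> he; have [|u uE] := @tmap_hom F X (Osh (- d)) M (fun a : A => a *: e).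
  split.
  - by move=> m n; rewrite scalerBl.
  - move=> x a; rewrite (hm_span _ _ he); by [].
  - by apply: evT => x y a m _ _; rewrite scaleO scalerA.
by exists u; apply: evS uE _ => x h a ha; apply: h; apply/hm_Osh.
Qed.

(** A morphism from [M] is determined by its composites with the maps from line bundles given by
    homogeneous generators of [M]. *)
Lemma hom_finite M S : tors S -> exists n, cardE (fun _ : hom M S => True) eq n.
Proof.
move=> tS; have [n [d [e [eP eS]]]] := hgen (gsubT M).
have ex j : exists u : hom (Osh (- d j)) M, ev (fun x => forall a : A,
    Ahomog (x - d j) a -> fn u (a : car (Osh (- d j))) = a *: e j).
  by apply: Osh_elt; case: (eP j).
pose eps j := sval (cid (ex j)); have epsP j := svalP (cid (ex j)).
have [m cm] := @cardE_pi n (fun j => hom (Osh (- d j)) S) (fun _ _ => True) (fun _ => eq)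
  (fun j => Osh_hom_finite (- d j) tS).
apply: (@cardE_inj _ _ _ _ _ _ (fun (f : hom M S) phi => forall j, phi j = comp f (eps j)) _ _ _ _ cm).
- by split=> [f j|f g h j|f g k h1 h2 j] //; rewrite h1.
- by move=> f _; exists (fun j => comp f (eps j)).
move=> f f' phi phi' _ _ _ _ h h'; split=> [ff j|E]; first by rewrite h h' ff.
apply/homP.
have hj : ev (fun x => forall j (a : A), Ahomog (x - d j) a ->
    fn f (a *: e j) = fn f' (a *: e j)).
  apply: ev_all => j; have /homP Ej : comp f (eps j) = comp f' (eps j) by rewrite -h -h' E.
  apply: evS (evI Ej (evI (epsP j) (evI (fnM f (eps j)) (fnM f' (eps j))))) _.
  move=> x [h1 [h2 [h3 h4]]] a ha; have hx : hm x (a : car (Osh (- d j))) by apply/hm_Osh.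
  by rewrite -(h2 a ha) -h3 // h1 // h4.
apply: evS hj _ => x hx q hq; have [a [ha ->]] := eS x q I hq.
by rewrite !fn_sum; apply: eq_bigr => j _; apply: hx.
Qed.

Lemma Osh_end_finite (z z' : L) : exists n, cardE (fun _ : hom (Osh z) (Osh z') => True) eq n.
Proof.
have [s sP] := low_finite_alg X (ldeg (z' - z) + 1).
apply: (@cardE_cover _ _ _ _ s (fun (u : hom (Osh z) (Osh z')) (f : A) =>
  ev (fun x => forall a : A, Ahomog (x + z) a -> fn u (a : car (Osh z)) = a * f))).
- exact: equivr_eq.
- move=> u _; have [f hf uf] := Osh_hom u; exists f => //; apply: sP hf; lia.
- move=> u u' f _ _ h h'; apply/homP; apply: evS (evI h h') _ => x [h1 h2] a /hm_Osh ha.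
  by rewrite h1 // h2.
Qed.

Lemma cinj_comp M P K (i : hom P K) (j : hom M P) : cinj i -> cinj j -> cinj (comp i j).
Proof.
move=> iI jI; apply: evS (evI iI (evI jI (fnM i j))) _ => x [h1 [h2 h3]] m hx.
by rewrite h3 // => E; apply: h2 => //; apply: h1 => //; apply: fn_hm.
Qed.

Lemma csurj_comp M P K (i : hom P K) (j : hom M P) : csurj i -> csurj j -> csurj (comp i j).
Proof.
move=> iI jI; apply: evS (evI iI (evI jI (fnM i j))) _ => x [h1 [h2 h3]] k hk.
have [p hp <-] := h1 k hk; have [m hx <-] := h2 p hp; exists m => //; exact: h3.
Qed.

Lemma cinj_id M : cinj (idm M).
Proof. by apply: evS (fn1 M) _ => x h m hx; rewrite h. Qed.

(** Two powers of [f] coincide by the pigeonhole principle; cancelling the lower one, which is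
    monic, shows that a positive power of [f] is the identity. *)
Lemma mono_end_iso M (f : hom M M) n : cardE (fun _ : hom M M => True) eq n ->
  cinj f -> is_iso f.
Proof.
move=> cn fI; pose u k := iter k (fun h : hom M M => comp f h) (idm M).
have uI k : cinj (u k) by elim: k => [|k ih]; [apply: cinj_id|apply: cinj_comp].
have uD k l : u (k + l)%N = comp (u k) (u l).
  elim: k => [|k ih]; first by rewrite comp_idl.
  by rewrite addSn -[LHS]/(comp f (u (k + l)%N)) ih comp_assoc.
have fu k : comp f (u k) = comp (u k) f by rewrite -[LHS]/(u k.+1) -addn1 uD -[u 1%N]/(comp f (idm M)) comp_idr.
have [i [j [ij E]]] := pigeonhole u cn.
have E1 : u (j - i)%N = idm M.
  by apply: (cinj_cancel (uI i)); rewrite -uD subnKC 1?ltnW // -E comp_idr.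
have jE : (j - i)%N = (j - i).-1.+1 by lia.
rewrite jE in E1; exists (u (j - i).-1); rewrite -fu; by split.
Qed.

Lemma ev_germ (P : L -> Prop) (x y : L) : 0 < ldeg y -> ev P ->
  exists k0, forall k, (k0 <= k)%N -> P (x + y *+ k).
Proof. by move=> yp h; have [k0 hk] := ev_pow x yp h; exists k0 => k /hk; rewrite addrC. Qed.

Lemma germ_fn M P (f : hom M P) (x y : L) g v : 0 < ldeg y -> Ahomog y g ->
  germ x y g v -> germ x y g (fun k => fn f (v k)).
Proof.
move=> yp hg [k0 h]; have [k1 h1] := ev_germ x yp (fnZ f).
exists (maxn k0 k1) => k; rewrite geq_max => /andP[a b]; have [hk E] := h k a.
by split; [apply: fn_hm|rewrite E (h1 k b _ _ _ hg)].
Qed.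

Lemma germ_add M (x y : L) g (v w : nat -> car M) : germ x y g v -> germ x y g w ->
  germ x y g (fun k => v k + w k).
Proof.
move=> [k h] [l h']; exists (maxn k l) => i; rewrite geq_max => /andP[a b].
have [h1 e1] := h i a; have [h2 e2] := h' i b.
by split; [apply: hmD|rewrite e1 e2 scalerDr].
Qed.

Lemma germ_opp M (x y : L) g (v : nat -> car M) : germ x y g v -> germ x y g (fun k => - v k).
Proof.
move=> [k h]; exists k => i /h[h1 e1].
by split; [apply: hmN|rewrite e1 scalerN].
Qed.

(** Localisation is exact. A germ of the quotient is lifted by lifting a single late term and
    multiplying it by powers of [g], and two lifts differ by a germ of [M]. *)
Lemma germ_ses M P K (i : hom M P) (p : hom P K) (x y : L) g n1 n2 :
  0 < ldeg y -> Ahomog y g -> cses i p ->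
  cardE (@germ M x y g) (@geq M) n1 -> cardE (@germ K x y g) (@geq K) n2 ->
  cardE (@germ P x y g) (@geq P) (n2 * n1).
Proof.
move=> yp hg [iI pS e] c1 c2.
have [[rP sP tP] [rK sK tK]] := (equivr_geq P, equivr_geq K).
apply: (@cardE_mul _ _ _ _ _ _ (fun v u => geq (fun k => fn p (v k)) u) _ _ _ _ c2).
- exact: equivr_geq.
- exact: equivr_geq.
- by move=> v gv; exists (fun k => fn p (v k)); [apply: germ_fn|apply: rK].
- by move=> v u u' _ _ _ uu h; apply: tK h uu.
- move=> v v' u u' _ _ _ _ h h' [k vv]; apply: (tK _ _ _ (sK _ _ h)); apply: (tK _ _ _ _ h').
  by exists k => l /vv ->.
move=> u [k0 hu].
have [k1 h1] := ev_germ x yp (evI (fnZ p) pS).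
pose k := maxn k0 k1; have k0k : (k0 <= k)%N by apply: leq_maxl.
have k1k : (k1 <= k)%N by apply: leq_maxr.
have [lp sp] := h1 k k1k; have [b hb bE] := sp _ (proj1 (hu k k0k)).
pose v0 l := g ^+ (l - k) *: b.
have gv0 : germ x y g v0.
  exists k => l kl; split.
    have -> : x + y *+ l = x + y *+ k + y *+ (l - k) by rewrite -addrA -mulrnDr subnKC.
    by apply: hmZ => //; apply: AhomogX.
  by rewrite /v0 subSn // exprS scalerA.
have pv0 : geq (fun l => fn p (v0 l)) u.
  exists k => l kl; rewrite /v0 (lp _ _ _ (AhomogX (l - k) hg)) // bE.
  by rewrite -(germ_pow hu) // subnKC.
apply: (@cardE_bij _ _ _ _ _ _ (fun v w => geq v (fun l => v0 l + fn i (w l))) _ _ _ _ c1).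
- move=> v [gv vu].
  have gd := germ_add gv (germ_opp gv0).
  have [k2 h2] := gd; have [k3 h3] := ev_germ x yp (evI e (evI iI (fnZ i))).
  have [k4 h4] : geq (fun l => fn p (v l)) (fun l => fn p (v0 l)) by apply: (tK _ _ _ vu); apply: sK.
  pose q := maxn k2 (maxn k3 k4).
  have qP l : (q <= l)%N -> exists2 a : car M, hm (x + y *+ l) a & fn i a = v l - v0 l.
    rewrite !geq_max => /and3P[a2 a3 a4]; have [h31 _] := h3 l a3.
    by apply/h31; [case: (h2 l a2)|rewrite fnB h4 // subrr].
  have [a ha aE] := qP q (leqnn q).
  have qk3 : (k3 <= q)%N by rewrite /q; lia.
  have qk2 : (k2 <= q)%N by rewrite /q; lia.
  exists (fun l => g ^+ (l - q) *: a).
    exists q => l ql; split.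
      have -> : x + y *+ l = x + y *+ q + y *+ (l - q) by rewrite -addrA -mulrnDr subnKC.
      by apply: hmZ => //; apply: AhomogX.
    by rewrite subSn // exprS scalerA.
  exists q => l ql; have [_ [_ li]] := h3 q qk3.
  rewrite (li _ _ _ (AhomogX (l - q) hg)) // aE.
  by rewrite -(germ_pow h2) // subnKC // addrC subrK.
- move=> w gw; exists (fun l => v0 l + fn i (w l)); last exact: rP.
  split; first by apply: germ_add => //; apply: germ_fn.
  apply: (tK _ _ _ _ pv0).
  have [k2 h2] := gw; have [k3 h3] := ev_germ x yp e.
  exists (maxn k2 k3) => l; rewrite geq_max => /andP[a2 a3].
  rewrite fnD [fn p (fn i _)](_ : _ = 0) ?addr0 //.
  apply: (proj2 (h3 l a3 _ (fn_hm i (proj1 (h2 l a2))))).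
  by exists (w l) => //; case: (h2 l a2).
- move=> v v' w w' [gv _] [gv' _] [kw hw] [kw' hw'] [k2 h2] [k3 h3]; split=> [[k4 h4]|[k4 h4]].
    have [k5 h5] := ev_germ x yp iI.
    exists (maxn (maxn kw kw') (maxn (maxn k2 k3) (maxn k4 k5))) => l; rewrite !geq_max.
    move=> /and3P[/andP[a0 a1] /andP[a2 a3] /andP[a4 a5]].
    apply/eqP; rewrite -subr_eq0; apply/eqP; apply: (h5 l a5).
      by apply: hmB; [case: (hw l a0)|case: (hw' l a1)].
    have := h4 l a4; rewrite h2 // h3 // => /addrI E.
    by rewrite fnB E subrr.
  exists (maxn k2 (maxn k3 k4)) => l; rewrite !geq_max => /and3P[a2 a3 a4].
  by rewrite h2 // h3 // h4.
Qed.

End Finiteness.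

(** * Cokernels of monomorphisms between line bundles *)

Section CokernelUniqueness.
Variables (F : finFieldType) (X : wpl F).
Local Notation A := (Aalg X).
Local Notation L := (Lgrp X).
Local Notation C := (coh X).
Implicit Types M P K B D S Y : C.

(** Third isomorphism theorem. It will split off the cokernel of the common factor of two
    inclusions, leaving the coprime parts to be compared. *)
Lemma coker_comp_ses M P K Q Y R (u : hom M P) (w : hom P K) (q : hom P Q) (r : hom K R)
    (p : hom K Y) : cinj w -> csurj q -> cexact u q -> csurj r -> cexact w r ->
  csurj p -> cexact (comp w u) p ->
  exists (j : hom Q Y) (s : hom Y R), cses j s.
Proof.
move=> wI qS qe rS re pS pe.
have [|j jE] := @lift_surj F X P Y Q q (comp p w) qS.
  have E : comp (comp p w) u = hom0 M Y by rewrite -comp_assoc (cexact_comp pe).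
  move/cnullP: E => E; apply: evS (evI E (evI qe (fnM (comp p w) u))) _.
  move=> x [h1 [h2 h3]] m hx /h2 [//|a ha <-].
  by rewrite -h3 // h1.
have [|s sE] := @lift_surj F X K R Y p r pS.
  have E : comp r (comp w u) = hom0 M R by rewrite comp_assoc (cexact_comp re) comp_hom0l.
  move/cnullP: E => E; apply: evS (evI E (evI pe (fnM r (comp w u)))) _.
  move=> x [h1 [h2 h3]] m hx /h2 [//|a ha <-].
  by rewrite -h3 // h1.
move/homP: jE => jE; move/homP: sE => sE; exists j, s; split.
- apply: evS (evI jE (evI qS (evI qe (evI pe (evI wI (evI (fnM w u) (evI (fnM p w) (fnM j q)))))))) _.
  move=> x [h1 [h2 [h3 [h4 [h5 [h6 [h7 h8]]]]]]] n hn; have [b hb <-] := h2 n hn.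
  rewrite -h8 // h1 // h7 // => /h4 [|a ha]; first exact: fn_hm.
  rewrite h6 // => E; apply/h3 => //; exists a => //.
  apply/eqP; rewrite -subr_eq0; apply/eqP; apply: h5; last by rewrite fnB E subrr.
  by apply: hmB => //; apply: fn_hm.
- apply: evS (evI sE (evI rS (fnM s p))) _ => x [h1 [h2 h3]] n hn.
  by have [k hk <-] := h2 n hn; exists (fn p k); [apply: fn_hm|rewrite -h3 // h1].
- apply: evS (evI jE (evI sE (evI pS (evI qS (evI re (evI (fnM s p) (evI (fnM j q) (fnM p w)))))))) _.
  move=> x [h1 [h2 [h3 [h4 [h5 [h6 [h7 h8]]]]]]] n hn; have [k hk <-] := h3 n hn.
  rewrite -h6 // h2 //; split=> [/h5[//|b hb <-]|[l hl E]].
    by exists (fn q b); [apply: fn_hm|rewrite -h7 // h1 // h8].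
  have [b hb lE] := h4 l hl; move: E; rewrite -lE -h7 // h1 // h8 // => E.
  have hw : hm x (fn w b) by apply: fn_hm.
  rewrite -h2 // h6 // -E -h6 // h2 //.
  by apply/h5 => //; exists b.
Qed.

Lemma Osh_neq0 (z : L) : ~ czero (Osh z).
Proof.
move=> h; have [N hN] := ev_pow (- z) (ldeg_xg_gt0 ord0) h.
have := hN N (leqnn _) _ (Osh_pow z ord0 N).
by apply: Ahom_expn_neq0 (Ahomog_xg _) _; apply: xg_neq0.
Qed.

Lemma mul_inj (z z' : L) (u : hom (Osh z) (Osh z')) (f : A) : Ahomog (z' - z) f ->
  ev (fun x => forall a : A, Ahomog (x + z) a -> fn u (a : car (Osh z)) = a * f) ->
  cinj u <-> f <> 0.
Proof.
move=> hf uf; split=> [uI f0|f0].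
  apply: (@Osh_neq0 z); apply: evS (evI uf uI) _ => x [h1 h2] a ha; apply: h2 => //.
  by rewrite h1 ?f0 ?mulr0 //; apply/hm_Osh.
apply: evS uf _ => x h a /hm_Osh ha; rewrite h // => /(Ahom_domain ha hf) [//|].
by move=> /f0.
Qed.

Lemma coker_iso M K Y Y' (i i' : hom M K) (p : hom K Y) (p' : hom K Y') :
  csurj p -> cexact i p -> csurj p' -> cexact i' p' ->
  comp p' i = hom0 M Y' -> comp p i' = hom0 M Y -> isomorphic Y Y'.
Proof.
move=> pS pe pS' pe' E E'.
have [u uE] := coker_lift pS pe E; have [v vE] := coker_lift pS' pe' E'.
exists u, v; split.
  by apply: (csurj_cancel pS); rewrite -comp_assoc uE vE comp_idl.
by apply: (csurj_cancel pS'); rewrite -comp_assoc vE uE comp_idl.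
Qed.

Lemma nl_can (m : nat) (j : int) : can X *+ m = can X *~ j :> L -> nl (can X *+ m) = j.
Proof.
move=> E; have [|_ ->] := @nl_uniq F X (can X *+ m) 0%MM j.
  by rewrite mdegL0 add0r.
by rewrite big1 ?add0r // => i _; rewrite mnm0E div0n.
Qed.

Lemma germ0 M (x y : L) g : germ x y g (fun=> 0 : car M).
Proof. by exists 0%N => k _; split; [apply: hm0|rewrite scaler0]. Qed.

(* A quotient of O(z') by a copy of O(z) is determined by its localisations:
   writing the two inclusions as D * G and D * G' with coprime forms G, G' of
   the same degree, localisation at G kills the cokernel of G but not that
   of G' unless the degree is 0. *)
Lemma Osh_coker_uniq (z z' : L) Y Y' (i i' : hom (Osh z) (Osh z')) (p : hom (Osh z') Y)
    (p' : hom (Osh z') Y') : cses i p -> cses i' p' -> tors Y -> tors Y' ->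
  (forall x y g n n', 0 < ldeg y -> Ahomog y g -> cardE (@germ F X Y x y g) (@geq F X Y) n ->
     cardE (@germ F X Y' x y g) (@geq F X Y') n' -> n = n') ->
  isomorphic Y Y'.
Proof.
move=> [iI pS pe] [iI' pS' pe'] tY tY' same.
have [f hf fE] := Osh_hom i; have [f' hf' fE'] := Osh_hom i'.
have f0 := proj1 (mul_inj hf fE) iI; have f0' := proj1 (mul_inj hf' fE') iI'.
pose d := z' - z.
case nE: (nl d) => [n|n]; last by case: f0; apply: nform_neg hf; rewrite nE.
have [sG fG] := nform nE hf; have [sG' fG'] := nform nE hf'.
set G := gam f in sG fG; set G' := gam f' in sG' fG'.
have G0 : G != 0 by apply/eqP => E; apply: f0; apply: gam_eq0 hf E.
have G0' : G' != 0 by apply/eqP => E; apply: f0'; apply: gam_eq0 hf' E.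
pose D := gcdp G G'; pose G1 := G %/ D; pose G1' := G' %/ D.
have GE : G = G1 * D by rewrite divpK ?dvdp_gcdl.
have GE' : G' = G1' * D by rewrite divpK ?dvdp_gcdr.
have D0 : D != 0 by rewrite gcdp_eq0 negb_and G0.
have G10 : G1 != 0 by apply: contraNneq G0 => E; rewrite GE E mul0r.
have G10' : G1' != 0 by apply: contraNneq G0' => E; rewrite GE' E mul0r.
have cop : coprimep G1 G1' by rewrite coprimep_div_gcd // G0.
have szG : size G = (size G1 + size D).-1 by rewrite {1}GE size_mul.
have szG' : size G' = (size G1' + size D).-1 by rewrite {1}GE' size_mul.
have s1 : (0 < size G1)%N by rewrite size_poly_gt0.
have s1' : (0 < size G1')%N by rewrite size_poly_gt0.
have sD : (0 < size D)%N by rewrite size_poly_gt0.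
(* The larger of the degrees of [G1] and [G1']: homogenised in this degree the two do not both
   vanish at infinity. The rest [k] of the degree may exceed that of [D] and absorbs a common zero
   at infinity. *)
pose b := (maxn (size G1) (size G1')).-1.
have bn : (b + (size D).-1 <= n)%N by rewrite /b; lia.
pose k := (n - b)%N.
have sG1 : (size G1 <= b.+1)%N by rewrite /b; lia.
have sG1' : (size G1' <= b.+1)%N by rewrite /b; lia.
have sDk : (size D <= k.+1)%N by rewrite /k; lia.
have nbk : n = (b + k)%N by rewrite /k; lia.
pose Dm := mon (bas d) * hform X k D.
pose h1 := hform X b G1; pose h1' := hform X b G1'.
have fE1 : f = h1 * Dm.
  by rewrite fG GE nbk -hformM // /h1 /Dm; ring.
have fE1' : f' = h1' * Dm.
  by rewrite fG' GE' nbk -hformM // /h1' /Dm; ring.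
have Dm0 : Dm <> 0 by move=> E; apply: f0; rewrite fE1 E mulr0.
have h10 : h1 <> 0 by move=> E; apply: f0; rewrite fE1 E mul0r.
have h10' : h1' <> 0 by move=> E; apply: f0'; rewrite fE1' E mul0r.
(* In degree zero [f] and [f'] are proportional, so [i] and [i'] have the same image in large
   degree. *)
have [b0|b0] := posnP b.
  have c1 : size G1 == 1%N by lia.
  have c1' : size G1' == 1%N by lia.
  have /size_poly1P[c cn0 cE] := c1; have /size_poly1P[c' cn0' cE'] := c1'.
  have hC e : hform X b e%:P = cst X e.
    by rewrite /hform b0 big_ord1 coefC eqxx !expr0 !mulr1.
  have ff : f' = cst X (c' / c) * f.
    rewrite fE1' fE1 /h1 /h1' cE cE' !hC mulrA -cstM mulfVK //.
  have ff' : f = cst X (c / c') * f'.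
    rewrite fE1' fE1 /h1 /h1' cE cE' !hC mulrA -cstM mulfVK //.
  apply: (coker_iso pS pe pS' pe').
    apply/cnullP; apply: evS (evI fE (evI fE' (evI pe' (fnM p' i)))) _.
    move=> x [e1 [e2 [e3 e4]]] a ha; have /hm_Osh ha' := ha.
    rewrite e4 // e1 // ff' mulrCA mulrA; apply/e3.
      apply/hm_Osh; have -> : x + z' = x + z + (z' - z) by rewrite -addrA [z + _]addrC subrK.
      by apply: AhomogM => //; rewrite -[x + z]add0r; apply: AhomogM => //; apply: Ahomog_cst.
    have hca : Ahomog (x + z) (cst X (c / c') * a).
      by rewrite -[x + z]add0r; apply: AhomogM => //; apply: Ahomog_cst.
    by exists (cst X (c / c') * a); [apply/hm_Osh|rewrite e2].
  apply/cnullP; apply: evS (evI fE (evI fE' (evI pe (fnM p i')))) _.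
  move=> x [e1 [e2 [e3 e4]]] a ha; have /hm_Osh ha' := ha.
  rewrite e4 // e2 // ff mulrCA mulrA; apply/e3.
    apply/hm_Osh; have -> : x + z' = x + z + (z' - z) by rewrite -addrA [z + _]addrC subrK.
    by apply: AhomogM => //; rewrite -[x + z]add0r; apply: AhomogM => //; apply: Ahomog_cst.
  have hca : Ahomog (x + z) (cst X (c' / c) * a).
    by rewrite -[x + z]add0r; apply: AhomogM => //; apply: Ahomog_cst.
  by exists (cst X (c' / c) * a); [apply/hm_Osh|rewrite e1].
exfalso.
pose y : L := can X *+ b; pose z2 := z + y.
have hh1 : Ahomog y h1 by apply: Ahomog_hform.
have hh1' : Ahomog y h1' by apply: Ahomog_hform.
have yp : 0 < ldeg y.
  by rewrite raddfMn /= ldeg_can pmulrn_lgt0 // ltz_nat wtot_gt0.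
have z2E : z2 - z = y by rewrite /z2 addrAC subrr add0r.
have hDm : Ahomog (z' - z2) Dm.
  have -> : z' - z2 = mdegL (bas d) + can X *+ k.
    rewrite /z2 opprD addrA -/d {1}[d]bas_nl nE nbk -pmulrn mulrnDr addrA.
    by rewrite addrAC -/y addrK.
  by apply: AhomogM; [apply: Ahomog_mon|apply: Ahomog_hform].
have [w wE] := Osh_mul hDm.
have [u uE] : exists u : hom (Osh z) (Osh z2), ev (fun x => forall a : A, Ahomog (x + z) a ->
    fn u (a : car (Osh z)) = a * h1) by apply: Osh_mul; rewrite z2E.
have [u' uE'] : exists u : hom (Osh z) (Osh z2), ev (fun x => forall a : A, Ahomog (x + z) a ->
    fn u (a : car (Osh z)) = a * h1') by apply: Osh_mul; rewrite z2E.
have wI : cinj w by apply/(mul_inj hDm wE).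
have wu (v : hom (Osh z) (Osh z2)) (h f1 : A) (j : hom (Osh z) (Osh z')) : Ahomog y h ->
    ev (fun x => forall a : A, Ahomog (x + z) a -> fn v (a : car (Osh z)) = a * h) ->
    ev (fun x => forall a : A, Ahomog (x + z) a -> fn j (a : car (Osh z)) = a * f1) ->
    f1 = h * Dm -> j = comp w v.
  move=> hh vE jE f1E; apply/homP; apply: evS (evI vE (evI jE (evI wE (fnM w v)))) _.
  move=> x [e1 [e2 [e3 e4]]] a ha; have /hm_Osh ha' := ha.
  rewrite e4 // e2 // e1 // e3; first by rewrite f1E mulrA.
  by rewrite /z2 addrA; apply: AhomogM.
have iE := wu _ _ _ _ hh1 uE fE fE1; have iE' := wu _ _ _ _ hh1' uE' fE' fE1'.
rewrite iE in pe; rewrite iE' in pe'.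
have [Q [q [qS qe]]] := coker_ex u; have [Q' [q' [qS' qe']]] := coker_ex u'.
have [R [r [rS re]]] := coker_ex w.
have [j [s js]] := coker_comp_ses wI qS qe rS re pS pe.
have [j' [s' js']] := coker_comp_ses wI qS' qe' rS re pS' pe'.
have [jI sS _] := js; have [jI' _ _] := js'.
have tQ := tors_sub jI tY; have tQ' := tors_sub jI' tY'; have tR := tors_quot sS tY.
have [nQ cQ] := germ_finite (- z2) yp hh1 tQ.
have [nQ' cQ'] := germ_finite (- z2) yp hh1 tQ'.
have [nR cR] := germ_finite (- z2) yp hh1 tR.
have cY := germ_ses yp hh1 js cQ cR; have cY' := germ_ses yp hh1 js' cQ' cR.
have nE' := same _ _ _ _ _ yp hh1 cY cY'.
have nR0 : (0 < nR)%N.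
  have [g [_ _ g3]] := cR; have [o _] := g3 _ (germ0 R (- z2) y h1).
  exact: leq_ltn_trans (leq0n _) (ltn_ord o).
(* Inverting [h1] kills its own cokernel [Q]. Cancelling the common count [nR], the localisation of
   [Q'] at [h1] is trivial too. *)
have cQ1 : cardE (germ (M := Q) (- z2) y h1) (@geq F X Q) 1.
  exists (fun=> fun=> 0); split=> [o|o o' _|v [k0 hv]].
  - exact: germ0.
  - by rewrite !ord1.
  exists ord0.
  have [k1 hk1] := ev_germ (- z2) yp (evI qS (evI (fnZ q) (ev_shift y (evI uE qe)))).
  exists (maxn k0 k1).+1 => -[//|l]; rewrite ltnS geq_max => /andP[l0 l1].
  have [hl ->] := hv l l0; have [e1 [e2 [e3 e4]]] := hk1 l l1.
  have [a ha <-] := e1 _ hl; have /hm_Osh ha' := ha.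
  rewrite -(e2 _ _ _ hh1) //; apply/e4; first exact: hmZ.
  have ha2 : Ahomog (- z2 + y *+ l + y + z) a.
    by have -> : - z2 + y *+ l + y + z = - z2 + y *+ l + z2 by rewrite -addrA [y + z]addrC.
  exists a; first exact/hm_Osh.
  by rewrite e3 // scaleO mulrC.
have nQ1 := cardE_uniq (equivr_geq Q) cQ cQ1.
have nQ1' : nQ' = 1%N.
  by move: nE'; rewrite nQ1 => /eqP; rewrite eqn_pmul2l // => /eqP <-.
(* The germ of the unit section in [Q']; its vanishing says that [h1'] divides a power of [h1]. *)
pose v m := fn q' (h1 ^+ m : car (Osh z2)).
have hO m : hm (- z2 + y *+ m) (h1 ^+ m : car (Osh z2)).
  by apply/hm_Osh; rewrite addrC addrA subrr add0r; apply: AhomogX.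
have gv : germ (- z2) y h1 v.
  have [k1 hk1] := ev_germ (- z2) yp (fnZ q').
  exists k1 => m km; split; first by apply: fn_hm; apply: hO.
  by rewrite /v -(hk1 m km _ _ _ hh1) ?scaleO ?exprS //; apply: hO.
have [m0 hm0] : geq v (fun=> 0).
  move: cQ'; rewrite nQ1' => -[g [_ _ g3]].
  have [o vo] := g3 _ gv; have [o' oo] := g3 _ (germ0 Q' (- z2) y h1).
  have [_ sy tr] := equivr_geq Q'; apply: (tr _ _ _ vo); apply: sy.
  by rewrite (ord1 o) -(ord1 o').
have [k1 hk1] := ev_germ (- z2) yp (evI qe' uE').
pose m := (maxn m0 k1).+1.
have mm0 : (m0 <= m)%N by rewrite /m; lia.
have mk1 : (k1 <= m)%N by rewrite /m; lia.
have [e1 e2] := hk1 m mk1.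
have [|a /hm_Osh ha aE] := proj1 (e1 _ (hO m)); first exact: hm0.
rewrite e2 // in aE.
have ha' : Ahomog (can X *+ (b * m.-1)) a.
  have <- // : - z2 + y *+ m + z = can X *+ (b * m.-1).
  rewrite /z2 opprD addrAC [- z - y + z]addrAC addNr add0r mulrS addrA addNr add0r.
  by rewrite -mulrnA.
have [sa _] := nform (nl_can (erefl : can X *+ (b * m.-1) = can X *~ (b * m.-1)%N%:Z)) ha'.
have GmE : gam (h1 ^+ m) = G1 ^+ m.
  elim: (m) => [|j0 ih]; last first.
    by rewrite !exprS gam_hform // ih.
  rewrite !expr0; have <- : mon 0%MM = 1 :> A by exact: mon0.
  by rewrite gam_mon /gmon big1 // => o _; rewrite mnm0E div0n.
have GaE : G1 ^+ m = G1' * gam a by rewrite -GmE -aE mulrC gam_hform.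
(* [G1'] divides a power of [G1] and is coprime to it, so it is constant; then [G1] must have the
   full degree [b]. *)
have u1 : size G1' = 1%N.
  have : coprimep (G1 ^+ m) G1' by apply: coprimep_expl.
  rewrite coprimep_sym; rewrite /coprimep => /eqP <-.
  have : (G1' %| G1 ^+ m)%R by rewrite GaE dvdp_mulr.
  by move=> /dvdp_gcd_idl/eqp_size ->.
have u2 : size G1 = b.+1 by rewrite /b; lia.
have ga0 : gam a != 0.
  by apply: contraTneq isT => E; move: GaE; rewrite E mulr0 => /eqP; rewrite expf_eq0 (negbTE G10) andbF.
have := congr1 (fun q : {poly F} => size q) GaE.
have := size_exp G1 m; rewrite size_mul // u1 u2 add1n /= => sE1 sE2.
(* Degrees in $G_1^m = G_1'\cdot\mathrm{gam}(a)$, where [gam a] has degree at most $b(m-1)$,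
   contradict $b>0$. *)
have : (b * m <= b * m.-1)%N by rewrite -sE1 sE2; move: sa; case: (size _).
by rewrite leq_pmul2l // /m /= ltnn.
Qed.

End CokernelUniqueness.

(** * Indecomposable torsion sheaves are uniserial *)

Section Biproducts.
Variables (F : finFieldType) (X : wpl F).
Local Notation C := (coh X).
Implicit Types M P K B D S Y : C.

Definition cbip M P K (i1 : hom M K) (i2 : hom P K) (p1 : hom K M) (p2 : hom K P) : Prop :=
  [/\ comp p1 i1 = idm M, comp p2 i2 = idm P, comp p1 i2 = hom0 P M, comp p2 i1 = hom0 M P
    & ev (fun x => forall k : car K, hm x k -> fn i1 (fn p1 k) + fn i2 (fn p2 k) = k)].

Lemma comp_haddr M P K (f : hom P K) (g h : hom M P) :
  comp f (hadd g h) = hadd (comp f g) (comp f h).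
Proof.
apply/homP; apply: evS (evI (haddE g h) (evI (haddE (comp f g) (comp f h))
  (evI (fnM f (hadd g h)) (evI (fnM f g) (fnM f h))))) _.
by move=> x [h1 [h2 [h3 [h4 h5]]]] m hx; rewrite h3 // h1 // h2 // fnD h4 // h5.
Qed.

Lemma comp_haddl M P K (f g : hom P K) (h : hom M P) :
  comp (hadd f g) h = hadd (comp f h) (comp g h).
Proof.
apply/homP; apply: evS (evI (haddE f g) (evI (haddE (comp f h) (comp g h))
  (evI (fnM (hadd f g) h) (evI (fnM f h) (fnM g h))))) _.
move=> x [h1 [h2 [h3 [h4 h5]]]] m hx.
by rewrite h3 // h1 ?h2 ?h4 ?h5 //; apply: fn_hm.
Qed.

Lemma hadd0r M P (f : hom M P) : hadd f (hom0 M P) = f.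
Proof.
apply/homP; apply: evS (evI (haddE f (hom0 M P)) (hom0E M P)) _.
by move=> x [h1 h2] m hx; rewrite h1 // h2 // addr0.
Qed.

Lemma hadd0l M P (f : hom M P) : hadd (hom0 M P) f = f.
Proof.
apply/homP; apply: evS (evI (haddE (hom0 M P) f) (hom0E M P)) _.
by move=> x [h1 h2] m hx; rewrite h1 // h2 // add0r.
Qed.

Lemma biproductP M P K : @is_biproduct C M P K <->
  exists (i1 : hom M K) (i2 : hom P K) (p1 : hom K M) (p2 : hom K P), cbip i1 i2 p1 p2.
Proof.
split=> [[i1 [i2 [p1 [p2 [[e1 e2] [/zero_morP e3 /zero_morP e4] u1 _]]]]]|].
  exists i1, i2, p1, p2; split=> //.
  have [u [_ uU]] := u1 K p1 p2.
  have E : hadd (comp i1 p1) (comp i2 p2) = idm K.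
    rewrite -(uU (idm K)) ?comp_idr // -(uU (hadd (comp i1 p1) (comp i2 p2))) //.
    rewrite !comp_haddr !comp_assoc e1 e2 e3 e4 !comp_idl !comp_hom0l.
    by rewrite hadd0r hadd0l.
  move/homP: E => E.
  apply: evS (evI E (evI (haddE (comp i1 p1) (comp i2 p2)) (evI (fnM i1 p1)
    (evI (fnM i2 p2) (fn1 K))))) _ => x [h1 [h2 [h3 [h4 h5]]]] k hk.
  by rewrite -h3 // -h4 // -h2 // h1 // h5.
move=> [i1 [i2 [p1 [p2 [e1 e2 e3 e4 e5]]]]].
have idE : hadd (comp i1 p1) (comp i2 p2) = idm K.
  apply/homP; apply: evS (evI e5 (evI (haddE (comp i1 p1) (comp i2 p2)) (evI (fnM i1 p1)
    (evI (fnM i2 p2) (fn1 K))))) _ => x [h1 [h2 [h3 [h4 h5]]]] k hk.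
  by rewrite h2 // h3 // h4 // h1 // h5.
exists i1, i2, p1, p2; split.
- by [].
- by split; apply/zero_morP.
- move=> Z f g; exists (hadd (comp i1 f) (comp i2 g)); split.
    rewrite !comp_haddr !comp_assoc e1 e2 e3 e4 !comp_idl !comp_hom0l.
    by rewrite hadd0r hadd0l.
  move=> u [<- <-]; rewrite -[RHS]comp_idl -idE comp_haddl !comp_assoc.
  by [].
- move=> Z f g; exists (hadd (comp f p1) (comp g p2)); split.
    rewrite !comp_haddl -!comp_assoc e1 e2 e3 e4 !comp_idr !comp_hom0r.
    by rewrite hadd0r hadd0l.
  move=> u [<- <-]; rewrite -[RHS]comp_idr -idE comp_haddr !comp_assoc.
  by [].
Qed.

Lemma split_biproduct S (U V : set (car S)) : gsub U -> gsub V ->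
  ev (fun x => forall s : car S, hm x s -> U s -> V s -> s = 0) ->
  ev (fun x => forall s : car S, hm x s -> gadd U V s) ->
  indecomposable S ->
  ev (fun x => forall s : car S, hm x s -> U s -> s = 0) \/
  ev (fun x => forall s : car S, hm x s -> V s -> s = 0).
Proof.
move=> gU gV UV0 UVT [_ ind].
have dec x (s : car S) : hm x s -> gadd U V s -> exists u v, [/\ U u, V v, hm x u, hm x v & s = u + v].
  move=> hs [u [v [Uu Vv E]]]; exists (gpr x u), (gpr x v); split; try exact: hm_gpr.
  - by case: gU => _ _; apply.
  - by case: gV => _ _; apply.
  - by rewrite -gprD -E hs.
have [K [i [iI iE]]] := sub_obj gU; have [K' [i' [iI' iE']]] := sub_obj gV.
have [Q [q [qS qE]]] := quo_obj gV; have [Q' [q' [qS' qE']]] := quo_obj gU.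
(* The projection along [W'] is the quotient map by [W'] followed by the inverse of the isomorphism
   that it induces on [W]. *)
have mk (W W' : set (car S)) K0 K1 Q0 (j : hom K0 S) (j' : hom K1 S) (r : hom S Q0) :
    cinj j -> ev (fun x => forall m, hm x m -> (W m <-> exists2 k, hm x k & fn j k = m)) ->
    ev (fun x => forall m, hm x m -> (W' m <-> exists2 k, hm x k & fn j' k = m)) ->
    csurj r -> ev (fun x => forall m, hm x m -> (fn r m = 0 <-> W' m)) ->
    ev (fun x => forall s : car S, hm x s -> W s -> W' s -> s = 0) ->
    ev (fun x => forall s : car S, hm x s -> exists u v, [/\ W u, W' v, hm x u, hm x v & s = u + v]) ->
    exists p : hom S K0, [/\ comp p j = idm K0, comp p j' = hom0 K1 K0 &
      ev (fun x => forall s, hm x s -> fn p s = 0 <-> W' s)].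
  move=> jI jE jE' rS rE WW0 WWT.
  have /is_isoP[g [g1 g2]] : cinj (comp r j) /\ csurj (comp r j).
    split.
      apply: evS (evI jI (evI jE (evI rE (evI WW0 (fnM r j))))) _.
      move=> x [h1 [h2 [h3 [h4 h5]]]] k hk; rewrite h5 // => E; apply: h1 => //.
      apply: h4; first exact: fn_hm.
        by apply/h2; [apply: fn_hm|exists k].
      by apply/h3 => //; apply: fn_hm.
    apply: evS (evI jE (evI rS (evI rE (evI WWT (fnM r j))))) _.
    move=> x [h1 [h2 [h3 [h4 h5]]]] n hn; have [s hs <-] := h2 n hn.
    have [u [v [Wu Wv hu hv ->]]] := h4 s hs; have [k hk kE] := proj1 (h1 u hu) Wu.
    exists k => //; rewrite h5 // kE fnD (proj2 (h3 v hv) Wv) addr0.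
    by [].
  exists (comp g r); split; first by rewrite -comp_assoc.
    rewrite -comp_assoc [comp r j'](_ : _ = hom0 _ _) ?comp_hom0r //.
    apply/cnullP; apply: evS (evI rE (evI jE' (fnM r j'))) _ => x [h1 [h2 h3]] k hk.
    by rewrite h3 //; apply/h1; [apply: fn_hm|apply/h2; [apply: fn_hm|exists k]].
  have gI : cinj g by apply/(fun h => proj1 (proj1 (is_isoP g) h)); exists (comp r j).
  apply: evS (evI gI (evI rE (fnM g r))) _ => x [h1 [h2 h3]] s hs.
  rewrite h3 // -h2 //; split=> [E|->]; last by rewrite fn0.
  by apply: h1 => //; apply: fn_hm.
have [|p [e1 e2 e3]] := mk U V K K' Q i i' q iI iE iE' qS qE UV0.
  by apply: evS UVT _ => x h s hs; apply: dec => //; apply: h.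
have [||p' [e1' e2' e3']] := mk V U K' K Q' i' i q' iI' iE' iE qS' qE'.
- by apply: evS UV0 _ => x h s hs a b; apply: h.
- apply: evS UVT _ => x h s hs; have [u [v [a b c d E]]] := dec x s hs (h s hs).
  by exists v, u; split=> //; rewrite addrC.
have bip : is_biproduct K K' S.
  apply/biproductP; exists i, i', p, p'; split=> //.
  apply: evS (evI UVT (evI iE (evI iE' (evI (proj2 (homP _ _) e1) (evI (proj2 (homP _ _) e1')
    (evI e3 (evI e3' (evI (fnM p i) (evI (fnM p' i') (evI (fn1 K) (fn1 K'))))))))))) _.
  move=> x [h1 [h2 [h3 [h4 [h5 [h6 [h7 [h8 [h9 [h10 h11]]]]]]]]]] s hs.
  have [u [v [Uu Vv hu hv ->]]] := dec x s hs (h1 s hs).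
  rewrite (fnD p u v) (fnD p' u v) (proj2 (h6 v hv) Vv) (proj2 (h7 u hu) Uu) addr0 add0r.
  have [k hk <-] := proj1 (h2 u hu) Uu; have [k' hk' <-] := proj1 (h3 v hv) Vv.
  by rewrite -h8 // h4 // h10 // -h9 // h5 // h11.
have [/is_zeroP z|/is_zeroP z] := ind _ _ bip; [left|right].
  apply: evS (evI z iE) _ => x [h1 h2] s hs /(proj1 (h2 s hs)) [k hk <-].
  by rewrite (h1 k) // fn0.
apply: evS (evI z iE') _ => x [h1 h2] s hs /(proj1 (h2 s hs)) [k hk <-].
by rewrite (h1 k) // fn0.
Qed.

End Biproducts.

Section Uniserial.
Variables (F : finFieldType) (X : wpl F).
Local Notation t := (wt_n X).+2.
Local Notation A := (Aalg X).
Local Notation L := (Lgrp X).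
Local Notation C := (coh X).
Local Notation o1 := (lift ord0 ord0 : 'I_t).
Local Notation X0 := (xg (ord0 : 'I_t)).
Local Notation X1 := (xg o1).
Implicit Types M P K B D S Y : C.
Variable S : C.
Hypotheses (tS : tors S) (iS : indecomposable S).

Definition nilp (g : A) : Prop :=
  exists n, ev (fun x => forall s : car S, hm x s -> g ^+ n *: s = 0).

Let S0 : ~ czero S.
Proof. by case: iS => h _ /is_zeroP. Qed.

(** Fitting's lemma: [tors] stabilises the images of the powers of [g] and Noetherianity their
    kernels, so for large [N] the kernel and the image of $g^N$ are complementary in large
    degree. *)
Lemma fitting (y : L) g : Ahomog y g -> nilp g \/
  ev (fun x => forall s : car S, hm x s -> g *: s = 0 -> s = 0).
Proof.
move=> hg; have [n hn] := tors_iter tS hg.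
have [l hl] := colon_stab (gsub0 S) hg.
pose N := maxn n l.
have KP k (s : car S) : g ^+ k *: s = 0 -> g ^+ N *: s = 0.
  move=> /hl E; have lN : (l <= N)%N by apply: leq_maxr.
  by rewrite -(subnK lN) exprD -scalerA E scaler0.
pose U : set (car S) := [set s | g ^+ N *: s = 0].
pose V : set (car S) := [set s | exists s', s = g ^+ N *: s'].
have gU : gsub U by apply: gsub_colon (gsub0 S) (AhomogX N hg).
have gV : gsub V by apply: gsub_im (AhomogX N hg).
have [||h|h] := split_biproduct gU gV _ _ iS.
- apply: evT => x s hs Us [s' E]; rewrite E; apply: (KP (N + N)%N).
  by rewrite exprD -scalerA -E Us.
- apply: evS (hn N) _ => x h s hs; have [s' hs' E] := h s hs.
  exists (s - g ^+ N *: s'), (g ^+ N *: s'); split; [|by exists s'|by rewrite subrK].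
  rewrite /U /= scalerBr scalerA -exprD.
  have nN : (n <= N)%N by apply: leq_maxl.
  rewrite -{1}(subnK nN) exprD -scalerA E scalerA -exprD.
  by rewrite addnA subnK // subrr.
- right; apply: evS h _ => x h s hs gs; apply: h => //.
  by apply: (KP 1%N); rewrite expr1.
- left; exists N; apply: evS (ev_shift (y *+ N) h) _ => x {}h s hs.
  by apply: h; [apply: hmZ => //; apply: AhomogX|exists s].
Qed.

(* Off the nilpotent ones, homogeneous elements act bijectively on every quotient of S. *)
Lemma nnil_inj (W : set (car S)) : gsub W -> ev (fun x => forall (y : L) b (s : car S),
  Ahomog y b -> ~ nilp b -> hm x s -> W (b *: s) -> W s).
Proof.
move=> gW; apply: evS (tail_sat gW) _ => x ts y b s hb nb hs Wbs.
have [n hn] := tors_iter tS hb.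
have [//|inj] := fitting hb.
have [l hl] := colon_stab gW hb.
have injX k : ev (fun x => forall s : car S, hm x s -> b ^+ k *: s = 0 -> s = 0).
  elim: k => [|k ih]; first by apply: evT => x' s' _; rewrite scale1r.
  apply: evS (evI inj (ev_shift y ih)) _ => x' [h1 h2] s' hs'.
  rewrite exprSr -scalerA => E; apply: h1 => //; apply: h2 => //; exact: hmZ.
have sur : ev (fun x => forall s : car S, hm x s -> exists2 s', hm (x - y *+ l) s' & s = b ^+ l *: s').
  apply: evS (evI (injX n) (hn l)) _ => x' [h1 h2] s' hs'.
  have [s2 hs2 E] := h2 s' hs'; exists s2 => //.
  apply/eqP; rewrite -subr_eq0; apply/eqP; apply: h1.
    apply: hmB => //; rewrite -[x'](subrK (y *+ l)); apply: hmZ => //; exact: AhomogX.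
  by rewrite scalerBr scalerA -exprD E subrr.
have key i N : (forall s : car S, hm (Lgen i *+ N + x) s -> exists2 s', hm (Lgen i *+ N + x - y *+ l) s' & s = b ^+ l *: s') ->
    W (xg i ^+ N *: s).
  move=> h; have hc : hm (Lgen i *+ N + x) (xg i ^+ N *: s).
    by rewrite addrC; apply: hmZ => //; apply: hpow.
  have [s' hs' E] := h _ hc.
  rewrite E; apply: (hl l.+1); rewrite exprS -scalerA -E scalerA mulrC -scalerA.
  exact: gsubZ.
have [Na ha] := ev_pow x (ldeg_xg_gt0 ord0) sur.
have [Nb hb'] := ev_pow x (ldeg_xg_gt0 o1) sur.
apply: (ts s (maxn Na Nb)) => //; apply: key.
  by apply: ha; apply: leq_maxl.
by apply: hb'; apply: leq_maxr.
Qed.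

Lemma nilpMl g h : nilp g -> nilp (h * g).
Proof.
move=> [n hn]; exists n; apply: evS hn _ => x hx s hs.
by rewrite exprMn -scalerA hx // scaler0.
Qed.

Lemma nilp_exp g k : nilp (g ^+ k) -> nilp g.
Proof. by move=> [n hn]; exists (k * n)%N; rewrite exprM. Qed.

Lemma nilpD g h : nilp g -> nilp h -> nilp (g + h).
Proof.
move=> [n hn] [m hm']; exists (n + m)%N; apply: evS (evI hn hm') _ => x [h1 h2] s hs.
rewrite exprDn scaler_suml big1 // => i _.
have [le|lt] := leqP m i.
  rewrite -(subnK le) [h ^+ _]exprD mulrA -mulrnAl -scalerA h2 // scaler0.
  by [].
have le : (n <= n + m - i)%N by lia.
rewrite -(subnK le) [g ^+ _]exprD -mulrA [g ^+ n * _]mulrC mulrA -mulrnAl -scalerA h1 // scaler0.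
by [].
Qed.

Lemma nilpN g : nilp g -> nilp (- g).
Proof. by rewrite -mulN1r; apply: nilpMl. Qed.

Lemma nilpB g h : nilp g -> nilp h -> nilp (g - h).
Proof. by move=> hg hh; exact: nilpD hg (nilpN hh). Qed.

Lemma nilp1 : ~ nilp 1.
Proof.
move=> [n hn]; apply: S0; apply: evS hn _ => x h s hs.
by have := h s hs; rewrite expr1n scale1r.
Qed.

Lemma nilp_cst c g : c != 0 -> nilp (cst X c * g) -> nilp g.
Proof.
move=> c0 h; have -> : g = cst X c^-1 * (cst X c * g).
  by rewrite mulrA -cstM mulVf // cst1 mul1r.
exact: nilpMl.
Qed.

(** If neither factor is nilpotent, all powers of both act injectively in large degree, so no power
    of the product can kill the nonzero [S]. *)
Lemma nilp_prime (y z : L) g h : Ahomog y g -> Ahomog z h -> nilp (g * h) -> nilp g \/ nilp h.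
Proof.
move=> hg hh gh; apply: contrapT => no.
have ng : ~ nilp g by move=> a; apply: no; left.
have nh : ~ nilp h by move=> a; apply: no; right.
move: gh => [n hn]; have cg := nnil_inj (gsub0 S).
have ngn k : ~ nilp (g ^+ k) by case: k => [|k]; [exact: nilp1|move/nilp_exp].
have nhn k : ~ nilp (h ^+ k) by case: k => [|k]; [exact: nilp1|move/nilp_exp].
apply: S0; apply: evS (evI hn (evI cg (ev_shift (z *+ n) cg))) _ => x [h1 [h2 h3]] s hs.
apply: (h2 _ _ _ (AhomogX n hh) (nhn n) hs).
apply: (h3 _ _ _ (AhomogX n hg) (ngn n)); first by apply: hmZ => //; apply: AhomogX.
by rewrite scalerA -exprMn; apply: h1.
Qed.

Lemma not_ev (P : L -> Prop) d : ~ ev P -> exists2 x, d <= ldeg x & ~ P x.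
Proof.
move=> h; apply: contrapT => no; apply: h; exists d => x dx.
by apply: contrapT => nP; apply: no; exists x.
Qed.

(** If zero were the only nilpotent homogeneous element, $a \mapsto as$ would embed a line bundle
    into [S] and make it torsion, although it has no nonzero morphism from a torsion object. *)
Lemma nilp_ex : exists (y : L) g, [/\ Ahomog y g, g <> 0 & nilp g].
Proof.
apply: contrapT => no.
have [d hd] := nnil_inj (gsub0 S).
have [x dx hx] := not_ev d S0.
have [s [hs s0]] : exists s : car S, hm x s /\ s <> 0.
  apply: contrapT => h; apply: hx => s hs; apply: contrapT => s0; apply: h.
  by exists s.
have [u uE] := Osh_elt hs.
have uI : cinj u.
  apply: evS uE _ => z h a /hm_Osh ha; rewrite h // => E; apply: contrapT => a0.
  apply: s0; apply: (hd x dx (z - x) a s ha) => // na.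
  by apply: no; exists (z - x), a.
have /cnullP := tors_Osh (idm (Osh (- x))) (tors_sub uI tS).
move=> h; apply: (@Osh_neq0 F X (- x)); apply: evS (evI h (fn1 (Osh (- x)))) _.
by move=> z [h1 h2] a ha; rewrite -(h2 a) // h1.
Qed.

Lemma nilp_tg i : nilp (tg i) <-> nilp (xg i).
Proof.
split=> [/nilp_exp//|h]; rewrite /tg -(prednK (wt_gt0 X i)) exprSr; exact: nilpMl.
Qed.

Lemma nilp_X01 : nilp X0 -> nilp X1 -> False.
Proof.
move=> [n hn] [m hm']; apply: S0.
apply: evS (evI hn (evI hm' (tail_zero S))) _ => x [h1 [h2 h3]] s hs.
apply: (h3 s (n + m)%N) => //; first by rewrite addnC exprD -scalerA h1 // scaler0.
by rewrite exprD -scalerA h2 // scaler0.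
Qed.

Lemma pt_lam i : i != ord0 -> pt X i = Some (lam i).
Proof.
move=> i0; rewrite /lam; case E: (pt X i) => //.
by move: i0; rewrite (@pt_inj _ X _ _ (etrans E (esym (pt0 X)))) eqxx.
Qed.

(** The forms $X_i^{p_i}$ at two distinct points span the pencil, hence those at infinity and zero,
    and these are not both nilpotent by [nilp_X01]. *)
Lemma nilp_xg_uniq i j : nilp (xg i) -> nilp (xg j) -> i = j.
Proof.
move=> /nilp_tg ni /nilp_tg nj; apply/eqP; apply: contraT => ij; exfalso.
suff : nilp (tg ord0) /\ nilp (tg o1) by move=> [/nilp_tg h0 /nilp_tg h1]; apply: nilp_X01.
have one k : k != ord0 -> nilp (tg ord0) -> nilp (tg k) -> nilp (tg ord0) /\ nilp (tg o1).
  move=> k0 n0 nk; split; first exact: n0.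
  have := tgE k0 => /eqP; rewrite eq_sym subr_eq => /eqP ->.
  exact: nilpD nk (nilpMl _ n0).
have [i0|i0] := eqVneq i ord0; first by rewrite i0 in ni ij; apply: (one j _ ni nj); rewrite eq_sym.
have [j0|j0] := eqVneq j ord0; first by rewrite j0 in nj; exact: (one i i0 nj ni).
apply: (one i i0 _ ni).
have lij : lam j - lam i != 0.
  apply: contra ij; rewrite subr_eq0 => /eqP E; apply/eqP; apply: (@pt_inj _ X).
  by rewrite !pt_lam // E.
apply: (nilp_cst lij); rewrite cstB mulrBl.
have -> : cst X (lam j) * tg ord0 - cst X (lam i) * tg ord0 = tg i - tg j.
  by rewrite (tgE i0) (tgE j0); ring.
exact: nilpB ni nj.
Qed.

Lemma nilp_mon m : nilp (mon m) -> exists j, (0 < m j)%N /\ nilp (xg j).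
Proof.
have -> : mon m = \prod_(j <- index_enum 'I_t) xg j ^+ m j.
  by rewrite /mon mpolyXE_id rmorph_prod; apply: eq_bigr => i _; rewrite rmorphXn.
have hp r : Ahomog (\sum_(j <- r) Lgen j *+ m j) (\prod_(j <- r) xg j ^+ m j).
  elim: r => [|j r ih]; first by rewrite !big_nil; apply: Ahomog1.
  by rewrite !big_cons; apply: AhomogM => //; apply: hpow.
elim: (index_enum _) => [|j r ih]; first by rewrite big_nil => /nilp1.
rewrite big_cons => /(nilp_prime (hpow j (m j)) (hp r)) [h|/ih//].
exists j; split; last exact: nilp_exp h.
by rewrite lt0n; apply/eqP => E; move: h; rewrite E expr0 => /nilp1.
Qed.

Lemma hform1n n : hform X n 1 = tg ord0 ^+ n.
Proof.
elim: n => [|n ih]; first by rewrite hform1.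
by rewrite exprS -ih hform_T0 // size_poly1.
Qed.

Lemma hform_pad n k (p : {poly F}) : (size p <= n.+1)%N ->
  hform X (n + k) p = tg ord0 ^+ k * hform X n p.
Proof.
move=> sp; elim: k => [|k ih]; first by rewrite addn0 mul1r.
by rewrite addnS -hform_T0 ?ih ?exprS ?mulrA // (leq_trans sp) // ltnS leq_addr.
Qed.

Lemma hform_Xn n : hform X n 'X^n = tg o1 ^+ n.
Proof.
elim: n => [|n ih]; first by rewrite expr0 hform1.
by rewrite exprS -hform_T1 ih exprS.
Qed.

(** A positive residue at [i] gives the divisor at once. Otherwise [mon (bas z)] contains no
    nilpotent variable, so the form factor is nilpotent; its remainder at the marked point is a
    scalar times a form that is not nilpotent, hence zero. *)
Lemma nilp_hform_div i (z : L) a : nilp (xg i) -> Ahomog z a -> nilp a ->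
  exists2 b, Ahomog (z - Lgen i) b & a = xg i * b.
Proof.
move=> ni ha na; have [r0|rp] := posnP (res z i); last exact: xg_dvd.
case nE: (nl z) => [n|n]; last first.
  exists 0; first exact: Ahomog0.
  by rewrite mulr0; apply: nform_neg ha; rewrite nE.
have [sp aE] := nform nE ha; set p := gam a in sp aE.
have triv : p = 0 -> exists2 b, Ahomog (z - Lgen i) b & a = xg i * b.
  by move=> p0; exists 0; [apply: Ahomog0|rewrite mulr0; apply: gam_eq0 ha p0].
have nh : nilp (hform X n p).
  have := na; rewrite aE => /(nilp_prime (Ahomog_mon _) (Ahomog_hform X n p)) [|//].
  move=> /nilp_mon[j [mj nj]]; have ij := nilp_xg_uniq ni nj.
  by exfalso; move: mj; rewrite mnmE -ij r0.
have [i0|i0] := eqVneq i ord0.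
  rewrite i0 in ni r0 *; have [sz|sz] := leqP (size p) n; first exact: xg0_dvd nE ha sz.
  exfalso; have sE : size p = n.+1 by lia.
  pose c := p`_n; have c0 : c != 0.
    have := lead_coef_eq0 p; rewrite lead_coefE sE /= -/c => ->.
    by apply/eqP => p0; move: sE; rewrite p0 size_poly0.
  pose r := p - c *: 'X^n.
  have sr : (size r <= n)%N.
    apply/leq_sizeP => j nj; rewrite coefB coefZ coefXn.
    case: (eqVneq j n) => [->|jn]; first by rewrite mulr1 subrr.
    by rewrite mulr0 subr0; apply: (leq_sizeP _ _ sp); lia.
  have pE : p = c *: 'X^n + r by rewrite /r addrC subrK.
  (* At infinity the remainder is the leading term: all other terms contain the nilpotent
     [tg ord0]. *)
  have nT : nilp (cst X c * tg o1 ^+ n).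
    have -> : cst X c * tg o1 ^+ n = hform X n p - hform X n r.
      by rewrite pE raddfD /= hformC hform_Xn addrK.
    apply: (nilpB nh).
    have [n0|n0] := posnP n.
      have -> : r = 0 by apply/eqP; rewrite -size_poly_eq0; lia.
      by rewrite raddf0; exists 1%N; apply: evT => x s _; rewrite expr1 scale0r.
    have nE1 : n = n.-1.+1 by lia.
    rewrite nE1 -hform_T0; last by rewrite -nE1.
    by rewrite mulrC; apply: nilpMl; apply/nilp_tg.
  have /nilp_exp/nilp_tg n1 := nilp_cst c0 nT.
  exact: nilp_X01 ni n1.
pose q := p %/ lin i; pose c := (p %% lin i)`_0.
have linS : size (lin i) = 2%N by rewrite linE // size_XsubC.
have lin0' : lin i != 0 by rewrite -size_poly_eq0 linS.
have mE : p %% lin i = c%:P.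
  apply: size1_polyC; rewrite -ltnS -linS ltn_modp //.
have pE : p = lin i * q + c%:P by rewrite -mE mulrC -divp_eq.
case: n nE sp aE nh => [|n] nE sp aE nh.
  apply: triv; have pc : p = (p`_0)%:P by apply: size1_polyC.
  have : nilp (cst X p`_0 * 1).
    by have := nh; rewrite /hform big_ord1 !expr0 mulr1.
  have [E|c0] := eqVneq p`_0 0; first by rewrite pc E.
  by move=> /(nilp_cst c0)/nilp1.
have sq : (size q <= n.+1)%N by rewrite size_divp // linS /= leq_subLR.
have hE : hform X n.+1 p = tg i * hform X n q + cst X c * tg ord0 ^+ n.+1.
  by rewrite {1}pE raddfD /= -hform_T // -[c%:P]mulr1 mul_polyC hformC hform1n.
have cz : c = 0.
  apply/eqP; apply: contraT => c0; exfalso.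
  have : nilp (cst X c * tg ord0 ^+ n.+1).
    have -> : cst X c * tg ord0 ^+ n.+1 = hform X n.+1 p - tg i * hform X n q.
      by rewrite hE addrAC subrr add0r.
    by apply: (nilpB nh); rewrite mulrC; apply: nilpMl; apply/nilp_tg.
  move=> /(nilp_cst c0)/nilp_exp/nilp_tg n0.
  by move: i0; rewrite (nilp_xg_uniq ni n0) eqxx.
rewrite cz cst0 mul0r addr0 in hE.
exists (mon (bas z) * (xg i ^+ (wt X i).-1 * hform X n q)).
  have -> : z - Lgen i = mdegL (bas z) + (Lgen i *+ (wt X i).-1 + can X *+ n).
    rewrite {1}[z]bas_nl nE -addrA; congr (_ + _).
    rewrite -pmulrn mulrSr addrC addrCA addrC; congr (_ + _).
    by rewrite -(Lgen_can i) -{1}(prednK (wt_gt0 X i)) mulrS addrA addNr add0r.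
  apply: AhomogM; first exact: Ahomog_mon.
  by apply: AhomogM; [apply: hpow|apply: Ahomog_hform].
rewrite {1}aE hE [RHS]mulrCA; congr (_ * _); rewrite mulrA -exprS.
by rewrite prednK ?wt_gt0.
Qed.

(** The nilpotent homogeneous elements have one generator: a marked variable if one is nilpotent,
    and otherwise a nilpotent form of least degree, by Euclidean division in the affine
    coordinate. *)
Lemma nilp_gen : exists (y : L) g, [/\ Ahomog y g, 0 < ldeg y, nilp g &
  forall (z : L) a, Ahomog z a -> nilp a -> exists2 b, Ahomog (z - y) b & a = g * b].
Proof.
have [[i ni]|no] := pselect (exists i, nilp (xg i)).
  exists (Lgen i), (xg i); split=> // [||z a]; [exact: Ahomog_xg|exact: ldeg_xg_gt0|].
  exact: nilp_hform_div.
have red (z : L) n a : nl z = n%:Z -> Ahomog z a -> nilp a -> nilp (hform X n (gam a)).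
  move=> nE ha; have [_ aE] := nform nE ha; rewrite {1}aE.
  move=> /(nilp_prime (Ahomog_mon _) (Ahomog_hform X n _)) [|//].
  by move=> /nilp_mon[j [_ nj]]; case: no; exists j.
pose Q n := `[< exists p : {poly F}, [/\ p != 0, (size p <= n.+1)%N & nilp (hform X n p)] >].
have exQ : exists n, Q n.
  have [z [a [ha a0 na]]] := nilp_ex.
  case nE: (nl z) => [n|n]; last by case: a0; apply: nform_neg ha; rewrite nE.
  exists n; apply/asboolP; exists (gam a); split.
  - by apply/eqP => g0; apply: a0; apply: gam_eq0 ha g0.
  - by have [] := nform nE ha.
  - exact: red nE ha na.
case: (ex_minnP exQ) => n /asboolP[p [p0 sp np]] mn.
have nT0 k : ~ nilp (tg ord0 ^+ k).
  by case: k => [|k]; [exact: nilp1|move=> /nilp_exp/nilp_tg h; apply: no; exists ord0].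
have small k (r : {poly F}) : (k < n)%N -> (size r <= k.+1)%N -> nilp (hform X k r) -> r = 0.
  move=> kn sr nr; apply/eqP; apply: contraT => r0.
  have /mn : Q k by apply/asboolP; exists r.
  by rewrite leqNgt kn.
have npos : (0 < n)%N.
  rewrite lt0n; apply/eqP => n0; move: np sp; rewrite n0 => np sp.
  have pc : p = (p`_0)%:P by apply: size1_polyC.
  have c0 : p`_0 != 0 by apply: contra p0 => /eqP E; rewrite pc E.
  have : nilp (cst X p`_0 * 1) by have := np; rewrite /hform big_ord1 !expr0 mulr1.
  by move=> /(nilp_cst c0)/nilp1.
(* A form of least degree does not vanish at infinity: else [tg ord0] would split off, leaving a
   smaller nilpotent form by primeness. *)
have szp : size p = n.+1.
  apply/eqP; rewrite eqn_leq sp ltnNge; apply/negP => le.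
  have nE1 : n = n.-1.+1 by lia.
  have := np; rewrite nE1 -hform_T0; last by rewrite -nE1.
  move=> /(nilp_prime (Ahomog_tg ord0) (Ahomog_hform X _ _)) [h|h].
    by apply: (nT0 1%N); rewrite expr1.
  by move: p0; rewrite (small n.-1 p) ?eqxx //; [lia|rewrite -nE1].
exists (can X *+ n), (hform X n p); split=> //.
- exact: Ahomog_hform.
- by rewrite raddfMn /= ldeg_can pmulrn_lgt0 // ltz_nat wtot_gt0.
move=> z a ha na.
case nE: (nl z) => [m|m]; last first.
  exists 0; first exact: Ahomog0.
  by rewrite mulr0; apply: nform_neg ha; rewrite nE.
have [sq aE] := nform nE ha; have nq := red _ _ _ nE ha na; set q := gam a in sq aE nq.
have [mn'|nm] := ltnP m n.
  exists 0; first exact: Ahomog0.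
  by rewrite mulr0; apply: gam_eq0 ha _; apply: (small m).
pose r := q %% p; have sr : (size r <= n)%N by rewrite -ltnS -szp ltn_modp.
have qE : q = (q %/ p) * p + r by rewrite -divp_eq.
have sd : (size (q %/ p)%R <= (m - n).+1)%N by rewrite size_divp // szp /= leq_subLR addnS subnKC.
have hE : hform X m q = hform X (m - n) (q %/ p) * hform X n p + hform X m r.
  by rewrite {1}qE raddfD /= hformM ?szp // subnK.
have r0 : r = 0.
  apply: (small n.-1); [by lia|by rewrite prednK|].
  have nr : nilp (hform X m r).
    have -> : hform X m r = hform X m q - hform X (m - n) (q %/ p) * hform X n p.
      by rewrite hE addrAC subrr add0r.
    exact: nilpB nq (nilpMl _ np).
  (* Homogenised in degree [m], the remainder is a power of [tg ord0] times its homogenisation in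
     degree [n.-1], to which minimality applies. *)
  have mE : m = (n.-1 + (m - n.-1))%N by lia.
  move: nr; rewrite mE hform_pad; last by rewrite prednK.
  by move=> /(nilp_prime (AhomogX _ (Ahomog_tg ord0)) (Ahomog_hform X _ _)) [/nT0|].
exists (mon (bas z) * hform X (m - n) (q %/ p)).
  have -> : z - can X *+ n = mdegL (bas z) + can X *+ (m - n).
    by rewrite {1}[z]bas_nl nE -addrA -pmulrn mulrnBr.
  by apply: AhomogM; [apply: Ahomog_mon|apply: Ahomog_hform].
rewrite {1}aE hE r0 raddf0 addr0; ring.
Qed.

End Uniserial.

(** * Cyclic generation and comparability of subobjects *)

Section Cyclic.
Variables (F : finFieldType) (X : wpl F).
Local Notation t := (wt_n X).+2.
Local Notation A := (Aalg X).
Local Notation L := (Lgrp X).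
Local Notation C := (coh X).
Local Notation o1 := (lift ord0 ord0 : 'I_t).
Local Notation X0 := (xg (ord0 : 'I_t)).
Local Notation X1 := (xg o1).
Implicit Types M P K B D S Y : C.
Variable S : C.
Hypotheses (tS : tors S) (iS : indecomposable S).

Lemma gsub_cyc (d : L) (e : car S) : hm d e -> gsub [set s : car S | exists a : A, s = a *: e].
Proof.
move=> he; split; first by exists 0; rewrite scale0r.
  by move=> b m n [a ->] [c ->]; exists (b * a + c); rewrite scalerDl scalerA.
by move=> x m [a ->]; exists (Apr (x - d) a); rewrite (hm_span _ _ he).
Qed.

Lemma max_complement (E : set (car S)) : exists U : set (car S),
  [/\ gsub U, forall s, U s -> E s -> s = 0 &
    forall V : set (car S), gsub V -> U `<=` V -> (forall s, V s -> E s -> s = 0) -> V `<=` U].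
Proof.
(* [P] omits [U 0] because the union of the empty chain is empty; zero is recovered below from
   maximality. *)
pose P (U : set (car S)) := [/\ forall (a : A) m n, U m -> U n -> U (a *: m + n),
  forall x m, U m -> U (gpr x m) & forall s, U s -> E s -> s = 0].
have [|U [[U1 U2 U3] Umax]] := @Zorn_bigcup (car S) P.
  move=> FF FP tot; split.
  - move=> a m n [V FV Vm] [W FW Wn]; have [VW|WV] := tot V W FV FW.
      by exists W => //; have [h _ _] := FP W FW; apply: h => //; apply: VW.
    by exists V => //; have [h _ _] := FP V FV; apply: h => //; apply: WV.
  - by move=> x m [V FV Vm]; exists V => //; have [_ h _] := FP V FV; apply: h.
  - by move=> s [V FV Vs]; have [_ _ h] := FP V FV; apply: h.
have U0 : U 0.
  have [[m Um]|no] := pselect (exists m, U m).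
    by have := U1 (-1) m m Um Um; rewrite scaleN1r addNr.
  exfalso; apply: (Umax [set 0]).
    split; first by move=> m Um; case: no; exists m.
    by move=> h; apply: no; exists 0; apply: h.
  have [g0 g1 g2] := gsub0 S; split=> //; by move=> s ->.
exists U; split=> // V gV UV V0 s Vs; apply: contrapT => Us.
apply: (Umax V); first by split=> // h; apply: Us; apply: h.
by have [v0 v1 v2] := gV; split.
Qed.

(** As for modules over a discrete valuation ring, a cyclic submodule of maximal exponent is a
    direct summand: [e] is not killed by $g^{n-1}$ with [n] minimal for [S], and a maximal submodule
    [U] meeting $Ae$ in zero is a complement in large degree. Indecomposability then removes [U]. *)
Lemma cyclic_gen : exists (y w : L) (g : A) (e : car S) (n : nat),
  [/\ Ahomog y g, 0 < ldeg y, hm w e,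
      ev (fun x => forall s : car S, hm x s -> g ^+ n *: s = 0) /\
      (forall (z : L) a, Ahomog z a -> nilp S a -> exists2 b, Ahomog (z - y) b & a = g * b)
    & ev (fun x => forall s : car S, hm x s -> exists2 a, Ahomog (x - w) a & s = a *: e)].
Proof.
have S0 : ~ czero S by case: iS => h _ /is_zeroP.
have [y [g [hg yp ng gP]]] := nilp_gen tS iS.
pose Z n := `[< ev (fun x => forall s : car S, hm x s -> g ^+ n *: s = 0) >].
have exZ : exists n, Z n by case: ng => n hn; exists n; apply/asboolP.
case: (ex_minnP exZ) => n /asboolP hn nmin.
have npos : (0 < n)%N.
  rewrite lt0n; apply/eqP => n0; apply: S0; apply: evS hn _ => x h s hs.
  by have := h s hs; rewrite n0 expr0 scale1r.
have nZ : ~ ev (fun x => forall s : car S, hm x s -> g ^+ n.-1 *: s = 0).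
  by move=> h; have /nmin : Z n.-1 by [apply/asboolP]; lia.
have [d [hd hn']] : exists d, (forall x, d <= ldeg x -> forall (z : L) b (s : car S),
    Ahomog z b -> ~ nilp S b -> hm x s -> b *: s = 0 -> s = 0) /\
    (forall x, d <= ldeg x -> (forall (m : car S) (N : nat), hm x m ->
      X0 ^+ N *: m = 0 -> X1 ^+ N *: m = 0 -> m = 0)).
  have [d hd] := evI (nnil_inj tS iS (gsub0 S)) (tail_zero S).
  by exists d; split=> x /hd[].
have [w dw hw] := not_ev d nZ.
have [e [he e0]] : exists e : car S, hm w e /\ g ^+ n.-1 *: e <> 0.
  apply: contrapT => h; apply: hw => s hs; apply: contrapT => s0; apply: h.
  by exists s.
pose E : set (car S) := [set s | exists a : A, s = a *: e].
have gE : gsub E := gsub_cyc he.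
have [U [gU U0 Umax]] := max_complement E.
pose W := gadd U E; have gW : gsub W by apply: gsubA.
exists y, w, g, e, n; split=> //.
have WS : ev (fun x => forall s : car S, hm x s -> W s).
  apply: contrapT => nW.
  have [d1 hd1] := evI hn (nnil_inj tS iS gW).
  have [x dx hx] := not_ev d1 nW.
  have [s [hs nWs]] : exists s : car S, hm x s /\ ~ W s.
    apply: contrapT => h; apply: hx => s hs; apply: contrapT => s0; apply: h.
    by exists s.
  have ds k : d1 <= ldeg (x + y *+ k).
    by rewrite raddfD raddfMn /=; have : 0 <= ldeg y *+ k by [rewrite mulrn_wge0 // ltW]; lia.
  have [k [nWk Wk]] : exists k, ~ W (g ^+ k *: s) /\ W (g ^+ k.+1 *: s).
    apply: contrapT => no; have all k : ~ W (g ^+ k *: s).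
      elim: k => [|k ih]; first by rewrite scale1r.
      by move=> h; apply: no; exists k.
    apply: (all n); have [h _] := hd1 x dx; rewrite h //.
    by case: gW.
  pose s1 := g ^+ k *: s; pose x' := x + y *+ k.
  have hs1 : hm x' s1 by apply: hmZ => //; apply: AhomogX.
  have [u0 [v0 [Uu0 [a0 v0E] sE0]]] : W (g *: s1) by rewrite /s1 scalerA -exprS.
  pose u := gpr (x' + y) u0; pose a := Apr (x' + y - w) a0.
  have Uu : U u by case: gU => _ _; apply.
  have ha : Ahomog (x' + y - w) a by apply/AhomogP; rewrite Apr_idem eqxx.
  have sE : g *: s1 = u + a *: e.
    by rewrite -(hmZ hg hs1) sE0 v0E raddfD /= (hm_span _ _ he).
  (* Were [a] not nilpotent, $g^{n-1}ae = -g^{n-1}u$ would lie in both [E] and [U], forcing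
     $g^{n-1}e = 0$. *)
  have na : nilp S a.
    apply: contrapT => nna; apply: e0.
    have gn0 : g ^+ n.-1 *: (a *: e) = 0.
      apply: U0; last by exists (g ^+ n.-1 * a); rewrite scalerA.
      have -> : g ^+ n.-1 *: (a *: e) = - (g ^+ n.-1 *: u).
        apply/eqP; rewrite -addr_eq0 addrC -scalerDr -sE scalerA -exprSr prednK //.
        by have [h _] := hd1 _ (ds k); rewrite h.
      exact: gsubN gU (gsubZ _ gU Uu).
    apply: (hd (w + y *+ n.-1) _ _ a _ ha nna).
    - by rewrite raddfD raddfMn /=; have : 0 <= ldeg y *+ n.-1 by [rewrite mulrn_wge0 // ltW]; lia.
    - exact: hmZ (AhomogX _ hg) he.
    - by rewrite scalerA mulrC -scalerA.
  have [a' ha' aE] := gP _ _ ha na.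
  (* The correction puts $g s_2$ into [U] while $s_2$ stays outside [W]; then $U + A s_2$ still
     meets [E] in zero, against the maximality of [U]. *)
  pose s2 := s1 - a' *: e.
  have gs2 : g *: s2 = u by rewrite scalerBr (scalerA g a' e) -aE sE addrK.
  have hs2 : hm x' s2.
    apply: hmB => //; have -> : x' = w + (x' + y - w - y) by rewrite [RHS]addrC [x' + y - w - y]addrAC addrK subrK.
    exact: hmZ.
  have nWs2 : ~ W s2.
    move=> h; apply: nWk; rewrite -/s1 -[s1](subrK (a' *: e)); apply: gsubD => //.
    by apply: gaddr => //; exists a'.
  pose V := gadd U [set v : car S | exists b : A, v = b *: s2].
  have gV : gsub V by apply: gsubA => //; apply: gsub_cyc hs2.
  apply: (nWs2); apply: gaddl => //; apply: (Umax V) => //.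
  - by apply: gaddl; apply: gsub_cyc hs2.
  - move=> v Vv Ev; apply: gpr_ext => q; rewrite gpr0.
    move: Vv => [u1 [_ [Uu1 [b0 ->] vE]]].
    have Eq : E (gpr q v) by case: gE => _ _; apply.
    pose b := Apr (q - x') b0; have hb : Ahomog (q - x') b by apply/AhomogP; rewrite Apr_idem eqxx.
    have qE : gpr q v = gpr q u1 + b *: s2.
      by rewrite {1}vE raddfD /= (hm_span _ _ hs2).
    have Uq : U (gpr q u1) by case: gU => _ _; apply.
    have [nb|nb] := pselect (nilp S b).
      apply: U0 => //; rewrite qE; apply: gsubD => //.
      have [b' hb' ->] := gP _ _ hb nb.
      by rewrite mulrC -scalerA gs2; apply: gsubZ.
    exfalso; apply: nWs2.
    have [_ h] := hd1 _ (ds k); apply: (h _ b s2 hb nb hs2).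
    have -> : b *: s2 = gpr q v - gpr q u1 by rewrite qE addrAC subrr add0r.
    exact: gsubB gW (gaddr gU Eq) (gaddl gE Uq).
  - by apply: gaddr => //; exists 1; rewrite scale1r.
have [|zU|zE] := split_biproduct gU gE _ WS iS.
- by apply: evT => x s _; apply: U0.
- apply: evS (evI zU WS) _ => x [h1 h2] s hs; have [u [v [Uu [a vE] sE]]] := h2 s hs.
  exists (Apr (x - w) a); first by apply/AhomogP; rewrite Apr_idem eqxx.
  rewrite -{1}hs sE raddfD /= vE (hm_span _ _ he).
  rewrite [gpr x u]h1 ?add0r //; first exact: hm_gpr.
  by case: gU => _ _; apply.
- exfalso; apply: e0.
  have [Na ha] := ev_pow w (ldeg_xg_gt0 ord0) zE.
  have [Nb hb] := ev_pow w (ldeg_xg_gt0 o1) zE.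
  have e00 : e = 0.
    apply: (hn' w dw e (maxn Na Nb)) => //.
      apply: (ha _ (leq_maxl Na Nb)); last by exists (X0 ^+ maxn Na Nb).
      by rewrite addrC; apply: hmZ => //; apply: hpow.
    apply: (hb _ (leq_maxr Na Nb)); last by exists (X1 ^+ maxn Na Nb).
    by rewrite addrC; apply: hmZ => //; apply: hpow.
  by rewrite e00 scaler0.
Qed.

(** In large degree every graded submodule is some $g^kS$: if it lies in $g^kS$ but not in
    $g^{k+1}S$, it contains some $g^kae$ with [a] not nilpotent, and by [nnil_inj] such an [a] can
    be cancelled modulo the submodule. *)
Lemma gsub_comparable (V V' : set (car S)) : gsub V -> gsub V' ->
  ev (fun x => forall s : car S, hm x s -> V s -> V' s) \/
  ev (fun x => forall s : car S, hm x s -> V' s -> V s).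
Proof.
move=> gV gV'; have [y [w [g [e [n [hg yp he [gn gP] cyc]]]]]] := cyclic_gen.
pose In (T : set (car S)) k := ev (fun x => forall s : car S, hm x s -> T s ->
  exists2 r : car S, hm (x - y *+ k) r & s = g ^+ k *: r).
have big_ (T : set (car S)) k : gsub T -> In T k -> ~ In T k.+1 ->
    ev (fun x => forall r : car S, hm x r -> T (g ^+ k *: r)).
  move=> gT Tk nTk.
  have [d hd] := evI Tk (ev_shift (- (y *+ k)) cyc).
  have [x dx hx] := not_ev d nTk.
  have [s [hs Ts ns]] : exists s : car S, [/\ hm x s, T s &
      ~ exists2 r : car S, hm (x - y *+ k.+1) r & s = g ^+ k.+1 *: r].
    apply: contrapT => h; apply: hx => s hs Ts; apply: contrapT => s0; apply: h.
    by exists s.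
  have [h1 h2] := hd x dx; have [r hr rE] := h1 s hs Ts; have [a ha aE] := h2 r hr.
  have na : ~ nilp S a.
    move=> /(gP _ _ ha) [b hb bE]; apply: ns; exists (b *: e).
      have -> : x - y *+ k.+1 = w + (x - y *+ k - w - y).
        by rewrite mulrSr opprD addrA [w + _]addrC [RHS]addrAC subrK.
      exact: hmZ.
    by rewrite rE aE bE exprSr !scalerA mulrA.
  have inj := nnil_inj tS iS gT.
  apply: evS (evI cyc (ev_shift (y *+ k) inj)) _ => z [c1 c2] q hq.
  have [c hc qE] := c1 q hq.
  apply: (c2 _ a _ ha na); first by apply: hmZ => //; apply: AhomogX.
  have -> : a *: (g ^+ k *: q) = c *: s.
    by rewrite qE rE aE !scalerA; congr (_ *: _); ring.
  exact: gsubZ.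
have both k : (In V k /\ In V' k) \/
    (ev (fun x => forall s : car S, hm x s -> V s -> V' s) \/
     ev (fun x => forall s : car S, hm x s -> V' s -> V s)).
  elim: k => [|k [[i1 i2]|ih]]; last by right.
    left; split; apply: evT => x s hs _; exists s; rewrite ?mulr0n ?subr0 ?scale1r //.
  have [j1|j1] := pselect (In V k.+1); last first.
    right; right; have b1 := big_ V k gV i1 j1.
    apply: evS (evI i2 (ev_shift (- (y *+ k)) b1)) _ => x [h1 h2] s hs /(h1 s hs) [r hr ->].
    exact: h2.
  have [j2|j2] := pselect (In V' k.+1); first by left.
  right; left; have b1 := big_ V' k gV' i2 j2.
  apply: evS (evI i1 (ev_shift (- (y *+ k)) b1)) _ => x [h1 h2] s hs /(h1 s hs) [r hr ->].
  exact: h2.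
have [[i1 _]|//] := both n; left.
apply: evS (evI i1 (ev_shift (- (y *+ n)) gn)) _ => x [h1 h2] s hs /(h1 s hs) [r hr ->].
by rewrite h2 //; case: gV'.
Qed.

Lemma uniserial K K' (i : hom K S) (i' : hom K' S) : cinj i -> cinj i' ->
  (exists u : hom K K', comp i' u = i) \/ (exists u : hom K' K, comp i u = i').
Proof.
move=> iI iI'; have [U [gU UE]] := im_gsub i; have [U' [gU' UE']] := im_gsub i'.
have [h|h] := gsub_comparable gU gU'; [left|right]; apply: lift_inj => //.
  apply: evS (evI h (evI UE UE')) _ => x [h1 [h2 h3]] k hk.
  have hik := fn_hm i hk.
  by apply/(h3 _ hik); apply: h1 => //; apply/(h2 _ hik); exists k.
apply: evS (evI h (evI UE UE')) _ => x [h1 [h2 h3]] k hk.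
have hik := fn_hm i' hk.
by apply/(h2 _ hik); apply: h1 => //; apply/(h3 _ hik); exists k.
Qed.

End Cyclic.

(** * Epimorphisms from a line bundle plus a torsion sheaf *)

Section LineBundleObjects.
Variables (F : finFieldType) (X : wpl F).
Local Notation t := (wt_n X).+2.
Local Notation C := (coh X).
Implicit Types M P K B D S Y : C.

Lemma iso_trans M P K : @isomorphic C M P -> isomorphic P K -> isomorphic M K.
Proof.
move=> [f [f' [f1 f2]]] [g [g' [g1 g2]]]; exists (comp g f), (comp f' g'); split.
  by rewrite -comp_assoc [comp g' _]comp_assoc g1 comp_idl f1.
by rewrite -comp_assoc [comp f _]comp_assoc f2 comp_idl g2.
Qed.

Lemma iso_refl M : @isomorphic C M M.
Proof. by exists (idm M), (idm M); rewrite comp_idl. Qed.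

Lemma is_iso_comp M P K (g : hom P K) (f : hom M P) : is_iso g -> is_iso f -> is_iso (comp g f).
Proof.
by move=> /is_isoP[g1 g2] /is_isoP[f1 f2]; apply/is_isoP; split; [apply: cinj_comp|apply: csurj_comp].
Qed.

Lemma cses_iso M M' P P' K K' (i : hom M P) (p : hom P K) (a : hom M' M) (b : hom P P')
    (b' : hom P' P) (c : hom K K') : cses i p -> is_iso a -> comp b b' = idm P' ->
  comp b' b = idm P -> is_iso c -> cses (comp b (comp i a)) (comp c (comp p b')).
Proof.
move=> [iI pS e] /is_isoP[aI aS] bb b'b /is_isoP[cI cS].
have /is_isoP[bI bS] : is_iso b by exists b'.
have /is_isoP[bI' bS'] : is_iso b' by exists b.
split; [exact: cinj_comp bI (cinj_comp iI aI)|exact: csurj_comp cS (csurj_comp pS bS')|].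
apply: evS (evI e (evI aS (evI cI (evI (fnM b (comp i a)) (evI (fnM i a) (evI (fnM c (comp p b'))
  (evI (fnM p b') (evI (fnM b b') (evI (fnM b' b) (evI (fn1 P') (evI (fn1 P)
  (evI (proj2 (homP _ _) bb) (proj2 (homP _ _) b'b))))))))))))) _.
move=> x [h1 [h2 [h3 [h4 [h5 [h6 [h7 [h8 [h9 [h10 [h11 [h12 h13]]]]]]]]]]]] n hn.
have hn' := fn_hm b' hn; rewrite h6 // h7 //; split=> [E|[m hm' <-]].
  have E' : fn p (fn b' n) = 0 by apply: h3 => //; apply: fn_hm.
  have [m hm' mE] := proj1 (h1 _ hn') E'; have [q hq qE] := h2 m hm'.
  by exists q => //; rewrite h4 // h5 // qE mE -h8 // h12 // h10.
rewrite h4 // h5 // -h9 ?h13 ?h11; try by do 2!apply: fn_hm.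
by rewrite (proj2 (h1 _ _)) ?fn0 //; [do 2!apply: fn_hm|exists (fn a m) => //; apply: fn_hm].
Qed.

Lemma lb_lift M K B D (i : hom K B) (p : hom B D) (u : hom M D) : is_line_bundle M ->
  cses i p -> tors K -> exists v : hom M B, comp p v = u.
Proof.
move=> [z [f [g [gf fg]]]] ip tK; have [v vE] := Osh_lift (comp u g) ip tK.
by exists (comp v f); rewrite comp_assoc vE -comp_assoc gf comp_idr.
Qed.

Lemma lb_tors0 M S (f : hom S M) : is_line_bundle M -> tors S -> f = hom0 S M.
Proof.
move=> [z [g [g' [gg' _]]]] tS; have := tors_Osh (comp g f) tS.
by move=> /(congr1 (comp g')); rewrite comp_assoc gg' comp_idl comp_hom0r.
Qed.

Lemma lb_epi_iso M Y (p p' : hom M Y) : is_line_bundle M -> csurj p -> csurj p' ->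
  exists2 u : hom Y Y, is_iso u & comp u p = p'.
Proof.
move=> [z [g [g' [gg' g'g]]]] pS pS'.
have /is_isoP[_ gS'] : is_iso g' by exists g.
have [u uI uE] := Osh_epi_iso (csurj_comp pS gS') (csurj_comp pS' gS').
exists u => //; apply: (csurj_cancel gS').
by rewrite -comp_assoc.
Qed.

(** Transported along isomorphisms, [f] becomes a monic endomorphism of some $\mathcal{O}(z)$, whose
    endomorphism set is finite. *)
Lemma lb_mono_iso M M' (f : hom M M') : is_line_bundle M -> isomorphic M M' -> cinj f -> is_iso f.
Proof.
move=> [z [g [g' [gg' g'g]]]] [h [h' [hh' h'h]]] fI.
have [n cn] := Osh_end_finite z z.
have /is_isoP[gI _] : is_iso g by exists g'.
have /is_isoP[gI' _] : is_iso g' by exists g.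
have /is_isoP[hI' _] : is_iso h' by exists h.
have iso : is_iso (comp g (comp h' (comp f g'))).
  exact: mono_end_iso cn (cinj_comp gI (cinj_comp hI' (cinj_comp fI gI'))).
have -> : f = comp h (comp g' (comp (comp g (comp h' (comp f g'))) g)).
  rewrite !comp_assoc -[comp (comp h g') g]comp_assoc gg' comp_idr h'h comp_idl.
  by rewrite -comp_assoc gg' comp_idr.
by do ?apply: is_iso_comp => //; [exists h'|exists g|exists g'].
Qed.

Lemma lb_coker_uniq M M' Y Y' (i i' : hom M M') (p : hom M' Y) (p' : hom M' Y') :
  is_line_bundle M -> is_line_bundle M' -> cses i p -> cses i' p' -> tors Y -> tors Y' ->
  (forall x y g n n', 0 < ldeg y -> Ahomog y g -> cardE (@germ F X Y x y g) (@geq F X Y) n ->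
     cardE (@germ F X Y' x y g) (@geq F X Y') n' -> n = n') ->
  isomorphic Y Y'.
Proof.
move=> [z [g [g' [gg' g'g]]]] [z' [h [h' [hh' h'h]]]] ip ip' tY tY' same.
have gi : is_iso g' by exists g.
have idY K : is_iso (idm K) by exists (idm K); rewrite comp_idl.
apply: (Osh_coker_uniq (cses_iso ip gi h'h hh' (idY Y)) (cses_iso ip' gi h'h hh' (idY Y')) tY tY' same).
Qed.

Lemma cbip_idE M P K (i1 : hom M K) (i2 : hom P K) (p1 : hom K M) (p2 : hom K P) :
  cbip i1 i2 p1 p2 -> hadd (comp i1 p1) (comp i2 p2) = idm K.
Proof.
move=> [e1 e2 e3 e4 e5]; apply/homP.
apply: evS (evI e5 (evI (haddE (comp i1 p1) (comp i2 p2)) (evI (fnM i1 p1)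
  (evI (fnM i2 p2) (fn1 K))))) _ => x [h1 [h2 [h3 [h4 h5]]]] k hk.
by rewrite h2 // h3 // h4 // h1 // h5.
Qed.

Lemma cbip_ev M P K (i1 : hom M K) (i2 : hom P K) (p1 : hom K M) (p2 : hom K P) :
  cbip i1 i2 p1 p2 -> ev (fun x =>
    [/\ forall m, hm x m -> fn p1 (fn i1 m) = m /\ fn p2 (fn i1 m) = 0,
        forall m, hm x m -> fn p2 (fn i2 m) = m /\ fn p1 (fn i2 m) = 0
      & forall k, hm x k -> fn i1 (fn p1 k) + fn i2 (fn p2 k) = k]).
Proof.
move=> [/homP e1 /homP e2 /cnullP e3 /cnullP e4 e5].
apply: evS (evI e1 (evI e2 (evI e3 (evI e4 (evI e5 (evI (fnM p1 i1) (evI (fnM p2 i2)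
  (evI (fnM p1 i2) (evI (fnM p2 i1) (evI (fn1 M) (fn1 P))))))))))) _.
move=> x [h1 [h2 [h3 [h4 [h5 [h6 [h7 [h8 [h9 [h10 h11]]]]]]]]]]; split=> //.
  by move=> m hx; rewrite -h6 // h1 // h10 // -h9 // h4.
by move=> m hx; rewrite -h7 // h2 // h11 // -h8 // h3.
Qed.

Section Structure.
Variables (M M' S S' S2 K K' : C).
Variables (j1 : hom M K) (j2 : hom S K) (q1 : hom K M) (q2 : hom K S).
Variables (i1 : hom M' K') (i2 : hom S' K') (p1 : hom K' M') (p2 : hom K' S').
Hypotheses (hM : is_line_bundle M) (hM' : is_line_bundle M').
Hypotheses (tS : tors S) (tS' : tors S').
Hypotheses (bK : cbip j1 j2 q1 q2) (bK' : cbip i1 i2 p1 p2).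

(** With no morphism from torsion into a line bundle, the inclusion of the kernel is triangular for
    the two decompositions; its diagonal entries are [a] and [b]. *)
Lemma epi_split Y (k : hom K K') (p : hom K' S2) (c : hom S2 Y) : cses k p ->
  csurj c -> cexact (comp p i2) c ->
  (exists a : hom S S', cinj a /\ cexact a (comp p i2)) /\
  (exists b : hom M M', cses b (comp c (comp p i1))).
Proof.
move=> [kI pS e] cS ce.
have [a aE] : exists a, a = comp p2 (comp k j2) by exists (comp p2 (comp k j2)).
have pk0 : comp p1 (comp k j2) = hom0 S M' by apply: lb_tors0.
have kj : comp k j2 = comp i2 a.
  rewrite -[LHS]comp_idl -(cbip_idE bK') comp_haddl -!comp_assoc pk0 comp_hom0r.
  by rewrite hadd0l aE.
have eK := cbip_ev bK; have eK' := cbip_ev bK'.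
have aI : cinj a.
  have : cinj (comp k j2).
    apply: cinj_comp => //; apply: evS eK _ => x [_ h _] s hs E.
    by have [<- _] := h s hs; rewrite E fn0.
  rewrite kj => h; apply: evS (evI h (fnM i2 a)) _ => x [h1 h2] s hs E.
  by apply: h1 => //; rewrite h2 // E fn0.
have ae : cexact a (comp p i2).
  (* The full kernel of [comp p i2] is torsion and maps into [K]; its component in [M] vanishes, so
     it comes from [S]. *)
  have [T [ta [taI tae]]] := ker_ex (comp p i2).
  have tT := tors_sub taI tS'.
  have [|t tE] := @ker_lift F X K K' S2 T k p (comp i2 ta) kI e.
    by rewrite comp_assoc (cexact_comp tae).
  have t0 : comp q1 t = hom0 T M by apply: lb_tors0.
  have tj : t = comp j2 (comp q2 t).
    by rewrite -[LHS]comp_idl -(cbip_idE bK) comp_haddl -!comp_assoc t0 comp_hom0r hadd0l.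
  have taE : ta = comp a (comp q2 t).
    have : comp i2 ta = comp i2 (comp a (comp q2 t)) by rewrite comp_assoc -kj -comp_assoc -tj tE.
    move=> /(congr1 (comp p2)); rewrite !comp_assoc; have [_ -> _ _ _] := bK'.
    by rewrite !comp_idl.
  have pa0 : comp (comp p i2) a = hom0 S S2.
    by rewrite -comp_assoc -kj comp_assoc (cexact_comp e) comp_hom0l.
  move/homP: taE => taE; move/cnullP: pa0 => pa0.
  apply: evS (evI tae (evI taE (evI pa0 (evI (fnM a (comp q2 t)) (fnM (comp p i2) a))))) _.
  move=> x [h1 [h2 [h3 [h4 h5]]]] s hs; split=> [/h1[//|r hr <-]|[r hr <-]].
    by exists (fn (comp q2 t) r); [apply: fn_hm|rewrite -h4 // -h2].
  by rewrite -h5 // h3.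
split; first by exists a.
exists (comp p1 (comp k j1)).
have common := evI eK (evI eK' (evI kI (evI pS (evI e (evI cS (evI ce (evI aI (evI ae
  (evI (fnM p i1) (evI (fnM p i2) (evI (fnM c (comp p i1)) (evI (fnM p1 (comp k j1))
  (evI (fnM k j1) (evI (fnM k j2) (evI (fnM i2 a) (proj2 (homP _ _) kj)))))))))))))))).
split.
- apply: evS common _ => x [[e1 e2 e3] [[f1 f2 f3] [h3 [h4 [h5 [h6 [h7 [h8 [h9 [h10 [h11 [h12 [h13 [h14 [h15 [h16 h17]]]]]]]]]]]]]]]] m hx.
  rewrite h13 // h14 // => E; set n := fn k (fn j1 m) in E.
  have hn : hm x n by do 2!apply: fn_hm.
  have nE : n = fn i2 (fn p2 n) by rewrite -{1}(f3 n hn) E fn0 add0r.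
  have h0 : fn (comp p i2) (fn p2 n) = 0.
    rewrite h11; last exact: fn_hm.
    by rewrite -nE; apply/h5 => //; exists (fn j1 m) => //; apply: fn_hm.
  have [s hs sE] := proj1 (h9 _ (fn_hm p2 hn)) h0.
  have jE : fn j1 m = fn j2 s.
    apply/eqP; rewrite -subr_eq0; apply/eqP; apply: h3; first by apply: hmB; apply: fn_hm.
    by rewrite fnB -/n nE -sE -h16 // -h17 // h15 // subrr.
  by rewrite -(proj1 (e1 m hx)) jE (proj2 (e2 s hs)).
- apply: evS common _ => x [[e1 e2 e3] [[f1 f2 f3] [h3 [h4 [h5 [h6 [h7 [h8 [h9 [h10 [h11 [h12 [h13 [h14 [h15 [h16 h17]]]]]]]]]]]]]]]] n hn.
  have [s hs <-] := h6 n hn; have [m hm' <-] := h4 s hs.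
  exists (fn p1 m); first exact: fn_hm.
  have hp1 := fn_hm p1 hm'; have hp2 := fn_hm p2 hm'.
  rewrite h12 // h10 // -[in RHS](f3 m hm') !fnD -h11 //.
  rewrite [fn c (fn (comp p i2) _)](_ : _ = 0) ?addr0 //.
  by apply/h7; [apply: fn_hm|exists (fn p2 m)].
- apply: evS common _ => x [[e1 e2 e3] [[f1 f2 f3] [h3 [h4 [h5 [h6 [h7 [h8 [h9 [h10 [h11 [h12 [h13 [h14 [h15 [h16 h17]]]]]]]]]]]]]]]] n hn.
  rewrite h12 // h10 //; have hp := fn_hm p (fn_hm i1 hn); split=> [/h7[//|s hs sE]|[m hm' mE]].
    have hd : hm x (fn i1 n - fn i2 s) by apply: hmB; apply: fn_hm.
    have [|m hm' mE] := proj1 (h5 _ hd); first by rewrite fnB -h11 // sE subrr.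
    exists (fn q1 m); first exact: fn_hm.
    rewrite h13 ?h14; try exact: fn_hm.
    have E1 := congr1 (fn p1) mE; rewrite fnB (proj1 (f1 n hn)) (proj2 (f2 s hs)) subr0 in E1.
    rewrite -[in RHS]E1 -[in RHS](e3 m hm') !fnD -[fn k (fn j2 _)]h15; last exact: fn_hm.
    rewrite h17 ?h16; try exact: fn_hm.
    by rewrite (proj2 (f2 _ _)) ?addr0 //; do 2!apply: fn_hm.
  set r := fn k (fn j1 m); have hr : hm x r by do 2!apply: fn_hm.
  have pr : fn p r = 0 by apply/h5 => //; exists (fn j1 m) => //; apply: fn_hm.
  rewrite h13 // h14 // -/r in mE; apply/h7 => //.
  exists (- fn p2 r); first by apply: hmN; apply: fn_hm.
  rewrite h11; last by apply: hmN; apply: fn_hm.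
  have -> : fn i2 (- fn p2 r) = fn i1 n - r.
    by rewrite -{2}(f3 r hr) mE -sub0r fnB fn0 sub0r opprD addrA subrr add0r.
  by rewrite fnB pr subr0.
Qed.

(** The kernel of [p] is an extension of [M] by [S] through the snake lemma, and it splits because
    line bundles lift along epimorphisms with torsion kernel. *)
Lemma split_epi Y (p : hom K' S2) (c : hom S2 Y) (a : hom S S') (b : hom M M') :
  cinj a -> cexact a (comp p i2) -> cexact (comp p i2) c ->
  cses b (comp c (comp p i1)) -> exists k : hom K K', cses k p.
Proof.
move=> aI ae ce [bI bS be].
have eK := cbip_ev bK; have eK' := cbip_ev bK'.
have [K0 [k0 [k0I k0e]]] := ker_ex p.
have [|r rE] := @ker_lift F X M M' Y K0 b (comp c (comp p i1)) (comp p1 k0) bI be.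
  have : comp (comp c p) (comp (hadd (comp i1 p1) (comp i2 p2)) k0) = hom0 K0 Y.
    by rewrite (cbip_idE bK') comp_idl -comp_assoc (cexact_comp k0e) comp_hom0r.
  rewrite comp_haddl comp_haddr -[comp (comp i2 p2) k0]comp_assoc.
  rewrite [comp (comp c p) (comp i2 _)]comp_assoc -[comp (comp c p) i2]comp_assoc.
  by rewrite (cexact_comp ce) comp_hom0l hadd0r !comp_assoc.
have [|al alE] := @ker_lift F X K0 K' S2 S k0 p (comp i2 a) k0I k0e.
  by rewrite comp_assoc (cexact_comp ae).
have rses : cses al r.
  have common := evI eK' (evI k0I (evI k0e (evI aI (evI ae (evI ce (evI bI (evI be
    (evI (fnM k0 al) (evI (fnM i2 a) (evI (fnM b r) (evI (fnM p1 k0) (evI (fnM p i2)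
    (evI (fnM p i1) (evI (fnM c (comp p i1)) (evI (proj2 (homP _ _) rE)
      (proj2 (homP _ _) alE)))))))))))))))).
  split.
  - apply: evS common _ => x [[f1 f2 f3] [h1 [h2 [h3 [h4 [h5 [h6 [h7 [h8 [h9 [h10 [h11 [h12 [h13 [h14 [h15 h16]]]]]]]]]]]]]]]] s hs E.
    apply: h3 => //; rewrite -(proj1 (f2 _ (fn_hm a hs))) -h9 // -h16 // h8 // E.
    by rewrite !fn0.
  - apply: evS common _ => x [[f1 f2 f3] [h1 [h2 [h3 [h4 [h5 [h6 [h7 [h8 [h9 [h10 [h11 [h12 [h13 [h14 [h15 h16]]]]]]]]]]]]]]]] m hx.
    have hb := fn_hm b hx; have hpb := fn_hm p (fn_hm i1 hb).
    have E0 : fn c (fn p (fn i1 (fn b m))) = 0.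
      by rewrite -h13 // -h14 //; apply/(h7 _ hb); exists m.
    have [s hs sE] := proj1 (h5 _ hpb) E0.
    have hd : hm x (fn i1 (fn b m) - fn i2 s) by apply: hmB; apply: fn_hm.
    have [|n hn nE] := proj1 (h2 _ hd); first by rewrite fnB -h12 // sE subrr.
    exists n => //; apply/eqP; rewrite -subr_eq0; apply/eqP; apply: h6.
      by apply: hmB => //; apply: fn_hm.
    rewrite fnB -h10 // h15 // h11 // nE fnB (proj1 (f1 _ hb)) (proj2 (f2 _ hs)).
    by rewrite subr0 subrr.
  - apply: evS common _ => x [[f1 f2 f3] [h1 [h2 [h3 [h4 [h5 [h6 [h7 [h8 [h9 [h10 [h11 [h12 [h13 [h14 [h15 h16]]]]]]]]]]]]]]]] n hn.
    have hk := fn_hm k0 hn; have hp2 := fn_hm p2 hk; split=> [E|[s hs <-]].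
      have E1 : fn p1 (fn k0 n) = 0 by rewrite -h11 // -h15 // h10 // E fn0.
      have E2 : fn k0 n = fn i2 (fn p2 (fn k0 n)) by rewrite -{1}(f3 _ hk) E1 fn0 add0r.
      have [|s hs sE] := proj1 (h4 _ hp2).
        by rewrite h12 // -E2; apply/(h2 _ hk); exists n.
      exists s => //; apply/eqP; rewrite -subr_eq0; apply/eqP; apply: h1.
        by apply: hmB => //; apply: fn_hm.
      by rewrite fnB -h8 // h16 // h9 // sE -E2 subrr.
    have ha := fn_hm al hs; apply: h6; first exact: fn_hm.
    by rewrite -h10 // h15 // h11 // -h8 // h16 // h9 // (proj2 (f2 _ (fn_hm a hs))).
have [sg sgE] := lb_lift (idm M) hM rses tS; have [alI rS re] := rses.
pose th := hadd (comp sg q1) (comp al q2); exists (comp k0 th).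
have common := evI eK (evI k0I (evI k0e (evI alI (evI re (evI (fnM k0 th)
  (evI (haddE (comp sg q1) (comp al q2)) (evI (fnM sg q1) (evI (fnM al q2)
  (evI (fnM r sg) (evI (fn1 M) (proj2 (homP _ _) sgE))))))))))).
split.
- apply: evS common _ => x [[e1 e2 e3] [h1 [h2 [h3 [h4 [h5 [h6 [h7 [h8 [h9 [h10 h11]]]]]]]]]]] n hn.
  rewrite h5 // => /(h1 _ (fn_hm th hn)); rewrite h6 // h7 // h8 // => E.
  have hq1 := fn_hm q1 hn; have hq2 := fn_hm q2 hn.
  have E1 : fn q1 n = 0.
    have := congr1 (fn r) E; rewrite fnD -h9 // h11 // h10 // fn0.
    by rewrite (proj2 (h4 _ _)) ?addr0 //; [apply: fn_hm|exists (fn q2 n)].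
  rewrite E1 fn0 add0r in E.
  by rewrite -(e3 _ hn) E1 (h3 _ hq2 E) !fn0 addr0.
- apply: evS (evI eK' (evI bS (evI ce (evI (fnM p i2) (evI (fnM p i1)
    (fnM c (comp p i1))))))) _ => x [[f1 f2 f3] [h1 [h2 [h3 [h4 h5]]]]] s hs.
  have [m hx mE] := h1 _ (fn_hm c hs); rewrite h5 // h4 // in mE.
  have hd : hm x (s - fn p (fn i1 m)) by apply: hmB => //; do 2!apply: fn_hm.
  have [|s' hs' sE] := proj1 (h2 _ hd); first by rewrite fnB mE subrr.
  exists (fn i1 m + fn i2 s'); first by apply: hmD; apply: fn_hm.
  by rewrite fnD -h3 // sE addrC subrK.
- apply: evS common _ => x [[e1 e2 e3] [h1 [h2 [h3 [h4 [h5 [h6 [h7 [h8 [h9 [h10 h11]]]]]]]]]]] n hn.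
  split=> [/(h2 _ hn)[m hx <-]|[m hx <-]]; last first.
    by rewrite h5 //; apply/(h2 _ (fn_hm k0 (fn_hm th hx))); exists (fn th m) => //; apply: fn_hm.
  have hr := fn_hm r hx.
  have hd : hm x (m - fn sg (fn r m)) by apply: hmB => //; apply: fn_hm.
  have [|s hs sE] := proj1 (h4 _ hd).
    by rewrite fnB -h9 // h11 // h10 // subrr.
  have hj1 := fn_hm j1 hr; have hj2 := fn_hm j2 hs.
  exists (fn j1 (fn r m) + fn j2 s); first by apply: hmD.
  rewrite h5 ?h6; try exact: hmD.
  rewrite h7 ?h8; try exact: hmD.
  rewrite (fnD q1) (fnD q2) (proj1 (e1 _ hr)) (proj2 (e1 _ hr)) (proj1 (e2 _ hs)).
  by rewrite (proj2 (e2 _ hs)) addr0 add0r sE addrC subrK.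
Qed.

End Structure.

End LineBundleObjects.

(** * Hall numbers *)

Section Counting.
Variables (F : finFieldType) (X : wpl F).
Local Notation A := (Aalg X).
Local Notation C := (coh X).
Implicit Types M P K B D S Y : C.

Lemma ncard_bij (T U : Type) (Q : T -> Prop) (R : U -> Prop) (phi : T -> U) (psi : U -> T) :
  cancel phi psi -> cancel psi phi -> (forall x, Q x <-> R (phi x)) -> ncard Q = ncard R.
Proof.
move=> phiK psiK QR; rewrite /ncard; congr (xget _ _); apply: funext => n.
apply: propext; split=> -[f [fI fE]].
  exists (fun i => phi (f i)); split=> [i j /(can_inj phiK)/fI//|u].
  rewrite -(psiK u) -QR fE; split=> -[i E]; exists i; first by rewrite E.
  by apply: (can_inj phiK).
exists (fun i => psi (f i)); split=> [i j /(can_inj psiK)/fI//|x].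
rewrite QR fE; split=> -[i E]; exists i; first by rewrite E.
by rewrite -E psiK.
Qed.

(** Either sum equals a double sum over pairs of isomorphic representatives, which is symmetric in
    the two enumerations; so [xget] can return no other value. *)
Lemma sum_iso_eq (f : C -> rat) n (e : 'I_n -> C) :
  (forall M P, isomorphic M P -> f M = f P) ->
  (forall i j, isomorphic (e i) (e j) -> i = j) ->
  (forall M, f M <> 0 -> exists i, isomorphic M (e i)) -> sum_iso f = \sum_i f (e i).
Proof.
move=> fE eI eC.
have half m (e1 : 'I_m -> C) m' (e2 : 'I_m' -> C) :
    (forall i j, isomorphic (e2 i) (e2 j) -> i = j) ->
    (forall M, f M <> 0 -> exists i, isomorphic M (e2 i)) ->
    \sum_i f (e1 i) = \sum_i \sum_j if `[< isomorphic (e1 i) (e2 j) >] then f (e1 i) else 0.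
  move=> I2 C2; apply: eq_bigr => i _.
  have [f0|/eqP f0] := eqVneq (f (e1 i)) 0; first by rewrite big1 // => j _; rewrite f0 if_same.
  have [j ij] := C2 _ f0; rewrite (bigD1 j) //= (asboolT ij) big1 ?addr0 // => l lj.
  case: asboolP => // il; case/eqP: lj; apply: I2.
  exact: iso_trans (isoN il) ij.
rewrite /sum_iso; case: xgetP => [v _ [m [e' [eI' eC' ->]]]|h]; last first.
  by case: (h (\sum_i f (e i))); exists n, e.
rewrite (half _ _ _ _ eI eC) [RHS](half _ _ _ _ eI' eC') exchange_big /=.
apply: eq_bigr => i _; apply: eq_bigr => j _.
case: asboolP => [ij|ij]; case: asboolP => [ji|ji] //; last 2 first.
- by case: ji; apply: isoN.
- by case: ij; apply: isoN.
exact: fE.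
Qed.

Lemma aut_card_iso M P : @isomorphic C M P -> aut_card M = aut_card P.
Proof.
move=> [f fI]; have [g [gf fg]] := fI; have gI : is_iso g by exists f.
apply: (@ncard_bij _ _ _ _ (fun u => comp f (comp u g)) (fun v => comp g (comp v f))) => [u|v|u].
- by rewrite !comp_assoc gf comp_idl -comp_assoc gf comp_idr.
- by rewrite !comp_assoc fg comp_idl -comp_assoc fg comp_idr.
split=> [uI|uI]; first exact: is_iso_comp fI (is_iso_comp uI gI).
have -> : u = comp g (comp (comp f (comp u g)) f).
  by rewrite !comp_assoc gf comp_idl -comp_assoc gf comp_idr.
exact: is_iso_comp gI (is_iso_comp uI fI).
Qed.

Lemma cexact_cinj M P K B (a : hom M P) (p : hom P K) (j : hom K B) : cinj j ->
  cexact a (comp j p) <-> cexact a p.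
Proof.
move=> jI.
have e0 : ev (fun x => forall n, hm x n -> (fn (comp j p) n = 0 <-> fn p n = 0)).
  apply: evS (evI jI (fnM j p)) _ => x [h1 h2] n hn; rewrite h2 //.
  by split=> [|->]; [apply: h1; apply: fn_hm|rewrite fn0].
by split=> e; apply: evS (evI e0 e) _ => x [h1 h2] n hn; rewrite -h2 // h1.
Qed.

Lemma cexact_csurj M P K B (p : hom M P) (j : hom P K) (c : hom K B) : csurj p ->
  cexact (comp j p) c <-> cexact j c.
Proof.
move=> pS; split=> e; apply: evS (evI pS (evI (fnM j p) e)) _ => x [h1 [h2 h3]] n hn;
  rewrite h3 //; split=> -[m hx <-].
- by exists (fn p m); [apply: fn_hm|rewrite h2].
- by have [m' hx' <-] := h1 m hx; exists m' => //; rewrite h2.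
- by have [m' hx' <-] := h1 m hx; exists m' => //; rewrite h2.
- by exists (fn p m); [apply: fn_hm|rewrite h2].
Qed.

Lemma im_ex M P (h : hom M P) : exists (T : C) (p : hom M T) (j : hom T P),
  [/\ csurj p, cinj j & comp j p = h].
Proof.
have [U [gU UE]] := im_gsub h; have [T [j [jI jE]]] := sub_obj gU.
have [|p pE] := @lift_inj F X M P T j h jI.
  apply: evS (evI UE jE) _ => x [h1 h2] m hx; have hh := fn_hm h hx.
  by apply/(h2 _ hh)/(h1 _ hh); exists m.
exists T, p, j; split=> //.
apply: evS (evI UE (evI jE (evI jI (evI (fnM j p) (proj2 (homP _ _) pE))))) _.
move=> x [h1 [h2 [h3 [h4 h5]]]] n hn; have hj := fn_hm j hn.
have /(h1 _ hj)[m hx mE] : U (fn j n) by apply/(h2 _ hj); exists n.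
exists m => //; apply/eqP; rewrite -subr_eq0; apply/eqP; apply: h3.
  by apply: hmB => //; apply: fn_hm.
by rewrite fnB -h4 // h5 // mE subrr.
Qed.

Lemma ses_diff M K B D (i : hom K B) (p : hom B D) (g0 g : hom M B) : cinj i -> cexact i p ->
  comp p g = comp p g0 -> exists w : hom M K, hadd g0 (comp i w) = g.
Proof.
move=> iI e E; have [|w wE] := @ker_lift F X K B D M i p (hadd g (hopp g0)) iI e.
  rewrite comp_haddr E; apply/cnullP.
  apply: evS (evI (haddE (comp p g0) (comp p (hopp g0))) (evI (fnM p g0)
    (evI (fnM p (hopp g0)) (hoppE g0)))) _ => x [h1 [h2 [h3 h4]]] m hx.
  by rewrite h1 // h2 // h3 // h4 // -[- _]sub0r fnB fn0 sub0r subrr.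
exists w; rewrite wE; apply/homP.
apply: evS (evI (haddE g0 (hadd g (hopp g0))) (evI (haddE g (hopp g0)) (hoppE g0))) _.
by move=> x [h1 [h2 h3]] m hx; rewrite h1 // h2 // h3 // addrC subrK.
Qed.

Lemma hadd_cancel M P (f g h : hom M P) : hadd f g = hadd f h -> g = h.
Proof.
move=> /homP E; apply/homP; apply: evS (evI E (evI (haddE f g) (haddE f h))) _.
by move=> x [h1 [h2 h3]] m hx; apply: (addrI (fn f m)); rewrite -h2 // -h3 // h1.
Qed.

(** Each [u] lifts to [B], and the lifts of one [u] form a torsor under $\mathrm{Hom}(M,K)$. *)
Lemma lb_torsor M K B D (i : hom K B) (p : hom B D) (Q : hom M D -> Prop) nQ nK :
  is_line_bundle M -> cses i p -> tors K -> cardE Q eq nQ ->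
  cardE (fun _ : hom M K => True) eq nK ->
  cardE (fun g : hom M B => Q (comp p g)) eq (nQ * nK)%N.
Proof.
move=> hM ip tK cQ cK; have [iI pS e] := ip.
apply: (@cardE_mul _ _ _ eq Q eq (fun g u => comp p g = u)) => //; try exact: equivr_eq.
- by move=> g Qg; exists (comp p g).
- by move=> g u u' _ _ _ ->.
- by move=> g g' u u' _ _ _ _ <- <- ->.
move=> u Qu; have [g0 g0E] := lb_lift u hM ip tK.
apply: (@cardE_bij _ _ _ eq _ eq (fun g w => hadd g0 (comp i w) = g)) cK.
- move=> g [_ gE]; have [|w wE] := @ses_diff M K B D i p g0 g iI e; first by rewrite gE.
  by exists w.
- move=> w _; exists (hadd g0 (comp i w)) => //.
  have E : comp p (hadd g0 (comp i w)) = u.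
    by rewrite comp_haddr comp_assoc (cexact_comp e) comp_hom0l hadd0r.
  by rewrite E.
- move=> g g' w w' _ _ _ _ <- <-; split=> [|->//].
  by move=> /hadd_cancel /(cinj_cancel iI).
Qed.

Lemma lb_epi_count M Y (p : hom M Y) n : is_line_bundle M -> csurj p ->
  cardE (fun u : hom Y Y => is_iso u) eq n -> cardE (fun q : hom M Y => csurj q) eq n.
Proof.
move=> hM pS; apply: (@cardE_bij _ _ _ eq _ eq (fun q u => comp u p = q)).
- by move=> q /(lb_epi_iso hM pS)[u uI uE]; exists u.
- move=> u /is_isoP[_ uS]; exists (comp u p) => //; exact: csurj_comp.
- move=> q q' u u' _ _ _ _ <- <-; split=> [|->//]; exact: csurj_cancel.
Qed.

Lemma hom_cardE M S : tors S -> cardE (fun _ : hom M S => True) eq (hom_card M S).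
Proof. by move=> /(hom_finite M)[n cn]; rewrite /hom_card (ncardE cn). Qed.

Lemma aut_cardE S : tors S -> cardE (fun u : hom S S => is_iso u) eq (aut_card S).
Proof.
move=> /(hom_finite S)[n cn].
have [m cm] := @cardE_sub _ (fun=> True) (fun u : hom S S => is_iso u) eq n (@equivr_eq _)
  (fun _ _ => I) cn.
by rewrite /aut_card (ncardE cm).
Qed.

Lemma cardE_gt0 (T : Type) (Q : T -> Prop) (E : T -> T -> Prop) n x :
  Q x -> cardE Q E n -> (0 < n)%N.
Proof. by move=> Qx [f [_ _ fC]]; have [i _] := fC x Qx; apply: leq_ltn_trans (ltn_ord i). Qed.

Lemma hom_card_gt0 M S : tors S -> (0 < hom_card M S)%N.
Proof. by move=> tS; exact: (@cardE_gt0 _ _ _ _ (hom0 M S) I (hom_cardE M tS)). Qed.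

Lemma is_iso_id M : is_iso (idm M).
Proof. by exists (idm M); rewrite comp_idl. Qed.

Lemma aut_card_gt0 S : tors S -> (0 < aut_card S)%N.
Proof. by move=> tS; exact: (cardE_gt0 (is_iso_id S) (aut_cardE tS)). Qed.

Lemma ker_uniq M M' P K (k : hom M P) (k' : hom M' P) (p : hom P K) :
  cinj k -> cexact k p -> cinj k' -> cexact k' p -> exists2 u : hom M M', is_iso u & comp k' u = k.
Proof.
move=> kI ke kI' ke'.
have [u uE] := ker_lift kI' ke' (cexact_comp ke).
have [v vE] := ker_lift kI ke (cexact_comp ke').
exists u => //; exists v; split.
  by apply: (cinj_cancel kI); rewrite comp_assoc vE uE comp_idr.
by apply: (cinj_cancel kI'); rewrite comp_assoc uE vE comp_idr.
Qed.

Lemma coker_uniq M P K K' (k : hom M P) (p : hom P K) (p' : hom P K') :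
  csurj p -> cexact k p -> csurj p' -> cexact k p' -> exists2 u : hom K K', is_iso u & comp u p = p'.
Proof.
move=> pS pe pS' pe'.
have [u uE] := coker_lift pS pe (cexact_comp pe').
have [v vE] := coker_lift pS' pe' (cexact_comp pe).
exists u => //; exists v; split.
  by apply: (csurj_cancel pS); rewrite -comp_assoc uE vE comp_idl.
by apply: (csurj_cancel pS'); rewrite -comp_assoc vE uE comp_idl.
Qed.

Lemma sub_classP M P K (k : hom M K) (k' : hom P K) :
  sub_class k = sub_class k' <-> exists2 u : hom M P, is_iso u & comp k' u = k.
Proof.
split=> [E|[u uI uE]].
  have : sub_class k' (existT _ P k') by exists (idm P); [exact: is_iso_id|rewrite comp_idr].
  by rewrite -E.
have [v [vu uv]] := uI; have vI : is_iso v by exists u.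
apply: funext => -[Z j]; apply: propext; split=> -[w wI /= wE].
  exists (comp w v); first exact: is_iso_comp.
  have vE : comp k v = k' by rewrite -uE -comp_assoc uv comp_idr.
  by rewrite -vE -wE comp_assoc.
exists (comp w u); first exact: is_iso_comp.
by rewrite -uE -wE comp_assoc.
Qed.

(** The subobjects counted by [hall], with [B] itself as the source of the representative. *)
Definition hallset (A B M : C) (K : {Y : C & hom Y M} -> Prop) : Prop :=
  exists2 k : hom B M, exists p : hom M A, cses k p & K = sub_class k.

Lemma hallsetE (A B M : C) : hall A B M = ncard (@hallset A B M).
Proof.
rewrite /hall; congr (ncard _); apply: funext => K; apply: propext; split.
  move=> [P [i [/is_monoP iI [u uI] [p /is_cokernelP[pS e]] ->]]].
  have [v [vu uv]] := uI; have vI : is_iso v by exists u.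
  exists (comp i v); last by apply/sub_classP; exists u => //; rewrite -comp_assoc vu comp_idr.
  have /is_isoP[vI' vS] := vI; exists p; split=> //; first exact: cinj_comp.
  exact/cexact_csurj.
move=> [k [p [kI pS e]] ->]; exists B, k; split=> //; first exact/is_monoP.
  exact: iso_refl.
by exists p; apply/is_cokernelP.
Qed.

(** An epimorphism with kernel [B] amounts to a subobject with an identification of its quotient
    with [A]; these identifications form a torsor under $\mathrm{Aut}(A)$. *)
Lemma hall_epi (A B M : C) N : tors A ->
  cardE (fun p : hom M A => exists k : hom B M, cses k p) eq N ->
  (hall A B M * aut_card A = N)%N.
Proof.
move=> tA cN; have [f [fP fI fC]] := cN.
have [h ch] : exists h, cardE (@hallset A B M) eq h.
  apply: (@cardE_cover _ 'I_N _ eq (enum 'I_N)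
    (fun Q i => exists2 k : hom B M, cses k (f i) & Q = sub_class k)).
  - exact: equivr_eq.
  - move=> K [k [p kp] KE]; have [|i iE] := fC p; first by exists k.
    by exists i; [rewrite mem_enum|exists k => //; rewrite -iE].
  - move=> K K' i _ _ [k [kI _ ke] ->] [k' [kI' _ ke'] ->].
    exact/sub_classP/(ker_uniq kI ke kI' ke').
rewrite hallsetE (ncardE ch); apply: cardE_uniq (@equivr_eq _) _ cN.
apply: (@cardE_mul _ _ _ eq _ eq
  (fun p Q => exists2 k : hom B M, cses k p & Q = sub_class k)) ch _ _ _ _; try exact: equivr_eq.
- by move=> p [k kp]; exists (sub_class k); exists k => //; exists p.
- by move=> p K K' _ _ _ ->.
- move=> p p' K K' _ _ _ _ [k [kI _ ke] ->] [k' [kI' _ ke'] ->] E; rewrite -E in ke'.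
  exact/sub_classP/(ker_uniq kI ke kI' ke').
move=> K [k0 [p0 [kI0 pS0 e0]] KE].
apply: (@cardE_bij _ _ _ eq _ eq (fun p u => comp u p0 = p)) (aut_cardE tA).
- move=> p [_ [k [kI pS e]]]; rewrite KE => /sub_classP[u /is_isoP[_ uS] uE].
  have e' : cexact k0 p by rewrite -uE; apply/cexact_csurj.
  by have [v vI vE] := coker_uniq pS0 e0 pS e'; exists v.
- move=> u /is_isoP[uI uS]; exists (comp u p0) => //.
  have k0p : cses k0 (comp u p0) by split=> //; [exact: csurj_comp|apply/cexact_cinj].
  by split; exists k0.
- by move=> p p' u u' _ _ _ _ <- <-; split=> [|->//]; exact: csurj_cancel.
Qed.

Lemma hall_mono (A B M : C) N : tors M -> tors B ->
  cardE (fun k : hom B M => exists p : hom M A, cses k p) eq N ->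
  (hall A B M * aut_card B = N)%N.
Proof.
move=> tM tB cN; have [f [fP fI fC]] := cN.
have [h ch] : exists h, cardE (@hallset A B M) eq h.
  apply: (@cardE_cover _ 'I_N _ eq (enum 'I_N) (fun Q i => Q = sub_class (f i))).
  - exact: equivr_eq.
  - move=> K [k [p kp] KE]; have [|i iE] := fC k; first by exists p.
    by exists i; [rewrite mem_enum|rewrite -iE].
  - by move=> K K' i _ _ -> ->.
rewrite hallsetE (ncardE ch); apply: cardE_uniq (@equivr_eq _) _ cN.
apply: (@cardE_mul _ _ _ eq _ eq (fun k Q => Q = sub_class k)) ch _ _ _ _; try exact: equivr_eq.
- by move=> k [p kp]; exists (sub_class k) => //; exists k => //; exists p.
- by move=> p K K' _ _ _ ->.
- by move=> k k' K K' _ _ _ _ -> -> ->.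
move=> K [k0 [p0 [kI0 pS0 e0]] KE].
apply: (@cardE_bij _ _ _ eq _ eq (fun k u => comp k0 u = k)) (aut_cardE tB).
- by move=> k [_ ]; rewrite KE => /esym/sub_classP[u uI uE]; exists u.
- move=> u uI; have /is_isoP[uI' uS] := uI; exists (comp k0 u) => //; split.
    by exists p0; split=> //; [exact: cinj_comp|apply/cexact_csurj].
  by rewrite KE; apply/esym/sub_classP; exists u.
- by move=> p p' u u' _ _ _ _ <- <-; split=> [|->//]; exact: cinj_cancel.
Qed.

Lemma hall_isol (A A' B M : C) : isomorphic A A' -> hall A B M = hall A' B M.
Proof.
have half (A1 A2 : C) Q : isomorphic A1 A2 -> @hallset A1 B M Q -> @hallset A2 B M Q.
  move=> [u /is_isoP[uI uS]] [k [p [kI pS e]] ->]; exists k => //; exists (comp u p).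
  by split=> //; [exact: csurj_comp|apply/cexact_cinj].
move=> AA'; rewrite !hallsetE; congr (ncard _); apply: funext => K; apply: propext.
by split; apply: half => //; apply: isoN.
Qed.

Lemma hall_isor (A B B' M : C) : isomorphic B B' -> hall A B M = hall A B' M.
Proof.
have half (B1 B2 : C) Q : isomorphic B2 B1 -> @hallset A B1 M Q -> @hallset A B2 M Q.
  move=> [u uI] [k [p [kI pS e]] ->]; have /is_isoP[uI' uS] := uI; exists (comp k u).
    by exists p; split=> //; [exact: cinj_comp|apply/cexact_csurj].
  by apply/esym/sub_classP; exists u.
move=> BB'; rewrite !hallsetE; congr (ncard _); apply: funext => K; apply: propext.
by split; apply: half => //; apply: isoN.
Qed.

End Counting.

(** * Counting morphisms by kernel, cokernel and image *)

Section HallNumbers.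
Variables (F : finFieldType) (X : wpl F).
Local Notation C := (coh X).
Implicit Types M P K B D S Y : C.

Definition khom S S' S'' S2 (h : hom S' S'') : Prop :=
  (exists a : hom S S', cinj a /\ cexact a h) /\
  (exists c : hom S'' S2, csurj c /\ cexact h c).

Lemma khom_finite S S' S'' S2 : tors S'' -> exists n, cardE (@khom S S' S'' S2) eq n.
Proof.
move=> tS''; have [n cn] := hom_finite S' tS''.
exact: (@cardE_sub _ (fun=> True) _ eq n (@equivr_eq _) (fun _ _ => I) cn).
Qed.

Lemma factor_uniq M P T T' (p : hom M T) (j : hom T P) (p' : hom M T') (j' : hom T' P) :
  csurj p -> cinj j -> csurj p' -> cinj j' -> comp j p = comp j' p' ->
  exists u : hom T T', [/\ is_iso u, comp u p = p' & comp j' u = j].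
Proof.
move=> pS jI pS' jI' E; have [K [k [kI ke]]] := ker_ex (comp j p).
have e1 : cexact k p by apply/(cexact_cinj _ _ jI).
have e2 : cexact k p' by rewrite E in ke; apply/(cexact_cinj _ _ jI').
have [u uI uE] := coker_uniq pS e1 pS' e2; exists u; split=> //.
by apply: (csurj_cancel pS); rewrite -comp_assoc uE.
Qed.

Section Classes.
Variables S S' S'' S2 : C.
Hypotheses (tS' : tors S') (tS'' : tors S'').

Definition kimage (Z : C) : Prop :=
  (exists (a : hom S S') (p : hom S' Z), cses a p) /\
  (exists (j : hom Z S'') (c : hom S'' S2), cses j c).

Definition imageof (h : hom S' S'') (Z : C) : Prop :=
  exists (p : hom S' Z) (j : hom Z S''), [/\ csurj p, cinj j & comp j p = h].

Lemma imageof_uniq h Z Z' : imageof h Z -> imageof h Z' -> isomorphic Z Z'.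
Proof.
move=> [p [j [pS jI E]]] [p' [j' [pS' jI' E']]].
have [|u [uI _ _]] := factor_uniq pS jI pS' jI'; first by rewrite E.
by exists u.
Qed.

Lemma kimage_finite : exists n, cardE kimage (@isomorphic C) n.
Proof.
have [N [f [_ _ fC]]] := hom_finite S' tS''.
apply: (@cardE_cover _ 'I_N _ _ (enum 'I_N) (fun Z i => imageof (f i) Z)).
- by split; [exact: iso_refl|exact: isoN|move=> M P K; exact: iso_trans].
- move=> Z [[a [p [_ pS _]]] [j [c [jI _ _]]]]; have [i iE] := fC (comp j p) I.
  by exists i; [rewrite mem_enum|exists p, j].
- by move=> Z Z' i _ _; exact: imageof_uniq.
Qed.

(** Count pairs of an epimorphism onto [Z] and a monomorphism from [Z]. Each Hall number brings a
    factor $a_Z$, and the pairs with a given composite form a torsor under $\mathrm{Aut}(Z)$, which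
    takes one of the two factors away. *)
Lemma khom_image_card Z n : tors Z -> cardE (fun h => @khom S S' S'' S2 h /\ imageof h Z) eq n ->
  (n = hall Z S S' * hall S2 Z S'' * aut_card Z)%N.
Proof.
move=> tZ cn.
have [N1 c1] : exists N, cardE (fun p : hom S' Z => exists a : hom S S', cses a p) eq N.
  have [N cN] := hom_finite S' tZ.
  exact: (@cardE_sub _ (fun=> True) _ eq N (@equivr_eq _) (fun _ _ => I) cN).
have [N2 c2] : exists N, cardE (fun j : hom Z S'' => exists c : hom S'' S2, cses j c) eq N.
  have [N cN] := hom_finite Z tS''.
  exact: (@cardE_sub _ (fun=> True) _ eq N (@equivr_eq _) (fun _ _ => I) cN).
have E1 := hall_epi tZ c1; have E2 := hall_mono tS'' tZ c2.
have c12 := cardE_prod c1 c2.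
pose EQ := fun p q : hom S' Z * hom Z S'' => p.1 = q.1 /\ p.2 = q.2.
have eqv : equivr EQ.
  split=> [[p j]//|[p j] [p' j'] [/= -> ->]//|[p j] [p' j'] [p'' j''] [/= -> ->]//].
have : (N1 * N2 = n * aut_card Z)%N.
  apply: (cardE_uniq eqv c12).
  apply: (@cardE_mul _ _ _ EQ _ eq (fun q h => comp q.2 q.1 = h)) cn _ _ _ _ => //; first exact: equivr_eq.
  - move=> [p j] [/= [a [aI pS ae]] [c [jI cS ce]]]; exists (comp j p) => //; split; last by exists p, j.
    split; first by exists a; split=> //; apply/(cexact_cinj _ _ jI).
    by exists c; split=> //; apply/(cexact_csurj _ _ pS).
  - by move=> q h h' _ _ _ ->.
  - by move=> [p j] [p' j'] h h' _ _ _ _ /= <- <- [/= -> ->].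
  move=> h [[[a [aI ae]] [c [cS ce]]] [p0 [j0 [pS0 jI0 E0]]]].
  apply: (@cardE_bij _ _ _ EQ _ eq (fun q u => comp u p0 = q.1 /\ comp q.2 u = j0)) (aut_cardE tZ).
  - move=> [p j] [/= [[a' [aI' pS ae']] [c' [jI cS' ce']]] E].
    have [|u [uI u1 u2]] := factor_uniq pS0 jI0 pS jI; first by rewrite E0.
    by exists u.
  - move=> u uI; have /is_isoP[uI' uS] := uI; have [v [vu uv]] := uI.
    have vI : is_iso v by exists u.
    have /is_isoP[vI' vS] := vI.
    exists (comp u p0, comp j0 v); last by rewrite -comp_assoc vu comp_idr.
    have E : comp (comp j0 v) (comp u p0) = h.
      by rewrite comp_assoc -[comp (comp j0 v) u]comp_assoc vu comp_idr.
    have pS : csurj (comp u p0) by exact: csurj_comp.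
    have jI : cinj (comp j0 v) by exact: cinj_comp.
    split=> //=; rewrite -E in ae ce; split.
      by exists a; split=> //; apply/(cexact_cinj _ _ jI).
    by exists c; split=> //; apply/(cexact_csurj _ _ pS).
  - move=> [p j] [p' j'] u u' _ _ uI uI' /= [<- E1'] [<- E2']; rewrite /EQ /=.
    split=> [[E _]|E]; first exact: csurj_cancel E.
    split; first by rewrite E.
    have /is_isoP[_ uS] := uI.
    by apply: (csurj_cancel uS); rewrite -E in E2'; exact: etrans E1' (esym E2').
rewrite -E1 -E2 => E; have a0 := aut_card_gt0 tZ.
by apply/eqP; rewrite -(eqn_pmul2r a0) -E; apply/eqP; ring.
Qed.

Lemma khom_card n : cardE (@khom S S' S'' S2) eq n -> exists m (e : 'I_m -> C),
  [/\ forall i j, isomorphic (e i) (e j) -> i = j,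
      forall Z, kimage Z -> exists i, isomorphic Z (e i)
    & n = (\sum_i hall (e i) S S' * hall S2 (e i) S'' * aut_card (e i))%N].
Proof.
move=> cn; have [m [e [eP eI eC]]] := kimage_finite; exists m, e; split=> //.
have tZ Z : kimage Z -> tors Z by move=> [[a [p [_ pS _]]] _]; exact: tors_quot pS tS'.
have fin i : exists k, cardE (fun h => @khom S S' S'' S2 h /\ imageof h (e i)) eq k.
  by apply: cardE_sub (@equivr_eq _) _ cn => h [].
have /choice[k kP] := fin.
have -> : (\sum_i hall (e i) S S' * hall S2 (e i) S'' * aut_card (e i) = \sum_i k i)%N.
  by apply: eq_bigr => i _; rewrite (khom_image_card (tZ _ (eP i)) (kP i)).
apply: cardE_uniq (@equivr_eq _) cn _.
apply: (@cardE_fib _ _ _ eq kimage (@isomorphic C) imageof m e k) => //.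
- exact: equivr_eq.
- by split; [exact: iso_refl|exact: isoN|move=> M P K; exact: iso_trans].
- move=> h [[a [aI ae]] [c [cS ce]]]; have [Z [p [j [pS jI E]]]] := im_ex h.
  exists Z; last by exists p, j.
  rewrite -E in ae ce; split.
    by exists a, p; split=> //; apply/(cexact_cinj _ _ jI).
  by exists j, c; split=> //; apply/(cexact_csurj _ _ pS).
- move=> h Z Z' _ _ _ [u uI] [p [j [pS jI E]]].
  have /is_isoP[uI' uS] := uI; have [v [vu uv]] := uI.
  have /is_isoP[vI vS] : is_iso v by exists u.
  exists (comp u p), (comp j v); split; [exact: csurj_comp|exact: cinj_comp|].
  by rewrite comp_assoc -[comp (comp j v) u]comp_assoc vu comp_idr.
- by move=> h h' Z Z' _ _ _ _ hZ hZ' E; rewrite -E in hZ'; exact: imageof_uniq hZ'.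
Qed.

End Classes.

Lemma germ_card_gt0 M x y g n : cardE (@germ F X M x y g) (@geq F X M) n -> (0 < n)%N.
Proof. by apply: cardE_gt0; exact: germ0. Qed.

Section MainCount.
Variables (M M' S S' S'' K K' S1 S2 : C).
Variables (j1 : hom M K) (j2 : hom S K) (q1 : hom K M) (q2 : hom K S).
Variables (i1 : hom M' K') (i2 : hom S' K') (p1 : hom K' M') (p2 : hom K' S').
Hypotheses (hM : is_line_bundle M) (hM' : is_line_bundle M').
Hypotheses (tS : tors S) (tS' : tors S') (tS'' : tors S'').
Hypotheses (bK : cbip j1 j2 q1 q2) (bK' : cbip i1 i2 p1 p2).
Variables (a0 : hom S S') (t0 : hom S' S1) (b0 : hom M M') (d0 : hom M' S2).
Variables (k0 : hom S1 S'') (c0 : hom S'' S2).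
Hypotheses (at0 : cses a0 t0) (bd0 : cses b0 d0) (kc0 : cses k0 c0).

(** Germ counts are multiplicative, so the image [T] and [S1], both quotients of [S'] by [S], have
    the same counts, and hence so do the cokernel [Y] and [S2]. Then [lb_coker_uniq] applies. *)
Lemma coker_type (p : hom K' S'') (k : hom K K') : cses k p -> @khom S S' S'' S2 (comp p i2).
Proof.
move=> kp; have [Y [c [cS ce]]] := coker_ex (comp p i2).
have [[a [aI ae]] [b bc]] := epi_split hM hM' tS tS' bK bK' kp cS ce.
have tS1 : tors S1 by case: at0 => _ tS0 _; exact: tors_quot tS0 tS'.
have tS2 : tors S2 by case: kc0 => _ cS0 _; exact: tors_quot cS0 tS''.
have tY := tors_quot cS tS''.
have [T [r [j [rS jI E]]]] := im_ex (comp p i2).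
have tT := tors_quot rS tS'.
split; first by exists a.
have [u uI] : isomorphic Y S2.
  apply: (lb_coker_uniq hM hM' bc bd0 tY tS2) => x y g n n' y0 hg cY c2.
  have [nS cS_] := germ_finite x y0 hg tS; have [n1 c1] := germ_finite x y0 hg tS1.
  have [nT cT] := germ_finite x y0 hg tT.
  have ar : cses a r by split=> //; apply/(cexact_cinj _ _ jI); rewrite E.
  have jc : cses j c by split=> //; apply/(cexact_csurj _ _ rS); rewrite E.
  have := cardE_uniq (@equivr_geq _ _ _) (germ_ses y0 hg ar cS_ cT) (germ_ses y0 hg at0 cS_ c1).
  move=> /eqP; rewrite eqn_pmul2r ?(germ_card_gt0 cS_) // => /eqP nT1.
  have := cardE_uniq (@equivr_geq _ _ _) (germ_ses y0 hg jc cT cY) (germ_ses y0 hg kc0 c1 c2).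
  by rewrite nT1 => /eqP; rewrite eqn_pmul2r ?(germ_card_gt0 c1) // => /eqP.
have /is_isoP[uI' uS] := uI; exists (comp u c); split; first exact: csurj_comp.
exact/cexact_cinj.
Qed.

(** For fixed [h], the choices are the maps from [M'] whose composite to the cokernel of [h] is epi.
    [S1] may replace the image of [h] in the count, since $|\mathrm{Hom}(M',-)|$ is
    $|\mathrm{Hom}(M',S')|/|\mathrm{Hom}(M',S)|$ for both. *)
Lemma hall_count n : cardE (@khom S S' S'' S2) eq n ->
  (hall S'' K K' * aut_card S'' = n * (aut_card S2 * hom_card M' S1))%N.
Proof.
move=> cn; apply: (hall_epi tS'').
have tS1 : tors S1 by case: at0 => _ tS0 _; exact: tors_quot tS0 tS'.
have tS2 : tors S2 by case: kc0 => _ cS0 _; exact: tors_quot cS0 tS''.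
apply: (@cardE_mul _ _ _ eq _ eq (fun p h => comp p i2 = h)) cn _ _ _ _; try exact: equivr_eq.
- by move=> p [k kp]; exists (comp p i2) => //; exact: coker_type kp.
- by move=> p h h' _ _ _ ->.
- by move=> p p' h h' _ _ _ _ <- <- ->.
move=> h [[a [aI ae]] [c [cS ce]]].
have [T [r [j [rS jI E]]]] := im_ex h.
have tT := tors_quot rS tS'.
have ar : cses a r by split=> //; apply/(cexact_cinj _ _ jI); rewrite E.
have jc : cses j c by split=> //; apply/(cexact_csurj _ _ rS); rewrite E.
have [_ dS0 de0] := bd0.
have cE := lb_epi_count hM' dS0 (aut_cardE tS2).
have -> : hom_card M' S1 = hom_card M' T.
  have t1 := lb_torsor hM' ar tS (hom_cardE M' tT) (hom_cardE M' tS).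
  have t2 := lb_torsor hM' at0 tS (hom_cardE M' tS1) (hom_cardE M' tS).
  have := cardE_uniq (@equivr_eq _) t2 t1 => /eqP.
  by rewrite eqn_pmul2r ?hom_card_gt0 // => /eqP.
have cF := lb_torsor hM' jc tT cE (hom_cardE M' tT).
apply: (@cardE_bij _ _ _ eq _ eq (fun p g => comp p i1 = g)) cF.
- move=> p [[k kp] ph]; exists (comp p i1) => //.
  rewrite -ph in ce; have [_ [b [_ bS _]]] := epi_split hM hM' tS tS' bK bK' kp cS ce.
  by [].
- move=> g gS; have [u uI uE] := lb_epi_iso hM' dS0 gS; have /is_isoP[uI' uS] := uI.
  have [e1 e2 e3 e4 _] := bK'.
  exists (hadd (comp g p1) (comp h p2)); last first.
    by rewrite comp_haddl -!comp_assoc e1 e4 comp_hom0r hadd0r comp_idr.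
  have pE : comp (hadd (comp g p1) (comp h p2)) i2 = h.
    by rewrite comp_haddl -!comp_assoc e2 e3 comp_hom0r hadd0l comp_idr.
  have gE : comp (hadd (comp g p1) (comp h p2)) i1 = g.
    by rewrite comp_haddl -!comp_assoc e1 e4 comp_hom0r hadd0r comp_idr.
  split=> //; apply: (@split_epi _ _ _ _ _ _ _ _ _ j1 j2 q1 q2 i1 i2 p1 p2 hM tS bK bK' S2 _ c a b0) => //.
  - by rewrite pE.
  - by rewrite pE.
  - by rewrite gE -uE; case: bd0 => bI0 _ _; split=> //; [rewrite uE|apply/cexact_cinj].
- move=> p p' g g' [_ ph] [_ ph'] _ _ <- <-; split=> [->//|E'].
  rewrite -[p]comp_idr -[p']comp_idr -(cbip_idE bK') !comp_haddr !comp_assoc.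
  by rewrite E' ph ph'.
Qed.

End MainCount.

End HallNumbers.

(** * The uniserial case *)

Section Indecomposable.
Variables (F : finFieldType) (X : wpl F).
Local Notation A := (Aalg X).
Local Notation C := (coh X).
Implicit Types M P K B D S Y : C.

Lemma ncard_neq0 (T : Type) (Q : T -> Prop) : ncard Q <> 0%N -> exists x, Q x.
Proof.
rewrite /ncard; case: xgetP => [n _ [f [_ fC]] n0|//].
have n_gt0 : (0 < n)%N by rewrite lt0n; apply/eqP.
by exists (f (Ordinal n_gt0)); apply/fC; exists (Ordinal n_gt0).
Qed.

Lemma hall_neq0 (A B M : C) : hall A B M <> 0%N ->
  exists (k : hom B M) (p : hom M A), cses k p.
Proof. by rewrite hallsetE => /ncard_neq0[K [k [p kp] _]]; exists k, p. Qed.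

(** By uniseriality one monomorphism factors through the other, via a monic endomorphism of [K];
    since [K] has finitely many endomorphisms, it is an automorphism. *)
Lemma mono_uniq S K (i i' : hom K S) : tors S -> indecomposable S -> cinj i -> cinj i' ->
  exists2 u : hom K K, is_iso u & comp i u = i'.
Proof.
move=> tS iS iI iI'; have [n cn] := hom_finite K (tors_sub iI tS).
have inj (f g : hom K S) u : comp f u = g -> cinj g -> cinj u.
  move=> /homP E gI; apply: evS (evI gI (evI (fnM f u) E)) _ => x [h1 [h2 h3]] m hx u0.
  by apply: h1 => //; rewrite -h3 // h2 // u0 fn0.
have [[u uE]|[u uE]] := uniserial tS iS iI iI'; last first.
  by exists u => //; apply: (mono_end_iso cn); exact: inj uE iI'.
have uI : is_iso u by apply: (mono_end_iso cn); exact: inj uE iI.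
have [v [vu uv]] := uI; exists v; first by exists u.
by rewrite -uE -comp_assoc uv comp_idr.
Qed.

Lemma mono_coker_iso S S' T T' (a a' : hom S S') (p : hom S' T) (p' : hom S' T') :
  tors S' -> indecomposable S' -> cses a p -> cses a' p' -> isomorphic T T'.
Proof.
move=> tS' iS' [aI pS e] [aI' pS' e'].
have [u /is_isoP[_ uS] uE] := mono_uniq tS' iS' aI aI'; rewrite -uE in e'.
have [v vI _] := coker_uniq pS e pS' (proj1 (cexact_csurj _ _ uS) e').
by exists v.
Qed.

Lemma khom_card_indec S S' S'' S1 S2 (a0 : hom S S') (t0 : hom S' S1) (k0 : hom S1 S'')
    (c0 : hom S'' S2) : tors S' -> tors S'' -> indecomposable S' -> indecomposable S'' ->
  cses a0 t0 -> cses k0 c0 -> cardE (@khom F X S S' S'' S2) eq (aut_card S1).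
Proof.
move=> tS' tS'' iS' iS'' [aI0 tS0 ae0] [kI0 cS0 ce0].
have tS1 := tors_quot tS0 tS'.
apply: (@cardE_bij _ _ _ eq _ eq (fun h u => comp k0 (comp u t0) = h)) (aut_cardE tS1).
- move=> h [[a [aI ae]] [c [cS ce]]].
  have [Z [p [j [pS jI E]]]] := im_ex h; rewrite -E in ae.
  have [w wI wE] := mono_uniq tS' iS' aI0 aI; have /is_isoP[_ wS] := wI.
  have ae' : cexact a0 p by apply/(cexact_csurj _ _ wS); rewrite wE; apply/(cexact_cinj _ _ jI).
  have [v vI vE] := coker_uniq tS0 ae0 pS ae'; have /is_isoP[vI' _] := vI.
  have [u uI uE] := mono_uniq tS'' iS'' kI0 (cinj_comp jI vI').
  by exists u => //; rewrite comp_assoc uE -comp_assoc vE.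
- move=> u /is_isoP[uI uS]; exists (comp k0 (comp u t0)) => //; split.
    exists a0; split=> //; apply/cexact_cinj => //; exact/cexact_cinj.
  by exists c0; split=> //; apply/cexact_csurj => //; exact: csurj_comp.
- move=> h h' u u' _ _ _ _ <- <-; split=> [|->//].
  by move=> /(cinj_cancel kI0)/(csurj_cancel tS0).
Qed.

(** The image of [g] is comparable with [S1]. It is not contained in [S1], as [S2] is nonzero; so it
    contains [S1], and it maps onto [S2]. *)
Lemma lb_epi_lift M S'' S1 S2 (k0 : hom S1 S'') (c0 : hom S'' S2) (g : hom M S'') :
  tors S'' -> indecomposable S'' -> ~ czero S2 -> cses k0 c0 ->
  csurj (comp c0 g) -> csurj g.
Proof.
move=> tS'' iS'' nz [kI0 cS0 ce0] gS.
have [T [p [j [pS jI E]]]] := im_ex g.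
have [[u uE]|[u uE]] := uniserial tS'' iS'' jI kI0.
  case: nz; have /cnullP g0 : comp c0 g = hom0 M S2.
    by rewrite -E -uE !comp_assoc (cexact_comp ce0) !comp_hom0l.
  by apply: evS (evI gS g0) _ => x [h1 h2] n hn; have [m hx <-] := h1 n hn; exact: h2.
apply: evS (evI gS (evI ce0 (evI pS (evI (fnM c0 g) (evI (fnM j u) (evI (fnM j p)
  (evI (proj2 (homP _ _) E) (proj2 (homP _ _) uE)))))))) _.
move=> x [h1 [h2 [h3 [h4 [h5 [h6 [h7 h8]]]]]]] n hn.
have [m hx mE] := h1 _ (fn_hm c0 hn); rewrite h4 // in mE.
have hd : hm x (n - fn g m) by apply: hmB => //; apply: fn_hm.
have [|s hs sE] := proj1 (h2 _ hd); first by rewrite fnB mE subrr.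
have [r hr rE] := h3 _ (fn_hm u hs).
exists (r + m); first exact: hmD.
by rewrite fnD -h7 // h6 // rE -h5 // h8 // sE subrK.
Qed.

Lemma zero_aut_card M : czero M -> aut_card M = 1%N.
Proof.
move=> z; have uniq (f : hom M M) : f = idm M.
  by apply/homP; apply: evS z _ => x h m hx; rewrite [LHS]h ?[RHS]h //; exact: fn_hm.
apply: ncardE; exists (fun=> idm M); split=> [i|i j _|f _]; first exact: is_iso_id.
  by rewrite !ord1.
by exists ord0; rewrite (uniq f).
Qed.

Lemma hom_card_iso M M' P P' : @isomorphic C M M' -> @isomorphic C P P' ->
  hom_card M P = hom_card M' P'.
Proof.
move=> [f [f' [f'f ff']]] [g [g' [g'g gg']]].
apply: (@ncard_bij _ _ _ _ (fun u => comp g (comp u f')) (fun v => comp g' (comp v f))) => //.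
- by move=> u; rewrite !comp_assoc g'g comp_idl -comp_assoc f'f comp_idr.
- by move=> u; rewrite !comp_assoc gg' comp_idl -comp_assoc ff' comp_idr.
Qed.

End Indecomposable.

Theorem proposition3p6 (F : finFieldType) (X : wpl F)
    (L L' S S' S'' LS LS' : coh X)
    (hL : is_line_bundle L) (hL' : is_line_bundle L')
    (hS : is_torsion S) (hS' : is_torsion S') (hS'' : is_torsion S'')
    (hLS : is_biproduct L S LS) (hLS' : is_biproduct L' S' LS') :
  [/\ ses LS LS' S'' <->
        (exists S1 S2 : coh X,
           [/\ ses S S' S1, ses L L' S2 & ses S1 S'' S2]),
      forall S1 S2 : coh X,
        ses S S' S1 -> ses L L' S2 -> ses S1 S'' S2 ->
        (hall S'' LS LS')%:R =
          (hom_card L' S')%:R / (hom_card L' S)%:R *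
          sum_iso (fun X2 : coh X =>
            (hall X2 S S')%:R * (hall S2 X2 S'')%:R *
            ((aut_card X2)%:R * (aut_card S2)%:R / (aut_card S'')%:R)) :> rat
    & ses LS LS' S'' -> indecomposable S' -> indecomposable S'' ->
        (isomorphic L L' -> hall S'' LS LS' = hom_card L S'') /\
        (~ isomorphic L L' ->
           forall T : coh X, ses S S' T -> hall S'' LS LS' = aut_card T)].
Proof.
have tS := torsion_tors hS; have tS' := torsion_tors hS'; have tS'' := torsion_tors hS''.
have [j1 [j2 [q1 [q2 bK]]]] := proj1 (biproductP _ _ _) hLS.
have [i1 [i2 [p1 [p2 bK']]]] := proj1 (biproductP _ _ _) hLS'.
have split3 : ses LS LS' S'' -> exists S1 S2 : coh X,
    [/\ ses S S' S1, ses L L' S2 & ses S1 S'' S2].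
  move=> /sesP[k [p kp]]; have [T [r [j [rS jI E]]]] := im_ex (comp p i2).
  have [Y [c [cS ce]]] := coker_ex (comp p i2).
  have [[a [aI ae]] [b bc]] := epi_split hL hL' tS tS' bK bK' kp cS ce.
  exists T, Y; split; apply/sesP.
  - by exists a, r; split=> //; apply/(cexact_cinj _ _ jI); rewrite E.
  - by exists b, (comp c (comp p i1)).
  - by exists j, c; split=> //; apply/(cexact_csurj _ _ rS); rewrite E.
split.
- split=> // -[S1 [S2 [/sesP[a [r ar]] /sesP[b [d bd]] /sesP[j [c jc]]]]].
  have [aI rS ae] := ar; have [jI cS ce] := jc; have [e1 e2 e3 e4 _] := bK'.
  (* A lift [g] of [d] to [S''], together with the composite of [S'] onto [S1] into [S''], gives the
     required epimorphism. *)
  have [g gE] := lb_lift d hL' jc (tors_quot rS tS').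
  pose h := comp j r; pose p := hadd (comp g p1) (comp h p2).
  have pE : comp p i2 = h by rewrite comp_haddl -!comp_assoc e2 e3 comp_hom0r hadd0l comp_idr.
  have pg : comp p i1 = g by rewrite comp_haddl -!comp_assoc e1 e4 !comp_hom0r hadd0r comp_idr.
  have [] := @split_epi _ _ _ _ _ _ _ _ _ j1 j2 q1 q2 i1 i2 p1 p2 hL tS bK bK' S2 p c a b => //.
  + by rewrite pE; apply/cexact_cinj.
  + by rewrite pE; apply/cexact_csurj.
  + by rewrite pg gE.
  by move=> k kp; apply/sesP; exists k, p.
- move=> S1 S2 /sesP[a [r ar]] /sesP[b [d bd]] /sesP[j [c jc]].
  have [aI rS ae] := ar; have [jI cS ce] := jc.
  have tS1 := tors_quot rS tS'; have tS2 := tors_quot cS tS''.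
  have [n cn] := @khom_finite _ _ S S' S'' S2 tS''.
  have := hall_count hL hL' tS tS' tS'' bK bK' ar bd jc cn.
  have [m [e [eI eC nE]]] := khom_card tS' tS'' cn.
  (* $|\mathrm{Hom}(L',S')| = |\mathrm{Hom}(L',S_1)|\cdot|\mathrm{Hom}(L',S)|$ trades the factor
     [hom_card L' S1] of [hall_count] for the quotient in the formula. *)
  have := cardE_uniq (@equivr_eq _) (hom_cardE L' tS')
    (lb_torsor hL' ar tS (hom_cardE L' tS1) (hom_cardE L' tS)).
  rewrite (sum_iso_eq _ eI); first last.
  + move=> Z Z0; apply: eC; split; apply: hall_neq0 => h0; apply: Z0.
      by rewrite h0 !mul0r.
    by rewrite h0 mulr0 mul0r.
  + by move=> Z Z' ZZ'; rewrite (hall_isol _ _ ZZ') (hall_isor _ _ ZZ') (aut_card_iso ZZ').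
  have -> : \sum_i (hall (e i) S S')%:R * (hall S2 (e i) S'')%:R *
      ((aut_card (e i))%:R * (aut_card S2)%:R / (aut_card S'')%:R) =
      n%:R * ((aut_card S2)%:R / (aut_card S'')%:R) :> rat.
    by rewrite nE natr_sum mulr_suml; apply: eq_bigr => i _; rewrite !natrM !mulrA.
  move=> -> E; have := congr1 (fun k : nat => k%:R : rat) E; rewrite /= !natrM => {}E.
  have aut0 : (aut_card S'')%:R != 0 :> rat by rewrite pnatr_eq0 -lt0n aut_card_gt0.
  have hom0 : (hom_card L' S)%:R != 0 :> rat by rewrite pnatr_eq0 -lt0n hom_card_gt0.
  by apply: (mulIf aut0); rewrite E; field; rewrite aut0 hom0.
- move=> s3 iS' iS''; have [S1 [S2 [/sesP[a [r ar]] /sesP[b [d bd]] /sesP[j [c jc]]]]] := split3 s3.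
  have [aI rS ae] := ar; have [jI cS ce] := jc.
  have tS1 := tors_quot rS tS'; have tS2 := tors_quot cS tS''.
  have cn := khom_card_indec tS' tS'' iS' iS'' ar jc.
  have E := hall_count hL hL' tS tS' tS'' bK bK' ar bd jc cn.
  have aut0 := aut_card_gt0 tS''; have [bI dS de] := bd.
  split=> [LL'|nLL' T /sesP[a' [p' ap']]].
    (* A monomorphism between isomorphic line bundles is an isomorphism, so [S2] vanishes and [j]
       identifies [S1] with [S'']. *)
    have /is_isoP[_ bS] := lb_mono_iso hL LL' bI.
    have z2 : czero S2.
      apply: evS (evI dS (evI de bS)) _ => x [h1 [h2 h3]] s hs.
      by have [m hx <-] := h1 s hs; apply/(h2 _ hx); exact: h3.
    have S1S'' : isomorphic S1 S''.
      exists j; apply/is_isoP; split=> //; apply: evS (evI z2 ce) _ => x [h1 h2] s hs.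
      by apply/(h2 _ hs)/h1; exact: fn_hm.
    apply/eqP; rewrite -(eqn_pmul2r aut0) E (zero_aut_card z2) (aut_card_iso S1S'').
    by rewrite (hom_card_iso LL' (isoN S1S'')) mul1n mulnC.
  have nz : ~ czero S2.
    move=> z2; apply: nLL'; exists b; apply/is_isoP; split=> //.
    by apply: evS (evI z2 de) _ => x [h1 h2] m hx; apply/(h2 _ hx)/h1; exact: fn_hm.
  rewrite -(aut_card_iso (mono_coker_iso tS' iS' ar ap')).
  apply/eqP; rewrite -(eqn_pmul2r aut0) E; apply/eqP; congr (_ * _)%N.
  have [g gE] := lb_lift d hL' jc tS1.
  have gS : csurj g by apply: (lb_epi_lift tS'' iS'' nz jc); rewrite gE.
  (* Both sides of the remaining equality count the epimorphisms from [L'] to [S'']. *)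
  apply: (cardE_uniq (@equivr_eq _)) (lb_epi_count hL' gS (aut_cardE tS'')).
  have cF := lb_torsor hL' jc tS1 (lb_epi_count hL' dS (aut_cardE tS2)) (hom_cardE L' tS1).
  apply: (@cardE_bij _ _ _ eq _ eq eq) cF.
  + by move=> f fS; exists f => //; exact: csurj_comp.
  + by move=> f fS; exists f => //; exact: lb_epi_lift jc fS.
  + by move=> f f' u u' _ _ _ _ -> ->.
Qed.
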